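(* For every $n\in\mathbb N$ there exist $\sigma_1=\sigma_1(n)>0$ and $C_1=C_1(n)>0$, $C_2=C_2(n)>0$ such that the following holds. Let $r>0$, let $X$ be a metric space with $\operatorname{diam}(X)>r$, and let $0<\delta<\sigma_1 r$. Suppose that $X$ is $\delta$-intrinsic and $\delta$-close to $\mathbb R^n$ at scale $r$. Then there exists a complete $n$-dimensional Riemannian manifold $M$ such that: (1) $X$ and $M$ are $(1+C_1\delta r^{-1},\,C_1\delta)$-quasi-isometric. Moreover, when the diameter of $X$ is finite, $d_{GH}(X,M)\le 2C_1\,\delta\, r^{-1}\operatorname{diam}(X)$. (2) The sectional curvature of $M$ satisfies $|\mathrm{Sec}_M|\le C_2\,\delta r^{-3}$. (3) The injectivity radius of $M$ is bounded below by $r/2$.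
   Context: For a metric space $X$, $B_r^X(x)$ is the open ball of radius $r$ centered at $x$; $B_r^n$ is the ball of radius $r$ centered at $0$ in Euclidean $\mathbb R^n$. $d_{GH}(X,Y)$ is the Gromov–Hausdorff distance: the infimum of $\varepsilon>0$ such that there are a metric space $Z$ and subsets $X',Y'\subset Z$ isometric to $X,Y$ with Hausdorff distance $d_H(X',Y')<\varepsilon$. For pointed spaces $(X,x_0),(Y,y_0)$ the pointed GH distance is defined in the same way with the additional requirement that the copies of $x_0,y_0$ in $Z$ are at distance $<\varepsilon$. The GH distance between two metric balls always means the pointed GH distance with the centers as distinguished points. For $r>\delta>0$, $X$ is $\delta$-close to $\mathbb R^n$ at scale $r$ if $d_{GH}(B_r^X(x),B_r^n)<\delta$ for every $x\in X$. A $\delta$-chain in $X=(X,d)$ is a finite sequence $x_1,\dots,x_N$ with $d(x_i,x_{i+1})<\delta$ for $1\le i\le N-1$. A sequence $x_1,\dots,x_N$ is $\delta$-straight if $d(x_i,x_j)+d(x_j,x_k)<d(x_i,x_k)+\delta$ for all $1\le i<j<k\le N$. $X$ is $\delta$-intrinsic if for every $x,y\in X$ there is a $\delta$-straight $\delta$-chain $x_1,\dots,x_N$ with $x_1=x$, $x_N=y$. For $\lambda\ge1$, $\varepsilon>0$, a (not necessarily continuous) map $f:X\to Y$ is a $(\lambda,\varepsilon)$-quasi-isometry if $f(X)$ is an $\varepsilon$-net in $Y$ (every point of $Y$ lies within distance $\varepsilon$ of $f(X)$) and $\lambda^{-1}d_X(x,y)-\varepsilon<d_Y(f(x),f(y))<\lambda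 d_X(x,y)+\varepsilon$ for all $x,y\in X$. $X$ and $Y$ are $(\lambda,\varepsilon)$-quasi-isometric if there are $(\lambda,\varepsilon)$-quasi-isometries in both directions. A Riemannian manifold is regarded as a metric space with its Riemannian distance. *)

(* Defs.v *)
From mathcomp Require Import all_boot all_order all_algebra.
From mathcomp Require Import all_classical all_reals all_analysis.

Set Implicit Arguments.
Unset Strict Implicit.
Unset Printing Implicit Defensive.
Import Order.TTheory GRing.Theory Num.Theory.
Import numFieldNormedType.Exports.

Local Open Scope classical_set_scope.
Local Open Scope ring_scope.

Section MetricNotions.
Context {R : realType}.

(* The metric notions below take the distance as an explicit function, so that
   they apply alike to a metricType, to 'rV[R]_n with the Euclidean distance
   (its library norm is the sup norm) and to a Riemannian manifold. *)

Definition diam {X : Type} (d : X -> X -> R) : \bar R :=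
  ereal_sup [set (d p.1 p.2)%:E | p in [set: X * X]].

Definition hausdorff_dist {Z : metricType R} (P Q : set Z) : \bar R :=
  ereal_inf [set e%:E | e in [set e : R | [/\ 0 < e,
    (forall p, P p -> exists2 q, Q q & mdist p q < e) &
    (forall q, Q q -> exists2 p, P p & mdist p q < e)]]].

Definition isometric_on {X : Type} (d : X -> X -> R) (A : set X)
    {Z : metricType R} (f : X -> Z) :=
  forall x y, A x -> A y -> mdist (f x) (f y) = d x y.

Definition GH_dist {X Y : Type} (dX : X -> X -> R) (A : set X)
    (dY : Y -> Y -> R) (B : set Y) : \bar R :=
  ereal_inf [set e%:E | e in [set e : R | 0 < e /\
    exists (Z : metricType R) (f : X -> Z) (g : Y -> Z),
      [/\ isometric_on dX A f, isometric_on dY B g &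
          (hausdorff_dist (f @` A) (g @` B) < e%:E)%E]]].

Definition pointed_GH_dist {X Y : Type} (dX : X -> X -> R) (A : set X) (a : X)
    (dY : Y -> Y -> R) (B : set Y) (b : Y) : \bar R :=
  ereal_inf [set e%:E | e in [set e : R | 0 < e /\
    exists (Z : metricType R) (f : X -> Z) (g : Y -> Z),
      [/\ isometric_on dX A f, isometric_on dY B g,
          (hausdorff_dist (f @` A) (g @` B) < e%:E)%E &
          mdist (f a) (g b) < e]]].

Definition eucl_dist {n : nat} (u v : 'rV[R]_n) : R :=
  Num.sqrt (\sum_i (u 0 i - v 0 i) ^+ 2).

Definition dball {X : Type} (d : X -> X -> R) (x : X) (r : R) : set X :=
  [set y | d x y < r].

Definition delta_close_Rn (n : nat) (delta r : R) {X : Type}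
    (d : X -> X -> R) :=
  forall x : X,
    let o : 'rV[R]_n := 0 in
    (pointed_GH_dist d (dball d x r) x
       eucl_dist (dball eucl_dist o r) o < delta%:E)%E.

Definition delta_chain {X : Type} (d : X -> X -> R) (delta : R) (N : nat)
    (c : 'I_N -> X) :=
  forall i j : 'I_N, j = i.+1 :> nat -> d (c i) (c j) < delta.

Definition delta_straight {X : Type} (d : X -> X -> R) (delta : R) (N : nat)
    (c : 'I_N -> X) :=
  forall i j k : 'I_N, (i < j < k)%N ->
    d (c i) (c j) + d (c j) (c k) < d (c i) (c k) + delta.

Definition delta_intrinsic (delta : R) {X : Type} (d : X -> X -> R) :=
  forall x y : X, exists (N : nat) (c : 'I_N.+1 -> X),
    [/\ c ord0 = x, c ord_max = y,
        delta_chain d delta c & delta_straight d delta c].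

Definition quasi_isometry (lambda eps : R) {X Y : Type} (dX : X -> X -> R)
    (dY : Y -> Y -> R) (f : X -> Y) :=
  (forall y, exists x, dY y (f x) <= eps) /\
  (forall x x', lambda^-1 * dX x x' - eps < dY (f x) (f x')
                /\ dY (f x) (f x') < lambda * dX x x' + eps).

Definition quasi_isometric (lambda eps : R) {X Y : Type} (dX : X -> X -> R)
    (dY : Y -> Y -> R) :=
  (exists f : X -> Y, quasi_isometry lambda eps dX dY f) /\
  (exists g : Y -> X, quasi_isometry lambda eps dY dX g).

End MetricNotions.

Section LocalCalculus.
Context {R : realType} {n : nat}.

(* Meaningful for U open. *)
Fixpoint Ck {W : normedModType R} (k : nat) (U : set 'rV[R]_n)
    (f : 'rV[R]_n -> W) : Prop :=
  if k is k'.+1 then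
    (forall x, U x -> differentiable f x) /\
    (forall i : 'I_n, Ck k' U (fun x => 'D_(delta_mx 0 i) f x))
  else forall x, U x -> {for x, continuous f}.

Definition smooth {W : normedModType R} (U : set 'rV[R]_n)
    (f : 'rV[R]_n -> W) := forall k, Ck k U f.

Implicit Types (g : 'rV[R]_n -> 'M[R]_n) (x : 'rV[R]_n).

(* Gamma^k_ij of the metric g_ij *)
Definition christoffel g x (k i j : 'I_n) : R :=
  2^-1 * \sum_l invmx (g x) k l *
    ('D_(delta_mx 0 i) (fun y => g y j l) x
     + 'D_(delta_mx 0 j) (fun y => g y i l) x
     - 'D_(delta_mx 0 l) (fun y => g y i j) x).

(* Sign convention: R(u,v)w = nabla_u nabla_v w - nabla_v nabla_u w
   - nabla_[u,v] w, expanded on coordinate fields; with it, round spheres have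
   positive sectional curvature. *)
Definition curvature g x (u v w : 'rV[R]_n) : 'rV[R]_n :=
  let Gam := christoffel g in
  \row_l \sum_i \sum_j \sum_k u 0 i * v 0 j * w 0 k *
    ('D_(delta_mx 0 i) (fun y => Gam y l j k) x
     - 'D_(delta_mx 0 j) (fun y => Gam y l i k) x
     + \sum_m (Gam x l i m * Gam x m j k - Gam x l j m * Gam x m i k)).

End LocalCalculus.

(* Connected smooth n-manifolds with a smooth Riemannian metric.  The atlas is
   indexed by the points of M, the chart [chart p] being defined on a
   neighbourhood [dom p] of p; every smooth structure is given by such an atlas.
   [chartV p] is the inverse of [chart p], and [tensor p] is the matrix of the
   metric in the coordinates [chart p], as a function of these coordinates.
   Only the restrictions of [chart p], [chartV p] and [tensor p] to [dom p] and
   its image are meaningful. *)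
Record riemannian_manifold (R : realType) (n : nat) := RiemannianManifold {
  carrier :> topologicalType ;
  carrier_hausdorff : hausdorff_space carrier ;
  carrier_second_countable : @second_countable carrier ;
  carrier_connected : connected [set: carrier] ;
  dom : carrier -> set carrier ;
  chart : carrier -> carrier -> 'rV[R]_n ;
  chartV : carrier -> 'rV[R]_n -> carrier ;
  dom_open : forall p, open (dom p) ;
  dom_center : forall p, dom p p ;
  chart_open : forall p, open (chart p @` dom p) ;
  chartK : forall p x, dom p x -> chartV p (chart p x) = x ;
  chart_continuous : forall p x, dom p x -> {for x, continuous (chart p)} ;
  chartV_continuous : forall p y, (chart p @` dom p) y ->
    {for y, continuous (chartV p)} ;
  transition_smooth : forall p q,
    smooth (chart p @` (dom p `&` dom q)) (chart q \o chartV p) ;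
  tensor : carrier -> 'rV[R]_n -> 'M[R]_n ;
  tensor_smooth : forall p, smooth (chart p @` dom p) (tensor p) ;
  tensor_sym : forall p x, dom p x ->
    (tensor p (chart p x))^T = tensor p (chart p x) ;
  tensor_pos : forall p x (v : 'rV[R]_n), dom p x -> v != 0 ->
    0 < (v *m tensor p (chart p x) *m v^T) 0 0 ;
  tensor_transition : forall p q x, dom p x -> dom q x ->
    let J := jacobian (chart q \o chartV p) (chart p x) in
    tensor p (chart p x) = J *m tensor q (chart q x) *m J^T
}.

Section RiemannianGeometry.
Context {R : realType} {n : nat} (M : riemannian_manifold R n).
Implicit Types (x y p : M) (u v : 'rV[R]_n) (gamma : R -> M).

(* The tangent space at x is identified with 'rV[R]_n through [chart x]. *)
Definition inner x u v : R := (u *m tensor x (chart x x) *m v^T) 0 0.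

Definition tnorm x v : R := Num.sqrt (inner x v v).

Definition velocity gamma (t : R) : 'rV[R]_n :=
  derive1 (chart (gamma t) \o gamma) t.

Definition C1_curve gamma :=
  continuous gamma /\
  forall p t, dom p (gamma t) ->
    (\forall s \near t, derivable (chart p \o gamma) s 1) /\
    {for t, continuous (derive1 (chart p \o gamma))}.

Definition arc_length gamma (a b : R) : R :=
  \int[lebesgue_measure]_(t in `[a, b]) tnorm (gamma t) (velocity gamma t).

(* [piecewise_C1_path x y l]: some piecewise C^1 path from x to y has length l.
   Such a path is a concatenation of C^1 arcs, and each C^1 arc on a compact
   interval extends to a C^1 curve on the whole line. *)
Inductive piecewise_C1_path : M -> M -> R -> Prop :=
| path_nil x : piecewise_C1_path x x 0
| path_cons gamma a b y l : a <= b -> C1_curve gamma ->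
    piecewise_C1_path (gamma b) y l ->
    piecewise_C1_path (gamma a) y (arc_length gamma a b + l).

Definition riem_dist x y : R := inf [set l | piecewise_C1_path x y l].

Definition complete_manifold :=
  forall s : nat -> M,
    (forall e : R, 0 < e -> exists N : nat, forall i j : nat,
       (N <= i)%N -> (N <= j)%N -> riem_dist (s i) (s j) < e) ->
    exists x, riem_dist (s i) x @[i --> \oo] --> (0 : R).

Definition sectional x u v : R :=
  inner x (curvature (tensor x) (chart x x) u v v) u /
  (inner x u u * inner x v v - inner x u v ^+ 2).

Definition sectional_le (K : R) :=
  forall x u v, free [:: u; v] -> `|sectional x u v| <= K.

Definition geodesic gamma :=
  continuous gamma /\
  forall p t, dom p (gamma t) ->
    let c := chart p \o gamma in
    let c' := derive1 c in
    [/\ \forall s \near t, derivable c s 1, derivable c' t 1 &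
        forall k, derive1 c' t 0 k =
          - \sum_i \sum_j christoffel (tensor p) (c t) k i j *
              (c' t 0 i * c' t 0 j)].

(* Geodesics are taken on the whole line, so this is the exponential map of
   complete manifolds; the default value x is irrelevant for these. *)
Definition exp_map x v : M :=
  xget x [set y | exists gamma, [/\ geodesic gamma, gamma 0 = x,
                                    velocity gamma 0 = v & gamma 1 = y]].

(* exp_x is a diffeomorphism from the open ball of radius rho in the tangent
   space at x onto an open subset of M. *)
Definition exp_diffeo_ball x (rho : R) :=
  let B := [set v | tnorm x v < rho] in
  let E := exp_map x @` B in
  [/\ open E,
      forall p, open (B `&` exp_map x @^-1` dom p) /\
        smooth (B `&` exp_map x @^-1` dom p) (chart p \o exp_map x) &
      exists lg : M -> 'rV[R]_n,
        (forall v, B v -> lg (exp_map x v) = v) /\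
        forall p, smooth (chart p @` (dom p `&` E)) (lg \o chartV p)].

Definition inj_radius_at x : \bar R :=
  ereal_sup [set rho%:E | rho in [set rho : R | 0 < rho /\
                                                exp_diffeo_ball x rho]].

Definition inj_radius : \bar R :=
  ereal_inf [set inj_radius_at x | x in [set: M]].

End RiemannianGeometry.

(* Main.v *)
Require Import Defs.
From HB Require Import structures.
From mathcomp Require Import all_boot all_order all_algebra.
From mathcomp Require Import all_classical all_reals all_analysis.
From mathcomp Require Import ring lra.
Set Implicit Arguments.
Unset Strict Implicit.
Unset Printing Implicit Defensive.
Import Order.TTheory GRing.Theory Num.Theory.
Import numFieldNormedType.Exports.
Local Open Scope classical_set_scope.
Local Open Scope ring_scope.

(* The rescaled space X is covered by unit balls that are delta/r-close to
   Euclidean balls. Comparing the charts of neighbouring points gives affine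
   transition maps that are orthogonal and satisfy the cocycle condition up to
   errors O(delta/r). The points of a net are coloured so that neighbours have
   different colours; adding one colour at a time, the transition maps between
   the new charts and the old ones are replaced by averages of compositions
   through the old charts. This perturbs them by O(delta/r) in every C^k norm
   and makes the cocycle condition exact, so that the balls glue to a manifold.
   Averaging the pulled back Euclidean metrics gives a Riemannian metric that is
   O(delta/r)-close to the flat one in C^2, in every chart; hence the bound on
   the curvature, and an exponential map that is near the identity, hence a
   diffeomorphism, on balls of radius r/2. The charts also define maps between X
   and the manifold that almost preserve distances at scale r. Both spaces being
   almost intrinsic, long distances are compared by cutting them into pieces of
   that scale, at the cost of a multiplicative error. *)

(** The constants may depend on [n] only, while [X], hence the gluing data, is arbitrary.
    Corrections are therefore given as functions of the data, chosen in advance, and estimates are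
    stated for families indexed by all data at once ([ubk]). Corrections are counted in units of
    [eps], so that a bounded family yields an error O(eps) at each order of derivation. Functions
    live on the whole of R^n and are cut off by bumps, which avoids carrying domains. Radii are a
    budget. At scale 1 the affine cocycle condition holds within 13/20; the colours together spend
    3/100, which leaves exact gluing within 31/50 and charts of radius 3/5. Every point lies within
    1/20 of the centre of some chart, so geodesics of length about 1/2 stay inside it. Each colour
    costs radius and lowers the threshold on [eps], so their number must be bounded in terms of [n]:
    a packing argument gives this. Maps from a new chart back to an old one must be exact inverses;
    they come from an inverse function theorem near the identity with bounds at all orders.
    Smoothness of the exponential map comes from flows in charts, whose first variation is again a
    flow. *)

Section PartialDerivatives.
Context {R : realType}.
Implicit Types (m l : nat).

Definition pd m (i : 'I_m) (f : 'rV[R]_m -> R) : 'rV[R]_m -> R :=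
  fun x => 'D_(delta_mx 0 i) f x.

Lemma row_sum_delta_coord m (u : 'rV[R]_m) :
  u = \sum_j u 0 j *: delta_mx 0 j.
Proof. by rewrite {1}(row_sum_delta u). Qed.

Lemma differentiable_coords (V : normedModType R) p q (f : V -> 'M[R]_(p, q)) x :
  (forall i j, differentiable (fun y => f y i j) x) -> differentiable f x.
Proof.
move=> h.
have -> : f = \sum_(i < p) \sum_(j < q) (fun y => f y i j *: delta_mx i j).
  apply/funext => y; rewrite {1}(matrix_sum_delta (f y)) fct_sumE.
  by apply: eq_bigr => i _; rewrite fct_sumE.
apply: differentiable_sum => i; apply: differentiable_sum => j.
exact: differentiableZl.
Qed.

Lemma differentiable_coord_comp (V : normedModType R) p q (f : V -> 'M[R]_(p, q)) x i j :
  differentiable f x -> differentiable (fun y => f y i j) x.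
Proof.
move=> df; apply: (@differentiable_comp _ _ _ _ f (fun M : 'M[R]_(p, q) => M i j)) => //.
exact: differentiable_coord.
Qed.

Lemma derive_coord (V : normedModType R) p q (f : V -> 'M[R]_(p, q)) x v i j :
  derivable f x v -> 'D_v f x i j = 'D_v (fun y => f y i j) x.
Proof. by move=> df; rewrite derive_mx // mxE. Qed.

Lemma derive_pd m (f : 'rV[R]_m -> R) x v : differentiable f x ->
  'D_v f x = \sum_j v 0 j * pd j f x.
Proof.
move=> df; rewrite deriveE // {1}(row_sum_delta_coord v) linear_sum.
by apply: eq_bigr => j _; rewrite linearZ /= /pd deriveE.
Qed.

Lemma derive_comp (V : normedModType R) l (f : 'rV[R]_l -> R) (h : V -> 'rV[R]_l) x v :
  differentiable f (h x) -> differentiable h x ->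
  'D_v (fun y => f (h y)) x = \sum_j 'D_v (fun y => h y 0 j) x * pd j f (h x).
Proof.
move=> df dh.
rewrite -[fun y => _]/(f \o h) deriveE; last exact: differentiable_comp.
rewrite diff_comp //= -!deriveE // derive_pd //.
by apply: eq_bigr => j _; rewrite derive_coord //; exact: diff_derivable.
Qed.

Lemma pd_comp m l (f : 'rV[R]_l -> R) (h : 'rV[R]_m -> 'rV[R]_l) i x :
  differentiable f (h x) -> differentiable h x ->
  pd i (fun y => f (h y)) x = \sum_j pd i (fun y => h y 0 j) x * pd j f (h x).
Proof. by move=> df dh; rewrite /pd derive_comp. Qed.

Lemma pdD m (f g : 'rV[R]_m -> R) i x : differentiable f x -> differentiable g x ->
  pd i (fun y => f y + g y) x = pd i f x + pd i g x.
Proof. by move=> df dg; rewrite /pd -deriveD //; exact: diff_derivable. Qed.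

Lemma pdN m (f : 'rV[R]_m -> R) i x : differentiable f x ->
  pd i (fun y => - f y) x = - pd i f x.
Proof. by move=> df; rewrite /pd -deriveN //; exact: diff_derivable. Qed.

Lemma pdB m (f g : 'rV[R]_m -> R) i x : differentiable f x -> differentiable g x ->
  pd i (fun y => f y - g y) x = pd i f x - pd i g x.
Proof. by move=> df dg; rewrite /pd -deriveB //; exact: diff_derivable. Qed.

Lemma pdM m (f g : 'rV[R]_m -> R) i x : differentiable f x -> differentiable g x ->
  pd i (fun y => f y * g y) x = f x * pd i g x + pd i f x * g x.
Proof.
move=> df dg; rewrite [pd i f x * _]mulrC /pd.
by rewrite -[fun y => _]/(f * g) deriveM //; exact: diff_derivable.
Qed.

Lemma pdV m (f : 'rV[R]_m -> R) i x : differentiable f x -> f x != 0 ->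
  pd i (fun y => (f y)^-1) x = - (pd i f x * ((f x)^-1 * (f x)^-1)).
Proof.
move=> df f0; rewrite /pd deriveV //; last exact: diff_derivable.
by rewrite expr2 invfM /GRing.scale /= mulNr mulrC.
Qed.

Lemma pd_cst m (c : R) (i : 'I_m) x : pd i (fun=> c) x = 0 :> R.
Proof. exact: (@derive_cst _ ('rV[R]_m)). Qed.

Lemma pd_coord m (j i : 'I_m) x : pd i (fun y : 'rV[R]_m => y 0 j) x = (i == j)%:R.
Proof.
rewrite /pd -(@derive_coord _ _ _ id) //= ?derive_id ?mxE ?eqxx //=.
by rewrite eq_sym.
Qed.

Lemma pd_sum m (I : Type) (s : seq I) (f : I -> 'rV[R]_m -> R) i x :
  (forall j, differentiable (f j) x) ->
  pd i (fun y => \sum_(j <- s) f j y) x = \sum_(j <- s) pd i (f j) x.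
Proof.
move=> df; elim: s => [|a s IH].
  by rewrite big_nil -[RHS](pd_cst 0 i x); congr pd; apply/funext => y; rewrite big_nil.
rewrite big_cons -IH -pdD //.
  by congr pd; apply/funext => y; rewrite big_cons.
elim: s {IH} => [|b s IH].
  have -> : (fun y => \sum_(j <- [::]) f j y) = cst 0 by apply/funext => y; rewrite big_nil.
  exact: differentiable_cst.
have -> : (fun y => \sum_(j <- b :: s) f j y) = f b + (fun y => \sum_(j <- s) f j y).
  by apply/funext => y; rewrite big_cons.
exact: differentiableD.
Qed.

Lemma differentiable_bigsum (V : normedModType R) (I : Type) (s : seq I) (f : I -> V -> R) x :
  (forall j, differentiable (f j) x) -> differentiable (fun y => \sum_(j <- s) f j y) x.
Proof.
move=> df; elim: s => [|b s IH].
  have -> : (fun y => \sum_(j <- [::]) f j y) = cst 0 by apply/funext => y; rewrite big_nil.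
  exact: differentiable_cst.
have -> : (fun y => \sum_(j <- b :: s) f j y) = f b + (fun y => \sum_(j <- s) f j y).
  by apply/funext => y; rewrite big_cons.
exact: differentiableD.
Qed.

End PartialDerivatives.

(** * Bounds on derivatives, uniform over families of functions *)

Section BoundedDerivatives.
Context {R : realType}.
Implicit Types (m l k : nat).

Section BdDef.
Variable m : nat.

(** A single constant bounds all partial derivatives of order at most [k], on the whole space: no
    domain is carried along, at the price of cutting off whatever is unbounded. The derivatives of
    order [k] are only asked to be continuous. *)
Fixpoint bd k (K : R) (f : 'rV[R]_m -> R) : Prop :=
  (forall x, `|f x| <= K) /\
  if k is k'.+1 then (forall x, differentiable f x) /\ forall i, bd k' K (pd i f)
  else continuous f.

End BdDef.

Lemma bd_bound m k K (f : 'rV[R]_m -> R) : bd k K f -> forall x, `|f x| <= K.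
Proof. by case: k => [|k] []. Qed.

Lemma bd_le m k K K' (f : 'rV[R]_m -> R) : K <= K' -> bd k K f -> bd k K' f.
Proof.
move=> KK'; elim: k f => [|k IH] f [fK h]; split => //=.
- by move=> x; exact: le_trans (fK x) KK'.
- by move=> x; exact: le_trans (fK x) KK'.
- by case: h => df h; split => // i; exact: IH (h i).
Qed.

Lemma bd_continuous m k K (f : 'rV[R]_m -> R) : bd k K f -> continuous f.
Proof. by case: k => [|k] [_] // [df _] x; exact: differentiable_continuous. Qed.

Lemma bd_lower m k K (f : 'rV[R]_m -> R) : bd k.+1 K f -> bd k K f.
Proof.
elim: k f => [|k IH] f h; first by split; [exact: bd_bound h|exact: bd_continuous h].
by case: h => fK [df h]; split => //; split => // i; exact: IH.
Qed.

Lemma bd_ext m k K (f g : 'rV[R]_m -> R) : f =1 g -> bd k K f -> bd k K g.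
Proof. by move=> /funext ->. Qed.

Lemma bdD m k K K' (f g : 'rV[R]_m -> R) :
  bd k K f -> bd k K' g -> bd k (K + K') (fun x => f x + g x).
Proof.
elim: k f g => [|k IH] f g /= [fK hf] [gK hg]; split.
- by move=> x; exact: le_trans (ler_normD _ _) (lerD (fK x) (gK x)).
- by move=> x; exact: (continuousD (hf x) (hg x)).
- by move=> x; exact: le_trans (ler_normD _ _) (lerD (fK x) (gK x)).
- case: hf hg => df hf [dg hg]; split; first by move=> x; exact: differentiableD.
  move=> i; apply: bd_ext (IH _ _ (hf i) (hg i)) => x.
  by rewrite pdD.
Qed.

Lemma bdN m k K (f : 'rV[R]_m -> R) : bd k K f -> bd k K (fun x => - f x).
Proof.
elim: k f => [|k IH] f /= [fK hf]; split.
- by move=> x; rewrite normrN.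
- by move=> x; exact: (continuousN (hf x)).
- by move=> x; rewrite normrN.
- case: hf => df hf; split; first by move=> x; exact: differentiableN.
  by move=> i; apply: bd_ext (IH _ (hf i)) => x; rewrite pdN.
Qed.

Lemma bd_cst m k (c : R) : bd k `|c| (fun _ : 'rV[R]_m => c).
Proof.
elim: k c => [|k IH] c; split => //=; first by move=> x; exact: cst_continuous.
split; first by move=> x; exact: differentiable_cst.
move=> i; apply: (@bd_le _ _ `|0|); first by rewrite normr0.
by apply: bd_ext (IH 0) => x; rewrite pd_cst.
Qed.

Lemma bd_ge0 m k K (f : 'rV[R]_m -> R) : bd k K f -> 0 <= K.
Proof. by move=> /bd_bound h; exact: le_trans (normr_ge0 _) (h 0). Qed.

(** Each differentiation turns a product into a sum of two products, hence the factor [2 ^+ k]. *)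
Lemma bdM m k K K' (f g : 'rV[R]_m -> R) :
  bd k K f -> bd k K' g -> bd k (2 ^+ k * (K * K')) (fun x => f x * g x).
Proof.
elim: k f g => [|k IH] f g hf0 hg0; have K0 := bd_ge0 hf0; have K'0 := bd_ge0 hg0.
  case: hf0 hg0 => fK hf [gK hg]; split; last by move=> x; exact: (continuousM (hf x) (hg x)).
  by move=> x; rewrite expr0 mul1r normrM ler_pM.
have hf' := bd_lower hf0; have hg' := bd_lower hg0.
case: hf0 hg0 => fK [df hf] [gK [dg hg]]; split.
  move=> x; rewrite normrM; apply: (@le_trans _ _ (K * K')); first exact: ler_pM.
  by rewrite ler_peMl ?mulr_ge0 // exprn_ege1 // ler1n.
split; first by move=> x; exact: differentiableM.
move=> i; rewrite exprS mulrAC -mulrA [in X in _ * X]mulrC mulr_natl mulr2n.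
apply: bd_ext (bdD (IH _ _ hf' (hg i)) (IH _ _ (hf i) hg')) => x.
by rewrite pdM.
Qed.

Lemma bd_sum m k K N (I : eqType) (s : seq I) (f : I -> 'rV[R]_m -> R) : (size s <= N)%N -> 0 <= K ->
  (forall j, j \in s -> bd k K (f j)) -> bd k (N%:R * K) (fun x => \sum_(j <- s) f j x).
Proof.
move=> sN K0 h; apply: (@bd_le _ _ ((size s)%:R * K)).
  by rewrite ler_wpM2r // ler_nat.
elim: s h {sN} => [|a s IH] h.
  rewrite mul0r -[X in bd _ X](normr0 R); apply: bd_ext (bd_cst _ _ 0) => x.
  by rewrite big_nil.
rewrite -[size _]/(size s).+1 -natr1 addrC mulrDl mul1r.
apply: bd_ext (bdD (h a (mem_head _ _)) (IH _)) => [x|j js]; first by rewrite big_cons.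
by apply: h; rewrite in_cons js orbT.
Qed.

End BoundedDerivatives.

Section Families.
Context {R : realType}.
Implicit Types (m l k : nat).

(* A family [f] indexed by [P] is considered on the indices satisfying [D], so
   that bounds depend on the family only. *)
Definition ubk (P : Type) (D : P -> Prop) m k (f : P -> 'rV[R]_m -> R) :=
  exists K, forall p, D p -> bd k K (f p).

(** Derivatives of orders 1 to [k] are bounded, not the functions themselves. This fits affine and
    transition maps, which grow at infinity, and it is what an inner function of a composite has to
    satisfy. *)
Definition lbk (P : Type) (D : P -> Prop) m k (f : P -> 'rV[R]_m -> R) :=
  if k is k'.+1 then
    (forall p, D p -> forall x, differentiable (f p) x) /\
    forall i, ubk D k' (fun p => pd i (f p))
  else forall p, D p -> continuous (f p).

Definition LBk (P : Type) (D : P -> Prop) m l k (h : P -> 'rV[R]_m -> 'rV[R]_l) :=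
  forall j, lbk D k (fun p y => h p y 0 j).

Definition ub (P : Type) (D : P -> Prop) m (f : P -> 'rV[R]_m -> R) := forall k, ubk D k f.
Definition LB (P : Type) (D : P -> Prop) m l (h : P -> 'rV[R]_m -> 'rV[R]_l) :=
  forall k, LBk D k h.

Section Closure.
Variables (P : Type) (D : P -> Prop).

Lemma ubk_ext m k (f g : P -> 'rV[R]_m -> R) :
  (forall p, D p -> f p =1 g p) -> ubk D k f -> ubk D k g.
Proof. by move=> e [K h]; exists K => p Dp; apply: bd_ext (h p Dp); exact: e. Qed.

Lemma lbk_ext m k (f g : P -> 'rV[R]_m -> R) :
  (forall p, D p -> f p =1 g p) -> lbk D k f -> lbk D k g.
Proof.
have e0 p : (forall p, D p -> f p =1 g p) -> D p -> f p = g p by move=> e Dp; apply/funext; exact: e.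
case: k => [|k] e /=; first by move=> h p Dp; rewrite -e0 //; exact: h.
case=> h1 h2; split => [p Dp|i]; first by rewrite -e0 //; exact: h1.
by apply: ubk_ext (h2 i) => p Dp x; rewrite e0.
Qed.

Lemma ubk_lower m k (f : P -> 'rV[R]_m -> R) : ubk D k.+1 f -> ubk D k f.
Proof. by move=> [K h]; exists K => p Dp; exact: bd_lower (h p Dp). Qed.

Lemma ubk_lbk m k (f : P -> 'rV[R]_m -> R) : ubk D k f -> lbk D k f.
Proof.
case: k => [|k] [K h] /=; first by move=> p Dp; exact: bd_continuous (h p Dp).
split=> [p Dp|i]; first by case: (h p Dp) => _ [].
by exists K => p Dp; case: (h p Dp) => _ [_]; apply.
Qed.

Lemma ubkS m k (f : P -> 'rV[R]_m -> R) :
  (exists K, forall p, D p -> forall x, `|f p x| <= K) -> lbk D k f -> ubk D k f.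
Proof.
case: k => [|k] [K hK] /=; first by move=> h; exists K => p Dp; split; [exact: hK|exact: h].
case=> df /choice [L hL]; exists (`|K| + \sum_i `|L i|) => p Dp; split.
  move=> x; apply: (le_trans (hK p Dp x)); apply: (le_trans (ler_norm K)).
  by rewrite lerDl sumr_ge0.
split; [exact: df|move=> i; apply: bd_le (hL i p Dp)].
apply: (le_trans (ler_norm _)); rewrite (bigD1 i) //= addrCA lerDl addr_ge0 //.
exact: sumr_ge0.
Qed.

Lemma lbk_lower m k (f : P -> 'rV[R]_m -> R) : lbk D k.+1 f -> lbk D k f.
Proof.
case: k => [|k] /= [df h].
  by move=> p Dp x; apply: differentiable_continuous; exact: df.
by split => // i; exact: ubk_lower.
Qed.

Lemma LBk_lower m l k (h : P -> 'rV[R]_m -> 'rV[R]_l) : LBk D k.+1 h -> LBk D k h.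
Proof. by move=> h0 j; exact: lbk_lower. Qed.

Lemma ubkD m k (f g : P -> 'rV[R]_m -> R) :
  ubk D k f -> ubk D k g -> ubk D k (fun p x => f p x + g p x).
Proof. by move=> [K h] [L h']; exists (K + L) => p Dp; apply: bdD; auto. Qed.

Lemma ubkN m k (f : P -> 'rV[R]_m -> R) :
  ubk D k f -> ubk D k (fun p x => - f p x).
Proof. by move=> [K h]; exists K => p Dp; apply: bdN; auto. Qed.

Lemma ubkB m k (f g : P -> 'rV[R]_m -> R) :
  ubk D k f -> ubk D k g -> ubk D k (fun p x => f p x - g p x).
Proof. by move=> hf hg; apply: ubkD => //; exact: ubkN. Qed.

Lemma ubkM m k (f g : P -> 'rV[R]_m -> R) :
  ubk D k f -> ubk D k g -> ubk D k (fun p x => f p x * g p x).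
Proof. by move=> [K h] [L h']; exists (2 ^+ k * (K * L)) => p Dp; apply: bdM; auto. Qed.

Lemma ubk_cst m k (c : P -> R) : (exists K, forall p, D p -> `|c p| <= K) ->
  ubk D k (fun p (_ : 'rV[R]_m) => c p).
Proof. by move=> [K h]; exists K => p Dp; apply: bd_le (h p Dp) _; exact: bd_cst. Qed.

Lemma ubk_cst1 m k (c : R) : ubk D k (fun p (_ : 'rV[R]_m) => c).
Proof. by apply: ubk_cst; exists `|c|. Qed.

Lemma ubk_sum m k (I : Type) (s : seq I) (f : I -> P -> 'rV[R]_m -> R) :
  (forall i, ubk D k (f i)) -> ubk D k (fun p x => \sum_(i <- s) f i p x).
Proof.
move=> h; elim: s => [|a s IH].
  by apply: ubk_ext (@ubk_cst1 m k 0) => p _ x; rewrite big_nil.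
by apply: ubk_ext (ubkD (h a) IH) => p _ x; rewrite big_cons.
Qed.

Lemma ubk_prod m k (I : Type) (s : seq I) (f : I -> P -> 'rV[R]_m -> R) :
  (forall i, ubk D k (f i)) -> ubk D k (fun p x => \prod_(i <- s) f i p x).
Proof.
move=> h; elim: s => [|a s IH].
  by apply: ubk_ext (@ubk_cst1 m k 1) => p _ x; rewrite big_nil.
by apply: ubk_ext (ubkM (h a) IH) => p _ x; rewrite big_cons.
Qed.

(** The derivative of [1 / f] is a product of a derivative of [f] and two factors [1 / f], so each
    order follows from the previous one. *)
Lemma ubk_inv m k (f : P -> 'rV[R]_m -> R) (c : R) : 0 < c ->
  (forall p, D p -> forall x, c <= f p x) ->
  ubk D k f -> ubk D k (fun p x => (f p x)^-1).
Proof.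
move=> c0 cf.
have f0 p x : D p -> f p x != 0 by move=> Dp; rewrite gt_eqF // (lt_le_trans c0) // cf.
have B : exists K, forall p, D p -> forall x, `|(f p x)^-1| <= K.
  exists c^-1 => p Dp x; have fx := lt_le_trans c0 (cf p Dp x).
  by rewrite gtr0_norm ?invr_gt0 // lef_pV2 ?posrE //; exact: cf.
elim: k => [|k IH] hf; apply: ubkS => //=.
  move=> p Dp x; apply: continuousV; first exact: f0.
  exact: (ubk_lbk hf).
have [df hd] := ubk_lbk hf; split=> [p Dp x|i].
  by apply: differentiableV; [exact: df|exact: f0].
have IH' := IH (ubk_lower hf).
apply: ubk_ext (ubkN (ubkM (hd i) (ubkM IH' IH'))) => p Dp x.
by rewrite pdV //; [exact: df|exact: f0].
Qed.

Lemma lbk_continuous m k (f : P -> 'rV[R]_m -> R) : lbk D k f -> forall p, D p -> continuous (f p).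
Proof. by elim: k f => [|k IH] f // /lbk_lower; exact: IH. Qed.

Lemma continuous_coords (T : topologicalType) a b (f : T -> 'M[R]_(a, b)) x :
  (forall i j, {for x, continuous (fun y => f y i j)}) -> {for x, continuous f}.
Proof.
move=> h A /= [B hB BA].
have : \forall y \near x, forall ij : 'I_a * 'I_b, B ij.1 ij.2 (f y ij.1 ij.2).
  by apply: filter_forall => -[i j] /=; exact: h (hB i j).
by apply: filterS => y hy; apply: BA => i j; exact: (hy (i, j)).
Qed.

Lemma LBk_continuous m l k (h : P -> 'rV[R]_m -> 'rV[R]_l) : LBk D k h -> forall p, D p -> continuous (h p).
Proof.
move=> hh p Dp x; apply: continuous_coords => i j; rewrite ord1.
exact: (lbk_continuous (hh j) Dp).
Qed.

Lemma LBk_differentiable m l k (h : P -> 'rV[R]_m -> 'rV[R]_l) : LBk D k.+1 h ->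
  forall p, D p -> forall x, differentiable (h p) x.
Proof.
move=> hh p Dp x; apply: differentiable_coords => i j; rewrite ord1.
exact: (hh j).1.
Qed.

(** Induction on the order by the chain rule: the inner map enters only through its derivatives,
    whence [LBk] for it. *)
Lemma ubk_comp m l k (f : P -> 'rV[R]_l -> R) (h : P -> 'rV[R]_m -> 'rV[R]_l) :
  ubk D k f -> LBk D k h -> ubk D k (fun p x => f p (h p x)).
Proof.
elim: k f => [|k IH] f hf hh; apply: ubkS => /=.
- by case: hf => K h'; exists K => p Dp x; exact: bd_bound (h' p Dp) _.
- move=> p Dp x; apply: (@continuous_comp _ _ _ (h p) (f p)).
    exact: (LBk_continuous hh Dp).
  exact: (ubk_lbk hf).
- by case: hf => K h'; exists K => p Dp x; exact: bd_bound (h' p Dp) _.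
have [df hd] := ubk_lbk hf.
split=> [p Dp x|i].
  apply: (@differentiable_comp _ _ _ _ (h p) (f p)); last exact: df.
  exact: LBk_differentiable hh p Dp x.
apply: (@ubk_ext _ _ (fun p x => \sum_(j <- index_enum 'I_l) pd i (fun y => h p y 0 j) x * pd j (f p) (h p x))).
  by move=> p Dp x; rewrite pd_comp //; [exact: df|exact: LBk_differentiable hh p Dp x].
apply: ubk_sum => j; apply: ubkM; first exact: (hh j).2.
by apply: IH (hd j) _; exact: LBk_lower.
Qed.

Lemma lbk_comp m l k (f : P -> 'rV[R]_l -> R) (h : P -> 'rV[R]_m -> 'rV[R]_l) :
  lbk D k f -> LBk D k h -> lbk D k (fun p x => f p (h p x)).
Proof.
case: k => [|k] /= hf hh.
  move=> p Dp x; apply: (@continuous_comp _ _ _ (h p) (f p)).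
    exact: (LBk_continuous hh Dp).
  exact: hf.
have [df hd] := hf.
split=> [p Dp x|i].
  apply: (@differentiable_comp _ _ _ _ (h p) (f p)); last exact: df.
  exact: LBk_differentiable hh p Dp x.
apply: (@ubk_ext _ _ (fun p x => \sum_(j <- index_enum 'I_l) pd i (fun y => h p y 0 j) x * pd j (f p) (h p x))).
  by move=> p Dp x; rewrite pd_comp //; [exact: df|exact: LBk_differentiable hh p Dp x].
apply: ubk_sum => j; apply: ubkM; first exact: (hh j).2.
by apply: ubk_comp (hd j) _; exact: LBk_lower.
Qed.

Lemma LBk_comp m l q k (f : P -> 'rV[R]_l -> 'rV[R]_q) (h : P -> 'rV[R]_m -> 'rV[R]_l) :
  LBk D k f -> LBk D k h -> LBk D k (fun p x => f p (h p x)).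
Proof. by move=> hf hh j; exact: lbk_comp (hf j) hh. Qed.

Lemma lbkD m k (f g : P -> 'rV[R]_m -> R) :
  lbk D k f -> lbk D k g -> lbk D k (fun p x => f p x + g p x).
Proof.
case: k => [|k] /=.
  by move=> hf hg p Dp x; exact: (continuousD (hf p Dp x) (hg p Dp x)).
move=> [df hf] [dg hg]; split=> [p Dp x|i]; first by apply: differentiableD; auto.
by apply: ubk_ext (ubkD (hf i) (hg i)) => p Dp x; rewrite pdD; auto.
Qed.

Lemma lbkZ m k (c : P -> R) (f : P -> 'rV[R]_m -> R) : (exists K, forall p, D p -> `|c p| <= K) ->
  lbk D k f -> lbk D k (fun p x => c p * f p x).
Proof.
case: k => [|k] /= hc.
  by move=> hf p Dp x; exact: (continuousM (@cst_continuous _ _ (c p) _) (hf p Dp x)).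
move=> [df hf]; split=> [p Dp x|i].
  by apply: differentiableM; [exact: differentiable_cst|auto].
apply: ubk_ext (ubkM (ubk_cst m k hc) (hf i)) => p Dp x.
rewrite pdM; [|exact: differentiable_cst|by auto].
by rewrite pd_cst mul0r addr0.
Qed.

Lemma lbkN m k (f : P -> 'rV[R]_m -> R) :
  lbk D k f -> lbk D k (fun p x => - f p x).
Proof.
move=> hf; apply: (@lbk_ext _ _ (fun p x => (-1) * f p x)).
  by move=> p _ x; rewrite mulN1r.
by apply: lbkZ => //; exists `|-1|.
Qed.

Lemma lbkB m k (f g : P -> 'rV[R]_m -> R) :
  lbk D k f -> lbk D k g -> lbk D k (fun p x => f p x - g p x).
Proof. by move=> hf hg; apply: lbkD => //; exact: lbkN. Qed.

Lemma lbk_cst m k (c : P -> R) : lbk D k (fun p (_ : 'rV[R]_m) => c p).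
Proof.
case: k => [|k] /=; first by move=> p _ x; exact: cst_continuous.
split=> [p Dp x|i]; first exact: differentiable_cst.
by apply: ubk_ext (@ubk_cst1 m k 0) => p _ x; rewrite pd_cst.
Qed.

Lemma lbk_sum m k (I : Type) (s : seq I) (f : I -> P -> 'rV[R]_m -> R) :
  (forall i, lbk D k (f i)) -> lbk D k (fun p x => \sum_(i <- s) f i p x).
Proof.
move=> h; elim: s => [|a s IH].
  by apply: lbk_ext (@lbk_cst m k (fun=> 0)) => p _ x; rewrite big_nil.
by apply: lbk_ext (lbkD (h a) IH) => p _ x; rewrite big_cons.
Qed.

Lemma lbk_coord m k j : lbk D k (fun p (x : 'rV[R]_m) => x 0 j).
Proof.
case: k => [|k] /=; first by move=> p _; exact: coord_continuous.
split=> [p _ x|i]; first exact: differentiable_coord.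
by apply: ubk_ext (@ubk_cst1 m k (i == j)%:R) => p _ x; rewrite pd_coord.
Qed.

Lemma lbk_affine m l k (L : P -> 'M[R]_(m, l)) (b : P -> 'rV[R]_l) :
  (exists K, forall p, D p -> forall i j, `|L p i j| <= K) ->
  LBk D k (fun p x => x *m L p + b p).
Proof.
move=> [K hK] j; apply: (@lbk_ext _ _ (fun p x => \sum_(i <- index_enum 'I_m) L p i j * x 0 i + b p 0 j)).
  by move=> p Dp x; rewrite !mxE; congr (_ + _); apply: eq_bigr => i _; rewrite mulrC.
apply: lbkD; last exact: lbk_cst.
apply: lbk_sum => i; apply: lbkZ; last exact: lbk_coord.
by exists K => p Dp; exact: hK.
Qed.

Lemma ubk_det m k n (A : P -> 'rV[R]_m -> 'M[R]_n) :
  (forall i j, ubk D k (fun p x => A p x i j)) -> ubk D k (fun p x => \det (A p x)).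
Proof.
move=> h; apply: ubk_sum => s; apply: ubkM; first exact: ubk_cst1.
by apply: ubk_prod => i; exact: h.
Qed.

(** Cramer's formula: the entries of the inverse are polynomials in those of the matrix divided by
    the determinant, which is bounded away from 0. *)
Lemma ubk_invmx m k n (A : P -> 'rV[R]_m -> 'M[R]_n) (c : R) : 0 < c ->
  (forall p, D p -> forall x, c <= \det (A p x)) ->
  (forall i j, ubk D k (fun p x => A p x i j)) ->
  forall i j, ubk D k (fun p x => invmx (A p x) i j).
Proof.
move=> c0 cA h i j.
apply: (@ubk_ext _ _ (fun p x => (\det (A p x))^-1 * ((-1) ^+ (j + i) * \det (row' j (col' i (A p x)))))).
  move=> p Dp x; rewrite /invmx unitmxE unitfE gt_eqF; first by rewrite !mxE.
  exact: lt_le_trans (cA _ _ _).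
apply: ubkM; first by apply: (@ubk_inv _ _ _ c) => //; exact: ubk_det.
apply: ubkM; first exact: ubk_cst1.
by apply: ubk_det => a b; apply: ubk_ext (h (lift j a) (lift i b)) => p Dp x; rewrite !mxE.
Qed.

End Closure.

Lemma ubk_reindex (P Q : Type) (D : P -> Prop) (E : Q -> Prop) (s : Q -> P) m k (f : P -> 'rV[R]_m -> R) :
  (forall q, E q -> D (s q)) -> ubk D k f -> ubk E k (fun q => f (s q)).
Proof. by move=> h [K hK]; exists K => q Eq; exact: hK (h q Eq). Qed.

Lemma lbk_reindex (P Q : Type) (D : P -> Prop) (E : Q -> Prop) (s : Q -> P) m k (f : P -> 'rV[R]_m -> R) :
  (forall q, E q -> D (s q)) -> lbk D k f -> lbk E k (fun q => f (s q)).
Proof.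
move=> h; case: k => [|k] /=; first by move=> hf q Eq; exact: hf (h q Eq).
case=> df hf; split=> [q Eq|i]; first exact: df (h q Eq).
exact: (ubk_reindex h (hf i)).
Qed.

End Families.

(** * From the bounds to the smoothness predicates of the statement *)

Section LinkCk.
Context {R : realType}.

Lemma diff_eps (V W : normedModType R) (f : V -> W) (df : {linear V -> W}) x :
  continuous df ->
  (forall e, 0 < e -> \forall h \near (0 : V), `|f (h + x) - f x - df h| <= e * `|h|) ->
  differentiable f x /\ ('d f x = df :> (V -> W)).
Proof.
move=> cdf h.
have E : f \o shift x = cst (f x) + df +o_ 0 id.
  apply/eqaddoP => e e0; apply: filterS (h e e0) => y /=.
  by rewrite !fctE /= opprD addrA.
have E' := diff_unique cdf E; split => //.
by apply/diff_locallyP; rewrite E'.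
Qed.

Lemma diff_epsP (V W : normedModType R) (f : V -> W) x : differentiable f x ->
  forall e, 0 < e -> \forall h \near (0 : V), `|f (h + x) - f x - 'd f x h| <= e * `|h|.
Proof.
move=> /diff_locally/eqaddoP h e e0; apply: filterS (h e e0) => y /=.
by rewrite !fctE /= opprD addrA.
Qed.

Lemma near_eq_differentiable (V W : normedModType R) (f g : V -> W) x :
  (\forall y \near x, f y = g y) -> differentiable g x -> differentiable f x.
Proof.
move=> fg dg; suff [] : differentiable f x /\ ('d f x = 'd g x :> (V -> W)) by [].
apply: diff_eps; first exact: diff_continuous.
move=> e e0; have h := diff_epsP dg e0.
have fg0 := nbhs_singleton fg.
have fg' : \forall h \near (0 : V), f (h + x) = g (h + x).
  by move: fg; rewrite (near_shift 0) subr0.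
by apply: filterS2 fg' h => y -> ; rewrite fg0.
Qed.

Lemma Ck_congr n (W : normedModType R) k (U : set 'rV[R]_n) (f g : 'rV[R]_n -> W) :
  open U -> (forall x, U x -> f x = g x) -> Ck k U g -> Ck k U f.
Proof.
elim: k f g => [|k IH] f g oU fg /=.
  move=> cg x Ux.
  have Ng : {near x, g =1 f}.
    by apply: filterS (open_nbhs_nbhs (conj oU Ux)) => y Uy; rewrite fg.
  by apply: cvg_trans (near_eq_cvg Ng) _; rewrite fg //; exact: cg.
case=> dg hg; have Ng x : U x -> \forall y \near x, f y = g y.
  by move=> Ux; apply: filterS (open_nbhs_nbhs (conj oU Ux)) => y; exact: fg.
split=> [x Ux|i]; first exact: near_eq_differentiable (Ng x Ux) (dg x Ux).
by apply: IH (hg i) => // x Ux; apply: near_eq_derive; exact: Ng.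
Qed.

Lemma lbk_Ck (P : Type) (D : P -> Prop) n k U (f : P -> 'rV[R]_n -> R) p :
  lbk D k f -> D p -> Ck k U (f p).
Proof.
move=> + Dp; elim: k f => [|k IH] f /=; first by move=> h x _; exact: h.
by case=> df hf; split=> [x _|i]; [exact: df|exact: IH (ubk_lbk (hf i))].
Qed.

Lemma Ck_coords n k a b U (f : 'rV[R]_n -> 'M[R]_(a, b)) :
  open U -> (forall i j, Ck k U (fun x => f x i j)) -> Ck k U f.
Proof.
move=> oU; elim: k f => [|k IH] f /= h.
  by move=> x Ux; apply: continuous_coords => i j; exact: h.
have df x : U x -> differentiable f x.
  by move=> Ux; apply: differentiable_coords => i j; exact: (h i j).1.
split=> // i; apply: IH => a' b'.
apply: Ck_congr ((h a' b').2 i) => // x Ux.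
by rewrite derive_coord //; apply: diff_derivable; exact: df.
Qed.

Lemma LB_smooth (P : Type) (D : P -> Prop) n m (f : P -> 'rV[R]_n -> 'rV[R]_m) p U :
  open U -> LB D f -> D p -> smooth U (f p).
Proof.
move=> oU h Dp k; apply: Ck_coords => // i j; rewrite ord1.
exact: (lbk_Ck U (h k j) Dp).
Qed.

Lemma smooth_congr n (W : normedModType R) (U : set 'rV[R]_n) (f g : 'rV[R]_n -> W) :
  open U -> (forall x, U x -> f x = g x) -> smooth U g -> smooth U f.
Proof. by move=> oU e h k; exact: Ck_congr e (h k). Qed.

End LinkCk.

Section ContinuousBigop.
Context {R : realType}.

Lemma continuous_bigsum (T : topologicalType) (I : Type) (s : seq I) (f : I -> T -> R) x :
  (forall i, {for x, continuous (f i)}) -> {for x, continuous (fun y => \sum_(i <- s) f i y)}.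
Proof.
move=> h; elim: s => [|a s IH].
  have -> : (fun y => \sum_(i <- [::]) f i y) = cst 0 by apply/funext => y; rewrite big_nil.
  exact: cst_continuous.
have -> : (fun y => \sum_(i <- a :: s) f i y) = (fun y => f a y + (fun y => \sum_(i <- s) f i y) y).
  by apply/funext => y; rewrite big_cons.
exact: (continuousD (h a) IH).
Qed.

Lemma continuous_bigprod (T : topologicalType) (I : Type) (s : seq I) (f : I -> T -> R) x :
  (forall i, {for x, continuous (f i)}) -> {for x, continuous (fun y => \prod_(i <- s) f i y)}.
Proof.
move=> h; elim: s => [|a s IH].
  have -> : (fun y => \prod_(i <- [::]) f i y) = cst 1 by apply/funext => y; rewrite big_nil.
  exact: cst_continuous.
have -> : (fun y => \prod_(i <- a :: s) f i y) = (fun y => f a y * (fun y => \prod_(i <- s) f i y) y).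
  by apply/funext => y; rewrite big_cons.
exact: (continuousM (h a) IH).
Qed.

End ContinuousBigop.

(** * Euclidean norm, mean values and limits with geometric error *)

Section Euclidean.
Context {R : realType} {n : nat}.
Implicit Types u v w : 'rV[R]_n.

Definition dot u v : R := \sum_i u 0 i * v 0 i.
Definition en u : R := Num.sqrt (dot u u).

Lemma dotE u v : dot u v = (u *m v^T) 0 0.
Proof. by rewrite mxE; apply: eq_bigr => i _; rewrite mxE. Qed.

Lemma dotC u v : dot u v = dot v u.
Proof. by apply: eq_bigr => i _; rewrite mulrC. Qed.

Lemma dotDl u v w : dot (u + v) w = dot u w + dot v w.
Proof. by rewrite -big_split; apply: eq_bigr => i _; rewrite mxE mulrDl. Qed.

Lemma dotNl u w : dot (- u) w = - dot u w.
Proof. by rewrite -sumrN; apply: eq_bigr => i _; rewrite mxE mulNr. Qed.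

Lemma dotBl u v w : dot (u - v) w = dot u w - dot v w.
Proof. by rewrite dotDl dotNl. Qed.

Lemma dotZl a u w : dot (a *: u) w = a * dot u w.
Proof. by rewrite mulr_sumr; apply: eq_bigr => i _; rewrite mxE mulrA. Qed.

Lemma dotDr u v w : dot w (u + v) = dot w u + dot w v.
Proof. by rewrite dotC dotDl !(dotC w). Qed.

Lemma dotBr u v w : dot w (u - v) = dot w u - dot w v.
Proof. by rewrite dotC dotBl !(dotC w). Qed.

Lemma dotNr u w : dot w (- u) = - dot w u.
Proof. by rewrite dotC dotNl (dotC w). Qed.

Lemma dotZr a u w : dot w (a *: u) = a * dot w u.
Proof. by rewrite dotC dotZl (dotC w). Qed.

Lemma dot_ge0 u : 0 <= dot u u.
Proof. by apply: sumr_ge0 => i _; rewrite -expr2 sqr_ge0. Qed.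

Lemma en_ge0 u : 0 <= en u.
Proof. exact: sqrtr_ge0. Qed.

Lemma enK u : en u ^+ 2 = dot u u.
Proof. by rewrite sqr_sqrtr // dot_ge0. Qed.

Lemma coord_le_en u i : `|u 0 i| <= en u.
Proof.
rewrite -sqrtr_sqr; apply: ler_wsqrtr; rewrite /dot (bigD1 i) //= expr2 lerDl.
by apply: sumr_ge0 => j _; rewrite -expr2 sqr_ge0.
Qed.

Lemma norm_rV_le u (c : R) : 0 <= c -> (forall i, `|u 0 i| <= c) -> `|u| <= c.
Proof.
move=> c0 h; rewrite /Num.Def.normr /= mx_normrE; apply: bigmax_le => // -[i j] _ /=.
by rewrite ord1.
Qed.

Lemma coord_le_norm u i : `|u 0 i| <= `|u|.
Proof. by rewrite [leRHS]/Num.Def.normr /= mx_normrE; exact: (le_bigmax _ _ (0, i)). Qed.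

Lemma norm_le_en u : `|u| <= en u.
Proof. by apply: norm_rV_le; [exact: en_ge0|exact: coord_le_en]. Qed.

Lemma en_eq0 u : en u = 0 -> u = 0.
Proof.
move=> h; apply/rowP => i; apply/eqP; rewrite mxE -normr_le0.
by rewrite -h; exact: coord_le_en.
Qed.

Lemma en_gt0 u : u != 0 -> 0 < en u.
Proof. by move=> u0; rewrite lt0r en_ge0 andbT; apply: contraNneq u0 => /en_eq0 ->. Qed.

Lemma en0 : en 0 = 0.
Proof. by rewrite /en /dot big1 ?sqrtr0 // => i _; rewrite mxE mul0r. Qed.

Lemma enN u : en (- u) = en u.
Proof. by rewrite /en dotNl dotNr opprK. Qed.

Lemma enB u v : en (u - v) = en (v - u).
Proof. by rewrite -enN opprB. Qed.

Lemma enZ a u : en (a *: u) = `|a| * en u.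
Proof. by rewrite /en dotZl dotZr mulrA sqrtrM -?expr2 ?sqr_ge0 // sqrtr_sqr. Qed.

Lemma dot_le u v : dot u v <= en u * en v.
Proof.
have [->|v0] := eqVneq v 0.
  by rewrite en0 mulr0 /dot big1 // => i _; rewrite mxE mulr0.
have v1 := en_gt0 v0.
have [->|u0] := eqVneq u 0.
  by rewrite en0 mul0r /dot big1 // => i _; rewrite mxE mul0r.
have u1 := en_gt0 u0.
have := dot_ge0 (en v *: u - en u *: v).
rewrite dotBl !dotBr !dotZl !dotZr (dotC v u) -!enK => h.
have : 2 * (en u * en v) * dot u v <= 2 * (en u * en v) * (en u * en v) by lra.
by rewrite ler_pM2l // !mulr_gt0.
Qed.

Lemma dot_norm_le u v : `|dot u v| <= en u * en v.
Proof. by rewrite ler_norml dot_le andbT lerNl -dotNl -(enN u) dot_le. Qed.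

Lemma en_triangle u v : en (u + v) <= en u + en v.
Proof.
rewrite -(ler_pXn2r (_ : 0 < 2)%N) ?nnegrE ?addr_ge0 ?en_ge0 //.
rewrite enK dotDl !dotDr (dotC v u) -!enK.
have := dot_le u v; lra.
Qed.

Lemma en_triangleB u v w : en (u - w) <= en (u - v) + en (v - w).
Proof. by rewrite -(subrKA v); exact: en_triangle. Qed.

Lemma en_le_norm u : en u <= n%:R * `|u|.
Proof.
apply: (@le_trans _ _ (\sum_i `|u 0 i|)).
  rewrite -(ler_pXn2r (_ : 0 < 2)%N) ?nnegrE ?en_ge0 ?sumr_ge0 //.
  rewrite enK expr2 mulr_suml; apply: ler_sum => i _.
  apply: (le_trans (ler_norm _)); rewrite normrM ler_wpM2l //.
  by rewrite (bigD1 i) //= lerDl sumr_ge0.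
apply: (@le_trans _ _ (\sum_(i < n) `|u|)).
  by apply: ler_sum => i _; exact: coord_le_norm.
by rewrite sumr_const card_ord mulr_natl.
Qed.

Lemma eucl_distE u v : eucl_dist u v = en (u - v).
Proof.
rewrite /eucl_dist /en /dot; congr Num.sqrt.
by apply: eq_bigr => i _; rewrite !mxE expr2.
Qed.

Lemma en_continuous : continuous en.
Proof.
move=> x; apply: continuous_comp; last exact: sqrt_continuous.
apply: continuous_bigsum => i; apply: continuousM; exact: coord_continuous.
Qed.

Lemma open_en_ball (r : R) : open [set y : 'rV[R]_n | en y < r].
Proof.
rewrite (_ : [set y | _] = en @^-1` [set x | x < r]) //.
by apply: open_comp => [x _|]; [exact: en_continuous|exact: open_lt].
Qed.

Lemma norm_mulmx_le m (v : 'rV[R]_m) (A : 'M[R]_(m, n)) (c : R) : 0 <= c ->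
  (forall i j, `|A i j| <= c) -> `|v *m A| <= m%:R * c * `|v|.
Proof.
move=> c0 h; apply: norm_rV_le => [|j]; first by rewrite !mulr_ge0.
rewrite mxE; apply: (le_trans (ler_norm_sum _ _ _)).
apply: (@le_trans _ _ (\sum_(i < m) c * `|v|)).
  apply: ler_sum => i _; rewrite normrM mulrC ler_pM //.
  rewrite [leRHS]/Num.Def.normr /= mx_normrE; exact: (le_bigmax _ _ (0, i)).
by rewrite sumr_const card_ord -[leLHS]mulr_natl mulrA.
Qed.

End Euclidean.

Section MeanValue.
Context {R : realType}.

Lemma differentiable_line n (y w : 'rV[R]_n) (t : R) :
  differentiable (fun s : R => y + s *: w) t.
Proof.
apply: differentiableD; first exact: differentiable_cst.
by apply: differentiableZl.
Qed.

Lemma is_derive_line n (f : 'rV[R]_n -> R) (y w : 'rV[R]_n) t :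
  differentiable f (y + t *: w) ->
  is_derive t 1 (fun s : R => f (y + s *: w)) (\sum_j w 0 j * pd j f (y + t *: w)).
Proof.
move=> df; have dl := differentiable_line y w t.
apply: DeriveDef.
  by apply: diff_derivable; apply: (@differentiable_comp _ _ _ _ (fun s : R => y + s *: w) f).
rewrite derive_comp //; apply: eq_bigr => j _; congr (_ * _).
rewrite -derive_coord; last exact: diff_derivable.
rewrite deriveD; [|exact: derivable_cst|by apply: diff_derivable; exact: differentiableZl].
rewrite derive_cst add0r deriveE; last exact: differentiableZl.
by rewrite diffZl // diff_val scale1r.
Qed.

Lemma mean_value_line n (f : 'rV[R]_n -> R) (y w : 'rV[R]_n) :
  (forall t, 0 <= t <= 1 -> differentiable f (y + t *: w)) ->
  exists2 t, 0 < t < 1 & f (y + w) - f y = \sum_j w 0 j * pd j f (y + t *: w).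
Proof.
move=> df.
have [||t t01] := @MVT R (fun s => f (y + s *: w)) (fun t => \sum_j w 0 j * pd j f (y + t *: w)) 0 1 ltr01.
- move=> t; rewrite in_itv /= => /andP[t0 t1]; apply: is_derive_line; apply: df.
  by rewrite !ltW.
- apply: derivable_within_continuous => t; rewrite in_itv /= => t01.
  by have [] := is_derive_line (df t t01).
rewrite scale1r scale0r addr0 subr0 mulr1 => e; exists t => //.
Qed.

Lemma lipschitz_pd n (f : 'rV[R]_n -> R) (K : R) (x y : 'rV[R]_n) : (forall z, differentiable f z) ->
  (forall j z, `|pd j f z| <= K) -> `|f x - f y| <= n%:R * K * `|x - y|.
Proof.
move=> df hK; have [t _] := @mean_value_line n f y (x - y) (fun t _ => df _).
rewrite (addrC y) subrK => ->; apply: (le_trans (ler_norm_sum _ _ _)).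
apply: (@le_trans _ _ (\sum_(j < n) K * `|x - y|)).
  by apply: ler_sum => j _; rewrite normrM mulrC ler_pM // coord_le_norm.
by rewrite sumr_const card_ord -[leLHS]mulr_natl mulrA.
Qed.

End MeanValue.

Section GeometricSequences.
Context {R : realType}.

Lemma geometric_le0 (C a : R) : (forall k, a <= C * 2 ^- k) -> a <= 0.
Proof.
move=> h; rewrite leNgt; apply/negP => a0.
have C0 : 0 < C by have := h 0%N; rewrite expr0 invr1 mulr1; exact: lt_le_trans.
have [k hk] : exists k : nat, C / a < k%:R.
  by exists (Num.bound (C / a)); rewrite archi_boundP // divr_ge0 // ltW.
have := h k; rewrite ler_pdivlMr ?exprn_gt0 // leNgt => /negP; apply.
rewrite mulrC -ltr_pdivrMr // (lt_le_trans hk) // -natrX ler_nat.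
exact/ltnW/ltn_expl.
Qed.

Lemma geometric_limit (u : nat -> R) (K : R) :
  (forall k, `|u k.+1 - u k| <= K * 2 ^- k) ->
  exists l, forall k, `|u k - l| <= 2 * K * 2 ^- k.
Proof.
move=> h.
have K0 : 0 <= K by have := h 0%N; rewrite expr0 invr1 mulr1; exact: le_trans.
have q0 k : 0 <= 2 ^- k :> R by rewrite invr_ge0 exprn_ge0.
have tail k j : `|u (k + j)%N - u k| <= 2 * K * 2 ^- k - 2 * K * 2 ^- (k + j).
  elim: j => [|j IH]; first by rewrite addn0 !subrr normr0.
  rewrite addnS; have := h (k + j)%N; have := ler_distD (u (k + j)%N) (u (k + j).+1) (u k).
  move: IH; rewrite exprS invfM; move: (2 ^- k) (2 ^- (k + j)) => p q; lra.
(* A term minus the largest possible remaining variation is below every term plus its own remaining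
   variation; the supremum of these lower bounds is the limit. *)
pose a k := u k - 2 * K * 2 ^- k.
have ab j k : a j <= u k + 2 * K * 2 ^- k.
  have [/subnKC e|/ltnW/subnKC e] := leqP k j.
    have := tail k (j - k)%N; rewrite e ler_distl /a => /andP[_].
    have : 0 <= K * 2 ^- j by rewrite mulr_ge0.
    have : 0 <= K * 2 ^- j by rewrite mulr_ge0.
    move: (2 ^- k) (2 ^- j) => p q; lra.
  have := tail j (k - j)%N; rewrite e ler_distl /a => /andP[+ _].
  have : 0 <= K * 2 ^- k by rewrite mulr_ge0.
  move: (2 ^- k) (2 ^- j) => p q; lra.
exists (sup (range a)) => k.
have A0 : has_sup (range a).
  split; first by exists (a 0%N); exists 0%N.
  by exists (u 0%N + 2 * K * 2 ^- 0) => _ [j _ <-]; exact: ab.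
have l1 : a k <= sup (range a) by apply: sup_upper_bound => //; exists k.
have l2 : sup (range a) <= u k + 2 * K * 2 ^- k.
  by apply: ge_sup; [exact: A0.1|move=> _ [j _ <-]; exact: ab].
rewrite ler_distl; rewrite /a in l1; apply/andP; split; lra.
Qed.

End GeometricSequences.

(** * Inverses of maps near the identity *)

Section NearIdentity.
Context {R : realType} (n : nat).

Lemma det_near1 : exists2 eta : R, 0 < eta &
  forall E : 'M[R]_n, (forall i j, `|E i j| <= eta) -> 2^-1 <= \det (1%:M + E).
Proof.
have detc : {for 1%:M, continuous (fun A : 'M[R]_n => \det A)}.
  apply: continuous_bigsum => s; apply: continuousM; first exact: cst_continuous.
  by apply: continuous_bigprod => i; exact: coord_continuous.
have /cvgrPdist_lt/(_ 2^-1) := detc.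
rewrite invr_gt0 ltr0n => /(_ isT) /nbhs_ballP[d /= d0 hd].
exists (d / 2); first by rewrite divr_gt0.
move=> E hE; have := hd (1%:M + E) _.
rewrite det1 ltr_norml => H; suff /H/andP[] : ball (1%:M : 'M[R]_n) d (1%:M + E) by lra.
split=> // i j; rewrite /ball /= !mxE opprD addrA subrr sub0r normrN.
by rewrite (le_lt_trans (hE i j)) // ltr_pdivrMr // ltr_pMr // ltr1n.
Qed.

Lemma fixed_point (f : 'rV[R]_n -> 'rV[R]_n) :
  (forall x y, `|f x - f y| <= 2^-1 * `|x - y|) -> exists x, x = f x.
Proof.
move=> h; pose u k := iter k f 0; pose K := `|u 1%N - u 0%N|; have K0 : 0 <= K := normr_ge0 _.
have uK k : `|u k.+1 - u k| <= K * 2 ^- k.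
  elim: k => [|k IH]; first by rewrite expr0 invr1 mulr1.
  apply: (le_trans (h _ _)); apply: (@le_trans _ _ (2^-1 * (K * 2 ^- k))).
    by rewrite ler_wpM2l // invr_ge0.
  by rewrite exprS invfM mulrCA.
have [l hl] : exists l : 'rV[R]_n, forall k i, `|u k 0 i - l 0 i| <= 2 * K * 2 ^- k.
  have H i : exists l, forall k, `|u k 0 i - l| <= 2 * K * 2 ^- k.
    apply: geometric_limit => k; apply: le_trans (uK k).
    by apply: le_trans (coord_le_norm _ i); rewrite !mxE.
  by have [l hl] := choice H; exists (\row_i l i) => k i; rewrite mxE.
have hl' k : `|u k - l| <= 2 * K * 2 ^- k.
  apply: norm_rV_le => [|i]; last by rewrite !mxE.
  by rewrite divr_ge0 ?mulr_ge0 ?exprn_ge0 //.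
exists l; apply/eqP; rewrite -subr_eq0 -normr_le0.
apply: (@geometric_le0 R (2 * K)) => k.
have := hl' k.+1; have := h (u k) l; have := hl' k.
rewrite exprS invfM -/(u k.+1) => h1 h2 h3.
have : `|l - f l| <= `|u k.+1 - l| + `|u k.+1 - f l|.
  by rewrite -(subrKA (u k.+1)) (distrC (u k.+1) l); exact: ler_normD.
have h4 : `|u k.+1 - f l| <= 2^-1 * `|u k - l| := h2.
move: (2 ^- k) h1 h3 => q h1 h3; lra.
Qed.

(* [h = id + e] has Lipschitz inverse [k = id - e o k], whose Jacobian is the
   inverse of that of [h] along [k]: this gains one derivative at a time. *)
Lemma near_identity_inverse : exists2 eta : R, 0 < eta &
  forall (P : Type) (D : P -> Prop) (e : P -> 'rV[R]_n -> 'rV[R]_n), LB D e ->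
  (forall p, D p -> forall i j x, `|pd i (fun y => e p y 0 j) x| <= eta) ->
  exists k : P -> 'rV[R]_n -> 'rV[R]_n,
  [/\ LB D k, (forall p, D p -> forall x, k p x + e p (k p x) = x) &
      (forall p, D p -> forall x, k p (x + e p x) = x)].
Proof.
have [eta0 eta00 hdet] := det_near1.
(* The first bound keeps the Jacobian invertible, the second makes [e p] a contraction of ratio 1/2
   for the sup norm. *)
pose eta := Num.min eta0 (n%:R * 2 + 1)^-1.
have N0 : 0 < n%:R * 2 + 1 :> R by rewrite ltr_wpDl // mulr_ge0.
exists eta; first by rewrite lt_min eta00 invr_gt0.
move=> P D e LBe he.
have eta_n : n%:R * eta <= 2^-1.
  apply: (@le_trans _ _ (n%:R * (n%:R * 2 + 1)^-1)); first by rewrite ler_wpM2l // ge_min lexx orbT.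
  rewrite ler_pdivrMr //; have := ler0n R n; lra.
have lip p : D p -> forall x y, `|e p x - e p y| <= 2^-1 * `|x - y|.
  move=> Dp x y; apply: norm_rV_le => [|j]; first by rewrite mulr_ge0 // invr_ge0.
  rewrite !mxE.
  apply: (le_trans (lipschitz_pd _ _ (fun z => (LBe 1 j).1 p Dp z) (fun i z => he p Dp i j z))).
  exact: ler_wpM2r.
have fp p x : exists z, D p -> z + e p z = x.
  have [Dp|nD] := pselect (D p); last by exists 0.
  have [|z hz] := @fixed_point (fun z => x - e p z).
    move=> a b; rewrite (_ : _ - _ = e p b - e p a); first by rewrite (distrC a); exact: lip.
    by apply/rowP => i; rewrite !mxE; ring.
  by exists z => _; rewrite {1}hz subrK.
pose k p x := projT1 (cid (fp p x)).
have hk p x : D p -> k p x + e p (k p x) = x by exact: projT2 (cid (fp p x)).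
(* The contraction cannot undo more than half of a displacement. This gives both the uniqueness of
   the preimage and the Lipschitz bound for [k]. *)
have inj p : D p -> forall x y, `|x - y| <= 2 * `|(x + e p x) - (y + e p y)|.
  move=> Dp x y; have := lip p Dp x y.
  have : `|x - y| <= `|(x + e p x) - (y + e p y)| + `|e p x - e p y|.
    have -> : x - y = ((x + e p x) - (y + e p y)) - (e p x - e p y).
      by apply/rowP => i; rewrite !mxE; ring.
    exact: ler_normB.
  lra.
exists k; split=> [|p Dp x|p Dp x]; first last.
- apply/eqP; rewrite -subr_eq0 -normr_le0; apply: le_trans (inj p Dp _ _) _.
  by rewrite hk // subrr normr0 mulr0.
- exact: hk.
have klip p : D p -> forall x y, `|k p x - k p y| <= 2 * `|x - y|.
  by move=> Dp x y; have := inj p Dp (k p x) (k p y); rewrite !hk.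
pose J p (x : 'rV[R]_n) : 'M[R]_n := 1%:M + \matrix_(i, j) pd i (fun y => e p y 0 j) x.
have Jdet p x : D p -> 2^-1 <= \det (J p x).
  by move=> Dp; apply: hdet => i j; rewrite mxE (le_trans (he p Dp i j x)) // ge_min lexx.
have Junit p x : D p -> J p x \in unitmx.
  by move=> Dp; rewrite unitmxE unitfE gt_eqF // (lt_le_trans _ (Jdet p x Dp)) // invr_gt0.
have de p x : D p -> differentiable (e p) x.
  by move=> Dp; exact: (LBk_differentiable (LBe 1)).
have dJ p x v : D p -> v + 'd (e p) x v = v *m J p x.
  move=> Dp; rewrite mulmxDr mulmx1 -deriveE; last exact: de.
  congr (_ + _); apply/rowP => j.
  rewrite derive_coord; last by apply: diff_derivable; exact: de.
  rewrite derive_pd; last exact: (LBe 1 j).1.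
  by rewrite mxE; apply: eq_bigr => i _; rewrite mxE.
(* The first-order error of [e p] at [k p x] is small compared with the displacement of [k p], which
   the Lipschitz bound compares with [h]; multiplying by the inverse Jacobian gives the expansion of
   [k p]. *)
have dk p x : D p -> differentiable (k p) x /\ 'd (k p) x = (mulmxr (invmx (J p (k p x)))) :> ('rV[R]_n -> 'rV[R]_n).
  move=> Dp; set A := invmx _.
  have cA : continuous (mulmxr A : 'rV[R]_n -> 'rV[R]_n).
    move=> v; apply: continuous_coords => i j.
    rewrite (_ : (fun y => _) = (fun y : 'rV[R]_n => \sum_l y i l * A l j)); last first.
      by apply/funext => y; rewrite /= mxE.
    by apply: continuous_bigsum => l; apply: continuousM; [exact: coord_continuous|exact: cst_continuous].
  apply: (@diff_eps R _ _ (k p) (mulmxr A : {linear 'rV[R]_n -> 'rV[R]_n}) x cA) => eps eps0.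
  pose c : R := n%:R * `|A|.
  have c0 : 0 <= c by rewrite mulr_ge0.
  have e2 : 0 < eps / (2 * (c + 1)) by rewrite divr_gt0 // mulr_gt0 // ltr_wpDl.
  have := diff_epsP (de p (k p x) Dp) e2.
  rewrite {1}/nbhs /= => /nbhs_ballP[d /= d0 hd].
  apply/nbhs_ballP; exists (d / 2) => /=; first by rewrite divr_gt0.
  move=> h; rewrite -ball_normE /= sub0r normrN => hh.
  set u := k p (h + x) - k p x.
  have ul : `|u| <= 2 * `|h| by apply: le_trans (klip p Dp _ _) _; rewrite addrK.
  have := hd u; rewrite -ball_normE /= sub0r normrN => /(_ _) H.
  have /H : `|u| < d by rewrite (le_lt_trans ul) // mulrC -ltr_pdivlMr.
  rewrite /u subrK -/u.
  have -> : e p (k p (h + x)) - e p (k p x) - 'd (e p) (k p x) u = h - u *m J p (k p x).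
    rewrite -dJ //; have E1 := hk p (h + x) Dp; have E2 := hk p x Dp.
    apply/rowP => i; move/rowP/(_ i): E1; move/rowP/(_ i): E2; rewrite /u !mxE; lra.
  move=> hle.
  have -> : u - mulmxr A h = - ((h - u *m J p (k p x)) *m A).
    by rewrite mulmxBl -mulmxA mulmxV ?Junit // mulmx1 opprB.
  rewrite normrN; apply: (le_trans (norm_mulmx_le _ (normr_ge0 A) _)).
    by move=> i j; rewrite [leRHS]/Num.Def.normr /= mx_normrE; exact: (le_bigmax _ _ (i, j)).
  rewrite -/c; apply: (@le_trans _ _ (c * (eps / (2 * (c + 1)) * (2 * `|h|)))).
    by rewrite ler_wpM2l // (le_trans hle) // ler_wpM2l // ltW.
  have -> : c * (eps / (2 * (c + 1)) * (2 * `|h|)) = (c / (c + 1)) * (eps * `|h|).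
    by field; rewrite gt_eqF // ltr_wpDl.
  rewrite ler_piMl ?mulr_ge0 ?(ltW eps0) // ler_pdivrMr ?ltr_wpDl // mul1r lerDl //.
have dkc j p x i : D p -> pd i (fun y => k p y 0 j) x = invmx (J p (k p x)) i j.
  move=> Dp; have [d1 d2] := dk p x Dp.
  rewrite /pd -derive_coord; last exact: diff_derivable.
  by rewrite deriveE // d2 /= -rowE mxE.
move=> o; elim: o => [|o IH] j.
  move=> p Dp; move=> x; apply: (@continuous_comp _ _ _ (k p) (fun y : 'rV[R]_n => y 0 j)).
    exact/differentiable_continuous/(dk p x Dp).1.
  exact: coord_continuous.
split=> [p Dp x|i]; first by apply: differentiable_coord_comp; exact: (dk p x Dp).1.
apply: (@ubk_ext _ _ _ _ _ (fun p x => invmx (J p (k p x)) i j)).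
  by move=> p Dp x; rewrite dkc.
apply: (@ubk_invmx _ _ _ _ _ _ (fun p x => J p (k p x)) 2^-1); first by rewrite invr_gt0.
  by move=> p Dp x; exact: Jdet.
move=> a b; apply: (@ubk_ext _ _ _ _ _ (fun p x => (a == b)%:R + pd a (fun y => e p y 0 b) (k p x))).
  by move=> p Dp x; rewrite !mxE.
apply: ubkD; first exact: ubk_cst1.
exact: (ubk_comp ((LBe o.+1 b).2 a) IH).
Qed.

End NearIdentity.

(** * Smooth steps and bump functions *)

Section SmoothStep.
Context {R : realType}.

(* The functions t^-p e^(-1/t) for t > 0, extended by 0, are closed under
   derivation. *)
Definition expinv (p : nat) (t : R) : R :=
  if 0 < t then t^-1 ^+ p * expR (- t^-1) else 0.

Lemma expinv_ge0 p t : 0 <= expinv p t.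
Proof.
rewrite /expinv; case: ifPn => // t0.
by rewrite mulr_ge0 ?expR_ge0 // exprn_ge0 // invr_ge0 ltW.
Qed.

Lemma expinv_gt0 p t : 0 < t -> 0 < expinv p t.
Proof. by move=> t0; rewrite /expinv t0 mulr_gt0 ?expR_gt0 // exprn_gt0 // invr_gt0. Qed.

Lemma expinv_neg p t : t <= 0 -> expinv p t = 0.
Proof. by move=> t0; rewrite /expinv ltNge t0. Qed.

Lemma expinv_le p t : `|expinv p t| <= (p`!)%:R.
Proof.
rewrite ger0_norm ?expinv_ge0 // /expinv; case: ifPn => [t0|_]; last by rewrite ler0n.
rewrite expRN.
have s0 : 0 <= t^-1 by rewrite invr_ge0 ltW.
case: p => [|p]; first by rewrite expr0 mul1r invf_le1 ?expR_gt0 // -[leLHS]expR0 ler_expR.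
have := expR_ge1Dxn p s0; have := expR_gt0 t^-1.
have : 0 < (p.+1`!)%:R :> R by rewrite ltr0n fact_gt0.
move: (expR _) (t^-1 ^+ _) (_%:R) => e x F F0 e0 h.
rewrite ler_pdivrMr // mulrC -ler_pdivrMr //; lra.
Qed.

(** Since [expinv p.+2] is bounded, this is the quadratic decay at 0 which gives the derivative 0
    there. *)
Lemma expinv_sqr p t : expinv p t = t ^+ 2 * expinv p.+2 t.
Proof.
rewrite /expinv; case: ifPn => [t0|_]; last by rewrite mulr0.
by rewrite mulrA; congr (_ * _); rewrite !exprS; field; rewrite gt_eqF.
Qed.

Lemma expinv_derive p (t : R) :
  is_derive t 1 (expinv p) (expinv p.+2 t - p%:R * expinv p.+1 t).
Proof.
have [t0|t0|t0] := ltgtP 0 t.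
- have dV : is_derive t (1 : R) (fun s : R => s^-1) (- (t^-1 ^+ 2)).
    have := @is_deriveV R id t 1 1 (lt0r_neq0 t0) (is_derive_id _ _).
    by move=> /is_derive_eq; apply; rewrite /GRing.scale /= mulr1 exprVn.
  have dE := @is_derive1_comp R expR (fun s => - s^-1) t _ _ (is_derive_expR (- t^-1)) (is_deriveN dV).
  have dX := is_deriveX p dV.
  have := is_deriveM dX dE.
  rewrite /expinv t0 /= => H.
  apply: near_eq_is_derive (is_derive_eq H _).
    near=> s; have -> : 0 < s by near: s; exact: lt_nbhsr.
    by rewrite !fctE.
  rewrite /GRing.scale /= !fctE /=.
  case: p {dX H} => [|p]; first by rewrite !mul0r expr0 expr2; ring.
  rewrite -pred_Sn !exprS; ring.
- have -> : expinv p.+2 t - p%:R * expinv p.+1 t = 0 by rewrite !expinv_neg ?ltW // mulr0 subrr.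
  apply: near_eq_is_derive (is_derive_cst (0 : R) t 1).
  near=> s; rewrite expinv_neg //; apply: ltW; near: s; exact: lt_nbhsl.
- rewrite -t0 !expinv_neg // mulr0 subrr.
  have [|] := @diff_eps R R R (expinv p) (\0 : {linear R -> R}) 0 (@cst_continuous _ _ _).
    move=> e e0; pose C : R := (p.+2`!)%:R.
    have C0 : 0 < C by rewrite ltr0n fact_gt0.
    near=> h; rewrite addr0 (expinv_neg _ (lexx 0)) subr0 subr0 expinv_sqr normrM normrX.
    apply: (@le_trans _ _ (`|h| ^+ 2 * C)); first by rewrite ler_wpM2l ?exprn_ge0 // expinv_le.
    rewrite expr2 -mulrA mulrC ler_wpM2r // -ler_pdivlMr //.
    near: h; apply/nbhs_ballP; exists (e / C) => /=; first by rewrite divr_gt0.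
    by move=> h /=; rewrite /ball /= sub0r normrN => /ltW.
  move=> d1 d2; apply: DeriveDef; first exact: diff_derivable.
  by rewrite deriveE // d2.
Unshelve. all: by end_near. Qed.

Lemma pd_coord_fun (F : R -> R) (dF : R -> R) (x : 'rV[R]_1) (i : 'I_1) :
  (forall t : R, is_derive t (1 : R) F (dF t)) ->
  differentiable (fun y : 'rV[R]_1 => F (y 0 0)) x /\
  pd i (fun y : 'rV[R]_1 => F (y 0 0)) x = dF (x 0 0).
Proof.
move=> h; have dFx : differentiable F (x 0 0) by apply/derivable1_diffP; case: (h (x 0 0)).
have dc : differentiable (fun y : 'rV[R]_1 => y 0 0) x by exact: differentiable_coord.
split; first exact: (@differentiable_comp _ _ _ _ (fun y : 'rV[R]_1 => y 0 0) F).
rewrite /pd -[fun y => _]/(F \o (fun y : 'rV[R]_1 => y 0 0)) deriveE; last exact: differentiable_comp.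
rewrite diff_comp //= -(deriveE _ dc) -/(pd i _ x) pd_coord ord1 eqxx.
by rewrite -deriveE //; case: (h (x 0 0)).
Qed.

Lemma ub_expinv p : ub (fun _ : unit => True) (fun _ (x : 'rV[R]_1) => expinv p (x 0 0)).
Proof.
move=> k; elim: k p => [|k IH] p; apply: ubkS => /=.
- by exists (p`!)%:R => _ _ x; exact: expinv_le.
- move=> _ _ x; apply: differentiable_continuous.
  exact: (pd_coord_fun x 0 (expinv_derive p)).1.
- by exists (p`!)%:R => _ _ x; exact: expinv_le.
split=> [_ _ x|i]; first exact: (pd_coord_fun x 0 (expinv_derive p)).1.
apply: ubk_ext (ubkB (IH p.+2) (ubkM (ubk_cst1 _ _ _ p%:R) (IH p.+1))) => _ _ x.
by rewrite (pd_coord_fun x i (expinv_derive p)).2.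
Qed.

Definition step (t : R) : R := expinv 0 t / (expinv 0 t + expinv 0 (1 - t)).

Lemma expinv_mono (t : R) : 2^-1 <= t -> expR (- 2) <= expinv 0 t.
Proof.
move=> t2; have t0 : 0 < t by apply: lt_le_trans t2; rewrite invr_gt0.
rewrite /expinv t0 expr0 mul1r ler_expR lerN2 -[leRHS]invrK lef_pV2 ?posrE ?invr_gt0 //.
Qed.

(** One of [t] and [1 - t] is at least 1/2. *)
Lemma step_den (t : R) : expR (- 2) <= expinv 0 t + expinv 0 (1 - t).
Proof.
have [h|h] := leP 2^-1 t.
  by apply: (le_trans (expinv_mono h)); rewrite lerDl expinv_ge0.
have h' : 2^-1 <= 1 - t by lra.
by apply: (le_trans (expinv_mono h')); rewrite lerDr expinv_ge0.
Qed.

Lemma step_den_gt0 (t : R) : 0 < expinv 0 t + expinv 0 (1 - t).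
Proof. exact: lt_le_trans (expR_gt0 _) (step_den t). Qed.

Lemma step_ge0 t : 0 <= step t.
Proof. by rewrite divr_ge0 ?expinv_ge0 // ltW // step_den_gt0. Qed.

Lemma step_le1 t : step t <= 1.
Proof. by rewrite ler_pdivrMr ?step_den_gt0 // mul1r lerDl expinv_ge0. Qed.

Lemma step0 t : t <= 0 -> step t = 0.
Proof. by move=> t0; rewrite /step expinv_neg // mul0r. Qed.

Lemma step1 t : 1 <= t -> step t = 1.
Proof.
move=> t1; rewrite /step [expinv 0 (1 - t)]expinv_neg ?subr_le0 // addr0 divff //.
by rewrite gt_eqF // expinv_gt0 // (lt_le_trans _ t1).
Qed.

Lemma LBk_row1 (P : Type) (D : P -> Prop) m k (g : P -> 'rV[R]_m -> R) :
  lbk D k g -> LBk D k (fun p x => \row_(_ < 1) g p x).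
Proof. by move=> h j; apply: lbk_ext h => p Dp x; rewrite mxE. Qed.

Lemma ub_step : ub (fun _ : unit => True) (fun _ (x : 'rV[R]_1) => step (x 0 0)).
Proof.
move=> k; have h2 : ubk (fun _ : unit => True) k (fun _ (x : 'rV[R]_1) => expinv 0 (1 - x 0 0)).
  apply: ubk_ext (ubk_comp (ub_expinv 0 k) (LBk_row1 (g := fun _ x => 1 - x 0 0) _)).
    by move=> _ _ x /=; rewrite mxE.
  by apply: lbkB; [exact: lbk_cst|exact: lbk_coord].
apply: ubkM; first exact: ub_expinv.
apply: (@ubk_inv _ _ _ _ _ _ (expR (- 2))); first exact: expR_gt0.
  by move=> _ _ x; exact: step_den.
by apply: ubkD => //; exact: ub_expinv.
Qed.

Lemma ubk_step_comp (P : Type) (D : P -> Prop) m k (g : P -> 'rV[R]_m -> R) :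
  lbk D k g -> ubk D k (fun p x => step (g p x)).
Proof.
move=> h; apply: ubk_ext (ubk_comp (f := fun _ (x : 'rV[R]_1) => step (x 0 0)) _ (LBk_row1 h)).
  by move=> p Dp x /=; rewrite mxE.
exact: (ubk_reindex (s := fun=> tt) (fun _ _ => I) (ub_step k)).
Qed.

End SmoothStep.

Section Bump.
Context {R : realType}.

Lemma near_coord_gt m (i : 'I_m) (c : R) (x : 'rV[R]_m) : c < `|x 0 i| ->
  \forall y \near x, c < `|(y : 'rV[R]_m) 0 i|.
Proof.
move=> h; have cc : {for x, continuous (fun y : 'rV[R]_m => `|y 0 i|)}.
  by apply: (@continuous_comp _ _ _ (fun y : 'rV[R]_m => y 0 i) (fun t => `|t|)); [exact: coord_continuous|exact: norm_continuous].
exact: (cc _ (lt_nbhsr h)).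
Qed.

(** The coordinate is unbounded, but [f] vanishes where it exceeds [c]; that set is open, so the
    derivatives of [f] vanish there too. *)
Lemma ubk_mul_coord (P : Type) (D : P -> Prop) m k (c : R) (i : 'I_m) (f : P -> 'rV[R]_m -> R) :
  (forall p, D p -> forall x : 'rV[R]_m, c < `|x 0 i| -> f p x = 0) ->
  ubk D k f -> ubk D k (fun p x => x 0 i * f p x).
Proof.
have B (g : P -> 'rV[R]_m -> R) k' : (forall p, D p -> forall x : 'rV[R]_m, c < `|x 0 i| -> g p x = 0) -> ubk D k' g ->
    exists K, forall p, D p -> forall x : 'rV[R]_m, `|x 0 i * g p x| <= K.
  move=> sg [K hK]; exists (`|c| * K) => p Dp x; rewrite normrM.
  have [/(sg p Dp x) ->|h] := ltP c `|x 0 i|.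
    by rewrite normr0 mulr0 mulr_ge0 // (bd_ge0 (hK p Dp)).
  by rewrite ler_pM // ?(le_trans h) ?ler_norm // (bd_bound (hK p Dp)).
elim: k f => [|k IH] f sf hf; apply: ubkS; first exact: B sf hf.
- move=> p Dp x; apply: continuousM; first exact: coord_continuous.
  exact: (ubk_lbk hf).
- exact: B sf hf.
have [df hd] := ubk_lbk hf.
split=> [p Dp x|j]; first by apply: differentiableM; [exact: differentiable_coord|exact: df].
apply: (@ubk_ext _ _ _ _ _ (fun p x => x 0 i * pd j (f p) x + (j == i)%:R * f p x)).
  move=> p Dp x; rewrite pdM; [|exact: differentiable_coord|exact: df].
  by rewrite pd_coord.
apply: ubkD; last by apply: ubkM; [exact: ubk_cst1|exact: ubk_lower].
apply: IH => // p Dp x cx; rewrite /pd -[RHS](@derive_cst R 'rV[R]_m R 0 x (delta_mx 0 j)).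
apply: near_eq_derive; apply: filterS (near_coord_gt cx) => y; exact: sf.
Qed.

Variables (n : nat) (a b : R).
Hypotheses (a0 : 0 <= a) (ab : a < b).

(** A substitute for the square with all derivatives bounded on the line: it equals [t ^+ 2] for
    [|t| <= b] and stays at least [b ^+ 2] beyond. A sum of such terms replaces the squared norm in
    [bump]. *)
Definition cutsq (t : R) : R :=
  let th := step (b + 1 - t) * step (b + 1 + t) in t * (t * th) + b ^+ 2 * (1 - th).

Definition bump (y : 'rV[R]_n) : R :=
  step ((b ^+ 2 - \sum_i cutsq (y 0 i)) / (b ^+ 2 - a ^+ 2)).

Let b0 : 0 < b. Proof. exact: le_lt_trans ab. Qed.

Lemma cutsq_small t : `|t| <= b -> cutsq t = t ^+ 2.
Proof.
rewrite ler_norml => /andP[t1 t2]; rewrite /cutsq !step1; [|lra..].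
by rewrite !mulr1 subrr mulr0 addr0 expr2.
Qed.

Lemma cutsq_ge0 t : 0 <= cutsq t.
Proof.
rewrite /cutsq; set th := step _ * step _.
have th0 : 0 <= th by rewrite mulr_ge0 ?step_ge0.
have th1 : th <= 1 by rewrite mulr_ile1 ?step_ge0 ?step_le1.
apply: addr_ge0; last by rewrite mulr_ge0 ?sqr_ge0 ?subr_ge0.
by rewrite mulrA mulr_ge0 // -expr2 sqr_ge0.
Qed.

Lemma cutsq_large t : b <= `|t| -> b ^+ 2 <= cutsq t.
Proof.
move=> bt; rewrite /cutsq; set th := step _ * step _.
have th0 : 0 <= th by rewrite mulr_ge0 ?step_ge0.
have tt : b ^+ 2 <= t ^+ 2 by rewrite -(real_normK (num_real t)) ler_pXn2r // ?nnegrE // ltW.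
have : 0 <= (t ^+ 2 - b ^+ 2) * th by rewrite mulr_ge0 // subr_ge0.
rewrite !expr2; lra.
Qed.

Lemma bump_ge0 y : 0 <= bump y. Proof. exact: step_ge0. Qed.
Lemma bump_le1 y : bump y <= 1. Proof. exact: step_le1. Qed.

Let ab2 : 0 < b ^+ 2 - a ^+ 2.
Proof. by rewrite subr_gt0 ltr_pXn2r // nnegrE ltW. Qed.

Lemma bump1 y : en y <= a -> bump y = 1.
Proof.
move=> ya; apply: step1; rewrite ler_pdivlMr // mul1r lerD2l lerN2.
rewrite (eq_bigr (fun i => y 0 i * y 0 i)); last first.
  move=> i _; rewrite cutsq_small // (le_trans (coord_le_en y i)) // (le_trans ya) //.
  exact: ltW.
by rewrite -/(dot y y) -enK ler_pXn2r // nnegrE en_ge0.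
Qed.

Lemma bump0 y : b <= en y -> bump y = 0.
Proof.
move=> yb; apply: step0; rewrite pmulr_lle0 ?invr_gt0 // subr_le0.
have [/existsP[i hi]|/existsPn h] := boolP [exists i, b <= `|y 0 i|].
  apply: (le_trans (cutsq_large hi)); rewrite (bigD1 i) //= lerDl.
  by apply: sumr_ge0 => j _; exact: cutsq_ge0.
rewrite (eq_bigr (fun i => y 0 i * y 0 i)); last first.
  by move=> i _; rewrite cutsq_small //; have := h i; rewrite -ltNge => /ltW.
by rewrite -/(dot y y) -enK ler_pXn2r // nnegrE ?en_ge0 // ltW.
Qed.

Lemma bump_neq0 y : bump y != 0 -> en y < b.
Proof. by apply: contraNlt => /bump0 ->. Qed.

Lemma ubk_cutsq (P : Type) (D : P -> Prop) k (i : 'I_n) : ubk D k (fun _ (y : 'rV[R]_n) => cutsq (y 0 i)).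
Proof.
have hth : ubk D k (fun _ (y : 'rV[R]_n) => step (b + 1 - y 0 i) * step (b + 1 + y 0 i)).
  apply: ubkM; apply: ubk_step_comp; [apply: lbkB|apply: lbkD]; by [exact: lbk_cst|exact: lbk_coord].
have sth (y : 'rV[R]_n) : b + 1 < `|y 0 i| -> step (b + 1 - y 0 i) * step (b + 1 + y 0 i) = 0.
  rewrite ltr_normr => /orP[h|h]; first by rewrite step0 ?mul0r //; lra.
  by rewrite (@step0 _ (b + 1 + y 0 i)) ?mulr0 //; lra.
have h1 := @ubk_mul_coord P D n k (b + 1) i _ (fun p _ y => @sth y) hth.
have h2 : ubk D k (fun _ (y : 'rV[R]_n) => y 0 i * (y 0 i * (step (b + 1 - y 0 i) * step (b + 1 + y 0 i)))).
  by apply: (ubk_mul_coord _ h1) => p _ y /sth ->; rewrite mulr0.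
rewrite /cutsq; apply: ubkD => //; apply: ubkM; first exact: ubk_cst1.
by apply: ubkB => //; exact: ubk_cst1.
Qed.

Lemma ub_bump (P : Type) (D : P -> Prop) : ub D (fun _ : P => bump).
Proof.
move=> k; apply: ubk_step_comp; apply: ubk_lbk; apply: ubkM; last exact: ubk_cst1.
apply: ubkB; first exact: ubk_cst1.
by apply: ubk_sum => i; exact: ubk_cutsq.
Qed.

End Bump.

(** * Sums over variable lists of neighbours *)

Section FamilyTools.
Context {R : realType}.

Lemma leq_nlt_eq (a b : nat) : (a <= b)%N -> (a < b)%N = false -> a = b.
Proof. by rewrite leq_eqVlt => /orP[/eqP|->]. Qed.

Lemma le_div8 (x y : R) : x * 8 < y -> x <= y / 8.
Proof. by move=> h; lra. Qed.

Lemma radius_le (x a t : R) : 0 < t -> x < a - t -> x <= a - t / 4.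
Proof. by move=> t0 h; lra. Qed.

Lemma radius_lt (x a t : R) : 0 < t -> x < a - t -> x < a.
Proof. by move=> t0 h; lra. Qed.

Lemma radius_close (x y a t : R) : 0 < t -> y <= x + t / 8 -> x < a - t -> y <= a - t / 2.
Proof. by move=> t0 h1 h2; lra. Qed.

Lemma radius_close_lt (x y a b t : R) : 0 < t -> a + t / 8 < b -> y <= x + t / 8 -> x < a - t -> y < b.
Proof. by move=> t0 h0 h1 h2; lra. Qed.

Lemma radius_chain (x y z u v w a t : R) : 0 < t -> w < a - t -> y <= w + t / 8 -> z <= y + u -> u <= t / 8 ->
  x <= z + v -> v <= t / 8 -> x <= a - t / 4.
Proof. by move=> t0 h1 h2 h3 h4 h5 h6; lra. Qed.

Lemma ubk_cases (P : Type) (D D1 D2 : P -> Prop) m k (f : P -> 'rV[R]_m -> R) :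
  (forall p, D p -> D1 p \/ D2 p) -> ubk D1 k f -> ubk D2 k f -> ubk D k f.
Proof.
move=> h [K1 h1] [K2 h2]; exists (`|K1| + `|K2|) => p /h [/h1|/h2]; apply: bd_le.
  by rewrite (le_trans (ler_norm _)) // lerDl.
by rewrite (le_trans (ler_norm _)) // lerDr.
Qed.

(** The list of terms, and even its type, varies with the index [p]; the common bound [N] on the
    length keeps the constant uniform. *)
Lemma ubk_sum_seq (P Q : Type) (D : P -> Prop) (E : Q -> Prop) m k N (I : P -> eqType)
    (s : forall p, seq (I p)) (q : forall p, I p -> Q) (f : Q -> 'rV[R]_m -> R) :
  ubk E k f -> (forall p, D p -> forall l, l \in s p -> E (q p l)) ->
  (forall p, D p -> (size (s p) <= N)%N) ->
  ubk D k (fun p x => \sum_(l <- s p) f (q p l) x).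
Proof.
move=> [K hK] hq hN; exists (N%:R * `|K|) => p Dp; apply: bd_sum => //; first exact: hN.
by move=> l ls; apply: bd_le (hK _ (hq p Dp l ls)); exact: ler_norm.
Qed.

Lemma ubk_dom (P : Type) (D E : P -> Prop) m k (f : P -> 'rV[R]_m -> R) :
  (forall p, D p -> E p) -> ubk E k f -> ubk D k f.
Proof. by move=> h [K hK]; exists K => p /h; exact: hK. Qed.

(** For comparing averages over the neighbours of two different charts: the lists differ, but the
    members with a nonzero weight are the same. *)
Lemma big_seq_congr (I : eqType) (W : nmodType) (s s' : seq I) (P P' : pred I) (f f' : I -> W) :
  uniq s -> uniq s' ->
  (forall m, m \in s -> P m -> [/\ m \in s', P' m & f m = f' m]) ->
  (forall m, m \in s' -> P' m -> m \in s /\ P m) ->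
  (forall m, ~~ P m -> f m = 0) -> (forall m, ~~ P' m -> f' m = 0) ->
  \sum_(m <- s) f m = \sum_(m <- s') f' m.
Proof.
move=> us us' h h' z z'.
rewrite (bigID P) /= [X in _ + X]big1 ?addr0 //.
rewrite [RHS](bigID P') /= [X in _ = _ + X]big1 ?addr0 //.
rewrite -big_filter -[RHS]big_filter.
have Q : perm_eq [seq m <- s | P m] [seq m <- s' | P' m].
  apply: uniq_perm; [exact: filter_uniq..|].
  move=> m; rewrite !mem_filter; apply/andP/andP => -[h1 h2].
    by have [] := h m h2 h1.
  by have [] := h' m h2 h1.
rewrite -(perm_big _ Q) /=; apply: eq_big_seq => m; rewrite mem_filter => /andP[h1 h2].
by have [] := h m h2 h1.
Qed.

End FamilyTools.

(** * Correcting the transition maps, one colour at a time *)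

Section GluingData.
Context {R : realType}.
Variable n : nat.

(* Approximate transition maps [aff i j] between charts indexed by [vtx]; the
   charts [i] and [j] may overlap only if [j \in nb i]. *)
Record gdata := GData {
  vtx :> eqType ;
  col : vtx -> nat ;
  nb : vtx -> seq vtx ;
  lin : vtx -> vtx -> 'M[R]_n ;
  trn : vtx -> vtx -> 'rV[R]_n ;
  eps : R
}.

Definition aff (G : gdata) (i j : G) (y : 'rV[R]_n) := y *m lin i j + trn i j.

Definition near_cocycle (C : R) (G : gdata) (i j l : G) :=
  (forall a b, `|(lin i j *m lin j l - lin i l) a b| <= C * eps G) /\
  (forall b, `|(trn i j *m lin j l + trn j l - trn i l) 0 b| <= C * eps G).

(** Identities and inverses are exact from the start. Only the cocycle condition is approximate, and
    only at points whose three coordinate vectors lie in the ball of radius [rho]; there it also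
    asserts that the two target charts are neighbours. *)
Record good (Kc N : nat) (C rho : R) (G : gdata) : Prop := Good {
  good_eps : 0 < eps G <= 1 ;
  good_col : forall i : G, (col i < Kc)%N ;
  good_size : forall i : G, (size (nb i) <= N)%N ;
  good_uniq : forall i : G, uniq (nb i) ;
  good_refl : forall i : G, i \in nb i ;
  good_sym : forall i j : G, j \in nb i -> i \in nb j ;
  good_colour : forall i j : G, j \in nb i -> col i = col j -> i = j ;
  good_lin : forall i j : G, j \in nb i -> forall a b, `|lin i j a b| <= C ;
  good_trn : forall i j : G, j \in nb i -> forall b, `|trn i j 0 b| <= C ;
  good_affi : forall (i : G) y, aff i i y = y ;
  good_affK : forall i j : G, j \in nb i -> forall y, aff j i (aff i j y) = y ;
  good_cocycle : forall i j l : G, j \in nb i -> l \in nb i -> forall y,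
    en y < rho -> en (aff i j y) < rho -> en (aff i l y) < rho ->
    l \in nb j /\ near_cocycle C i j l
}.

Record pt2 := Pt2 { g2 : gdata ; i2 : g2 ; j2 : g2 }.
Record pt3 := Pt3 { g3 : gdata ; i3 : g3 ; j3 : g3 ; l3 : g3 }.

(** The correction is counted in units of [eps G], so that [e] can be bounded independently of
    [G]. *)
Definition tr (e : pt2 -> 'rV[R]_n -> 'rV[R]_n) (G : gdata) (i j : G) y :=
  aff i j y + eps G *: e (Pt2 i j) y.

Variables (Kc N : nat) (C rho d : R).
Hypotheses (C0 : 0 <= C) (d0 : 0 < d) (dr : d * (Kc.+2)%:R < rho) (r1 : rho <= 1).

(** One margin [d] is spent per colour, and one in advance, so that a point displaced by a
    correction remains in the ball of radius [rho]. *)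
Definition rad (c : nat) : R := rho - d * c.+1%:R.

Definition Dst (sigma : R) (c : nat) : pt2 -> Prop := fun p =>
  [/\ good Kc N C rho (g2 p), eps (g2 p) < sigma, j2 p \in nb (i2 p),
      (col (i2 p) < c)%N & (col (j2 p) < c)%N].

Record stage_ok (c : nat) (e : pt2 -> 'rV[R]_n -> 'rV[R]_n) (G : gdata) : Prop := StageOk {
  stage_id : forall i : G, (col i < c)%N -> forall y, tr e i i y = y ;
  stage_close : forall i j : G, (col i < c)%N -> (col j < c)%N -> j \in nb i ->
    forall y, en (eps G *: e (Pt2 i j) y) <= d / 8 ;
  stage_inv : forall i j : G, (col i < c)%N -> (col j < c)%N -> j \in nb i ->
    forall y, tr e j i (tr e i j y) = y ;
  stage_cocycle : forall i j l : G, (col i < c)%N -> (col j < c)%N -> (col l < c)%N ->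
    j \in nb i -> l \in nb i -> forall y, en y < rad c -> en (tr e i j y) < rad c ->
    en (tr e i l y) < rad c -> l \in nb j /\ tr e j l (tr e i j y) = tr e i l y
}.

(** The threshold and the correction are chosen before the gluing data, and the bounds hold for all
    good data at once; this is what keeps the final constants independent of the space. *)
Definition stage (c : nat) := exists2 sigma : R, 0 < sigma &
  exists2 e : pt2 -> 'rV[R]_n -> 'rV[R]_n,
    forall a, ub (Dst sigma c) (fun p y => e p y 0 a) &
    forall G, good Kc N C rho G -> eps G < sigma -> stage_ok c e G.

Lemma stage0 : stage 0.
Proof.
exists 1 => //; exists (fun _ _ => 0).
  by move=> a k; apply: ubk_ext (@ubk_cst1 _ _ _ n k 0) => p _ x; rewrite mxE.
by move=> G _ _; split.
Qed.

Lemma rad_lt c : rad c.+1 = rad c - d.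
Proof. by rewrite /rad -[c.+2%:R]natr1; ring. Qed.

Lemma rad_rho c : rad c + d / 8 < rho.
Proof.
rewrite /rad -natr1 mulrDr mulr1; have : 0 <= d * c%:R by rewrite mulr_ge0 // ltW.
have := d0; lra.
Qed.

Lemma rad_gt0 c : (c <= Kc)%N -> d <= rad c.
Proof.
move=> cK; rewrite /rad; have : d * c.+1%:R <= d * Kc.+1%:R by rewrite ler_wpM2l ?ler_nat // ltW.
have := dr; rewrite -[Kc.+2%:R]natr1 mulrDr mulr1; lra.
Qed.

Section Step.
Variables (c : nat) (sigma : R) (e : pt2 -> 'rV[R]_n -> 'rV[R]_n).
Hypotheses (cK : (c < Kc)%N) (s0 : 0 < sigma) (ube : forall a, ub (Dst sigma c) (fun p y => e p y 0 a)).
Hypothesis hst : forall G, good Kc N C rho G -> eps G < sigma -> stage_ok c e G.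

Let chi : 'rV[R]_n -> R := bump (rad c - d / 4) (rad c).

Let ra0 : 0 <= rad c - d / 4.
Proof. by have := rad_gt0 (ltnW cK); have := d0; lra. Qed.

Let rab : rad c - d / 4 < rad c. Proof. have := d0; lra. Qed.

Let chi1 y : en y <= rad c - d / 4 -> chi y = 1. Proof. exact: bump1. Qed.
Let chi_neq0 y : chi y != 0 -> en y < rad c. Proof. exact: (bump_neq0 ra0 rab). Qed.
Let chi_ge0 y : 0 <= chi y. Proof. exact: bump_ge0. Qed.

Definition nbl (G : gdata) (i j : G) := [seq l <- nb i | (col l < c)%N && (j \in nb l)].

(** The failure of the affine cocycle condition along [i], [l], [j], in units of [eps]. The default
    value 0 keeps it bounded for triples that are not known to satisfy the estimate. *)
Definition defect_lin (q : pt3) : 'M[R]_n :=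
  if pselect (near_cocycle C (i3 q) (l3 q) (j3 q)) then
    (eps (g3 q))^-1 *: (lin (i3 q) (l3 q) *m lin (l3 q) (j3 q) - lin (i3 q) (j3 q)) else 0.

Definition defect_trn (q : pt3) : 'rV[R]_n :=
  if pselect (near_cocycle C (i3 q) (l3 q) (j3 q)) then
    (eps (g3 q))^-1 *: (trn (i3 q) (l3 q) *m lin (l3 q) (j3 q) + trn (l3 q) (j3 q) - trn (i3 q) (j3 q)) else 0.

(** Multiplied by [eps], this is the exact difference between passing from [i] to [j] through the
    old chart [l] and passing directly, as [defectE] shows. *)
Definition defect (q : pt3) (y : 'rV[R]_n) :=
  y *m defect_lin q + defect_trn q + e (Pt2 (i3 q) (l3 q)) y *m lin (l3 q) (j3 q).

(** Near the centre this is the sum of the weights. The index [l = i] contributes [chi y], so that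
    the added [1 - chi y] keeps the denominator at least 1 everywhere. *)
Definition den (G : gdata) (i j : G) y :=
  \sum_(l <- nbl i j) chi (tr e i l y) + 1 - chi y.

(** The mean of the defects over the old charts, cut off at [y] and at its image. Both cut-offs
    equal 1 in the smaller ball where the next stage states the cocycle condition. *)
Definition enew (G : gdata) (i j : G) y :=
  \sum_(l <- nbl i j) (chi y * chi (aff i j y) * chi (tr e i l y) / den i j y) *: defect (Pt3 i j l) y.

Definition D3 : pt3 -> Prop := fun q =>
  [/\ good Kc N C rho (g3 q) /\ eps (g3 q) < sigma,
      j3 q \in nb (i3 q), l3 q \in nb (i3 q), j3 q \in nb (l3 q) &
      (col (i3 q) < c)%N && (col (l3 q) < c)%N].

Definition D2 : pt2 -> Prop := fun p =>
  [/\ good Kc N C rho (g2 p), eps (g2 p) < sigma, j2 p \in nb (i2 p) & (col (i2 p) < c)%N].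

Lemma lb_aff (P : Type) (D : P -> Prop) (p2 : P -> pt2) :
  (forall p, D p -> good Kc N C rho (g2 (p2 p)) /\ j2 (p2 p) \in nb (i2 (p2 p))) ->
  LB D (fun p => aff (i2 (p2 p)) (j2 (p2 p))).
Proof.
move=> h k; apply: lbk_affine; exists C => p Dp a b.
by have [g a'] := h p Dp; exact: good_lin g _ _ a' a b.
Qed.

Lemma lb_tr (P : Type) (D : P -> Prop) (p2 : P -> pt2) (e' : pt2 -> 'rV[R]_n -> 'rV[R]_n) :
  (forall p, D p -> good Kc N C rho (g2 (p2 p)) /\ j2 (p2 p) \in nb (i2 (p2 p))) ->
  (forall a, ub D (fun p y => e' (p2 p) y 0 a)) ->
  LB D (fun p => tr e' (i2 (p2 p)) (j2 (p2 p))).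
Proof.
move=> h he k a; have := lb_aff h k a.
have := ubk_lbk (he a k) => h1 h2.
have hc : exists K, forall p, D p -> `|eps (g2 (p2 p))| <= K.
  exists 1 => p Dp; have [/good_eps/andP[e0 e1] _] := h p Dp.
  by rewrite ger0_norm // ltW.
apply: lbk_ext (lbkD h2 (lbkZ hc h1)) => p Dp y.
by rewrite /tr; case: (p2 p) => g i j; rewrite [in RHS]mxE [X in _ = _ + X]mxE.
Qed.

Lemma good_eps0 G : good Kc N C rho G -> 0 < eps G.
Proof. by move=> /good_eps/andP[]. Qed.

Lemma defect_lin_le q : D3 q -> forall a b, `|defect_lin q a b| <= C.
Proof.
move=> [[g _] _ _ _ _] a b; rewrite /defect_lin; case: pselect => [[h h']|h']; last by rewrite mxE normr0.
have e0 := good_eps0 g.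
by rewrite mxE normrM gtr0_norm ?invr_gt0 // mulrC ler_pdivrMr.
Qed.

Lemma defect_trn_le q : D3 q -> forall b, `|defect_trn q 0 b| <= C.
Proof.
move=> [[g _] _ _ _ _] b; rewrite /defect_trn; case: pselect => [[h' h]|h']; last by rewrite mxE normr0.
have e0 := good_eps0 g.
by rewrite mxE normrM gtr0_norm ?invr_gt0 // mulrC ler_pdivrMr.
Qed.

Lemma mem_nbl (G : gdata) (i j l : G) :
  (l \in nbl i j) = [&& (col l < c)%N, j \in nb l & l \in nb i].
Proof. by rewrite mem_filter andbA. Qed.

Lemma sum_chi_ge (G : gdata) (s : seq G) (i l : G) y : l \in s -> uniq s ->
  chi (tr e i l y) <= \sum_(m <- s) chi (tr e i m y).
Proof.
move=> ls us; rewrite (bigD1_seq l) //= lerDl.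
by apply: sumr_ge0 => m _; exact: chi_ge0.
Qed.

Lemma den_ge1 (G : gdata) (i j : G) y : good Kc N C rho G -> eps G < sigma -> (col i < c)%N -> j \in nb i ->
  1 <= den i j y.
Proof.
move=> g es ci aij; have : i \in nbl i j by rewrite mem_nbl ci aij (good_refl g).
move=> /(sum_chi_ge i y) /(_ (filter_uniq _ (good_uniq g i))).
rewrite (stage_id (hst g es)) //.
by rewrite /den; move: (\sum_(l <- _) _) => S h; lra.
Qed.

Lemma D3_of_D2 p l : D2 p -> l \in nbl (i2 p) (j2 p) -> D3 (Pt3 (i2 p) (j2 p) l).
Proof.
case: p l => G i j l [g es aij ci]; rewrite mem_nbl /= => /and3P[cl ajl ail].
by split => //=; rewrite ci.
Qed.

Lemma nbl_size p : D2 p -> (size (nbl (i2 p) (j2 p)) <= N)%N.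
Proof.
by move=> [g _ _ _]; rewrite size_filter (leq_trans (count_size _ _)) // (good_size g).
Qed.

Let pil (q : pt3) : pt2 := Pt2 (i3 q) (l3 q).

Lemma Dst_pil q : D3 q -> Dst sigma c (pil q).
Proof. by move=> [[g es] aij ail ajl /andP[ci cl]]; split. Qed.

Lemma ub_chi_tr : ub D3 (fun q y => chi (tr e (i3 q) (l3 q) y)).
Proof.
move=> k; apply: (@ubk_comp _ _ _ _ _ _ (fun _ => chi) (fun q => tr e (i3 q) (l3 q))).
  exact: ub_bump.
apply: (@lb_tr _ _ pil) => [q h|a k']; first by have [] := Dst_pil h.
exact: ubk_reindex Dst_pil (ube a k').
Qed.

Lemma ub_chi_aff : ub D2 (fun p y => chi (aff (i2 p) (j2 p) y)).
Proof.
move=> k; apply: (@ubk_comp _ _ _ _ _ _ (fun _ => chi) (fun p => aff (i2 p) (j2 p))).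
  exact: ub_bump.
by apply: (@lb_aff _ _ id) => p [].
Qed.

Lemma ub_den : ub D2 (fun p y => den (i2 p) (j2 p) y).
Proof.
move=> k; apply: ubkB; last exact: ub_bump.
apply: ubkD; last exact: ubk_cst1.
apply: (ubk_sum_seq (q := fun p l => Pt3 (i2 p) (j2 p) l) (ub_chi_tr k)).
  by move=> p Dp l; exact: D3_of_D2.
exact: nbl_size.
Qed.

(** The defect contains a term linear in [y]; the factor [chi] confines it to a ball, as in
    [ubk_mul_coord]. *)
Lemma ub_chi_defect a : ub D3 (fun q y => chi y * defect q y 0 a).
Proof.
move=> k.
have hC (f : pt3 -> R) : (forall q, D3 q -> `|f q| <= C) -> ubk D3 k (fun q (_ : 'rV[R]_n) => f q).
  by move=> h; apply: ubk_cst; exists C.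
have hchi : ubk D3 k (fun _ => chi) by exact: ub_bump.
apply: (@ubk_ext _ _ _ _ _ (fun q y => \sum_(b <- index_enum 'I_n) (y 0 b * chi y) * defect_lin q b a
  + chi y * defect_trn q 0 a
  + \sum_(b <- index_enum 'I_n) chi y * e (pil q) y 0 b * lin (l3 q) (j3 q) b a)).
  move=> q Dq y; rewrite /defect !mxE !mulrDr !mulr_sumr; congr (_ + _ + _).
    by apply: eq_bigr => b _; ring.
  by apply: eq_bigr => b _; rewrite mulrA.
apply: ubkD; [apply: ubkD|].
- apply: ubk_sum => b; apply: ubkM; last by apply: hC => q h; exact: defect_lin_le.
  apply: (@ubk_mul_coord _ _ _ _ _ (rad c)) => // p _ x h.
  by apply/eqP; apply: contraTT h => /chi_neq0 h; rewrite -leNgt (le_trans (coord_le_en _ _)) // ltW.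
- by apply: ubkM => //; apply: hC => q h; exact: defect_trn_le.
- apply: ubk_sum => b; apply: ubkM; last first.
    by apply: hC => q [[g _] _ _ alj _]; exact: good_lin g _ _ alj _ _.
  apply: ubkM => //; exact: ubk_reindex Dst_pil (ube b k).
Qed.

Lemma ub_enew a : ub D2 (fun p y => enew (i2 p) (j2 p) y 0 a).
Proof.
move=> k; apply: (@ubk_ext _ _ _ _ _ (fun p y => chi (aff (i2 p) (j2 p) y) * (den (i2 p) (j2 p) y)^-1 *
   (\sum_(l <- nbl (i2 p) (j2 p)) (fun q y => chi (tr e (i3 q) (l3 q) y) * (chi y * defect q y 0 a)) (Pt3 (i2 p) (j2 p) l) y))).
  move=> p Dp y; rewrite /enew summxE mulr_sumr; apply: eq_bigr => l _.
  rewrite [in RHS]mxE /=; move: (defect (Pt3 (i2 p) (j2 p) l) y 0 a) (chi y) (chi (aff _ _ y)) (chi (tr e (i2 p) l y)) ((den (i2 p) (j2 p) y)^-1) => x1 x2 x3 x4 x5; ring.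
apply: ubkM.
  apply: ubkM; first exact: ub_chi_aff.
  apply: (@ubk_inv _ _ _ _ _ _ 1) => //; last exact: ub_den.
  by move=> p [g es aij ci] y; exact: den_ge1.
apply: (ubk_sum_seq (q := fun p l => Pt3 (i2 p) (j2 p) l) (ubkM (ub_chi_tr k) (ub_chi_defect a k))).
  by move=> p Dp l; exact: D3_of_D2.
exact: nbl_size.
Qed.

(* The new transition maps are only used near the centre of the new chart. *)
Lemma defectE (G : gdata) (i j l : G) y : near_cocycle C i l j -> 0 < eps G ->
  aff i j y + eps G *: defect (Pt3 i j l) y = aff l j (tr e i l y).
Proof.
move=> nc e0; rewrite /defect /defect_lin /defect_trn /=.
case: pselect => [h|//] /=; rewrite -scalemxAr !scalerDr ![_ *: (_^-1 *: _)]scalerA divff ?gt_eqF // !scale1r.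
rewrite /tr /aff mulmxBr !mulmxDl -!mulmxA -scalemxAl.
by apply/rowP => a; rewrite !mxE; ring.
Qed.


Let tn (G : gdata) (i j : G) y := aff i j y + eps G *: enew i j y.

Lemma near_cocycle_of (G : gdata) (i j l : G) y : good Kc N C rho G -> eps G < sigma ->
  (col i < c)%N -> (col l < c)%N -> j \in nb i -> l \in nb i ->
  en y < rad c -> en (aff i j y) < rho -> en (tr e i l y) < rad c ->
  j \in nb l /\ near_cocycle C i l j.
Proof.
move=> g es ci cl aij ail hy hj hl.
have rr := rad_rho c; have dd := d0.
apply: (good_cocycle g ail aij (y := y)) => //; first by lra.
have := stage_close (hst g es) ci cl ail y.
have := en_triangleB (aff i l y) (tr e i l y) 0.
have -> : aff i l y - tr e i l y = - (eps G *: e (Pt2 i l) y).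
  by rewrite /tr opprD addrA subrr add0r.
rewrite enN !subr0; lra.
Qed.

(** Where both cut-offs equal 1, the affine map plus the mean of the defects is the weighted mean of
    the routes through the old charts. *)
Lemma new_formula (G : gdata) (i j : G) y : good Kc N C rho G -> eps G < sigma ->
  (col i < c)%N -> j \in nb i -> en y <= rad c - d / 4 -> en (aff i j y) <= rad c - d / 4 ->
  tn i j y = (\sum_(l <- nbl i j) chi (tr e i l y))^-1 *:
     \sum_(l <- nbl i j) chi (tr e i l y) *: aff l j (tr e i l y).
Proof.
move=> g es ci aij hy hj; have D1 := den_ge1 y g es ci aij.
have cy : chi y = 1 := chi1 hy.
have dS : den i j y = \sum_(l <- nbl i j) chi (tr e i l y) by rewrite /den cy addrK.
have S0 : den i j y != 0 by rewrite gt_eqF // (lt_le_trans _ D1).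
rewrite -dS /tn /enew cy (chi1 hj) !mul1r.
have {1}-> : aff i j y = \sum_(l <- nbl i j) (chi (tr e i l y) / den i j y) *: aff i j y.
  by rewrite -scaler_suml -mulr_suml -dS divff // scale1r.
rewrite !scaler_sumr -big_split /=; apply: eq_big_seq => l; rewrite mem_nbl => /and3P[cl ajl ail].
have [c0|/chi_neq0 c0] := eqVneq (chi (tr e i l y)) 0.
  by rewrite c0 mulr0 !mul0r !scale0r !scaler0 addr0.
have rr := rad_rho c; have dd := d0.
have [|||_ nc] := near_cocycle_of (y := y) g es ci cl aij ail; [lra|lra|by []|].
rewrite mul1r -(defectE _ nc (good_eps0 g)).
move: (aff i j y) (defect _ y) (chi _) (_^-1) => A B x t.
by apply/rowP => a; rewrite !mxE; ring.
Qed.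

(** The key to exactness. The weight of an old chart [m] and the route through it depend only on the
    coordinates of the point in [m]; by the cocycle condition of the previous stage these are the
    same computed from [i] or from [l]. Hence the two averages coincide term by term. *)
Lemma new_cocycle (G : gdata) (i j l : G) y : good Kc N C rho G -> eps G < sigma ->
  (forall q, D3 q -> g3 q = G -> forall y, en y <= rad c - d / 4 -> en (eps (g3 q) *: defect q y) <= d / 8) ->
  (col i < c)%N -> (col l < c)%N -> j \in nb i -> l \in nb i ->
  en y <= rad c - d / 4 -> en (aff i j y) <= rad c - d / 2 -> en (tr e i l y) <= rad c - d / 4 ->
  j \in nb l /\ tn l j (tr e i l y) = tn i j y.
Proof.
move=> g es hd ci cl aij ail hy hj hl; have st := hst g es.
have rr := rad_rho c; have dd := d0.
have [|||ajl nc] := near_cocycle_of (y := y) g es ci cl aij ail; [lra..|].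
split=> //; set z := tr e i l y.
have hjz : en (aff l j z) <= rad c - d / 4.
  rewrite /z -(defectE _ nc (good_eps0 g)); apply: le_trans (en_triangle _ _) _.
  have D : D3 (Pt3 i j l) by split; rewrite /= ?ci.
  have := hd _ D erefl y hy; move=> /=; lra.
rewrite (new_formula g es cl ajl hl hjz) new_formula //; last by lra.
have ali : i \in nb l := good_sym g ail.
have zi : tr e l i z = y by rewrite /z (stage_inv st).
have key m : m \in nbl i j -> chi (tr e i m y) != 0 -> m \in nbl l j /\ tr e l m z = tr e i m y.
  rewrite !mem_nbl => /and3P[cm ajm aim] /chi_neq0 hm.
  by have [|||a ->] := stage_cocycle st ci cl cm ail aim (y := y) => //; [lra|rewrite -/z; lra|rewrite cm ajm a].
have key' m : m \in nbl l j -> chi (tr e l m z) != 0 -> m \in nbl i j /\ tr e l m z = tr e i m y.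
  rewrite !mem_nbl => /and3P[cm ajm alm] /chi_neq0 hm.
  have [|||a <-] := stage_cocycle st cl ci cm ali alm (y := z) => //; [rewrite /z; lra|by rewrite zi; lra|].
  by rewrite cm ajm a zi.
have re (W : nmodType) (f : G -> 'rV[R]_n -> W) :
    (forall m x, chi x = 0 -> f m x = 0) ->
    \sum_(m <- nbl l j) f m (tr e l m z) = \sum_(m <- nbl i j) f m (tr e i m y).
  move=> hf.
  apply: (big_seq_congr (P := fun m => chi (tr e l m z) != 0) (P' := fun m => chi (tr e i m y) != 0)).
  - exact/filter_uniq/(good_uniq g).
  - exact/filter_uniq/(good_uniq g).
  - by move=> m h1 h2; have [h3 h4] := key' m h1 h2; rewrite -h4.
  - by move=> m h1 h2; have [h3 h4] := key m h1 h2; rewrite h4.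
  - by move=> m; rewrite negbK => /eqP h; exact: hf.
  - by move=> m; rewrite negbK => /eqP h; exact: hf.
have E1 := re _ (fun _ x => chi x) (fun _ _ h => h).
have E2 := re _ (fun m x => chi x *: aff m j x) (fun m x h => etrans (congr1 (fun t => t *: aff m j x) h) (scale0r _)).
by rewrite -/z E1 E2.
Qed.


Lemma en_scale_le (t K b : R) (v : 'rV[R]_n) : 0 < t -> 0 <= K ->
  (forall a, `|v 0 a| <= K) -> t * (n%:R * K + 1) <= b -> en (t *: v) <= b.
Proof.
move=> t0 K0 hv hb; rewrite enZ gtr0_norm //; apply: le_trans hb; rewrite ler_pM2l //.
apply: (le_trans (en_le_norm _)).
by apply: (@le_trans _ _ (n%:R * K)); [rewrite ler_wpM2l // norm_rV_le|rewrite lerDl].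
Qed.

Lemma ub_bound (P : Type) (D : P -> Prop) (f : P -> 'rV[R]_n -> 'rV[R]_n) :
  (forall a, ub D (fun p y => f p y 0 a)) ->
  exists2 K, 0 <= K & forall p, D p -> forall y a, `|f p y 0 a| <= K.
Proof.
move=> h; have [K hK] := choice (fun a => h a 0%N).
exists (\sum_a `|K a|); first exact: sumr_ge0.
move=> p Dp y a; apply: (le_trans (bd_bound (hK a p Dp) y)).
by rewrite (le_trans (ler_norm _)) // (bigD1 a) //= lerDl sumr_ge0.
Qed.

Let swap (p : pt2) : pt2 := Pt2 (j2 p) (i2 p).

(** From an old chart to a new one the map is the average; backwards it has to be the exact inverse.
    For [i] new and [j] old, [tn j i \o aff i j] is the identity plus [eps] times a bounded
    perturbation. For [eps] small it has an inverse [kk], and [aff i j \o kk] is the map sought. *)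
Lemma stepP : stage c.+1.
Proof.
have [eta eta0 hinv] := near_identity_inverse (R := R) n.
pose ep (p : pt2) y := enew (j2 p) (i2 p) (aff (i2 p) (j2 p) y).
(* [ep p] is the perturbation of [tn j i \o aff i j], where [j] is old and [i] is new *)
pose DI : pt2 -> Prop := fun p => D2 (swap p) /\ j2 p \in nb (i2 p).
have ubep a : ub DI (fun p y => ep p y 0 a).
  move=> k; apply: (@ubk_comp _ _ _ _ _ _ (fun p y => enew (j2 p) (i2 p) y 0 a) (fun p => aff (i2 p) (j2 p))).
    by apply: (ubk_reindex (s := swap) _ (ub_enew a k)) => p [].
  by apply: (@lb_aff _ _ id) => p [[g _ _ _] aij].
have [K1 K10 hK1] : exists2 K1, 0 <= K1 & forall p, DI p -> forall i j x, `|pd i (fun y => ep p y 0 j) x| <= K1.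
  have [K hK] := choice (fun a => ubep a 1%N); exists (\sum_a `|K a|); first exact: sumr_ge0.
  move=> p Dp i j x; have [_ [_ h]] := hK j p Dp.
  have hb : bd 0 (K j) (pd i (fun y => ep p y 0 j)) := h i.
  apply: (le_trans (bd_bound hb x)).
  by rewrite (le_trans (ler_norm _)) // (bigD1 j) //= lerDl sumr_ge0.
have [K2 K20 hK2] := @ub_bound pt2 D2 (fun p => enew (i2 p) (j2 p)) ub_enew.
have [K3 K30 hK3] := @ub_bound pt3 D3 (fun q y => chi y *: defect q y)
   (fun a k => ubk_ext (fun q _ y => esym (mxE _ _ 0 a)) (ub_chi_defect a k)).
pose s1 := Num.min sigma (eta / (K1 + 1)).
pose DJ : pt2 -> Prop := fun p => DI p /\ eps (g2 p) < s1.
pose pert (p : pt2) y := eps (g2 p) *: ep p y.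
have epos p : DI p -> 0 < eps (g2 p) by case: p => G i j [[g _ _ _] _]; exact: good_eps0 g.
have LBpert : LB DJ pert.
  move=> k a; apply: ubk_lbk.
  apply: (@ubk_ext _ _ _ _ _ (fun p y => eps (g2 p) * ep p y 0 a)); first by move=> p _ y; rewrite mxE.
  apply: ubkM; last by apply: ubk_dom (ubep a k) => p [].
  apply: ubk_cst; exists 1 => p [Dp _]; rewrite gtr0_norm ?epos //.
  by case: p Dp => G i j [[/good_eps/andP[]]].
have hpert p : DJ p -> forall i j x, `|pd i (fun y => pert p y 0 j) x| <= eta.
  move=> [Dp]; rewrite lt_min => /andP[_ es] i j x.
  have dp : differentiable (fun y => ep p y 0 j) x by exact: (ubk_lbk (ubep j 1%N)).1.
  have -> : (fun y => pert p y 0 j) = (fun y => eps (g2 p) * ep p y 0 j) by apply/funext => y; rewrite mxE.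
  rewrite pdM; [|exact: differentiable_cst|exact: dp].
  rewrite pd_cst mul0r addr0 normrM gtr0_norm ?epos //.
  move: es; rewrite ltr_pdivlMr ?ltr_wpDl // => es.
  have := hK1 p Dp i j x; have := epos p Dp => e1 e2.
  apply: le_trans (ltW es); rewrite ler_pM2l //; lra.
have [kk [LBk1 hk1 hk2]] := hinv _ _ _ LBpert hpert.
(* As [kk p y = y - eps * ep p (kk p y)], this is the correction, in units of [eps], that turns the
   affine map into [aff i j \o kk p]. *)
pose einv (p : pt2) y := - enew (j2 p) (i2 p) (aff (i2 p) (j2 p) (kk p y)) *m lin (i2 p) (j2 p).
have ubeinv a : ub DJ (fun p y => einv p y 0 a).
  move=> k; apply: (@ubk_ext _ _ _ _ _ (fun p y => \sum_(b <- index_enum 'I_n) - ep p (kk p y) 0 b * lin (i2 p) (j2 p) b a)).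
    by move=> p _ y; rewrite /einv mulNmx !mxE -sumrN; apply: eq_bigr => b _; rewrite mulNr.
  apply: ubk_sum => b; apply: ubkM.
    apply: ubkN; apply: (@ubk_comp _ _ _ _ _ _ (fun p y => ep p y 0 b) kk); last exact: LBk1.
    by apply: ubk_dom (ubep b k) => p [].
  apply: ubk_cst; exists C => p [[[g _ _ _] aij] _]; exact: good_lin g _ _ aij _ _.
have [K4 K40 hK4] := @ub_bound pt2 DJ einv ubeinv.
pose b0 := d / 8; have b00 : 0 < b0 by rewrite divr_gt0.
(* Bounds, in units of [eps], the entries of the cocycle error when the first chart is new and the
   others old: linear defect, translation defect, and the correction of the first map transported by
   the second. *)
pose K5 := n%:R * C + C + n%:R * (K4 * C).
have K50 : 0 <= K5 by rewrite !addr_ge0 ?mulr_ge0.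
pose s2 := Num.min s1 (Num.min (b0 / (n%:R * K2 + 1)) (Num.min (b0 / (n%:R * K3 + 1)) (Num.min (b0 / (n%:R * K4 + 1)) (b0 / (n%:R * K5 + 1))))).
have pos K : 0 <= K -> 0 < n%:R * K + 1 :> R by move=> K0; rewrite ltr_wpDl // mulr_ge0.
have s20 : 0 < s2 by rewrite !lt_min s0 !divr_gt0 // ?pos // ltr_wpDl.
(* The final 0 concerns two new charts: neighbours of one colour coincide, and the map is then the
   identity. *)
pose e' (p : pt2) y := if (col (i2 p) < c)%N then if (col (j2 p) < c)%N then e p y else enew (i2 p) (j2 p) y
  else if (col (j2 p) < c)%N then einv p y else 0.
have s2s (G : gdata) : eps G < s2 -> [/\ eps G < sigma, eps G < s1, eps G * (n%:R * K2 + 1) <= b0,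
    eps G * (n%:R * K3 + 1) <= b0 & eps G * (n%:R * K4 + 1) <= b0 /\ eps G * (n%:R * K5 + 1) <= b0].
  rewrite !lt_min !ltr_pdivlMr ?pos // ?ltr_wpDl // => /andP[/andP[h1 h2] /andP[h3 /andP[h4 /andP[h5 h6]]]].
  by rewrite h1 h2 /b0; split=> //; [exact: le_div8|exact: le_div8|split; exact: le_div8].
exists s2 => //; exists e'.
  move=> a k; apply: (@ubk_cases _ _ _ (fun p => Dst s2 c.+1 p /\ (col (i2 p) < c)%N) (fun p => Dst s2 c.+1 p /\ ~~ (col (i2 p) < c)%N)).
  - by move=> p Dp; case: (boolP (col (i2 p) < c)%N); [left|right].
  - apply: (@ubk_cases _ _ _ (fun p => (Dst s2 c.+1 p /\ (col (i2 p) < c)%N) /\ (col (j2 p) < c)%N)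
      (fun p => (Dst s2 c.+1 p /\ (col (i2 p) < c)%N) /\ ~~ (col (j2 p) < c)%N)).
    + by move=> p Dp; case: (boolP (col (j2 p) < c)%N); [left|right].
    + apply: (@ubk_ext _ _ _ _ _ (fun p y => e p y 0 a)); first by move=> p [[_ h1] h2] y; rewrite /e' h1 h2.
      by apply: ubk_dom (ube a k) => p [[[g /s2s[es _ _ _ _] aij _ _] ci] cj].
    + apply: (@ubk_ext _ _ _ _ _ (fun p y => enew (i2 p) (j2 p) y 0 a)); first by move=> p [[_ h1] /negbTE h2] y; rewrite /e' h1 h2.
      by apply: ubk_dom (ub_enew a k) => p [[[g /s2s[es _ _ _ _] aij _ _] ci] _].
  - apply: (@ubk_cases _ _ _ (fun p => (Dst s2 c.+1 p /\ ~~ (col (i2 p) < c)%N) /\ (col (j2 p) < c)%N)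
      (fun p => (Dst s2 c.+1 p /\ ~~ (col (i2 p) < c)%N) /\ ~~ (col (j2 p) < c)%N)).
    + by move=> p Dp; case: (boolP (col (j2 p) < c)%N); [left|right].
    + apply: (@ubk_ext _ _ _ _ _ (fun p y => einv p y 0 a)); first by move=> p [[_ /negbTE h1] h2] y; rewrite /e' h1 h2.
      apply: ubk_dom (ubeinv a k) => p [[[g /s2s[es es1 _ _ _] aij _ _] _] cj].
      by split=> //; split=> //; split=> //; exact: good_sym g _ _ aij.
    + apply: (@ubk_ext _ _ _ _ _ (fun _ _ => 0)); last exact: ubk_cst1.
      by move=> p [[_ /negbTE h1] /negbTE h2] y; rewrite /e' h1 h2 mxE.
move=> G g /s2s[es es1 t2 t3 [t4 t5]]; have st := hst g es; have e0 := good_eps0 g.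
have dd := d0; have rr := rad_rho c; have rl := rad_lt c.
have oldE (i j : G) y : (col i < c)%N -> (col j < c)%N -> tr e' i j y = tr e i j y.
  by move=> h1 h2; rewrite /tr /e' /= h1 h2.
have newE (i j : G) y : (col i < c)%N -> (col j < c)%N = false -> tr e' i j y = tn i j y.
  by move=> h1 h2; rewrite /tr /e' /= h1 h2.
have idE (i : G) y : (col i < c.+1)%N -> tr e' i i y = y.
  rewrite ltnS leq_eqVlt => /orP[/eqP h|h]; last by rewrite oldE // (stage_id st).
  by rewrite /tr /e' /= h ltnn scaler0 addr0 (good_affi g).
have DJ' (i j : G) : (col i < c)%N = false -> (col j < c)%N -> j \in nb i -> DJ (Pt2 i j).
  by move=> _ cj aij; split=> //; split=> //; split=> //=; exact: good_sym g _ _ aij.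
have invE (i j : G) y : (col i < c)%N = false -> (col j < c)%N -> j \in nb i ->
    tr e' i j y = aff i j (kk (Pt2 i j) y).
  move=> h1 h2 aij; rewrite /tr /e' /= h1 h2 /einv /=.
  have := hk1 _ (DJ' i j h1 h2 aij) y; rewrite {1}/pert /ep /= => {1}<-.
  rewrite /aff !mulmxDl -scalemxAl mulNmx; move: (kk _ y *m _) => A.
  by apply/rowP => b; rewrite !mxE; ring.
have inv1 (i j : G) y : (col i < c)%N = false -> (col j < c)%N -> j \in nb i ->
    tn j i (aff i j (kk (Pt2 i j) y)) = y.
  move=> h1 h2 aij; rewrite /tn (good_affK g) //.
  by have := hk1 _ (DJ' i j h1 h2 aij) y.
have inv2 (i j : G) y : (col i < c)%N = false -> (col j < c)%N -> j \in nb i ->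
    aff i j (kk (Pt2 i j) (tn j i y)) = y.
  move=> h1 h2 aij; have aji := good_sym g aij; rewrite /tn.
  have := hk2 _ (DJ' i j h1 h2 aij) (aff j i y); rewrite /pert /ep /= (good_affK g) // => ->.
  by rewrite (good_affK g).
have sameE (i j : G) : (col i < c.+1)%N -> (col j < c.+1)%N -> (col i < c)%N = false -> (col j < c)%N = false ->
    j \in nb i -> i = j.
  rewrite !ltnS => h1 h2 h3 h4 aij; apply: (good_colour g aij).
  by rewrite (leq_nlt_eq h1 h3) (leq_nlt_eq h2 h4).
have invG (i j : G) y : (col i < c.+1)%N -> (col j < c.+1)%N -> j \in nb i -> tr e' j i (tr e' i j y) = y.
  move=> ci cj aij; have aji := good_sym g aij.
  case hi : (col i < c)%N; case hj : (col j < c)%N.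
  - by rewrite !oldE // (stage_inv st).
  - by rewrite (newE i j) // (invE j i) // (inv2 j i).
  - by rewrite (invE i j) // (newE j i) // (inv1 i j).
  - by rewrite -(sameE i j) // !idE.
have closeG (i j : G) y : (col i < c.+1)%N -> (col j < c.+1)%N -> j \in nb i -> en (eps G *: e' (Pt2 i j) y) <= d / 8.
  move=> ci cj aij; have aji := good_sym g aij; rewrite /e' /=.
  case hi : (col i < c)%N; case hj : (col j < c)%N.
  - exact: (stage_close st).
  - apply: (en_scale_le e0 K20 _ t2) => a; exact: (hK2 (Pt2 i j)).
  - by apply: (en_scale_le e0 K40 _ t4) => a; apply: (hK4 (Pt2 i j)); exact: DJ'.
  - by rewrite scaler0 en0 divr_ge0 // ltW.
have aff_close (i j : G) y : (col i < c.+1)%N -> (col j < c.+1)%N -> j \in nb i -> en (aff i j y) <= en (tr e' i j y) + d / 8.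
  move=> ci cj aij; have := closeG i j y ci cj aij.
  have := en_triangleB (aff i j y) (tr e' i j y) 0; rewrite !subr0.
  have -> : aff i j y - tr e' i j y = - (eps G *: e' (Pt2 i j) y) by rewrite /tr opprD addrA subrr add0r.
  rewrite enN; lra.
have hdef q : D3 q -> g3 q = G -> forall y, en y <= rad c - d / 4 -> en (eps (g3 q) *: defect q y) <= d / 8.
  move=> Dq eG y hy; rewrite eG; apply: (en_scale_le e0 K30 _ t3) => a.
  by have := hK3 q Dq y a; rewrite (chi1 hy) scale1r.
split => //; first by move=> i ci y; exact: idE.
  by move=> i j ci cj aij y; exact: closeG.
  by move=> i j ci cj aij y; exact: invG.
move=> i j l ci cj cl aij ail y hy hj hl; rewrite rl in hy hj hl.
have dd8 : en y <= en y + d / 8 by rewrite lerDl divr_ge0 // ltW.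
have ajl : l \in nb j.
  have h1 := aff_close i j y ci cj aij; have h2 := aff_close i l y ci cl ail.
  by have [|||] := good_cocycle g aij ail (y := y); [exact: radius_close_lt dd rr dd8 hy|exact: radius_close_lt dd rr h1 hj|exact: radius_close_lt dd rr h2 hl|].
split=> //; have aji := good_sym g aij; have ali := good_sym g ail; have alj := good_sym g ajl.
have hji := invG i j y ci cj aij; have hli := invG i l y ci cl ail.
(* Two new charts among the three are equal, so those cases reduce to identities and inverses. There
   remain the previous stage and three cases with exactly one new chart, all drawn from
   [new_cocycle]. *)
case hi : (col i < c)%N; case hjc : (col j < c)%N; case hlc : (col l < c)%N.
- have := stage_cocycle st hi hjc hlc aij ail (y := y).
  by rewrite -!oldE //; case=> //; exact: radius_lt dd _.
- have := aff_close i l y ci cl ail; rewrite (newE i l) // => ha; rewrite (newE i l) // in hl; rewrite (oldE i j) // in hj.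
  rewrite (oldE i j) //.
  have [|||_ <-] := new_cocycle (y := y) g es hdef hi hjc ail aij; [exact: radius_le dd hy|exact: radius_close dd ha hl|exact: radius_le dd hj|].
  by rewrite newE.
- have := aff_close i j y ci cj aij; rewrite (newE i j) // => ha; rewrite (newE i j) // in hj; rewrite (oldE i l) // in hl.
  have [|||_ H] := new_cocycle (y := y) g es hdef hi hlc aij ail; [exact: radius_le dd hy|exact: radius_close dd ha hj|exact: radius_le dd hl|].
  by rewrite -H -(newE l j) // (oldE i l) // invG.
- have e1 := sameE j l cj cl hjc hlc ajl; rewrite -e1 idE //.
(* With [i] new, [new_cocycle] is applied at the image [z] of [y] in [j]: going from [j] to [i]
   directly or through [l] gives the same point, and the last map is inverted. This requires
   [tr e j l z] in the smaller ball, which the affine cocycle estimate provides. *)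
- have hw : en (tr e j l (tr e' i j y)) <= rad c - d / 4.
    set z := tr e' i j y.
    have h1 := aff_close i j y ci cj aij; have h2 := aff_close i l y ci cl ail.
    have [||| _ [n1 n2]] := good_cocycle g aij ail (y := y);
      [exact: radius_close_lt dd rr dd8 hy|exact: radius_close_lt dd rr h1 hj|exact: radius_close_lt dd rr h2 hl|].
    pose D := y *m (lin i j *m lin j l - lin i l) + (trn i j *m lin j l + trn j l - trn i l) + (eps G *: e' (Pt2 i j) y) *m lin j l.
    have eD : aff j l z = aff i l y + D.
      rewrite /z /D /tr /aff mulmxBr !mulmxDl -!mulmxA -scalemxAl.
      by apply/rowP => a; rewrite !mxE; ring.
    have hD : en ((eps G) *: ((eps G)^-1 *: D)) <= d / 8.
      apply: (en_scale_le e0 K50 _ t5) => a.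
      rewrite mxE normrM gtr0_norm ?invr_gt0 // mulrC ler_pdivrMr //.
      have y1 b : `|y 0 b| <= 1.
        apply: (le_trans (coord_le_en y b)); apply: ltW; apply: lt_le_trans r1.
        exact: radius_close_lt dd rr dd8 hy.
      have b1 : `|(y *m (lin i j *m lin j l - lin i l)) 0 a| <= n%:R * (C * eps G).
        rewrite mxE; apply: (le_trans (ler_norm_sum _ _ _)).
        apply: (@le_trans _ _ (\sum_(b < n) C * eps G)); last by rewrite sumr_const card_ord -[leLHS]mulr_natl.
        by apply: ler_sum => b _; rewrite normrM -[leRHS]mul1r ler_pM.
      have b2 : `|((eps G *: e' (Pt2 i j) y) *m lin j l) 0 a| <= n%:R * (K4 * C * eps G).
        rewrite -scalemxAl mxE normrM gtr0_norm // mulrC [in leRHS]mulrA ler_pM2r //.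
        rewrite mxE; apply: (le_trans (ler_norm_sum _ _ _)).
        apply: (@le_trans _ _ (\sum_(b < n) K4 * C)); last by rewrite sumr_const card_ord -[leLHS]mulr_natl.
        apply: ler_sum => b _; rewrite normrM ler_pM //; last exact: good_lin g _ _ ajl _ _.
        by rewrite /e' /= hi hjc; apply: (hK4 (Pt2 i j)); exact: DJ'.
      have -> : D 0 a = (y *m (lin i j *m lin j l - lin i l)) 0 a + (trn i j *m lin j l + trn j l - trn i l) 0 a
          + ((eps G *: e' (Pt2 i j) y) *m lin j l) 0 a by rewrite mxE [X in X + _]mxE.
      apply: (le_trans (ler_normD _ _)); apply: (le_trans (lerD (ler_normD _ _) (lexx _))).
      apply: le_trans (lerD (lerD b1 (n2 a)) b2) _; rewrite le_eqVlt; apply/orP; left; apply/eqP; rewrite /K5; ring.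
    rewrite scalerA divff ?gt_eqF // scale1r in hD.
    have a1 := en_triangle (aff i l y) D; rewrite -eD in a1.
    have a2 := en_triangle (aff j l z) (eps G *: e (Pt2 j l) z); rewrite -/(tr e j l z) in a2.
    exact: radius_chain dd hl h2 a1 hD a2 (stage_close st hjc hlc ajl z).
  have zi : en (aff j i (tr e' i j y)) <= rad c - d / 2.
    by have := aff_close j i (tr e' i j y) cj ci aji; rewrite hji => h; exact: radius_close dd h hy.
  have [||| _ H] := new_cocycle (y := tr e' i j y) g es hdef hjc hlc aji ajl; [exact: radius_le dd hj|by []|by []|].
  move: H; rewrite -(newE l i) // -(newE j i) // hji -oldE // => H.
  have H2 := invG l i (tr e' j l (tr e' i j y)) cl ci ali.
  by move: H H2; move: (tr e' j l (tr e' i j y)) => u H H2; rewrite H in H2.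
- have e1 := sameE i l ci cl hi hlc ail; rewrite -e1 idE // -[RHS]hji.
- have e1 := sameE i j ci cj hi hjc aij; rewrite -e1 idE //.
- have e1 := sameE i j ci cj hi hjc aij; rewrite -e1 idE //.
Qed.

End Step.

Lemma stage_all c : (c <= Kc)%N -> stage c.
Proof.
elim: c => [|c IH] cK; first exact: stage0.
have [sigma s0 [e ube hst]] := IH (ltnW cK).
exact: stepP cK s0 ube hst.
Qed.

End GluingData.

(** * The manifold defined by exact transition maps *)

Section GeometricAtlas.
Context {R : realType}.

Definition jac n (f : 'rV[R]_n -> 'rV[R]_n) (y : 'rV[R]_n) : 'M[R]_n :=
  \matrix_(a, b) pd a (fun x => f x 0 b) y.

(* Charts are the balls of radius 3/5; every point has coordinates of norm less
   than 1/20 in a suitable chart. *)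
Record geom (n : nat) (kappa : R) := Geom {
  gI :> eqType ;
  gnb : gI -> seq gI ;
  gT : gI -> gI -> 'rV[R]_n -> 'rV[R]_n ;
  gg : gI -> 'rV[R]_n -> 'M[R]_n ;
  g_refl : forall i, i \in gnb i ;
  g_sym : forall i j, j \in gnb i -> i \in gnb j ;
  gT_smooth : forall i j, j \in gnb i -> LB (fun _ : unit => True) (fun _ => gT i j) ;
  gT_id : forall i y, gT i i y = y ;
  gT_inv : forall i j, j \in gnb i -> forall y, gT j i (gT i j y) = y ;
  gT_cocycle : forall i j l, j \in gnb i -> l \in gnb i -> forall y, en y < 3 / 5 ->
    en (gT i j y) < 3 / 5 -> en (gT i l y) < 3 / 5 ->
    l \in gnb j /\ gT j l (gT i j y) = gT i l y ;
  g_cover : forall i y, en y < 3 / 5 -> exists2 l, l \in gnb i & en (gT i l y) < 1 / 20 ;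
  g_conn : forall P : gI -> Prop, (exists i, P i) ->
    (forall i j y, j \in gnb i -> en y < 3 / 5 -> en (gT i j y) < 3 / 5 -> P i -> P j) -> forall i, P i ;
  gg_smooth : forall i a b, ub (fun _ : unit => True) (fun _ y => gg i y a b) ;
  gg_sym : forall i y, (gg i y)^T = gg i y ;
  gg_small : forall i a b, bd 2 kappa (fun y => gg i y a b - (a == b)%:R) ;
  gg_inv : forall i j, j \in gnb i -> forall y, en y < 3 / 5 -> en (gT i j y) < 3 / 5 ->
    gg i y = jac (gT i j) y *m gg j (gT i j y) *m (jac (gT i j) y)^T
}.

Section Carrier.
Variables (n : nat) (kappa : R) (G : geom n kappa).
Implicit Types (i j l : G) (y z : 'rV[R]_n).

(** A point is encoded by the relation between charts and its coordinates in them. The quotient of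
    the disjoint union of balls becomes a subtype of predicates, without a choice of
    representatives. *)
Definition cls i y : G -> 'rV[R]_n -> Prop :=
  fun j z => [/\ j \in gnb i, en z < 3 / 5 & gT i j y = z].

Definition carr := {p : G -> 'rV[R]_n -> Prop | exists i y, en y < 3 / 5 /\ p = cls i y}.

HB.instance Definition _ := gen_eqMixin carr.
HB.instance Definition _ := gen_choiceMixin carr.

Lemma carr_eq (p q : carr) : sval p = sval q -> p = q.
Proof. by case: p q => p hp [q hq] /= e; subst q; congr exist; exact: Prop_irrelevance. Qed.

Lemma en0_lt : en (0 : 'rV[R]_n) < 3 / 5.
Proof. by rewrite en0; lra. Qed.

(** Outside the ball of radius 3/5 the value is the centre of the chart, which makes [pt i]
    total. *)
Definition pt i y : carr :=
  match pselect (en y < 3 / 5) with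
  | left h => exist _ (cls i y) (ex_intro _ i (ex_intro _ y (conj h erefl)))
  | right _ => exist _ (cls i 0) (ex_intro _ i (ex_intro _ 0 (conj en0_lt erefl)))
  end.

Lemma val_pt i y : en y < 3 / 5 -> sval (pt i y) = cls i y.
Proof. by rewrite /pt; case: pselect. Qed.

(** Here the exactness of the cocycle condition is used: it identifies the coordinates of the point
    in every third chart. *)
Lemma pt_eqP i j y z : en y < 3 / 5 -> en z < 3 / 5 ->
  pt i y = pt j z <-> j \in gnb i /\ gT i j y = z.
Proof.
move=> hy hz; split=> [e|[ij e]].
  have : sval (pt i y) j z.
    by rewrite e val_pt //; split; rewrite ?g_refl ?gT_id.
  by rewrite val_pt // => -[].
apply: carr_eq; rewrite !val_pt //; apply/funext => l; apply/funext => w.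
apply/propext; rewrite -e in hz *; split=> -[il hw ew]; rewrite -ew in hw *.
  by have [] := gT_cocycle ij il hy hz hw.
have ji := g_sym ij.
have := gT_cocycle ji il hz _ hw; rewrite gT_inv // => /(_ hy) [h e']; by split.
Qed.

Lemma pt_eq_tr i j y z : en y < 3 / 5 -> en z < 3 / 5 -> pt i y = pt j z -> j \in gnb i /\ gT i j y = z.
Proof. by move=> hy hz /pt_eqP; apply. Qed.

Lemma pt_trE i j y : en y < 3 / 5 -> j \in gnb i -> en (gT i j y) < 3 / 5 -> pt j (gT i j y) = pt i y.
Proof. by move=> hy ij hj; apply/esym/pt_eqP. Qed.

Lemma pt_inj i y z : en y < 3 / 5 -> en z < 3 / 5 -> pt i y = pt i z -> y = z.
Proof. by move=> hy hz /pt_eqP[] // _; rewrite gT_id. Qed.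

Lemma pt_surj (p : carr) : exists i y, en y < 1 / 20 /\ p = pt i y.
Proof.
have [i [y [hy e]]] : exists i y, en y < 3 / 5 /\ p = pt i y.
  case: p => p [i [y [hy e]]]; exists i, y; split => //.
  by apply: carr_eq; rewrite val_pt.
have [l il hl] := g_cover i hy; exists l, (gT i l y); split => //.
by rewrite e; apply/pt_eqP => //; lra.
Qed.

Definition mopen (U : set carr) := forall i, open [set y | en y < 3 / 5 /\ U (pt i y)].

Lemma mopenT : mopen setT.
Proof.
move=> i; rewrite (_ : [set y | _] = [set y : 'rV[R]_n | en y < 3 / 5]); first exact: open_en_ball.
by apply/seteqP; split=> y //= -[].
Qed.

Lemma mopenI : setI_closed mopen.
Proof.
move=> U W oU oW i; have := openI (oU i) (oW i); congr open.
by apply/seteqP; split=> y /=; tauto.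
Qed.

Lemma mopen_bigU (J : Type) (f : J -> set carr) :
  (forall j : J, mopen (f j)) -> mopen (\bigcup_j f j).
Proof.
move=> of_ i; have : open (\bigcup_j [set y | en y < 3 / 5 /\ f j (pt i y)]).
  by apply: bigcup_open => j _; exact: of_.
congr open; apply/seteqP; split=> y /=.
  by move=> [j _ [h1 h2]]; split => //; exists j.
by move=> [h [j _ h2]]; exists j.
Qed.

HB.instance Definition _ := isOpenTopological.Build carr mopenT mopenI mopen_bigU.

Lemma carr_openE (U : set carr) : open U = mopen U.
Proof. by []. Qed.

Definition ptdom i : set carr := [set p | exists2 y, en y < 3 / 5 & p = pt i y].

Lemma gT_continuous i j : j \in gnb i -> continuous (gT i j).
Proof. by move=> ij; exact: (LBk_continuous (gT_smooth ij 0%N) I). Qed.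

Lemma open_pt i (W : set 'rV[R]_n) : open W -> open [set p | exists y, [/\ en y < 3 / 5, W y & p = pt i y]].
Proof.
move=> oW; rewrite carr_openE => j; have [ji|nji] := boolP (i \in gnb j).
  have oB := @open_en_ball R n (3 / 5).
  have := openI oB (open_comp (fun x _ => gT_continuous ji (x := x)) (openI oB oW)).
  congr open; apply/seteqP; split=> z /=.
    by move=> [hz [h1 h2]]; split=> //; exists (gT j i z); split=> //; apply/pt_eqP.
  by move=> [hz [y [hy Wy]]] /(pt_eq_tr hz hy)[_ ->].
rewrite (_ : [set y | _] = set0); first exact: open0.
apply/seteqP; split=> z //= [hz [y [hy Wy]]] /(pt_eq_tr hz hy)[ji _].
by rewrite ji in nji.
Qed.

Lemma open_ptdom i : open (ptdom i).
Proof.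
have := @open_pt i _ openT; congr open; apply/seteqP; split=> p /=; first by move=> [y [hy _ ->]]; exists y.
by move=> [y hy ->]; exists y.
Qed.

Lemma pt_continuous i y : en y < 3 / 5 -> {for y, continuous (pt i)}.
Proof.
move=> hy A; rewrite nbhsE => -[U [oU Uy] UA].
apply: (filterS (P := [set z | en z < 3 / 5 /\ U (pt i z)])); first by move=> z [_ /UA].
by apply: open_nbhs_nbhs; split=> //; exact: oU i.
Qed.

Definition ch i (p : carr) : 'rV[R]_n := xget 0 [set y | en y < 3 / 5 /\ p = pt i y].

Lemma ch_pt i y : en y < 3 / 5 -> ch i (pt i y) = y.
Proof.
move=> hy; rewrite /ch; case: xgetP => [z _ [hz e]|/(_ y) []] //.
exact/esym/(pt_inj hy hz e).
Qed.

Lemma pt_ch i p : ptdom i p -> en (ch i p) < 3 / 5 /\ pt i (ch i p) = p.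
Proof. by move=> [y hy ->]; rewrite ch_pt. Qed.

Lemma ch_continuous i p : ptdom i p -> {for p, continuous (ch i)}.
Proof.
move=> dp A; rewrite nbhsE => -[W [oW Wp] WA].
have [h1 h2] := pt_ch dp.
apply: (filterS (P := [set p | exists y, [/\ en y < 3 / 5, W y & p = pt i y]])).
  by move=> _ [y [hy Wy ->]]; apply: WA; rewrite ch_pt.
by apply: open_nbhs_nbhs; split; [exact: open_pt|exists (ch i p)].
Qed.

(** A gluing may fail to be separated at the boundary of an overlap. Here the transition maps are
    continuous on the whole space: if [gT i j y = z] the points agree, both vectors being interior;
    otherwise disjoint balls around these two vectors separate them. Charts that are not neighbours
    have disjoint domains. *)
Lemma carr_hausdorff : hausdorff_space carr.
Proof.
move=> p q cl; apply: contrapT => npq.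
have [i [y [hy ep]]] := pt_surj p; have [j [z [hz eq]]] := pt_surj q.
have hy' : en y < 3 / 5 by lra.
have hz' : en z < 3 / 5 by lra.
have Np (W : set 'rV[R]_n) : open W -> W y -> nbhs p [set p | exists y, [/\ en y < 3 / 5, W y & p = pt i y]].
  by move=> oW Wy; apply: open_nbhs_nbhs; split; [exact: open_pt|exists y].
have Nq (W : set 'rV[R]_n) : open W -> W z -> nbhs q [set p | exists y, [/\ en y < 3 / 5, W y & p = pt j y]].
  by move=> oW Wy; apply: open_nbhs_nbhs; split; [exact: open_pt|exists z].
have [ij|nij] := boolP (j \in gnb i); last first.
  have [x [[y' [h1 _ e1]] [z' [h2 _ e2]]]] := cl _ _ (Np _ openT I) (Nq _ openT I).
  by have [ij _] := pt_eq_tr h1 h2 (etrans (esym e1) e2); rewrite ij in nij.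
have Tz : gT i j y != z by apply/eqP => e; apply: npq; rewrite ep eq; apply/pt_eqP.
have /eqP Tz' : `|gT i j y - z| != 0 by rewrite normr_eq0 subr_eq0.
pose e := `|gT i j y - z| / 2.
have e0 : 0 < e by rewrite divr_gt0 // lt0r normr_ge0 andbT; exact/eqP.
have oW1 : open (gT i j @^-1` ball (gT i j y) e).
  by apply: open_comp; [move=> x _; exact: gT_continuous|exact: ball_open].
have [x [[y' [h1 W1 e1]] [z' [h2 W2 e2]]]] := cl _ _ (Np _ oW1 (@ballxx _ _ _ e e0)) (Nq _ (ball_open z e) (@ballxx _ _ z e e0)).
have [_ E] := pt_eq_tr h1 h2 (etrans (esym e1) e2).
move: W1 W2; rewrite /= -!ball_normE /= E => W1 W2.
have := ler_distD z' (gT i j y) z; rewrite (distrC z') /e in W1 W2 *; lra.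
Qed.


(* [g_conn] reduces connectedness to that of the balls. *)
Lemma pt_segment_conn (U : set carr) i y z : open U -> open (~` U) ->
  en y < 3 / 5 -> en z < 3 / 5 -> U (pt i y) -> U (pt i z).
Proof.
move=> oU oCU hy hz Uy; apply: contrapT => nUz.
pose c (t : R) := y + t *: (z - y).
have hc t : 0 <= t <= 1 -> en (c t) < 3 / 5.
  move=> /andP[t0 t1]; rewrite /c (_ : y + _ = (1 - t) *: y + t *: z); last first.
    by apply/rowP => a; rewrite !mxE; ring.
  apply: (le_lt_trans (en_triangle _ _)); rewrite !enZ !ger0_norm ?subr_ge0 //.
  have m1 : en y <= Num.max (en y) (en z) by rewrite le_max lexx.
  have m2 : en z <= Num.max (en y) (en z) by rewrite le_max lexx orbT.
  have : Num.max (en y) (en z) < 3 / 5 by rewrite gt_max hy hz.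
  move: (Num.max _ _) m1 m2 => m m1 m2 m3.
  have := ler_wpM2l t0 m2; have t1' : 0 <= 1 - t by lra.
  have := ler_wpM2l t1' m1; lra.
have cc : continuous c by move=> t; exact/differentiable_continuous/differentiable_line.
pose A := [set t : R | 0 <= t <= 1 /\ U (pt i (c t))].
have A0 : A 0 by split; rewrite ?lexx ?ler01 //= /c scale0r addr0.
have hA : has_sup A by split; [exists 0|exists 1 => t [/andP[]]].
have s01 : 0 <= sup A <= 1.
  by rewrite (sup_upper_bound hA A0) ge_sup //; [exists 0|move=> t [/andP[]]].
have near_in (W : set carr) : open W -> W (pt i (c (sup A))) ->
    exists2 e, 0 < e & forall t, 0 <= t <= 1 -> `|t - sup A| < e -> W (pt i (c t)).
  move=> oW Wc; have o1 := open_comp (fun x _ => cc x) (oW i).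
  have [e /= e0 he] := (nbhs_ballP _ _).1 (open_nbhs_nbhs (conj o1 (conj (hc _ s01) Wc))).
  by exists e => // t t01 ht; have [] := he t; rewrite // -ball_normE /= distrC.
have [Us|nUs] := pselect (U (pt i (c (sup A)))).
  have [e e0 he] := near_in U oU Us.
  have s1 : sup A < 1.
    rewrite lt_neqAle; case/andP: s01 => _ ->; rewrite andbT; apply/eqP => E; apply: nUz.
    by move: Us; rewrite E /c scale1r addrC subrK.
  have : A (Num.min 1 (sup A + e / 2)).
    case/andP: s01 => s0 _; split.
      by rewrite ge_min lexx le_min ler01 addr_ge0 // divr_ge0 // ltW.
    apply: he; first by rewrite ge_min lexx le_min ler01 addr_ge0 // divr_ge0 // ltW.
    have : sup A <= Num.min 1 (sup A + e / 2) by rewrite le_min (ltW s1) lerDl divr_ge0 // ltW.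
    have : Num.min 1 (sup A + e / 2) <= sup A + e / 2 by rewrite ge_min lexx orbT.
    move: (Num.min _ _) => m h1 h2; rewrite ger0_norm ?subr_ge0 //; lra.
  move=> /(sup_upper_bound hA); rewrite ge_min => /orP[|]; lra.
have [e e0 he] := near_in (~` U) oCU nUs.
have [t At ht] := sup_adherent e0 hA.
have [t01 Ut] := At; apply: (he t t01) => //.
have := sup_upper_bound hA At => h; rewrite ler0_norm; lra.
Qed.

Lemma carr_connected : connected [set: carr].
Proof.
move=> U [p Up] [V oV eV] [W cW eW].
have oU : open U by rewrite eV setTI.
have oCU : open (~` U) by rewrite eW setTI; exact: closed_openC.
apply/seteqP; split=> // q _.
have H : forall i : G, forall y, en y < 3 / 5 -> U (pt i y).
  apply: g_conn => [|i j y ij hy hj Ui z hz].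
    have [i [y [hy e]]] := pt_surj p; exists i => z hz.
    by apply: (pt_segment_conn (y := y)) => //; rewrite -?e //; lra.
  apply: (pt_segment_conn (y := gT i j y)) => //.
  have <- : pt i y = pt j (gT i j y) by apply/pt_eqP.
  exact: Ui.
by have [i [y [hy ->]]] := pt_surj q; apply: H; lra.
Qed.

(** By [g_conn], every chart is reached from a fixed one in finitely many steps, and each chart has
    finitely many neighbours. *)
Lemma gI_countable : exists en_ : nat -> seq G, forall i, exists k, i \in en_ k.
Proof.
have [[i0]|none] := pselect (exists i : G, True); last first.
  by exists (fun _ => [::]) => i; exfalso; apply: none; exists i.
move=> _; pose L k := iter k (fun s : seq G => flatten (map (@gnb _ _ G) s)) [:: i0].
exists L; apply: g_conn; first by exists i0, 0%N; rewrite mem_head.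
move=> i j _ ij _ _ [k hk]; exists k.+1; apply/flatten_mapP; exists i => //.
Qed.

(** The base consists of the images of the boxes with rational centre and size [1 / k.+1]; a chart
    is named by a list of [gI_countable] and a position in it. *)
Lemma carr_second_countable : @second_countable carr.
Proof.
have [e_ he] := gI_countable.
pose box (q : {ffun 'I_n -> rat}) (k : nat) : set 'rV[R]_n := [set y | forall a, `|ratr (q a) - y 0 a| < k.+1%:R^-1].
have obox q k : open (box q k).
  rewrite openE => y hy; apply: (@filter_forall _ 'I_n (fun a => [set y : 'rV[R]_n | `|ratr (q a) - y 0 a| < k.+1%:R^-1]) (nbhs y)) => a.
  have cc : {for y, continuous (fun y : 'rV[R]_n => `|ratr (q a) - y 0 a|)}.
    apply: (@continuous_comp _ _ _ (fun y : 'rV[R]_n => ratr (q a) - y 0 a) (fun t => `|t|)); last exact: norm_continuous.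
    by apply: continuousB; [exact: cst_continuous|exact: coord_continuous].
  exact: (cc _ (lt_nbhsl (hy a))).
pose bs (c : nat * nat * {ffun 'I_n -> rat} * nat) : set carr :=
  if ohead (drop c.1.1.2 (e_ c.1.1.1)) is Some i then
    [set p | exists y, [/\ en y < 3 / 5, box c.1.2 c.2 y & p = pt i y]] else set0.
have obs c : open (bs c) by rewrite /bs; case: ohead => [i|]; [exact: open_pt|exact: open0].
exists (range bs).
  exact: (card_le_trans (card_image_le _ _) (countableP _)).
split=> [_ [c _ <-]|p A]; first exact: obs.
rewrite nbhsE => -[U [oU Up] UA].
have [i [y [hy ep]]] := pt_surj p; have hy' : en y < 3 / 5 by lra.
have := open_nbhs_nbhs (conj (oU i) (conj hy' _ : [set y | en y < 3 / 5 /\ U (pt i y)] y)).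
rewrite -ep => /(_ Up) /nbhs_ballP[r /= r0 hr].
have [k hk] : exists k : nat, 2 / k.+1%:R < r.
  exists (Num.bound (2 / r)); rewrite ltr_pdivrMr // mulrC -ltr_pdivrMr //.
  apply: lt_trans (archi_boundP _) _; first by rewrite divr_ge0 // ltW.
  by rewrite ltr_nat.
have k0 : 0 < k.+1%:R^-1 :> R by rewrite invr_gt0 ltr0n.
have [q hq] : exists q : {ffun 'I_n -> rat}, box q k y.
  have H a : exists q : rat, `|ratr q - y 0 a| < k.+1%:R^-1.
    have [|q] := @rat_in_itvoo R (y 0 a - k.+1%:R^-1) (y 0 a + k.+1%:R^-1); first by move: (k.+1%:R^-1) k0 => t t0; lra.
    by rewrite in_itv /= => /andP[h1 h2]; exists q; rewrite ltr_distl h1 h2.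
  by have [q hq] := choice H; exists [ffun a => q a] => a; rewrite ffunE.
have [m hm] := he i.
exists (bs (m, index i (e_ m), q, k)).
  split; first by exists (m, index i (e_ m), q, k).
  by rewrite /bs /= drop_index //; exists y.
rewrite /bs /= drop_index //= => _ [z [hz bz ->]]; apply: UA.
have [] // := hr z; rewrite -ball_normE /=.
apply: le_lt_trans hk; apply: norm_rV_le => [|a]; first by rewrite divr_ge0.
rewrite !mxE; have := hq a; have := bz a; move: (k.+1%:R^-1) k0 => t t0 h1 h2.
by have := ler_distD (ratr (q a)) (y 0 a) (z 0 a); rewrite (distrC (y 0 a) (ratr _)); lra.
Qed.


(** The atlas is indexed by points, and [gbase p] is the chart used at [p]. Having [p] within 1/20
    of the centre leaves room for geodesics of length about 1/2 before radius 3/5. *)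
Definition gbase (p : carr) : G := projT1 (cid (pt_surj p)).

Lemma gbaseP p : en (ch (gbase p) p) < 1 / 20 /\ ptdom (gbase p) p.
Proof.
rewrite /gbase; case: cid => i /= [y [hy e]].
have hy' : en y < 3 / 5 by lra.
by rewrite {1}e ch_pt //; split=> //; exists y.
Qed.

Lemma ch_image i : ch i @` ptdom i = [set y | en y < 3 / 5].
Proof.
apply/seteqP; split=> [_ [p dp <-]|y hy] /=; first by have [] := pt_ch dp.
by exists (pt i y); [exists y|rewrite ch_pt].
Qed.

Definition overlap i j : set 'rV[R]_n := [set y | [/\ en y < 3 / 5, j \in gnb i & en (gT i j y) < 3 / 5]].

Lemma ch_overlap i j : ch i @` (ptdom i `&` ptdom j) = overlap i j.
Proof.
apply/seteqP; split=> [_ [_ [[y hy ->] [z hz e]] <-]|y [hy ij hz]] /=.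
  by rewrite ch_pt //; have [ij e'] := pt_eq_tr hy hz e; split=> //; rewrite e'.
exists (pt i y); last by rewrite ch_pt.
by split; [exists y|exists (gT i j y) => //; rewrite pt_trE].
Qed.

Lemma open_overlap i j : open (overlap i j).
Proof.
have [ij|nij] := boolP (j \in gnb i); last first.
  rewrite (_ : overlap i j = set0); first exact: open0.
  by apply/seteqP; split=> y //= [_ ij]; rewrite ij in nij.
have oB := @open_en_ball R n (3 / 5).
have := openI oB (open_comp (fun x _ => gT_continuous ij (x := x)) oB); congr open.
by apply/seteqP; split=> y; [move=> [h1 h2]; split|move=> [h1 _ h2]; split].
Qed.

Lemma ch_transition i j y : overlap i j y -> ch j (pt i y) = gT i j y.
Proof. by move=> [hy ij hz]; rewrite -(pt_trE hy ij hz) ch_pt. Qed.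

Lemma transition_is_smooth i j : smooth (ch i @` (ptdom i `&` ptdom j)) (ch j \o pt i).
Proof.
rewrite ch_overlap; have oO := @open_overlap i j.
have [ij|nij] := boolP (j \in gnb i).
  apply: (smooth_congr (g := gT i j) oO); first by move=> y hy; rewrite /= ch_transition.
  exact: (LB_smooth (D := fun _ : unit => True) (f := fun _ => gT i j) oO (gT_smooth ij) (p := tt)).
apply: (smooth_congr (g := fun=> 0) oO); first by move=> y [_ ij]; rewrite ij in nij.
apply: (LB_smooth (D := fun _ : unit => True) (f := fun _ _ => 0) oO (p := tt)) => // k a.
by apply: lbk_cst.
Qed.

Lemma gT_differentiable i j : j \in gnb i -> forall y, differentiable (gT i j) y.
Proof. by move=> ij; exact: (LBk_differentiable (gT_smooth ij 1%N) (p := tt) I). Qed.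

Lemma jacobian_jac (f : 'rV[R]_n -> 'rV[R]_n) y : differentiable f y -> jacobian f y = jac f y.
Proof.
move=> df; apply/row_matrixP => a; rewrite !rowE -deriveEjacobian //.
apply/rowP => b; rewrite -rowE !mxE derive_coord //; exact: diff_derivable.
Qed.

Lemma derive_jac (f : 'rV[R]_n -> 'rV[R]_n) y v : differentiable f y -> 'D_v f y = v *m jac f y.
Proof. by move=> df; rewrite deriveEjacobian // jacobian_jac. Qed.

Lemma transition_jacobian i j y : overlap i j y -> jacobian (ch j \o pt i) y = jac (gT i j) y.
Proof.
move=> oy; have [hy ij hz] := oy.
have N : \forall z \near y, (ch j \o pt i) z = gT i j z.
  apply: filterS (open_nbhs_nbhs (conj (@open_overlap i j) oy)) => z oz.
  by rewrite /= ch_transition.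
have df := near_eq_differentiable N (gT_differentiable ij y).
rewrite jacobian_jac //; apply/matrixP => a b; rewrite !mxE /pd; apply: near_eq_derive.
by apply: filterS N => z ->.
Qed.

Section Tensor.
Hypothesis kappa_small : n%:R ^+ 2 * kappa <= 1 / 100.

Definition quad i y (v : 'rV[R]_n) : R := (v *m gg i y *m v^T) 0 0.

Lemma quad_close_nu i y v : `|quad i y v - dot v v| <= n%:R ^+ 2 * kappa * dot v v.
Proof.
have -> : quad i y v - dot v v = \sum_a \sum_b v 0 a * v 0 b * (gg i y a b - (a == b)%:R).
  rewrite /quad mxE (eq_bigr (fun b => \sum_a v 0 a * v 0 b * gg i y a b)); last first.
    by move=> b _; rewrite !mxE mulr_suml; apply: eq_bigr => a _; ring.
  rewrite exchange_big /= /dot -sumrB; apply: eq_bigr => a _.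
  have -> : v 0 a * v 0 a = \sum_b v 0 a * v 0 b * (a == b)%:R.
    rewrite (bigD1 a) //= eqxx mulr1 big1 ?addr0 // => b ba.
    by rewrite eq_sym (negbTE ba) mulr0.
  by rewrite -sumrB; apply: eq_bigr => b _; rewrite mulrBr.
apply: (le_trans (ler_norm_sum _ _ _)).
have step : forall a : 'I_n, `|\sum_b v 0 a * v 0 b * (gg i y a b - (a == b)%:R)| <= n%:R * (kappa * dot v v).
  move=> a; apply: (le_trans (ler_norm_sum _ _ _)).
  apply: (@le_trans _ _ (\sum_(b < n) kappa * dot v v)); last by rewrite sumr_const card_ord -[leLHS]mulr_natl.
  apply: ler_sum => b _; rewrite normrM mulrC; apply: ler_pM => //.
    exact: (bd_bound (gg_small i a b)).
  by rewrite normrM -enK expr2; apply: ler_pM => //; exact: coord_le_en.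
apply: (@le_trans _ _ (\sum_(a < n) n%:R * (kappa * dot v v))); first by apply: ler_sum.
by rewrite sumr_const card_ord -[leLHS]mulr_natl expr2 !mulrA.
Qed.

Lemma quad_close i y v : `|quad i y v - dot v v| <= 1 / 100 * dot v v.
Proof. by apply: le_trans (quad_close_nu i y v) _; rewrite ler_wpM2r // dot_ge0. Qed.

Lemma quad_gt0 i y v : v != 0 -> 0 < quad i y v.
Proof.
move=> v0; have : 0 < dot v v by rewrite -enK exprn_gt0 // en_gt0.
by have := quad_close i y v; rewrite ler_distl => /andP[]; lra.
Qed.

Lemma quad_inv i j y v : overlap i j y -> quad i y v = quad j (gT i j y) (v *m jac (gT i j) y).
Proof. by move=> [hy ij hz]; rewrite /quad (gg_inv ij hy hz) trmx_mul !mulmxA. Qed.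

Variable r : R.
Hypothesis r0 : 0 < r.

Lemma gg_is_smooth i U : open U -> smooth U (fun y => r ^+ 2 *: gg i y).
Proof.
move=> oU k; apply: Ck_coords => // a b.
apply: (@lbk_Ck _ unit (fun _ => True) _ _ _ (fun _ y => (r ^+ 2 *: gg i y) a b) tt) => //.
apply: (@lbk_ext _ _ _ _ _ (fun _ y => r ^+ 2 * gg i y a b)); first by move=> _ _ y; rewrite mxE.
by apply: ubk_lbk; apply: ubkM; [exact: ubk_cst1|exact: gg_smooth].
Qed.

Lemma mfd_chartK i p : ptdom i p -> pt i (ch i p) = p.
Proof. by move=> /pt_ch[]. Qed.

Lemma mfd_chart_open i : open (ch i @` ptdom i).
Proof. by rewrite ch_image; exact: open_en_ball. Qed.

Lemma mfd_chartV_continuous i y : (ch i @` ptdom i) y -> {for y, continuous (pt i)}.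
Proof. by rewrite ch_image; exact: pt_continuous. Qed.

Lemma mfd_tensor_sym i (x : carr) : (r ^+ 2 *: gg i (ch i x))^T = r ^+ 2 *: gg i (ch i x).
Proof. by rewrite linearZ /= gg_sym. Qed.

Lemma mfd_tensor_pos i (x : carr) (v : 'rV[R]_n) : v != 0 -> 0 < (v *m (r ^+ 2 *: gg i (ch i x)) *m v^T) 0 0.
Proof.
move=> v0; rewrite -scalemxAr -scalemxAl mxE mulr_gt0 ?exprn_gt0 //.
exact: quad_gt0.
Qed.

Lemma mfd_tensor_transition i j (x : carr) : ptdom i x -> ptdom j x ->
  let J := jacobian (ch j \o pt i) (ch i x) in
  r ^+ 2 *: gg i (ch i x) = J *m (r ^+ 2 *: gg j (ch j x)) *m J^T.
Proof.
move=> di dj J; have [hy ep] := pt_ch di; have [hz eq] := pt_ch dj.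
have [ij e] := pt_eq_tr hy hz (etrans ep (esym eq)).
have o : overlap i j (ch i x) by split=> //; rewrite e.
rewrite /J transition_jacobian // -scalemxAr -scalemxAl -e -gg_inv //.
by rewrite e.
Qed.

(** The charts are built at unit scale; the factor [r ^+ 2] on the tensor restores the scale [r]. *)
Definition mfd : riemannian_manifold R n := @RiemannianManifold R n carr
  carr_hausdorff carr_second_countable carr_connected
  (fun p => ptdom (gbase p)) (fun p => ch (gbase p)) (fun p => pt (gbase p))
  (fun p => open_ptdom (i := gbase p)) (fun p => (gbaseP p).2)
  (fun p => @mfd_chart_open (gbase p)) (fun p x => @mfd_chartK (gbase p) x)
  (fun p x => @ch_continuous (gbase p) x) (fun p y => @mfd_chartV_continuous (gbase p) y)
  (fun p q => @transition_is_smooth (gbase p) (gbase q))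
  (fun p y => r ^+ 2 *: gg (gbase p) y)
  (fun p => @gg_is_smooth (gbase p) _ (@mfd_chart_open (gbase p)))
  (fun p x _ => mfd_tensor_sym (gbase p) x)
  (fun p x v _ => @mfd_tensor_pos (gbase p) x v)
  (fun p q x => @mfd_tensor_transition (gbase p) (gbase q) x).

End Tensor.
End Carrier.
End GeometricAtlas.

(** * One-variable calculus: continuous induction, primitives, vector mean values *)

Section RealTools.
Context {R : realType}.
Implicit Types (f g df dg : R -> R) (a b t : R).

Lemma is_derive_cont f t (d : R) : is_derive t 1 f d -> {for t, continuous f}.
Proof. by case=> h _; exact/differentiable_continuous/derivable1_diffP. Qed.

Lemma derive_ge0_le f df a b : a <= b ->
  (forall t, a <= t <= b -> is_derive t (1 : R) f (df t)) ->
  (forall t, a <= t <= b -> 0 <= df t) -> f a <= f b.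
Proof.
move=> ab h h0; have [||c] := @MVT_segment R f df a b ab.
- by move=> t; rewrite in_itv /= => /andP[t1 t2]; apply: h; rewrite !ltW.
- apply: derivable_within_continuous => t; rewrite in_itv /= => tab.
  by have [] := h t tab.
rewrite in_itv /= => cab e; rewrite -subr_ge0 e mulr_ge0 ?subr_ge0 //.
exact: h0.
Qed.

Lemma derive_le f df g dg a b : a <= b ->
  (forall t, a <= t <= b -> is_derive t (1 : R) f (df t)) ->
  (forall t, a <= t <= b -> is_derive t (1 : R) g (dg t)) ->
  (forall t, a <= t <= b -> df t <= dg t) -> f b - f a <= g b - g a.
Proof.
move=> ab hf hg h.
have := @derive_ge0_le (g - f) (fun t => dg t - df t) a b ab.
rewrite !fctE => H; suff : g a - f a <= g b - f b by lra.
apply: H => t tab; last by rewrite subr_ge0 h.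
by apply: is_deriveB; [exact: hg|exact: hf].
Qed.

Lemma derive_eq f g df a b : a <= b ->
  (forall t, a <= t <= b -> is_derive t (1 : R) f (df t)) ->
  (forall t, a <= t <= b -> is_derive t (1 : R) g (df t)) -> f b - f a = g b - g a.
Proof.
by move=> ab hf hg; apply/eqP; rewrite eq_le !(derive_le ab (df := df) (dg := df)).
Qed.

(** If [P] failed at some time, consider the supremum of the earlier times up to which it holds: the
    closed step gives [P] there and the open step goes beyond it. *)
Lemma real_induction (P : R -> Prop) a b : P a ->
  (forall t, a <= t < b -> (forall s, a <= s <= t -> P s) ->
     exists2 e, 0 < e & forall s, t < s < t + e -> s <= b -> P s) ->
  (forall t, a < t <= b -> (forall s, a <= s < t -> P s) -> P t) ->
  forall t, a <= t <= b -> P t.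
Proof.
move=> Pa hopen hclosed t0 /andP[at0 t0b]; apply: contrapT => nP.
pose S := [set t | a <= t <= t0 /\ forall s, a <= s <= t -> P s].
have Sa : S a by split; [rewrite lexx|move=> s; rewrite -eq_le => /eqP <-].
have hS : has_sup S by split; [exists a|exists t0 => t [/andP[]]].
pose m := sup S.
have am : a <= m by exact: sup_upper_bound hS _ Sa.
have mt0 : m <= t0 by apply: ge_sup; [exists a|move=> t [/andP[]]].
have below s : a <= s < m -> P s.
  move=> /andP[as_ sm]; have ms : 0 < m - s by rewrite subr_gt0.
  have [t St /ltW] := sup_adherent ms hS.
  by rewrite -/m => ht'; case: St => _; apply; rewrite as_; lra.
have Pm : P m.
  move: am; rewrite le_eqVlt => /orP[/eqP <-//|am].
  by apply: hclosed => //; rewrite am (le_trans mt0).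
have all_m s : a <= s <= m -> P s.
  by move=> /andP[as_]; rewrite le_eqVlt => /orP[/eqP ->//|sm]; apply: below; rewrite as_.
have mt0' : m < t0.
  by rewrite lt_neqAle mt0 andbT; apply/eqP => e; apply: nP; rewrite -e.
have mb : a <= m < b by rewrite am (lt_le_trans mt0').
have [e e0 he] := hopen m mb all_m.
pose m' := Num.min t0 (m + e / 2).
have mm' : m < m' by rewrite lt_min mt0' ltrDl divr_gt0.
have m't0 : m' <= t0 by rewrite ge_min lexx.
have m'e : m' < m + e.
  by rewrite gt_min; apply/orP; right; lra.
have : S m'.
  split=> [|s /andP[as_ sm']]; first by rewrite m't0 andbT (le_trans am) // ltW.
  have [sm|ms] := leP s m; first by apply: all_m; rewrite as_.
  by apply: he; [rewrite ms (le_lt_trans sm')|rewrite (le_trans sm') // (le_trans m't0)].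
by move=> /(sup_upper_bound hS); rewrite leNgt mm'.
Qed.

Lemma integrable_cont f a b : continuous f ->
  (@lebesgue_measure R).-integrable `[a, b] (EFin \o f).
Proof.
move=> cf; apply: continuous_compact_integrable; first exact: segment_compact.
exact: continuous_subspaceT.
Qed.

Lemma primitive_from f (a : R) : continuous f ->
  exists F : R -> R, forall t, a < t -> is_derive t (1 : R) F (f t).
Proof.
move=> cf; exists (fun x => \int[lebesgue_measure]_(s in `[a, x]) f s) => t at_.
have [d e] := @continuous_FTC1_closed R f a t (t + 1) (etrans (ltrDl t 1) ltr01) (integrable_cont _ _ cf) at_ (cf t).
apply: DeriveDef; first exact: d.
by rewrite -derive1E; exact: e.
Qed.

(** [primitive_from] differentiates only to the right of its base point. The primitives based at
    [- N.+1], normalized to vanish at 0, agree where they overlap and are glued. *)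
Lemma primitive f : continuous f -> exists F : R -> R, forall t, is_derive t (1 : R) F (f t).
Proof.
move=> cf; have [F hF] := choice (fun N : nat => primitive_from (- N.+1%:R) cf).
pose H N x := F N x - F N 0.
have hH N t : - N.+1%:R < t -> is_derive t (1 : R) (H N) (f t).
  move=> Nt; rewrite -[f t]subr0; apply: is_deriveB; exact: hF.
have N0 N : - N.+1%:R < 0 :> R by rewrite oppr_lt0 ltr0n.
have agree N M t : - N.+1%:R < t -> - M.+1%:R < t -> H N t = H M t.
  have H0 K : H K 0 = 0 by rewrite /H subrr.
  move=> Nt Mt; have [t0|t0] := leP 0 t.
    have := @derive_eq (H N) (H M) f 0 t t0; rewrite !H0 !subr0; apply => s /andP[s0 _]; apply: hH; exact: lt_le_trans s0.
  have := @derive_eq (H N) (H M) f t 0 (ltW t0); rewrite !H0 !sub0r => e; apply: oppr_inj.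
  by apply: e => s /andP[s0 _]; apply: hH; exact: lt_le_trans s0.
pose B t := Num.bound `|t|.
have hB t : - (B t).+1%:R < t.
  have := archi_boundP (normr_ge0 t); rewrite /B => h.
  have : `|t| < (Num.bound `|t|).+1%:R by apply: (lt_trans h); rewrite ltr_nat.
  by rewrite ltr_norml => /andP[].
exists (fun t => H (B t) t) => t.
apply: near_eq_is_derive (hH (B t) t (hB t)).
near=> s; apply: agree; last exact: hB.
by near: s; apply: lt_nbhsr; exact: hB.
Unshelve. all: by end_near. Qed.

Lemma integral_primitive f F a b : a <= b -> continuous f ->
  (forall t, is_derive t (1 : R) F (f t)) ->
  \int[lebesgue_measure]_(t in `[a, b]) f t = F b - F a.
Proof.
rewrite le_eqVlt => /orP[/eqP <-|ab] cf hF.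
  by rewrite set_itv1 Rintegral_set1 subrr.
have cF x : {for x, continuous F} by exact: is_derive_cont (hF x).
rewrite /Rintegral (@continuous_FTC2 R f F a b ab) //.
- exact: continuous_subspaceT.
- split; first by move=> x _; case: (hF x).
  + exact/cvg_at_right_filter/cF.
  + exact/cvg_at_left_filter/cF.
- by move=> x _; rewrite derive1E; case: (hF x).
Qed.

Lemma is_derive_dot n (c : R -> 'rV[R]_n) (v u : 'rV[R]_n) t :
  is_derive t (1 : R) c v -> is_derive t (1 : R) (fun s => dot (c s) u) (dot v u).
Proof.
move=> [dc ec]; have dci j : derivable (fun s => c s 0 j) t 1.
  exact: (derivable_mxP _ _ _).1 dc 0 j.
have -> : (fun s => dot (c s) u) = \sum_(j < n) (fun s => c s 0 j * u 0 j).
  by apply/funext => s; rewrite fct_sumE.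
rewrite /dot; apply: is_derive_sum => j.
have h : is_derive t (1 : R) (fun s => c s 0 j) (v 0 j).
  by apply: DeriveDef => //; rewrite -ec derive_mx // mxE.
have := is_deriveM h (is_derive_cst (u 0 j) t 1).
by move=> /is_derive_eq; apply; rewrite scaler0 add0r /GRing.scale /= mulrC.
Qed.

(** Project on the displacement [u]: the scalar function [dot (c s) u] has derivative at most
    [dg s * en u]. *)
Lemma en_derive_le n (c : R -> 'rV[R]_n) dc g dg a b : a <= b ->
  (forall t, a <= t <= b -> is_derive t (1 : R) c (dc t)) ->
  (forall t, a <= t <= b -> is_derive t (1 : R) g (dg t)) ->
  (forall t, a <= t <= b -> en (dc t) <= dg t) -> en (c b - c a) <= g b - g a.
Proof.
move=> ab hc hg h; set u := c b - c a.
have [->|u0] := eqVneq u 0.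
  rewrite en0 subr_ge0; apply: (derive_ge0_le ab hg) => t tab.
  exact: le_trans (en_ge0 _) (h t tab).
have eu := en_gt0 u0.
have := @derive_le (fun s => dot (c s) u) (fun s => dot (dc s) u) (fun s => g s * en u) (fun s => dg s * en u) a b ab.
rewrite -dotBl -/u -enK -mulrBl expr2 => H.
rewrite -(ler_pM2r eu); apply: H => t tab.
- exact/is_derive_dot/hc.
- have := is_deriveM (hg t tab) (is_derive_cst (en u) t 1).
  by move=> /is_derive_eq; apply; rewrite scaler0 add0r /GRing.scale /= mulrC.
- apply: (le_trans (dot_le _ _)); rewrite ler_pM2r //; exact: h.
Qed.

End RealTools.

Lemma near_eq_continuous (T U : topologicalType) (f g : T -> U) x :
  {near x, f =1 g} -> {for x, continuous f} -> {for x, continuous g}.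
Proof.
move=> E cf; rewrite /prop_for /continuous_at -(nbhs_singleton E).
exact: cvg_trans (near_eq_cvg E) cf.
Qed.

(** * Curves in charts and their lengths *)

Section Lengths.
Context {R : realType}.
Variables (n : nat) (kappa : R) (G : geom n kappa).
Hypothesis kappa_small : n%:R ^+ 2 * kappa <= 1 / 100.
Variable r : R.
Hypothesis r0 : 0 < r.
Local Notation M := (@mfd R n kappa G kappa_small r r0).
Local Notation nu := (n%:R ^+ 2 * kappa).
Implicit Types (i j : G) (p q : M) (y z v : 'rV[R]_n) (s t : R).

Lemma nu_ge0 i : 0 <= nu.
Proof.
have [n0|n0] := posnP n; first by rewrite n0 expr0n mul0r.
by rewrite mulr_ge0 ?sqr_ge0 // (bd_ge0 (gg_small i (Ordinal n0) (Ordinal n0))).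
Qed.

Definition spd i y v : R := r * Num.sqrt (quad i y v).

Lemma quad_ge0 i y v : 0 <= quad i y v.
Proof.
have [->|v0] := eqVneq v 0; first by rewrite /quad mul0mx mul0mx mxE.
exact/ltW/(quad_gt0 kappa_small).
Qed.

Lemma spd_ge0 i y v : 0 <= spd i y v.
Proof. by rewrite mulr_ge0 ?sqrtr_ge0 // ltW. Qed.

Lemma spd_le i y v : spd i y v <= (1 + nu) * r * en v.
Proof.
have n0 := nu_ge0 i; rewrite /spd [(1 + _) * r]mulrC -mulrA ler_pM2l //.
rewrite -(ler_pXn2r (_ : 0 < 2)%N) ?nnegrE ?sqrtr_ge0 ?mulr_ge0 ?addr_ge0 ?en_ge0 //.
rewrite sqr_sqrtr ?quad_ge0 // exprMn enK.
have := quad_close_nu i y v; rewrite ler_distl => /andP[_ h]; have d0 := dot_ge0 v.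
move: nu n0 (quad i y v) (dot v v) h d0 => x x0 q D h D0.
have : 0 <= x * D + x ^+ 2 * D by rewrite addr_ge0 // mulr_ge0 // sqr_ge0.
rewrite !expr2; lra.
Qed.

(** Since [(1 + nu) ^+ 2 * (1 - nu) >= 1] for small [nu], the factor [1 + nu] of [spd_le] serves in
    this direction as well. *)
Lemma en_le_spd i y v : r * en v <= (1 + nu) * spd i y v.
Proof.
have n0 := nu_ge0 i; rewrite /spd mulrCA ler_pM2l //.
rewrite -(ler_pXn2r (_ : 0 < 2)%N) ?nnegrE ?sqrtr_ge0 ?mulr_ge0 ?addr_ge0 ?en_ge0 ?sqrtr_ge0 //.
rewrite enK exprMn sqr_sqrtr ?quad_ge0 //.
have := quad_close_nu i y v; rewrite ler_distl => /andP[h _]; have d0 := dot_ge0 v.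
have n1 := kappa_small; move: nu n0 n1 (quad i y v) (dot v v) h d0 => x x0 x1 q D h D0.
have h' : (1 - x) * D <= q by lra.
have x1' : 0 <= (1 + x) ^+ 2 by rewrite sqr_ge0.
apply: le_trans (ler_wpM2l x1' h').
rewrite mulrA ler_peMl // !expr2.
have : 0 <= x * (1 - x - x * x).
  rewrite mulr_ge0 //; have : x * x <= 1 / 100 * (1 / 100) by rewrite ler_pM //.
  lra.
rewrite !mulrBr; lra.
Qed.

Lemma tnorm_spd p v : tnorm p v = spd (gbase p) (ch (gbase p) p) v.
Proof.
rewrite /tnorm /inner /spd /= -scalemxAr -scalemxAl mxE sqrtrM ?sqr_ge0 //.
by rewrite sqrtr_sqr gtr0_norm.
Qed.

Lemma spd_inv i j y v : overlap i j y -> spd i y v = spd j (gT i j y) (v *m jac (gT i j) y).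
Proof. by move=> o; rewrite /spd (quad_inv v o). Qed.

Lemma is_derive_comp_jac (f : 'rV[R]_n -> 'rV[R]_n) (c : R -> 'rV[R]_n) t v :
  is_derive t (1 : R) c v -> differentiable f (c t) ->
  is_derive t (1 : R) (f \o c) (v *m jac f (c t)).
Proof.
move=> [dc ec] df; have dc' : differentiable c t by apply/derivable1_diffP.
apply: DeriveDef; first by apply: diff_derivable; exact: differentiable_comp.
rewrite deriveE; last exact: differentiable_comp.
by rewrite diff_comp //= -(deriveE _ dc') ec -deriveE // derive_jac.
Qed.

(* [c] represents [gam] near [t] in the chart [i], with derivative [dc]. *)
Definition repr (gam : R -> M) i (c dc : R -> 'rV[R]_n) t :=
  \forall s \near t, [/\ en (c s) < 3 / 5, gam s = pt i (c s) & is_derive s (1 : R) c (dc s)].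

Lemma is_derive_continuous (c : R -> 'rV[R]_n) t v : is_derive t (1 : R) c v -> {for t, continuous c}.
Proof. by case=> h _; exact/differentiable_continuous/derivable1_diffP. Qed.

Lemma repr_overlap (gam : R -> M) i j c dc t : repr gam i c dc t -> ptdom j (gam t) ->
  \forall s \near t, overlap i j (c s) /\ ch j (gam s) = gT i j (c s).
Proof.
move=> h; have [h1 h2 h3] := nbhs_singleton h.
rewrite h2 => -[z hz e]; have [ij e'] := pt_eq_tr h1 hz e.
have o : overlap i j (c t) by split => //; rewrite e'.
have cc := is_derive_continuous h3.
have N : \forall s \near t, overlap i j (c s).
  exact: (cc _ (open_nbhs_nbhs (conj (@open_overlap _ _ _ G i j) o))).
by apply: filterS2 N h => s os [g1 -> g3]; split=> //; rewrite ch_transition.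
Qed.

Lemma repr_change (gam : R -> M) i j c dc t : repr gam i c dc t -> ptdom j (gam t) ->
  repr gam j (gT i j \o c) (fun s => dc s *m jac (gT i j) (c s)) t.
Proof.
move=> h dj; have N := repr_overlap h dj.
apply: filterS2 N h => s [[w1 w2 w3] e] [g1 g2 g3]; split=> //=.
  by rewrite g2 pt_trE.
by apply: is_derive_comp_jac => //; exact: gT_differentiable.
Qed.

Lemma repr_velocity (gam : R -> M) i c dc t : repr gam i c dc t ->
  tnorm (gam t) (velocity gam t) = spd i (c t) (dc t).
Proof.
move=> h; set j := gbase (gam t); have dj : ptdom j (gam t) := (gbaseP (gam t)).2.
have N := repr_overlap h dj.
have [ov e] := nbhs_singleton N; have [w1 w2 w3] := ov.
rewrite tnorm_spd -/j e (spd_inv (dc t) ov); congr spd.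
have /nbhs_singleton[_ _ D] := repr_change h dj.
have E : \forall s \near t, (gT i j \o c) s = (ch j \o gam) s by apply: filterS N => s [_ e'] /=; rewrite e'.
rewrite /velocity derive1E; have [_] := near_eq_is_derive E D; exact.
Qed.

Definition C1at (gam : R -> M) i c dc t := repr gam i c dc t /\ {for t, continuous dc}.

Lemma jac_continuous i j (c : R -> 'rV[R]_n) t a b : j \in gnb i -> {for t, continuous c} ->
  {for t, continuous (fun s => jac (gT i j) (c s) a b)}.
Proof.
move=> ij cc; rewrite (_ : (fun s => _) = (fun y => pd a (fun x => gT i j x 0 b) y) \o c); last first.
  by apply/funext => s; rewrite /= mxE.
apply: continuous_comp => //.
have [_ /(_ a) [K hK]] := gT_smooth ij 2%N b; exact: (bd_continuous (hK tt I)).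
Qed.

Lemma C1at_change (gam : R -> M) i j c dc t : C1at gam i c dc t -> ptdom j (gam t) ->
  C1at gam j (gT i j \o c) (fun s => dc s *m jac (gT i j) (c s)) t.
Proof.
move=> [h cd] dj; split; first exact: repr_change.
have [_ _ h3] := nbhs_singleton h; have [[_ ij _] _] := nbhs_singleton (repr_overlap h dj).
apply: continuous_coords => a b; rewrite ord1.
rewrite (_ : (fun s => _) = (fun s => \sum_k dc s 0 k * jac (gT i j) (c s) k b)); last first.
  by apply/funext => s; rewrite mxE.
apply: continuous_bigsum => k; apply: continuousM; last by apply: jac_continuous => //; exact: is_derive_continuous h3.
by apply: (@continuous_comp _ _ _ dc (fun y => y 0 k)) => //; exact: coord_continuous.
Qed.

Lemma C1_of (gam : R -> M) : (forall t, exists i c dc, C1at gam i c dc t) -> C1_curve gam.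
Proof.
move=> h; split=> [t|p t dp].
  have [i [c [dc [hr _]]]] := h t; have [h1 h2 h3] := nbhs_singleton hr.
  have E : {near t, pt i \o c =1 gam} by apply: filterS hr => s [_ -> _].
  apply: (near_eq_continuous E).
  by apply: (@continuous_comp _ _ _ c (pt i)); [exact: is_derive_continuous h3|exact: pt_continuous].
have [i [c [dc hC]]] := h t; have [hr' hc'] := C1at_change hC dp.
have E : \forall s \near t, \forall u \near s, (gT i (gbase p) \o c) u = (ch (gbase p) \o gam) u.
  have N := repr_overlap hC.1 dp.
  have : \forall s \near t, (gT i (gbase p) \o c) s = (ch (gbase p) \o gam) s by apply: filterS N => s [_ e'] /=; rewrite e'.
  by move/nbhs_interior.
have D : \forall s \near t, is_derive s (1 : R) (ch (gbase p) \o gam) (dc s *m jac (gT i (gbase p)) (c s)).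
  by apply: filterS2 E hr' => s Es [_ _ Ds]; exact: near_eq_is_derive Es Ds.
split; first by apply: filterS D => s [].
have E2 : {near t, (fun s => dc s *m jac (gT i (gbase p)) (c s)) =1 derive1 (ch (gbase p) \o gam)}.
  by apply: filterS D => s [_ e]; rewrite derive1E e.
exact: (near_eq_continuous E2 hc').
Qed.

Lemma C1_coord (gam : R -> M) p t : C1_curve gam -> ptdom (gbase p) (gam t) ->
  C1at gam (gbase p) (ch (gbase p) \o gam) (derive1 (ch (gbase p) \o gam)) t.
Proof.
move=> [cg hg] dp; have [h1 h2] := hg p t dp; split=> //.
have N : \forall s \near t, ptdom (gbase p) (gam s).
  exact: (cg t _ (open_nbhs_nbhs (conj (@open_ptdom _ _ _ G (gbase p)) dp))).
apply: filterS2 N h1 => s /pt_ch[n1 n2] ds; split; [exact: n1|by rewrite /= n2|].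
by rewrite derive1E; exact: derivableP.
Qed.

Lemma spd_continuous i (c dc : R -> 'rV[R]_n) t : {for t, continuous c} -> {for t, continuous dc} ->
  {for t, continuous (fun s => spd i (c s) (dc s))}.
Proof.
move=> cc cd; apply: continuousM; first exact: cst_continuous.
apply: (@continuous_comp _ _ _ (fun s => quad i (c s) (dc s)) Num.sqrt); last exact: sqrt_continuous.
rewrite (_ : (fun s => _) = (fun s => \sum_b (\sum_a dc s 0 a * gg i (c s) a b) * dc s 0 b)); last first.
  by apply/funext => s; rewrite /quad mxE; apply: eq_bigr => b _; rewrite !mxE.
have cdk k : {for t, continuous (fun s => dc s 0 k)}.
  by apply: (@continuous_comp _ _ _ dc (fun y => y 0 k)) => //; exact: coord_continuous.
apply: continuous_bigsum => b; apply: continuousM => //.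
apply: continuous_bigsum => a; apply: continuousM => //.
apply: (@continuous_comp _ _ _ c (fun y => gg i y a b)) => //.
have [K hK] := gg_smooth i a b 0%N; exact: (bd_continuous (hK tt I)).
Qed.

Definition speed (gam : R -> M) t : R := tnorm (gam t) (velocity gam t).

Lemma speed_continuous (gam : R -> M) : C1_curve gam -> continuous (speed gam).
Proof.
move=> C t; have [hr hc] := C1_coord C (gbaseP (gam t)).2; set i := gbase (gam t) in hr hc.
have [_ _ h3] := nbhs_singleton hr.
have E : {near t, (fun s => spd i ((ch i \o gam) s) (derive1 (ch i \o gam) s)) =1 speed gam}.
  by apply: filterS (nbhs_interior hr) => s hs; rewrite /speed (repr_velocity hs).
have H := @spd_continuous i _ _ _ (is_derive_continuous h3) hc.
exact: near_eq_continuous E H.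
Qed.

Lemma speed_ge0 (gam : R -> M) t : 0 <= speed gam t.
Proof. exact: sqrtr_ge0. Qed.

Lemma arc_length_primitive (gam : R -> M) : C1_curve gam ->
  exists2 F : R -> R, (forall t, is_derive t (1 : R) F (speed gam t)) &
    forall a b, a <= b -> arc_length gam a b = F b - F a.
Proof.
move=> C; have [F hF] := primitive (speed_continuous C); exists F => // a b ab.
exact: integral_primitive ab (speed_continuous C) hF.
Qed.

Lemma primitive_mono (gam : R -> M) F a b : (forall t, is_derive t (1 : R) F (speed gam t)) -> a <= b -> F a <= F b.
Proof. by move=> hF ab; apply: (derive_ge0_le (df := speed gam) ab) => t _ //; exact: speed_ge0. Qed.

(** Continuous induction along the curve: by [en_le_spd] the coordinates move at most [(1 + nu) / r]
    times as fast as the length grows, so the curve cannot leave the chart while this budget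
    lasts. *)
Lemma curve_lower (gam : R -> M) F p a b y : C1_curve gam ->
  (forall t, is_derive t (1 : R) F (speed gam t)) ->
  en y < 3 / 5 -> gam a = pt (gbase p) y -> en y + (1 + nu) / r * (F b - F a) < 3 / 5 ->
  forall t, a <= t <= b -> exists z, [/\ en z < 3 / 5, gam t = pt (gbase p) z & en (z - y) <= (1 + nu) / r * (F t - F a)].
Proof.
move=> C hF hy ga hb; set i := gbase p in ga *; set k := (1 + nu) / r in hb *.
have k0 : 0 <= k by rewrite divr_ge0 ?(ltW r0) // addr_ge0 // (nu_ge0 i).
have inside z t : t <= b -> en (z - y) <= k * (F t - F a) -> en z < 3 / 5.
  move=> tb h; have m := primitive_mono hF tb.
  have := en_triangle (z - y) y; rewrite subrK => h2.
  apply: le_lt_trans hb; apply: (le_trans h2); rewrite addrC lerD2l (le_trans h) //.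
  by rewrite ler_wpM2l // lerB.
apply: real_induction.
- by exists y; rewrite ga !subrr mulr0 en0.
- move=> t /andP[at_ tb] /(_ t); rewrite at_ lexx => /(_ isT)[z [hz gz zy]].
  have dt : ptdom i (gam t) by rewrite gz; exists z.
  have [hr _] := C1_coord C dt.
  have /nbhs_ballP[e /= e0 he] := hr; exists e => // s /andP[ts se] sb.
  have hs u : t <= u <= s -> [/\ en (ch i (gam u)) < 3 / 5, gam u = pt i (ch i (gam u)) &
     is_derive u (1 : R) (ch i \o gam) (derive1 (ch i \o gam) u)].
    move=> /andP[tu us]; apply: he; rewrite -ball_normE /= ltr_norml; apply/andP; split; lra.
  have tss : t <= s <= s by rewrite (ltW ts) lexx.
  have [s1 s2 _] := hs s tss.
  exists (ch i (gam s)); split=> //.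
  have ec : en ((ch i \o gam) s - (ch i \o gam) t) <= k * F s - k * F t.
    have hkF u : is_derive u (1 : R) (fun u => k * F u) (k * speed gam u).
      have H := is_deriveM (is_derive_cst k u 1) (hF u).
      by apply: (is_derive_eq H); rewrite scaler0 addr0.
    apply: (en_derive_le (ltW ts) (dc := derive1 (ch i \o gam)) (g := fun u => k * F u) (dg := fun u => k * speed gam u)).
    + by move=> u hu; have [] := hs u hu.
    + move=> u /andP[tu us].
      have hr' : repr gam i (ch i \o gam) (derive1 (ch i \o gam)) u.
        apply/nbhs_ballP; exists (Num.min e (e - (u - t))) => /=.
          by rewrite lt_min e0 /=; lra.
        move=> w; rewrite -ball_normE /= => hw; apply: he; rewrite -ball_normE /=.
        have hw' : `|u - w| < e - (u - t) by apply: (lt_le_trans hw); rewrite ge_min lexx orbT.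
        have := ler_distD u t w; rewrite (distrC t u) (@ger0_norm _ (u - t)) ?subr_ge0 //; lra.
      rewrite /speed (repr_velocity hr') /k mulrAC ler_pdivlMr // mulrC.
      exact: en_le_spd.
  rewrite /= in ec; have ez : ch i (gam t) = z by rewrite gz ch_pt.
  rewrite ez in ec; apply: (le_trans (en_triangleB _ z _)); apply: (le_trans (lerD ec zy)).
  by rewrite le_eqVlt; apply/orP; left; apply/eqP; ring.
(* At a limit time the point is read in its own chart [j]. Its coordinates in [i] are recovered
   through [gT j i], which is continuous everywhere, so the estimate passes to the limit. *)
move=> t /andP[at_ tb] IH; set j := gbase (gam t).
have dj : ptdom j (gam t) := (gbaseP (gam t)).2.
have [hr _] := C1_coord C dj; rewrite -/j in hr.
have [n1 n2 n3] := nbhs_singleton hr.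
have left_near (Q : R -> Prop) : (\forall s \near t, Q s) -> exists2 s, a <= s < t & Q s.
  move=> /nbhs_ballP[e /= e0 he]; pose s := Num.max a (t - e / 2).
  have s1 : t - e / 2 <= s by rewrite le_max lexx orbT.
  have s2 : s < t by rewrite gt_max at_ /=; lra.
  exists s; first by rewrite s2 le_max lexx.
  by apply: he; rewrite -ball_normE /= ltr_norml; apply/andP; split; lra.
have ij : j \in gnb i.
  have [s hs [s1 s2 _]] := left_near _ hr; have [z [hz gz _]] := IH s hs.
  by have [] := pt_eq_tr hz s1 (etrans (esym gz) s2).
have ji := g_sym ij; set z := gT j i (ch j (gam t)).
have cz : {for t, continuous (fun s => en (gT j i (ch j (gam s)) - y) - k * (F s - F a))}.
  apply: continuousB.
    apply: (@continuous_comp _ _ _ (fun s => gT j i (ch j (gam s)) - y) en); last exact: en_continuous.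
    apply: continuousB; last exact: cst_continuous.
    apply: (@continuous_comp _ _ _ (ch j \o gam) (gT j i)); first exact: is_derive_continuous n3.
    exact: gT_continuous.
  apply: continuousM; first exact: cst_continuous.
  apply: continuousB; last exact: cst_continuous.
  exact: is_derive_cont (hF t).
have zy : en (z - y) <= k * (F t - F a).
  rewrite leNgt; apply/negP => h; rewrite -subr_gt0 in h.
  have N := cz _ (lt_nbhsr h).
  have [s hs [[s1 s2 _] s3]] := left_near _ (filterI hr N).
  have [w [hw gw wy]] := IH s hs; have [_ e] := pt_eq_tr s1 hw (etrans (esym s2) gw).
  by move: s3; rewrite /= e subr_gt0 ltNge wy.
exists z; split=> //; first exact: inside tb zy.
by rewrite n2 pt_trE //; exact: inside tb zy.
Qed.

End Lengths.

Section Reparametrize.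
Context {R : realType}.

Lemma is_derive_reparam (V : normedModType R) (c : R -> V) (h : R -> R) (t dh : R) (v : V) :
  is_derive t (1 : R) h dh -> is_derive (h t) (1 : R) c v -> is_derive t (1 : R) (fun s => c (h s)) (dh *: v).
Proof.
move=> [dh1 eh] [dc ec].
have dc' : differentiable c (h t) by apply/derivable1_diffP.
have dh' : differentiable h t by apply/derivable1_diffP.
have dch : differentiable (c \o h) t by exact: differentiable_comp.
apply: DeriveDef; first by apply: diff_derivable; exact: dch.
rewrite (deriveE _ dch) diff_comp //= -(deriveE _ dh') eh -[X in 'd c _ X]mulr1 -[X in 'd c _ X]/(dh *: (1 : R)).
by rewrite linearZ /= -(deriveE _ dc') ec.
Qed.

Lemma is_derive_neg (V : normedModType R) (c : R -> V) (t : R) (v : V) :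
  is_derive (- t) (1 : R) c v -> is_derive t (1 : R) (fun s => c (- s)) (- v).
Proof.
by move=> h; rewrite -scaleN1r; apply: is_derive_reparam h.
Qed.

Lemma is_derive_coords n (c : R -> 'rV[R]_n) (t : R) (v : 'rV[R]_n) :
  (forall a, is_derive t (1 : R) (fun s => c s 0 a) (v 0 a)) -> is_derive t (1 : R) c v.
Proof.
move=> h; have d : derivable c t 1 by apply/derivable_mxP => i j; rewrite ord1; case: (h j).
apply: DeriveDef => //; apply/rowP => a; rewrite derive_mx // mxE.
by case: (h a).
Qed.

Lemma is_derive_coord n (c : R -> 'rV[R]_n) (t : R) (v : 'rV[R]_n) a :
  is_derive t (1 : R) c v -> is_derive t (1 : R) (fun s => c s 0 a) (v 0 a).
Proof.
move=> [d e]; apply: DeriveDef; first exact: (derivable_mxP _ _ _).1 d 0 a.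
by rewrite -e derive_mx // mxE.
Qed.

Lemma is_derive_scalel (h : R -> R) (t dh : R) n (v : 'rV[R]_n) :
  is_derive t (1 : R) h dh -> is_derive t (1 : R) (fun s => h s *: v) (dh *: v).
Proof.
move=> H; apply: is_derive_coords => a; rewrite mxE.
rewrite (_ : (fun s => _) = (fun s => h s * v 0 a)); last by apply/funext => s; rewrite mxE.
have D := is_deriveM H (is_derive_cst (v 0 a) t 1).
by apply: (is_derive_eq D); rewrite scaler0 add0r /GRing.scale /= mulrC.
Qed.

Lemma rV_cauchy n (w : nat -> 'rV[R]_n) :
  (forall e, 0 < e -> exists K, forall a b, (K <= a)%N -> (K <= b)%N -> en (w a - w b) < e) ->
  exists L, forall e, 0 < e -> exists K, forall m, (K <= m)%N -> en (w m - L) < e.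
Proof.
move=> cau; have lim i : exists l, forall e, 0 < e -> exists K, forall m, (K <= m)%N -> `|w m 0 i - l| < e.
  have cw : cvgn (fun m => w m 0 i).
    apply/cauchy_cvgP/cauchy_exP => e e0; have [K hK] := cau _ e0.
    exists (w K 0 i), K => // m /= Km; rewrite -ball_normE /=; apply: le_lt_trans (hK K m (leqnn _) Km).
    by have := coord_le_en (w K - w m) i; rewrite !mxE.
  exists (lim ((fun m => w m 0 i) @ \oo)) => e e0.
  have /cvgrPdist_lt/(_ e e0)[K _ hK] := cw.
  by exists K => m Km; rewrite distrC; exact: hK.
have [L hL] := choice lim; exists (\row_i L i) => e e0.
have e0' : 0 < e / n.+1%:R by rewrite divr_gt0 // ltr0n.
have [K hK] := choice (fun i => hL i _ e0').
exists (\max_i K i)%N => m Km; apply: (le_lt_trans (en_le_norm _)).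
apply: (@le_lt_trans _ _ (n%:R * (e / n.+1%:R))).
  rewrite ler_wpM2l //; apply: norm_rV_le => [|i]; first exact: ltW.
  by rewrite !mxE ltW // hK // (leq_trans _ Km) // leq_bigmax.
by rewrite mulrCA gtr_pMr // ltr_pdivrMr ?ltr0n // mul1r ltr_nat.
Qed.

End Reparametrize.

(** * The Riemannian distance and completeness *)

Section Paths.
Context {R : realType}.
Variables (n : nat) (kappa : R) (G : geom n kappa).
Hypothesis kappa_small : n%:R ^+ 2 * kappa <= 1 / 100.
Variable r : R.
Hypothesis r0 : 0 < r.
Local Notation M := (@mfd R n kappa G kappa_small r r0).
Local Notation nu := (n%:R ^+ 2 * kappa).
Implicit Types (i j : G) (p q : M) (y z v : 'rV[R]_n) (s t : R).

Lemma nu_pt_ge0 p : 0 <= nu.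
Proof. exact: nu_ge0 (gbase p). Qed.

Lemma path_ge0 p q l : piecewise_C1_path p q l -> 0 <= l.
Proof.
elim=> // gam a b {}q {}l ab C _ l0; have [F hF e] := arc_length_primitive C.
by rewrite addr_ge0 // e // subr_ge0 (primitive_mono hF).
Qed.

Lemma path_lower p0 p q l y : piecewise_C1_path p q l -> p = pt (gbase p0) y -> en y < 3 / 5 ->
  en y + (1 + nu) / r * l < 3 / 5 ->
  exists z, [/\ en z < 3 / 5, q = pt (gbase p0) z & en (z - y) <= (1 + nu) / r * l].
Proof.
have k0 : 0 <= (1 + nu) / r by rewrite divr_ge0 ?(ltW r0) // addr_ge0 // (nu_pt_ge0 p0).
move: ((1 + nu) / r) k0 (@curve_lower R n kappa G kappa_small r r0) => k k0 cl H.
elim: H y => [{}p y -> hy _|gam a b {}q {}l ab C P IH y e hy hl].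
  by exists y; rewrite subrr en0 mulr0.
have l0 := path_ge0 P; have [F hF ea] := arc_length_primitive C; rewrite ea // in hl *.
have kl0 : 0 <= k * l by rewrite mulr_ge0.
have m : 0 <= k * (F b - F a) by rewrite mulr_ge0 // subr_ge0 (primitive_mono hF).
rewrite mulrDr in hl *.
have bb : a <= b <= b by rewrite ab lexx.
have hl' : en y + k * (F b - F a) < 3 / 5 by apply: le_lt_trans hl; rewrite addrA lerDl.
have [z [hz ez zy]] := cl gam F p0 a b y C hF hy e hl' b bb.
have tz := en_triangle (z - y) y; rewrite subrK in tz.
have [|w [hw ew wz]] := IH z ez hz.
  apply: le_lt_trans hl; rewrite addrA lerD2r (le_trans tz) // addrC.
    by rewrite lerD2r.
by exists w; split=> //; apply: (le_trans (en_triangleB _ z _)); rewrite addrC lerD.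
Qed.

Lemma path_cat p q q' l l' : piecewise_C1_path p q l -> piecewise_C1_path q q' l' ->
  piecewise_C1_path p q' (l + l').
Proof.
elim=> [{}p|gam a b {}q {}l ab C _ IH] h; first by rewrite add0r.
by rewrite -addrA; apply: path_cons => //; exact: IH.
Qed.

Lemma near_opp (P : R -> Prop) t : (\forall s \near - t, P s) -> \forall s \near t, P (- s).
Proof. by move=> h; exact: (@opp_continuous R^o t _ h). Qed.

Lemma repr_opp (gam : R -> M) i c dc t : repr gam i c dc (- t) ->
  repr (gam \o -%R) i (c \o -%R) (fun s => - dc (- s)) t.
Proof. by move=> /near_opp; apply: filterS => s [h1 h2 h3]; split=> //; exact: is_derive_neg. Qed.

Lemma C1at_opp (gam : R -> M) i c dc t : C1at gam i c dc (- t) ->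
  C1at (gam \o -%R) i (c \o -%R) (fun s => - dc (- s)) t.
Proof.
move=> [h cd]; split; first exact: repr_opp.
apply: (@continuous_comp _ _ _ (fun s => dc (- s)) -%R); last exact: opp_continuous.
by apply: (@continuous_comp _ _ _ -%R dc); first exact: opp_continuous.
Qed.

Lemma C1_opp (gam : R -> M) : C1_curve gam -> C1_curve (gam \o -%R).
Proof.
move=> C; apply: C1_of => t; have H := C1_coord C (gbaseP (gam (- t))).2.
by do 3 eexists; exact: C1at_opp H.
Qed.

Lemma spdN i y v : spd r i y (- v) = spd r i y v.
Proof. by rewrite /spd /quad linearN /= !mulNmx mulmxN opprK. Qed.

Lemma speed_opp (gam : R -> M) t : C1_curve gam -> speed (gam \o -%R) t = speed gam (- t).
Proof.
move=> C; have [H _] := C1_coord C (gbaseP (gam (- t))).2.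
by rewrite /speed (repr_velocity H) (repr_velocity (repr_opp H)) spdN.
Qed.

Lemma arc_length_opp (gam : R -> M) a b : a <= b -> C1_curve gam ->
  arc_length (gam \o -%R) (- b) (- a) = arc_length gam a b.
Proof.
move=> ab C; have [F hF ->] // := arc_length_primitive C.
have ab' : - b <= - a by rewrite lerN2.
have [F' hF' ->] // := arc_length_primitive (C1_opp C).
have H1 t : - b <= t <= - a -> is_derive t (1 : R) F' (speed (gam \o -%R) t) by move=> _; exact: hF'.
have H2 t : - b <= t <= - a -> is_derive t (1 : R) (fun t => - F (- t)) (speed (gam \o -%R) t).
  move=> _; rewrite speed_opp //.
  by have := is_deriveN (is_derive_neg (hF (- t))); rewrite opprK.
by rewrite (derive_eq ab' H1 H2) !opprK; ring.
Qed.

Lemma path_rev p q l : piecewise_C1_path p q l -> piecewise_C1_path q p l.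
Proof.
elim=> [{}p|gam a b {}q {}l ab C _ IH]; first exact: path_nil.
rewrite addrC; apply: (path_cat IH); rewrite -[arc_length _ _ _]addr0 -arc_length_opp //.
have e x : gam x = (gam \o -%R) (- x) by rewrite /= opprK.
rewrite (e b); apply: path_cons; [by rewrite lerN2|exact: C1_opp|].
by rewrite /= opprK; exact: path_nil.
Qed.

(** Intermediate value theorem for the length along the arc where the length [c] is reached. *)
Lemma path_split p q l c : piecewise_C1_path p q l -> 0 <= c <= l ->
  exists2 z, piecewise_C1_path p z c & piecewise_C1_path z q (l - c).
Proof.
move=> H; elim: H c => [{}p c|gam a b {}q {}l ab C P IH c] /andP[c0 cl].
  have -> : c = 0 by apply/eqP; rewrite eq_le c0 cl.
  by exists p; rewrite ?subrr; exact: path_nil.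
have [F hF e] := arc_length_primitive C; rewrite e // in cl *.
have [cF|Fc] := leP c (F b - F a).
  have cF' x : {for x, continuous F} by exact: is_derive_cont (hF x).
  have [||t] := @IVT R F a b (F a + c) ab.
  - by apply: continuous_subspaceT.
  - have m := primitive_mono hF ab; rewrite (min_idPl m) (max_idPr m).
    by rewrite lerDl c0 /=; lra.
  rewrite in_itv /= => /andP[at_ tb] Ft; exists (gam t).
    have -> : c = arc_length gam a t + 0 by rewrite addr0 e // Ft; ring.
    by apply: path_cons => //; exact: path_nil.
  have -> : F b - F a + l - c = arc_length gam t b + l by rewrite e // Ft; ring.
  exact: path_cons.
have [|z h1 h2] := IH (c - (F b - F a)); first by rewrite subr_ge0 (ltW Fc) /= lerBlDr addrC.
exists z; last by rewrite (_ : F b - F a + l - c = l - (c - (F b - F a))) //; ring.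
have -> : c = arc_length gam a b + (c - (F b - F a)) by rewrite e //; ring.
exact: path_cons.
Qed.

(** [C1_curve] concerns curves on the whole line. This parameter oscillates between 0 and 1, so the
    segment it describes never leaves the ball. *)
Definition segh t : R := (1 - cos t) / 2.

Lemma segh_derive t : is_derive t (1 : R) segh (sin t / 2).
Proof.
have h := is_deriveM (is_deriveB (is_derive_cst (1 : R) t 1) (is_derive_cos t)) (is_derive_cst (2^-1 : R) t 1).
by apply: (is_derive_eq h); rewrite scaler0 add0r sub0r opprK /GRing.scale /= mulrC.
Qed.

Lemma segment_path i y z : en y < 3 / 5 -> en z < 3 / 5 ->
  exists2 l, piecewise_C1_path (pt i y : M) (pt i z : M) l & l <= (1 + nu) * r * en (z - y).
Proof.
move=> hy hz; pose c t : 'rV[R]_n := y + segh t *: (z - y); pose dc t : 'rV[R]_n := (sin t / 2) *: (z - y).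
have h01 t : 0 <= segh t <= 1.
  by have := cos_le1 t; have := cos_geN1 t; rewrite /segh => h1 h2; apply/andP; split; lra.
have hc t : en (c t) < 3 / 5.
  have /andP[t0 t1] := h01 t.
  rewrite /c (_ : y + _ = (1 - segh t) *: y + segh t *: z); last by apply/rowP => a; rewrite !mxE; ring.
  apply: (le_lt_trans (en_triangle _ _)); rewrite !enZ !ger0_norm ?subr_ge0 //.
  have m1 : en y <= Num.max (en y) (en z) by rewrite le_max lexx.
  have m2 : en z <= Num.max (en y) (en z) by rewrite le_max lexx orbT.
  have : Num.max (en y) (en z) < 3 / 5 by rewrite gt_max hy hz.
  move: (Num.max _ _) m1 m2 => m m1 m2 m3.
  have := ler_wpM2l t0 m2; have t1' : 0 <= 1 - segh t by rewrite subr_ge0.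
  have := ler_wpM2l t1' m1; move: (segh t) => u; lra.
have dcP t : is_derive t (1 : R) c (dc t).
  have H := is_deriveD (is_derive_cst y t 1) (is_derive_scalel (z - y) (segh_derive t)).
  by apply: (is_derive_eq H); rewrite add0r.
have cdc : continuous dc.
  move=> t; have := is_derive_scalel (z - y) (is_deriveM (is_derive_sin t) (is_derive_cst (2^-1 : R) t 1)).
  by move=> /is_derive_continuous.
have hr t : repr (fun t => pt i (c t) : M) i c dc t by apply: filterE => s; split.
have C : C1_curve (fun t => pt i (c t) : M).
  apply: C1_of => t; exists i, c, dc.
  exact: (conj (hr t) (cdc t)).
have [F hF e] := arc_length_primitive C.
have pi0 : 0 <= pi :> R by exact: pi_ge0.
exists (arc_length (fun t => pt i (c t) : M) 0 pi + 0).
  have -> : pt i z = pt i (c pi) by rewrite /c /segh cospi (_ : (1 - -1) / 2 = 1 :> R) ?scale1r 1?addrC ?subrK //; lra.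
  have {1}-> : pt i y = pt i (c 0) by rewrite /c /segh cos0 subrr mul0r scale0r addr0.
  by apply: path_cons => //; exact: path_nil.
rewrite addr0 e //.
pose K := (1 + nu) * r * en (z - y).
have -> : (1 + nu) * r * en (z - y) = K * segh pi - K * segh 0.
  by rewrite /segh cospi cos0 -/K; lra.
have H1 t : 0 <= t <= pi -> is_derive t (1 : R) F (speed (fun t => pt i (c t) : M) t) by move=> _; exact: hF.
have H2 t : 0 <= t <= pi -> is_derive t (1 : R) (fun t => K * segh t) (K * (sin t / 2)).
  move=> _; have H := is_deriveM (is_derive_cst K t 1) (segh_derive t).
  by apply: (is_derive_eq H); rewrite scaler0 addr0.
apply: (derive_le pi0 H1 H2).
move=> t tpi; rewrite /speed (repr_velocity (hr t)); apply: (le_trans (spd_le kappa_small r0 _ _ _)).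
rewrite /dc enZ ger0_norm; last by rewrite divr_ge0 // sin_ge0_pi.
by rewrite /K mulrCA mulrC -!mulrA.
Qed.

Lemma path_exists p q : exists l, piecewise_C1_path p q l.
Proof.
have H : forall i y, en y < 3 / 5 -> exists l, piecewise_C1_path p (pt i y : M) l.
  apply: g_conn => [|i j y ij hy hj IH z hz].
    have [i [y [hy e]]] := pt_surj p; exists i => z hz; have hy' : en y < 3 / 5 by lra.
    by have [l hl _] := segment_path i hy' hz; exists l; rewrite -e in hl.
  have [l hl] := IH y hy; have [l' hl' _] := segment_path j hj hz.
  by exists (l + l'); apply: path_cat hl _; rewrite -(pt_trE hy ij hj).
have [i [y [hy e]]] := pt_surj q; have hy' : en y < 3 / 5 by lra.
by rewrite e; exact: H.
Qed.

Local Notation rd := (@riem_dist R n M).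

Lemma rd_has_inf p q : has_inf [set l | piecewise_C1_path p q l].
Proof. by split; [exact: path_exists|exists 0 => l /path_ge0]. Qed.

Lemma rd_le p q l : piecewise_C1_path p q l -> rd p q <= l.
Proof. by move=> h; apply: inf_lbound => //; have [] := rd_has_inf p q. Qed.

Lemma rd_lt p q a : rd p q < a -> exists2 l, piecewise_C1_path p q l & l < a.
Proof.
move=> h; have e0 : 0 < a - rd p q by rewrite subr_gt0.
have [l hl] := inf_adherent e0 (rd_has_inf p q); rewrite -/(rd p q) => hl'.
by exists l => //; lra.
Qed.

Lemma rd_ge0 p q : 0 <= rd p q.
Proof. by apply: lb_le_inf; [exact: path_exists|move=> l /path_ge0]. Qed.

Lemma rd_refl p : rd p p = 0.
Proof. by apply/eqP; rewrite eq_le rd_ge0 andbT; apply: rd_le; exact: path_nil. Qed.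

Lemma rd_sym p q : rd p q = rd q p.
Proof. by rewrite /riem_dist; congr inf; apply/seteqP; split=> l; exact: path_rev. Qed.

Lemma rd_triangle q p p' : rd p p' <= rd p q + rd q p'.
Proof.
apply/ler_addgt0Pr => e e0.
have [l hl hl'] : exists2 l, piecewise_C1_path p q l & l < rd p q + e / 2 by apply: rd_lt; lra.
have [m hm hm'] : exists2 l, piecewise_C1_path q p' l & l < rd q p' + e / 2 by apply: rd_lt; lra.
by apply: (le_trans (rd_le (path_cat hl hm))); lra.
Qed.

Lemma rd_upper i y z : en y < 3 / 5 -> en z < 3 / 5 -> rd (pt i y) (pt i z) <= (1 + nu) * r * en (z - y).
Proof. by move=> hy hz; have [l hl] := segment_path i hy hz; apply: le_trans; exact: rd_le. Qed.

(** Almost shortest paths stay in the chart by [path_lower]. The end point has only one coordinate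
    vector there, so its estimate passes to the infimum of the lengths. *)
Lemma rd_lower p0 y q (d : R) : en y < 3 / 5 -> rd (pt (gbase p0) y) q < d ->
  en y + (1 + nu) / r * d < 3 / 5 ->
  exists z, [/\ en z < 3 / 5, q = pt (gbase p0) z & en (z - y) <= (1 + nu) / r * rd (pt (gbase p0) y) q].
Proof.
move=> hy hd hd'; set D := rd _ _ in hd *.
have n0 := nu_pt_ge0 p0; have k0 : 0 < (1 + nu) / r by rewrite divr_gt0 // ltr_pwDl.
have H (e : R) : D < e -> e <= d -> exists z, [/\ en z < 3 / 5, q = pt (gbase p0) z & en (z - y) <= (1 + nu) / r * e].
  move=> De ed; have [l hl le] := rd_lt De.
  have [//|z [h1 h2 h3]] := path_lower hl erefl hy.
    by apply: le_lt_trans hd'; rewrite lerD2l ler_pM2l // (le_trans (ltW le)).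
  by exists z; split=> //; apply: (le_trans h3); rewrite ler_pM2l // ltW.
have [z [h1 h2 _]] := H d hd (lexx _).
exists z; split=> //; rewrite mulrC -ler_pdivrMr //; apply/ler_addgt0Pr => e e0.
have [||w [w1 w2 w3]] := H (Num.min d (D + e)); [by rewrite lt_min hd ltrDl|by rewrite ge_min lexx|].
rewrite (pt_inj h1 w1 (etrans (esym h2) w2)) ler_pdivrMr // mulrC (le_trans w3) // ler_pM2l //.
by rewrite ge_min lexx orbT.
Qed.

Lemma rd_eq0 p q : rd p q = 0 -> p = q.
Proof.
move=> e; have n0 := nu_pt_ge0 p; have k0 : 0 < (1 + nu) / r by rewrite divr_gt0 // ltr_pwDl.
have [hp ep] := pt_ch (gbaseP p).2; have h20 := (gbaseP p).1.
have d0 : 0 < 1 / 2 / ((1 + nu) / r) by rewrite divr_gt0.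
have [||z [hz eq]] := @rd_lower p (ch (gbase p) p) q (1 / 2 / ((1 + nu) / r)) hp.
- by rewrite ep e.
- rewrite [X in _ + X]mulrC divfK ?gt_eqF //; lra.
rewrite ep e mulr0 => h; have : en (z - ch (gbase p) p) = 0 by apply/eqP; rewrite eq_le h en_ge0.
by move/en_eq0/eqP; rewrite subr_eq0 => /eqP ez; rewrite eq ez ep.
Qed.

(** Cutting an almost shortest path; for the manifold this replaces the straight chains of the
    metric space. *)
Lemma rd_split p q (c e : R) : 0 < e -> 0 <= c <= rd p q ->
  exists z : M, [/\ rd p z <= c & rd z q <= rd p q + e - c].
Proof.
move=> e0 /andP[c0 cd]; have [l hl hl'] : exists2 l, piecewise_C1_path p q l & l < rd p q + e by apply: rd_lt; lra.
have dl := rd_le hl; have [|z h1 h2] := path_split (c := c) hl; first by rewrite c0 (le_trans cd).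
by exists z; split; [exact: rd_le|apply: (le_trans (rd_le h2)); lra].
Qed.

(** Chart balls have a uniform size and their distance is comparable to the Euclidean one. A tail of
    the sequence stays within coordinate distance 1/10 of one of its points, hence within 3/20 of
    the centre of a single chart, where its coordinates converge. *)
Lemma complete_mfd : complete_manifold M.
Proof.
move=> s hs; have n0 := nu_pt_ge0 (s 0%N); set k := (1 + nu) / r.
have k0 : 0 < k by rewrite /k divr_gt0 // ltr_pwDl.
have d0 : 0 < 1 / 10 / k by rewrite divr_gt0.
have [N hN] := hs _ d0; set p := s N; set i := gbase p.
have [hp ep] := pt_ch (gbaseP p).2; have h20 := (gbaseP p).1.
have kd : k * (1 / 10 / k) = 1 / 10 by rewrite mulrC divfK ?gt_eqF.
pose w m := ch i (s m).
have W m : (N <= m)%N -> en (w m) < 3 / 20 /\ s m = pt i (w m).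
  move=> Nm; have hd := hN N m (leqnn _) Nm.
  have [||z [hz eq h]] := @rd_lower p (ch i p) (s m) (1 / 10 / k) hp; first by rewrite -/i ep.
    by rewrite -/k kd; move: h20; rewrite -/i; lra.
  rewrite /w eq ch_pt //; split=> //.
  have := en_triangle (z - ch i p) (ch i p); rewrite subrK => t1.
  have : k * rd p (s m) <= 1 / 10 by rewrite -kd ler_pM2l // ltW.
  by move: h h20; rewrite -/k -/i ep; lra.
have cau (e : R) : 0 < e -> exists K, forall a b, (K <= a)%N -> (K <= b)%N -> en (w a - w b) < e.
  move=> e0; pose e' := Num.min (e / 2) (1 / 10).
  have e'0 : 0 < e' / k by rewrite divr_gt0 // lt_min; apply/andP; split; lra.
  have [K hK] := hs _ e'0; exists (maxn K N) => a b; rewrite !geq_max => /andP[aK aN] /andP[bK bN].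
  have [wa ea] := W a aN; have [wb eb] := W b bN.
  have wa' : en (w a) < 3 / 5 by lra.
  have wb' : en (w b) < 3 / 5 by lra.
  have ke : k * (e' / k) = e' by rewrite mulrC divfK ?gt_eqF.
  have e'e : e' <= e / 2 by rewrite ge_min lexx.
  have e'1 : e' <= 1 / 10 by rewrite ge_min lexx orbT.
  have hd := hK a b aK bK; rewrite ea in hd.
  have [|z [hz eq h]] := @rd_lower p (w a) (s b) (e' / k) wa' hd; first by rewrite -/k ke; lra.
  rewrite enB -(pt_inj hz wb' (etrans (esym eq) eb)) (le_lt_trans h) //.
  have : k * rd (pt i (w a)) (s b) <= e' by rewrite -ke ler_pM2l // ltW.
  by rewrite -/k -/i; lra.
have [L hL] := rV_cauchy cau.
have hL5 : en L < 3 / 5.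
  have [|K hK] := hL (1 / 10); first by lra.
  have h1 := hK _ (leq_maxl K N); have [h2 _] := W _ (leq_maxr K N).
  by have := en_triangleB L (w (maxn K N)) 0; rewrite !subr0 enB => h3; lra.
exists (pt i L); apply/cvgrPdist_lt => e e0.
have k1 : 0 < (1 + nu) * r by rewrite mulr_gt0 // ltr_pwDl.
have [K hK] : exists K, forall m, (K <= m)%N -> en (w m - L) < e / ((1 + nu) * r).
  by apply: hL; rewrite divr_gt0.
exists (maxn K N) => // m /=; rewrite geq_max => /andP[mK mN].
have [wm ->] := W m mN; have wm' : en (w m) < 3 / 5 by lra.
rewrite sub0r normrN ger0_norm ?rd_ge0 //; apply: (le_lt_trans (rd_upper i wm' hL5)).
by have := hK m mK; rewrite enB ltr_pdivlMr // mulrC.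
Qed.

End Paths.

(** * Existence and uniqueness for differential equations *)

Section Flows.
Context {R : realType}.
Implicit Types (t s : R).

(** Integration from 0 divides by [c] the norm weighted by the exponential. With [c = 2 * L] an
    integral operator with Lipschitz constant [L] becomes a contraction of ratio 1/2. *)
Lemma weighted_primitive_half (w dw : R -> R) (K c : R) : 0 < c -> w 0 = 0 ->
  (forall t, is_derive t (1 : R) w (dw t)) -> (forall t, `|dw t| <= K * expR (c * `|t|)) ->
  forall t, 0 <= t -> `|w t| <= K / c * expR (c * `|t|).
Proof.
move=> c0 w0 hw hK t t0.
have K0 : 0 <= K by have := hK 0; rewrite normr0 mulr0 expR0 mulr1; exact: le_trans.
have g s : is_derive s (1 : R) (fun s => K / c * expR (c * s)) (K * expR (c * s)).
  have h1 : is_derive s (1 : R) (fun s => c * s) c.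
    by have := is_deriveM (is_derive_cst c s 1) (is_derive_id s (1 : R)) => h; apply: (is_derive_eq h); rewrite scaler0 addr0 /GRing.scale /= mulr1.
  have h2 := is_derive_reparam h1 (is_derive_expR (c * s)).
  have h3 := is_deriveM (is_derive_cst (K / c) s 1) h2.
  apply: (is_derive_eq h3); rewrite scaler0 addr0 /GRing.scale /=; field; exact: lt0r_neq0.
have dom s : 0 <= s <= t -> `|dw s| <= K * expR (c * s).
  by move=> /andP[s0 _]; have := hK s; rewrite (ger0_norm s0).
have dw1 s : 0 <= s <= t -> is_derive s (1 : R) w (dw s) by move=> _.
have dw2 s : 0 <= s <= t -> is_derive s (1 : R) (fun s => - w s) (- dw s) by move=> _; exact: is_deriveN.
have g' s : 0 <= s <= t -> is_derive s (1 : R) (fun s => K / c * expR (c * s)) (K * expR (c * s)) by move=> _.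
have h1 := derive_le t0 dw1 g' (fun s hs => le_trans (ler_norm _) (dom s hs)).
have h2 := derive_le t0 dw2 g' (fun s hs => le_trans (ler_norm _) (le_trans (_ : _ <= `|dw s|) (dom s hs))).
have {}h2 : - w t - - w 0 <= K / c * expR (c * t) - K / c * expR (c * 0) by apply: h2 => s; rewrite normrN.
rewrite w0 mulr0 expR0 mulr1 in h1 h2; rewrite (ger0_norm t0) ler_norml.
have kc : 0 <= K / c by rewrite divr_ge0 // ltW.
clear -h1 h2 kc; set y := K / c in h1 h2 kc *; set x := y * _ in h1 h2 *.
apply/andP; split; lra.
Qed.

Lemma weighted_primitive (w dw : R -> R) (K c : R) : 0 < c -> w 0 = 0 ->
  (forall t, is_derive t (1 : R) w (dw t)) -> (forall t, `|dw t| <= K * expR (c * `|t|)) ->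
  forall t, `|w t| <= K / c * expR (c * `|t|).
Proof.
move=> c0 w0 hw hK t; have [t0|t0] := leP 0 t; first exact: weighted_primitive_half hw hK _ t0.
have t0' : 0 <= - t by lra.
have := @weighted_primitive_half (fun s => w (- s)) (fun s => - dw (- s)) K c c0 _ _ _ (- t) t0'.
rewrite opprK normrN oppr0; apply=> // s; first exact: is_derive_neg.
by rewrite normrN; have := hK (- s); rewrite normrN.
Qed.

Section Existence.
Variables (m : nat) (F : 'rV[R]_m -> 'rV[R]_m) (L : R).
Hypotheses (L0 : 0 < L) (lipF : forall x y, `|F x - F y| <= L * `|x - y|).

Lemma lip_continuous : continuous F.
Proof.
move=> x A /nbhs_ballP[e /= e0 he]; apply/nbhs_ballP; exists (e / L) => /=; first by rewrite divr_gt0.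
move=> y; rewrite -ball_normE /= => hy; apply: he; rewrite -ball_normE /=.
by apply: (le_lt_trans (lipF _ _)); rewrite mulrC -ltr_pdivlMr.
Qed.

Lemma vector_primitive (x : 'rV[R]_m) (f : R -> 'rV[R]_m) : continuous f ->
  exists U, U 0 = x /\ forall t, is_derive t (1 : R) U (f t).
Proof.
move=> cf; have h a : exists U : R -> R, forall t, is_derive t (1 : R) U (f t 0 a).
  apply: primitive => t; apply: (@continuous_comp _ _ _ f (fun y => y 0 a)); first exact: cf.
  exact: coord_continuous.
have [U hU] := choice h; exists (fun t => x + \row_a (U a t - U a 0)).
split=> [|t]; first by apply/rowP => a; rewrite !mxE subrr addr0.
apply: is_derive_coords => a.
rewrite (_ : (fun s => _) = (fun s => x 0 a + (U a s - U a 0))); last by apply/funext => s; rewrite !mxE.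
have H := is_deriveD (is_derive_cst (x 0 a) t 1) (is_deriveB (hU a t) (is_derive_cst (U a 0) t 1)).
by apply: (is_derive_eq H); rewrite add0r subr0.
Qed.

(* Picard iteration; successive iterates are compared with the weight
   [exp (2 L |t|)], which makes the integral operator a contraction on the whole line. *)
Lemma flow_exists (x : 'rV[R]_m) : exists u : R -> 'rV[R]_m,
  u 0 = x /\ forall t, is_derive t (1 : R) u (F (u t)).
Proof.
have L20 : 0 < 2 * L by rewrite mulr_gt0.
have [I hI] : {I : (R -> 'rV[R]_m) -> R -> 'rV[R]_m & forall c, continuous c ->
    I c 0 = x /\ forall t, is_derive t (1 : R) (I c) (F (c t))}.
  apply: (choice (P := fun c Ic => continuous c -> Ic 0 = x /\ forall t, is_derive t (1 : R) Ic (F (c t)))) => c.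
  have [cc|nc] := pselect (continuous c); last by exists (cst 0).
  have [|U hU] := @vector_primitive x (F \o c); last by exists U.
  by move=> t; apply: continuous_comp; [exact: cc|exact: lip_continuous].
pose u k := iter k I (cst x).
have uc k : continuous (u k).
  elim: k => [|k IH] t; first exact: cst_continuous.
  exact: is_derive_continuous ((hI _ IH).2 t).
have u0 k : u k 0 = x by case: k => [|k] //; exact: (hI _ (uc k)).1.
pose W t := expR (2 * L * `|t|).
have W0 t : 0 <= W t by exact: expR_ge0.
pose K := `|F x|.
have K0 : 0 <= K / (2 * L) by exact: divr_ge0 (normr_ge0 _) (ltW L20).
have q0 k : 0 <= 2 ^- k :> R by rewrite invr_ge0 exprn_ge0.
have step k t : `|u k.+1 t - u k t| <= K / (2 * L) * 2 ^- k * W t.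
  elim: k t => [|k IH] t.
    apply: norm_rV_le => [|a]; first exact: mulr_ge0 (mulr_ge0 K0 (q0 _)) (W0 t).
    rewrite expr0 invr1 mulr1 !mxE.
    apply: (@weighted_primitive (fun t => u 1%N t 0 a - x 0 a) (fun t => F x 0 a) K (2 * L)) => //.
    - by rewrite u0 subrr.
    - move=> s; rewrite -[F x 0 a]subr0; apply: is_deriveB.
      exact: (is_derive_coord a ((hI _ (uc 0%N)).2 s)).
    - move=> s; apply: (le_trans (coord_le_norm _ _)); rewrite ler_peMr //.
      by rewrite -[leLHS]expR0 ler_expR mulr_ge0 // ltW.
  apply: norm_rV_le => [|a]; first exact: mulr_ge0 (mulr_ge0 K0 (q0 _)) (W0 t).
  rewrite !mxE.
  have -> : K / (2 * L) * 2 ^- k.+1 = K / (2 * L) * 2 ^- k * L / (2 * L).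
    rewrite exprS invfM; field; by rewrite ?gt_eqF ?exprn_gt0.
  apply: (@weighted_primitive (fun t => u k.+2 t 0 a - u k.+1 t 0 a) (fun t => F (u k.+1 t) 0 a - F (u k t) 0 a) _ (2 * L)) => //.
  - by rewrite !u0 subrr.
  - by move=> s; apply: is_deriveB; [exact: (is_derive_coord a ((hI _ (uc k.+1)).2 s))|exact: (is_derive_coord a ((hI _ (uc k)).2 s))].
  - move=> s; have := coord_le_norm (F (u k.+1 s) - F (u k s)) a; rewrite !mxE => h.
    apply: (le_trans h); apply: (le_trans (lipF _ _)).
    by rewrite [leRHS]mulrAC mulrC; apply: ler_wpM2r; [exact: ltW|exact: IH].
have lim ta : exists l, forall k, `|u k ta.1 0 ta.2 - l| <= 2 * (K / (2 * L) * W ta.1) * 2 ^- k.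
  apply: geometric_limit => k; have := step k ta.1.
  rewrite -[X in _ <= X -> _]mulrAC; apply: le_trans.
  by have := coord_le_norm (u k.+1 ta.1 - u k ta.1) ta.2; rewrite !mxE.
have [l hl] := choice lim; pose v t : 'rV[R]_m := \row_a l (t, a).
pose C := K / L.
have C0 : 0 <= C by exact: divr_ge0 (normr_ge0 _) (ltW L0).
have hv k t : `|u k t - v t| <= C * 2 ^- k * W t.
  apply: norm_rV_le => [|a]; first exact: mulr_ge0 (mulr_ge0 C0 (q0 _)) (W0 t).
  have := hl (t, a) k; rewrite !mxE /= => /le_trans; apply.
  have -> : 2 * (K / (2 * L) * W t) * 2 ^- k = C * 2 ^- k * W t; last exact: lexx.
  rewrite /C; field; by rewrite ?gt_eqF ?exprn_gt0.
have v0 : v 0 = x.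
  apply/rowP => a; apply/eqP; rewrite -subr_eq0 -normr_le0; apply: (geometric_le0 (C := C * W 0)) => k.
  have := hv k 0; rewrite u0 => /(le_trans (coord_le_norm _ a)); rewrite !mxE distrC => /le_trans; apply.
  by rewrite mulrAC.
have cv : continuous v.
  move=> t; apply/cvgrPdist_lt => e e0.
  pose T := `|t| + 1; pose B := C * expR (2 * L * T).
  have B0 : 0 <= B by rewrite mulr_ge0 // expR_ge0.
  have [k hk] : exists k, B * 2 ^- k < e / 3.
    apply: contrapT => h; have : e / 3 <= 0; last by lra.
    apply: (geometric_le0 (C := B)) => k; rewrite leNgt; apply/negP => hk; apply: h; by exists k.
  have hB s : `|s| <= T -> `|u k s - v s| < e / 3.
    move=> sT; apply: le_lt_trans hk; apply: (le_trans (hv k s)); rewrite mulrAC ler_wpM2r ?invr_ge0 ?exprn_ge0 //.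
    by rewrite ler_wpM2l // ler_expR ler_pM2l.
  have e30 : 0 < e / 3 by lra.
  have N1 : \forall s \near t, `|u k t - u k s| < e / 3 by move: (uc k t) => /cvgrPdist_lt/(_ _ e30).
  have N2 : \forall s \near t, `|t - s| < 1.
    exact: (@cvgr_dist_lt _ _ _ (nbhs t) _ id t cvg_id 1 ltr01).
  apply: filterS2 N1 N2 => s h1 h2.
  have h3 : `|s| <= T.
    by rewrite /T; have := ler_normD t (s - t); rewrite addrC subrK (distrC s); lra.
  have h4 : `|t| <= T by rewrite /T lerDl.
  have := hB s h3; have := hB t h4; rewrite (distrC (u k t) (v t)) => a1 a2.
  have := ler_distD (u k t) (v t) (v s); have := ler_distD (u k s) (u k t) (v s); lra.
have [U0 hU] := hI v cv; exists v; split=> // t.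
suff e : v = I v by rewrite {1}e; exact: hU.
apply/funext => {}t; apply/rowP => a; apply/eqP; rewrite -subr_eq0 -normr_le0.
apply: (geometric_le0 (C := 2 * C * W t)) => k.
have h1 : `|u k.+1 t 0 a - I v t 0 a| <= C * 2 ^- k * L / (2 * L) * W t.
  apply: (@weighted_primitive (fun t => u k.+1 t 0 a - I v t 0 a) (fun t => F (u k t) 0 a - F (v t) 0 a) _ (2 * L)) => //.
  - by rewrite u0 U0 subrr.
  - by move=> s; apply: is_deriveB; [exact: (is_derive_coord a ((hI _ (uc k)).2 s))|exact: is_derive_coord].
  - move=> s; have := coord_le_norm (F (u k s) - F (v s)) a; rewrite !mxE => h.
    apply: (le_trans h); apply: (le_trans (lipF _ _)).
    by rewrite [leRHS]mulrAC mulrC; apply: ler_wpM2r; [exact: ltW|exact: hv].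
have := hv k.+1 t => /(le_trans (coord_le_norm _ a)); rewrite !mxE distrC => h2.
have ev : v t 0 a = l (t, a) by rewrite mxE.
have := ler_distD (u k.+1 t 0 a) (v t 0 a) (I v t 0 a); rewrite ev.
have e : C * 2 ^- k * L / (2 * L) * W t = C * 2 ^- k * W t / 2 by field; rewrite ?gt_eqF ?exprn_gt0.
rewrite e in h1; move: h1 h2; rewrite exprS invfM.
have := mulr_ge0 (mulr_ge0 C0 (q0 k)) (W0 t).
rewrite (_ : 2 * C * W t * 2 ^- k = 2 * (C * 2 ^- k * W t)); last by ring.
rewrite (_ : C * (2^-1 * 2 ^- k) * W t = C * 2 ^- k * W t / 2); last by ring.
move: (C * _ * W t) => q; lra.
Qed.

End Existence.

(** The square of the norm is differentiable also where [z] vanishes, and satisfies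
    [f' <= (2 * L + 1) * f + K ^+ 2] because [2 * x * K <= x ^+ 2 + K ^+ 2]. *)
Lemma gronwall m (z dz : R -> 'rV[R]_m) (L K a b : R) : 0 <= L -> 0 <= K -> a <= b ->
  (forall t, a <= t <= b -> is_derive t (1 : R) z (dz t)) ->
  (forall t, a <= t <= b -> en (dz t) <= L * en (z t) + K) ->
  en (z b) ^+ 2 <= (en (z a) ^+ 2 + K ^+ 2 * (b - a)) * expR ((2 * L + 1) * (b - a)).
Proof.
move=> L0 K0 ab hz h; set c := 2 * L + 1; have c0 : 0 <= c by rewrite addr_ge0 // mulr_ge0.
pose f t := \sum_(j < m) z t 0 j * z t 0 j.
pose df t := \sum_(j < m) (2 * (z t 0 j * dz t 0 j)).
have fE t : f t = en (z t) ^+ 2 by rewrite enK.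
have hf t : a <= t <= b -> is_derive t (1 : R) f (df t).
  move=> tab; rewrite (_ : f = \sum_(j < m) (fun s => z s 0 j * z s 0 j)); last first.
    by apply/funext => s; rewrite fct_sumE.
  apply: is_derive_sum => j; have hj := is_derive_coord j (hz t tab).
  have D := is_deriveM hj hj; apply: (is_derive_eq D).
  by rewrite /GRing.scale /=; ring.
have hE t : is_derive t (1 : R) (fun t => expR (- c * (t - a))) (- c * expR (- c * (t - a))).
  have h0 := is_deriveM (is_derive_cst (- c) t 1) (is_deriveB (is_derive_id t (1 : R)) (is_derive_cst a t 1)).
  have h1 : is_derive t (1 : R) (fun t => - c * (t - a)) (- c).
    by apply: (is_derive_eq h0); rewrite scaler0 addr0 subr0 /GRing.scale /= mulr1.
  exact: (is_derive_reparam h1 (is_derive_expR (- c * (t - a)))).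
have hg t : a <= t <= b -> is_derive t (1 : R) (fun t => f t * expR (- c * (t - a)))
    ((df t - c * f t) * expR (- c * (t - a))).
  by move=> tab; have H := is_deriveM (hf t tab) (hE t); apply: (is_derive_eq H); rewrite /GRing.scale /=; ring.
have hl t : a <= t <= b -> is_derive t (1 : R) (fun t => K ^+ 2 * t) (K ^+ 2).
  by move=> _; have H := is_deriveM (is_derive_cst (K ^+ 2) t 1) (is_derive_id t (1 : R)); apply: (is_derive_eq H); rewrite scaler0 addr0 /GRing.scale /= mulr1.
have E0 t : 0 < expR (- c * (t - a)) by exact: expR_gt0.
have le t : a <= t <= b -> (df t - c * f t) * expR (- c * (t - a)) <= K ^+ 2.
  move=> tab; have d1 : df t - c * f t <= K ^+ 2.
    have -> : df t = 2 * dot (z t) (dz t) by rewrite /df -mulr_sumr.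
    rewrite fE /c; have := dot_le (z t) (dz t); have := h t tab; have := en_ge0 (z t); have := en_ge0 (dz t).
    move: (en (z t)) (en (dz t)) (dot _ _) => x y w y0 x0 h1 h2.
    have := ler_wpM2l x0 h1; have : 0 <= (x - K) ^+ 2 by rewrite sqr_ge0.
    rewrite !expr2; lra.
  have e1 : expR (- c * (t - a)) <= 1.
    rewrite -expR0 ler_expR mulNr oppr_le0 mulr_ge0 // subr_ge0; by case/andP: tab.
  have [d0|d0] := leP (df t - c * f t) 0.
    apply: (@le_trans _ _ 0); last by rewrite sqr_ge0.
    by rewrite mulr_le0_ge0 // ltW.
  apply: le_trans d1; rewrite -[leRHS]mulr1 ler_pM2l //.
have := derive_le ab hg hl le; rewrite subrr mulr0 expR0 mulr1 -mulrBr !fE => H.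
rewrite -ler_pdivrMr ?expR_gt0 // -expRN -mulNr; lra.
Qed.

Lemma en_sqr_le m (u : 'rV[R]_m) (c : R) : 0 <= c -> en u ^+ 2 <= c ^+ 2 -> en u <= c.
Proof. by move=> c0; rewrite ler_pXn2r // nnegrE ?en_ge0. Qed.

Lemma flow_unique m (F : 'rV[R]_m -> 'rV[R]_m) (L : R) (u v : R -> 'rV[R]_m) a b : 0 <= L -> a <= b ->
  (forall t, a <= t <= b -> en (F (u t) - F (v t)) <= L * en (u t - v t)) ->
  (forall t, a <= t <= b -> is_derive t (1 : R) u (F (u t))) ->
  (forall t, a <= t <= b -> is_derive t (1 : R) v (F (v t))) ->
  u a = v a -> u b = v b.
Proof.
move=> L0 ab lip hu hv e.
have := @gronwall m (fun t => u t - v t) (fun t => F (u t) - F (v t)) L 0 a b L0 (lexx _) ab.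
rewrite e subrr en0 expr0n /= !mul0r addr0 mul0r => H.
have {}H : en (u b - v b) ^+ 2 <= 0.
  by apply: H => t tab; [apply: is_deriveB; [exact: hu|exact: hv]|rewrite addr0; exact: lip].
apply/eqP; rewrite -subr_eq0; apply/eqP/en_eq0/eqP.
by rewrite -sqrf_eq0 eq_le H sqr_ge0.
Qed.

Lemma is_derive_bigsum (V : normedModType R) n (f : 'I_n -> R -> V) (d : 'I_n -> V) t :
  (forall i, is_derive t (1 : R) (f i) (d i)) -> is_derive t (1 : R) (fun s => \sum_i f i s) (\sum_i d i).
Proof.
move=> h; rewrite (_ : (fun s => _) = \sum_i f i); first exact: is_derive_sum.
by apply/funext => s; rewrite fct_sumE.
Qed.

End Flows.

(** * Smooth dependence of flows on the initial point *)

Section SmoothFlows.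
Context {R : realType}.
Implicit Types (t s : R).
Local Notation T1 := (fun _ : unit => True).

Lemma LB_bounds m (F : 'rV[R]_m -> 'rV[R]_m) : LB T1 (fun _ => F) ->
  exists2 K, 0 < K & forall i j, bd 1 K (pd i (fun y => F y 0 j)).
Proof.
move=> h; have H (ij : 'I_m * 'I_m) : exists K, bd 1 K (pd ij.1 (fun y => F y 0 ij.2)).
  by have [_ /(_ ij.1) [K hK]] := h 2%N ij.2; exists K; exact: hK tt I.
have [K hK] := choice H; exists (1 + \sum_ij `|K ij|); first by rewrite ltr_pwDl // sumr_ge0.
move=> i j; apply: bd_le (hK (i, j)).
by apply: (le_trans (ler_norm _)); rewrite (bigD1 (i, j)) //= addrCA lerDl addr_ge0 // sumr_ge0.
Qed.

Section Bounds.
Variables (m : nat) (F : 'rV[R]_m -> 'rV[R]_m) (K : R).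
Hypotheses (LF : LB T1 (fun _ => F)) (K0 : 0 < K) (hK : forall i j, bd 1 K (pd i (fun y => F y 0 j))).

Let dF j x : differentiable (fun y => F y 0 j) x.
Proof. exact: (LF 1%N j).1 tt I x. Qed.

Definition lipc : R := m%:R * (m%:R * K).

Lemma lipc_ge0 : 0 <= lipc.
Proof. by rewrite !mulr_ge0 // ltW. Qed.

Lemma LB_lip x y : `|F x - F y| <= m%:R * K * `|x - y|.
Proof.
apply: norm_rV_le => [|j]; first by rewrite !mulr_ge0 // ltW.
have := @lipschitz_pd R m (fun y => F y 0 j) K x y (dF j) (fun i z => bd_bound (hK i j) z).
by rewrite !mxE.
Qed.

Lemma en_norm_le (u v : 'rV[R]_m) c : 0 <= c -> `|u| <= c * `|v| -> en u <= m%:R * c * en v.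
Proof.
move=> c0 h; apply: (le_trans (en_le_norm u)); rewrite -mulrA ler_wpM2l // (le_trans h) //.
by rewrite ler_wpM2l // norm_le_en.
Qed.

Lemma LB_en_lip x y : en (F x - F y) <= lipc * en (x - y).
Proof. by apply: en_norm_le; [rewrite mulr_ge0 // ltW|exact: LB_lip]. Qed.

Lemma jac_en_le (xi x : 'rV[R]_m) : en (xi *m jac F x) <= lipc * en xi.
Proof.
apply: en_norm_le; first by rewrite mulr_ge0 // ltW.
apply: norm_mulmx_le => [|i j]; first exact: ltW.
by rewrite mxE; exact: bd_bound (hK i j) x.
Qed.

Lemma taylor_en_le x w : en (F (x + w) - F x - w *m jac F x) <= m%:R * lipc * en w ^+ 2.
Proof.
have h : `|F (x + w) - F x - w *m jac F x| <= m%:R * (m%:R * K) * `|w| * `|w|.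
  apply: norm_rV_le => [|j]; first by rewrite !mulr_ge0 // ltW.
  have [t /andP[t0 t1] e] := @mean_value_line R m (fun y => F y 0 j) x w (fun t _ => dF j _).
  rewrite !mxE e -sumrB; apply: (le_trans (ler_norm_sum _ _ _)).
  apply: (@le_trans _ _ (\sum_(i < m) m%:R * K * `|w| * `|w|)); last first.
    by rewrite sumr_const card_ord -[leLHS]mulr_natl !mulrA.
  apply: ler_sum => i _; rewrite mxE -mulrBr normrM mulrC ler_pM // ?coord_le_norm //.
  have [_ [dd db]] := hK i j.
  have H := @lipschitz_pd R m (pd i (fun y => F y 0 j)) K (x + t *: w) x dd (fun l z => (db l).1 z).
  apply: (le_trans H).
  rewrite ler_wpM2l ?mulr_ge0 ?(ltW K0) // addrC addKr normrZ ger0_norm ?(ltW t0) //.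
  by rewrite ler_piMl // ltW.
apply: (le_trans (en_le_norm _)); rewrite -mulrA ler_wpM2l //; apply: (le_trans h).
by rewrite -mulrA ler_wpM2l ?lipc_ge0 // expr2 ler_pM ?norm_le_en.
Qed.

Variable Phi : 'rV[R]_m -> R -> 'rV[R]_m.
Hypothesis flowP : forall x, Phi x 0 = x /\ forall t, is_derive t (1 : R) (Phi x) (F (Phi x t)).

Definition growth : R := expR (2 * lipc + 1).

Lemma growth_ge1 : 1 <= growth.
Proof. by rewrite -expR0 ler_expR addr_ge0 // mulr_ge0 // lipc_ge0. Qed.

Lemma growth_le t : t <= 1 -> expR ((2 * lipc + 1) * t) <= growth.
Proof.
move=> t1; rewrite ler_expR -[leRHS]mulr1 ler_wpM2l // addr_ge0 // mulr_ge0 //.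
exact: lipc_ge0.
Qed.

Lemma flow_spread x y t : 0 <= t <= 1 -> en (Phi y t - Phi x t) ^+ 2 <= en (y - x) ^+ 2 * growth.
Proof.
move=> /andP[t0 t1].
have := @gronwall R m (fun t => Phi y t - Phi x t) (fun t => F (Phi y t) - F (Phi x t)) lipc 0 0 t lipc_ge0 (lexx _) t0.
rewrite !(flowP _).1 expr0n /= mul0r addr0 subr0 => h; apply: le_trans (h _ _) _.
- by move=> s _; apply: is_deriveB; exact: (flowP _).2.
- by move=> s _; rewrite addr0; exact: LB_en_lip.
- by rewrite ler_wpM2l ?sqr_ge0 // growth_le.
Qed.

(** Subtract from the difference of two trajectories the solution of the linearized equation with
    the same initial displacement [h]. By Taylor's formula the rest satisfies this equation up to a
    term of order [en h ^+ 2], and [gronwall] keeps it of that order. *)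
Lemma variation_deriv x (xi : 'I_m -> R -> 'rV[R]_m) : (forall i, xi i 0 = delta_mx 0 i) ->
  (forall i t, 0 <= t <= 1 -> is_derive t (1 : R) (xi i) (xi i t *m jac F (Phi x t))) ->
  differentiable (fun y => Phi y 1) x /\ forall i j, pd i (fun y => Phi y 1 0 j) x = xi i 1 0 j.
Proof.
move=> xi0 hxi; pose A : 'M[R]_m := \matrix_i xi i 1.
pose C := m%:R * lipc * growth * growth; have g1 := growth_ge1.
have g0 : 0 <= growth by exact: le_trans ler01 g1.
have C1 : 0 <= m%:R * lipc * growth by exact: mulr_ge0 (mulr_ge0 (ler0n _ _) lipc_ge0) g0.
have C0 : 0 <= C by exact: mulr_ge0 C1 g0.
have key h : en (Phi (h + x) 1 - Phi x 1 - h *m A) <= C * en h ^+ 2.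
  pose w t := \sum_i h 0 i *: xi i t.
  have hw t : 0 <= t <= 1 -> is_derive t (1 : R) w (w t *m jac F (Phi x t)).
    move=> t01; rewrite mulmx_suml; apply: is_derive_bigsum => i.
    by rewrite -scalemxAl; apply: is_deriveZ; exact: hxi.
  pose z t := Phi (h + x) t - Phi x t - w t.
  pose dz t := F (Phi (h + x) t) - F (Phi x t) - w t *m jac F (Phi x t).
  have hz t : 0 <= t <= 1 -> is_derive t (1 : R) z (dz t).
    by move=> t01; apply: is_deriveB; [apply: is_deriveB; exact: (flowP _).2|exact: hw].
  have z0 : z 0 = 0.
    rewrite /z !(flowP _).1 addrK; apply/eqP; rewrite subr_eq0; apply/eqP.
    by rewrite {1}(row_sum_delta h); apply: eq_bigr => i _; rewrite xi0.
  have -> : h *m A = w 1 by rewrite mulmx_sum_row; apply: eq_bigr => i _; rewrite rowK.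
  have bound t : 0 <= t <= 1 -> en (dz t) <= lipc * en (z t) + m%:R * lipc * growth * en h ^+ 2.
    move=> t01; pose d := Phi (h + x) t - Phi x t.
    have -> : dz t = z t *m jac F (Phi x t) + (F (Phi x t + d) - F (Phi x t) - d *m jac F (Phi x t)).
      by rewrite /dz /z -/d [Phi x t + d]addrC /d subrK mulmxBl; apply/rowP => a; rewrite !mxE; ring.
    apply: (le_trans (en_triangle _ _)); apply: lerD; first exact: jac_en_le.
    apply: (le_trans (taylor_en_le _ _)); rewrite -[leRHS]mulrA; apply: ler_wpM2l; first exact: mulr_ge0 (ler0n _ _) lipc_ge0.
    by have := flow_spread x (h + x) t01; rewrite addrK mulrC.
  have K1 : 0 <= m%:R * lipc * growth * en h ^+ 2 by exact: mulr_ge0 C1 (sqr_ge0 _).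
  have := gronwall lipc_ge0 K1 ler01 hz bound.
  rewrite z0 en0 expr0n /= add0r subr0 !mulr1 -/growth => H.
  apply: en_sqr_le; first by rewrite mulr_ge0 ?sqr_ge0.
  apply: (le_trans H); have -> : (C * en h ^+ 2) ^+ 2 = (m%:R * lipc * growth * en h ^+ 2) ^+ 2 * (growth * growth).
    by rewrite /C; ring.
  by rewrite ler_wpM2l ?sqr_ge0 // ler_peMl.
have cA : continuous (mulmxr A : 'rV[R]_m -> 'rV[R]_m).
  move=> u; apply: continuous_coords => a b; rewrite ord1.
  rewrite (_ : (fun y : 'rV[R]_m => _) = (fun y : 'rV[R]_m => \sum_i y 0 i * A i b)); last first.
    by apply/funext => y; rewrite mxE.
  apply: continuous_bigsum => i; apply: continuousM; [exact: coord_continuous|exact: cst_continuous].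
have [|d e] := @diff_eps R _ _ (fun y => Phi y 1) (mulmxr A) x cA.
  move=> e e0; have Cm : 0 <= C * (m%:R * m%:R) by exact: mulr_ge0 C0 (mulr_ge0 (ler0n _ _) (ler0n _ _)).
  have Cm1 : 0 < C * (m%:R * m%:R) + 1 by rewrite ltr_wpDl.
  have N : \forall h \near (0 : 'rV[R]_m), `|h| < e / (C * (m%:R * m%:R) + 1).
    apply/nbhs_ballP; exists (e / (C * (m%:R * m%:R) + 1)) => /=.
      by rewrite divr_gt0.
    by move=> h; rewrite -ball_normE /= sub0r normrN.
  apply: filterS N => h hh; apply: (le_trans (norm_le_en _)); apply: (le_trans (key h)).
  apply: (@le_trans _ _ (C * (m%:R * m%:R) * `|h| * `|h|)).
    rewrite -[leRHS]mulrA -[leRHS]mulrA; apply: ler_wpM2l => //; rewrite expr2 -mulrA (_ : m%:R * (m%:R * (`|h| * `|h|)) = (m%:R * `|h|) * (m%:R * `|h|)); last by ring.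
    by rewrite ler_pM // ?en_ge0 // en_le_norm.
  rewrite ler_wpM2r //; rewrite ltr_pdivlMr // in hh.
  by apply: le_trans (ltW hh); rewrite mulrDr mulr1 mulrC lerDl.
split=> // i j; rewrite /pd -(@derive_coord R _ _ _ (fun y => Phi y 1)); last exact: diff_derivable.
by rewrite (deriveE _ d) e /= -rowE rowK.
Qed.

End Bounds.

Section Cut.
Variables (m : nat) (B : R).
Hypothesis B0 : 0 <= B.
Let BB : B < B + 1. Proof. by rewrite ltrDl. Qed.

Definition cutv (xi : 'rV[R]_m) := bump B (B + 1) xi *: xi.

Lemma ub_cutv (P : Type) (D : P -> Prop) i : ub D (fun _ xi => cutv xi 0 i).
Proof.
move=> k; apply: (@ubk_ext _ _ _ _ _ (fun _ xi => xi 0 i * bump B (B + 1) xi)).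
  by move=> p _ x; rewrite mxE mulrC.
apply: (@ubk_mul_coord _ _ _ _ _ (B + 1)); last exact: ub_bump.
move=> p _ x hx; apply: bump0 => //; exact: le_trans (ltW hx) (coord_le_en x i).
Qed.

Lemma en_cutv xi : en (cutv xi) <= en xi.
Proof. by rewrite /cutv enZ ger0_norm ?bump_ge0 // ler_piMl ?en_ge0 // bump_le1. Qed.

Lemma cutv_id xi : en xi <= B -> cutv xi = xi.
Proof. by move=> h; rewrite /cutv bump1 ?scale1r. Qed.

Lemma cutv_bound xi : en (cutv xi) <= B + 1.
Proof.
have [h|h] := leP (B + 1) (en xi); last exact: le_trans (en_cutv xi) (ltW h).
by rewrite /cutv bump0 // scale0r en0 addr_ge0.
Qed.

End Cut.

Section Variation.
Variables (m : nat) (F : 'rV[R]_m -> 'rV[R]_m) (K : R).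
Hypotheses (LF : LB T1 (fun _ => F)) (K0 : 0 < K) (hK : forall i j, bd 1 K (pd i (fun y => F y 0 j))).
Local Notation B := (growth m K).

(* The first variation of the flow of [F], cut off to remain bounded; [B]
   bounds the variations issued from unit vectors up to time 1. *)
Definition varfield (w : 'rV[R]_(m + m)) : 'rV[R]_(m + m) :=
  row_mx (F (lsubmx w)) (cutv B (rsubmx w) *m jac F (lsubmx w)).

Let B1 : 1 <= B. Proof. exact: growth_ge1. Qed.
Let B0 : 0 <= B. Proof. exact: le_trans ler01 B1. Qed.

Lemma LBk_lsubmx (P : Type) (D : P -> Prop) k a b : LBk D k (fun _ (w : 'rV[R]_(a + b)) => lsubmx w).
Proof. by move=> j; apply: (lbk_ext _ (@lbk_coord R P D (a + b) k (lshift b j))) => p _ w; rewrite mxE. Qed.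

Lemma LBk_rsubmx (P : Type) (D : P -> Prop) k a b : LBk D k (fun _ (w : 'rV[R]_(a + b)) => rsubmx w).
Proof. by move=> j; apply: (lbk_ext _ (@lbk_coord R P D (a + b) k (rshift a j))) => p _ w; rewrite mxE. Qed.

Lemma LBk_row_mx (P : Type) (D : P -> Prop) k q a b (f : P -> 'rV[R]_q -> 'rV[R]_a) (g : P -> 'rV[R]_q -> 'rV[R]_b) :
  LBk D k f -> LBk D k g -> LBk D k (fun p x => row_mx (f p x) (g p x)).
Proof.
move=> hf hg j; case: (split_ordP j) => j' ->.
  by apply: (lbk_ext _ (hf j')) => p _ w; rewrite row_mxEl.
by apply: (lbk_ext _ (hg j')) => p _ w; rewrite row_mxEr.
Qed.

Lemma LB_varfield : LB T1 (fun _ => varfield).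
Proof.
move=> k; apply: LBk_row_mx.
  by apply: (@LBk_comp _ _ _ _ _ _ _ (fun _ => F) (fun _ w => lsubmx w)); [exact: LF|exact: LBk_lsubmx].
move=> j; apply: ubk_lbk.
apply: (@ubk_ext _ _ _ _ _ (fun _ w => \sum_(i <- index_enum 'I_m) cutv B (rsubmx w) 0 i * pd i (fun y => F y 0 j) (lsubmx w))).
  by move=> p _ w; rewrite mxE; apply: eq_bigr => i _; rewrite !mxE.
apply: ubk_sum => i; apply: ubkM.
  by apply: (@ubk_comp _ _ _ _ _ _ (fun _ xi => cutv B xi 0 i) (fun _ w => rsubmx w)); [exact: ub_cutv|exact: LBk_rsubmx].
apply: (@ubk_comp _ _ _ _ _ _ (fun _ => pd i (fun y => F y 0 j)) (fun _ w => lsubmx w)); last exact: LBk_lsubmx.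
exact: (LF k.+1 j).2.
Qed.

Lemma is_derive_lsubmx a b (c : R -> 'rV[R]_(a + b)) v t : is_derive t (1 : R) c v ->
  is_derive t (1 : R) (fun s => lsubmx (c s)) (lsubmx v).
Proof.
move=> h; apply: is_derive_coords => j; rewrite mxE (_ : (fun s => _) = fun s => c s 0 (lshift b j)).
  exact: is_derive_coord.
by apply/funext => s; rewrite mxE.
Qed.

Lemma is_derive_rsubmx a b (c : R -> 'rV[R]_(a + b)) v t : is_derive t (1 : R) c v ->
  is_derive t (1 : R) (fun s => rsubmx (c s)) (rsubmx v).
Proof.
move=> h; apply: is_derive_coords => j; rewrite mxE (_ : (fun s => _) = fun s => c s 0 (rshift a j)).
  exact: is_derive_coord.
by apply/funext => s; rewrite mxE.
Qed.

Lemma en_delta i : en (delta_mx 0 i : 'rV[R]_m) = 1.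
Proof.
rewrite /en /dot (bigD1 i) //= big1 ?addr0 ?mxE ?eqxx ?mulr1 ?sqrtr1 // => j ji.
by rewrite !mxE (negbTE ji) andbF mulr0.
Qed.

Variable Phi : 'rV[R]_m -> R -> 'rV[R]_m.
Hypothesis flowP : forall x, Phi x 0 = x /\ forall t, is_derive t (1 : R) (Phi x) (F (Phi x t)).

(** By [gronwall] the variation issued from a unit vector stays below [B] up to time 1, where the
    cut-off is the identity: the cut-off field computes the true first variation. *)
Lemma varflow (W : R -> 'rV[R]_(m + m)) x i : W 0 = row_mx x (delta_mx 0 i) ->
  (forall t, is_derive t (1 : R) W (varfield (W t))) ->
  forall t, 0 <= t <= 1 -> en (rsubmx (W t)) <= B /\
    is_derive t (1 : R) (fun s => rsubmx (W s)) (rsubmx (W t) *m jac F (Phi x t)).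
Proof.
move=> W0 hW t t01; have [t0 t1] := andP t01; have c0 := @lipc_ge0 m K K0.
have hl s : is_derive s (1 : R) (fun s => lsubmx (W s)) (F (lsubmx (W s))).
  by have := is_derive_lsubmx (hW s); rewrite row_mxKl.
have hr s : is_derive s (1 : R) (fun s => rsubmx (W s)) (cutv B (rsubmx (W s)) *m jac F (lsubmx (W s))).
  by have := is_derive_rsubmx (hW s); rewrite row_mxKr.
have el : lsubmx (W t) = Phi x t.
  apply: (@flow_unique R m F (lipc m K) (fun s => lsubmx (W s)) (Phi x) 0 t) => //.
  - by move=> s _; exact: LB_en_lip.
  - by move=> s _; exact: (flowP x).2.
  - by rewrite W0 row_mxKl (flowP x).1.
have eB : en (rsubmx (W t)) <= B.
  have h := @gronwall R m (fun s => rsubmx (W s)) (fun s => cutv B (rsubmx (W s)) *m jac F (lsubmx (W s))) (lipc m K) 0 0 t c0 (lexx _) t0.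
  apply: en_sqr_le => //; apply: (le_trans (h _ _)) => //.
    move=> s _; rewrite addr0; apply: (le_trans (jac_en_le K0 hK _ _)).
    by rewrite ler_wpM2l // en_cutv.
  rewrite W0 row_mxKr en_delta expr1n expr0n /= mul0r addr0 mul1r subr0.
  apply: (le_trans (@growth_le m K K0 t t1)).
  by rewrite expr2 ler_peMl.
split=> //; have := hr t; rewrite el cutv_id //.
Qed.

End Variation.

(** The partial derivatives of the flow are components of the flow of [varfield], to which the
    previous order applies. Hence the induction runs over all dimensions and fields; the cut-off is
    what keeps [varfield] in the class considered. *)
Lemma flow_LBk k m (F : 'rV[R]_m -> 'rV[R]_m) (Phi : 'rV[R]_m -> R -> 'rV[R]_m) : LB T1 (fun _ => F) ->
  (forall x, Phi x 0 = x /\ forall t, is_derive t (1 : R) (Phi x) (F (Phi x t))) ->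
  LBk T1 k (fun _ x => Phi x 1).
Proof.
elim: k m F Phi => [|k IH] m F Phi LF flowP.
all: have [K K0 hK] := LB_bounds LF; pose G := varfield F K.
all: have LG : LB T1 (fun _ => G) by exact: LB_varfield.
all: have [K' K'0 hK'] := LB_bounds LG.
all: have L0 : 0 < (m + m)%:R * K' + 1 by rewrite ltr_wpDl // mulr_ge0 // ltW.
all: have lipG x y : `|G x - G y| <= ((m + m)%:R * K' + 1) * `|x - y|
  by apply: (le_trans (LB_lip LG K'0 hK' x y)); rewrite ler_wpM2r // lerDl.
all: have [Psi hPsi] := choice (flow_exists L0 lipG).
all: have V x i t : 0 <= t <= 1 -> en (rsubmx (Psi (row_mx x (delta_mx 0 i)) t)) <= growth m K /\
    is_derive t (1 : R) (fun s => rsubmx (Psi (row_mx x (delta_mx 0 i)) s)) (rsubmx (Psi (row_mx x (delta_mx 0 i)) t) *m jac F (Phi x t))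
  by apply: (varflow LF K0 hK flowP (hPsi _).1 (hPsi _).2).
all: have D x := variation_deriv LF K0 hK flowP (x := x) (xi := fun i s => rsubmx (Psi (row_mx x (delta_mx 0 i)) s))
   (fun i => etrans (congr1 rsubmx (hPsi _).1) (row_mxKr _ _)) (fun i t h => (V x i t h).2).
  by move=> j p _ x; apply: differentiable_continuous; apply: (differentiable_coord_comp (f := fun y => Phi y 1)); exact: (D x).1.
move=> j; split=> [p _ x|i].
  by apply: (differentiable_coord_comp (f := fun y => Phi y 1)); exact: (D x).1.
apply: (@ubk_ext _ _ _ _ _ (fun _ x => Psi (row_mx x (delta_mx 0 i)) 1 0 (rshift m j))).
  by move=> p _ x; rewrite (D x).2 mxE.
apply: ubkS.
  exists (growth m K) => p _ x; have [|h _] := V x i 1; first by rewrite ler01 lexx.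
  by apply: le_trans h; have := coord_le_en (rsubmx (Psi (row_mx x (delta_mx 0 i)) 1)) j; rewrite mxE.
apply: (@lbk_comp _ _ _ _ _ _ (fun _ w => Psi w 1 0 (rshift m j)) (fun _ x => row_mx x (delta_mx 0 i))).
  exact: (IH _ G Psi LG hPsi (rshift m j)).
apply: LBk_row_mx => j'; first exact: lbk_coord.
by apply: lbk_cst.
Qed.

End SmoothFlows.

(** * Symmetry of second derivatives *)

Section Schwarz.
Context {R : realType}.

Lemma mean_value_axis n (f : 'rV[R]_n -> R) (y : 'rV[R]_n) a (h : R) : (forall x, differentiable f x) ->
  exists2 t, 0 < t < 1 & f (y + h *: delta_mx 0 a) - f y = h * pd a f (y + t *: (h *: delta_mx 0 a)).
Proof.
move=> df; have [t t01 e] := @mean_value_line R n f y (h *: delta_mx 0 a) (fun t _ => df _).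
exists t => //; rewrite e (bigD1 a) //= big1 ?addr0; first by rewrite !mxE !eqxx mulr1.
by move=> j ja; rewrite !mxE (negbTE ja) andbF mulr0 mul0r.
Qed.

Lemma pd_shift n (f : 'rV[R]_n -> R) (c y : 'rV[R]_n) a : (forall x, differentiable f x) ->
  pd a (fun x => f (x + c)) y = pd a f (y + c).
Proof.
move=> df; have dc : differentiable (fun x : 'rV[R]_n => x + c) y by apply: differentiableD.
rewrite (pd_comp (f := f) (h := fun x => x + c)) // (bigD1 a) //= big1 ?addr0.
  rewrite (_ : (fun y0 => _) = (fun x : 'rV[R]_n => x 0 a + c 0 a)); last by apply/funext => x; rewrite mxE.
  by rewrite pdD ?pd_cst ?pd_coord ?eqxx ?addr0 ?mul1r //; exact: differentiable_coord.
move=> j ja; rewrite (_ : (fun y0 => _) = (fun x : 'rV[R]_n => x 0 j + c 0 j)); last by apply/funext => x; rewrite mxE.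
rewrite pdD ?pd_cst ?pd_coord //; last exact: differentiable_coord.
by rewrite eq_sym (negbTE ja) addr0 mul0r.
Qed.

Lemma close_half (x y z : R) : `|x - z| < `|x - y| / 2 -> `|y - z| < `|x - y| / 2 -> False.
Proof. by move=> h1 h2; have := ler_distD z x y; rewrite (distrC z y); lra. Qed.

Lemma sub_swap (p q r s : R) : p - q - r + s = p - r - q + s.
Proof. by ring. Qed.

(** The mean value theorem, first for the increment of [f] along [b], then for its derivative. The
    left side being symmetric in [a] and [b], both mixed derivatives take the same value at points
    close to [y]. *)
Lemma second_difference n (f : 'rV[R]_n -> R) (y : 'rV[R]_n) a b (h : R) : h != 0 ->
  (forall x, differentiable f x) -> (forall i x, differentiable (pd i f) x) ->
  exists2 z, `|z - y| <= 2 * `|h| &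
    f (y + h *: delta_mx 0 a + h *: delta_mx 0 b) - f (y + h *: delta_mx 0 a) - f (y + h *: delta_mx 0 b) + f y =
    h * h * pd b (pd a f) z.
Proof.
move=> h0 df ddf; set ha := h *: delta_mx 0 a; set hb := h *: delta_mx 0 b.
have dfs x : differentiable (fun x => f (x + hb)) x.
  apply: (@differentiable_comp _ _ _ _ (fun x => x + hb) f); last exact: df.
  by apply: differentiableD.
have dphi x : differentiable (fun x => f (x + hb) - f x) x by apply: differentiableB; [exact: dfs|exact: df].
have [t /andP[t0 t1] e] := mean_value_axis y a h dphi.
have [s /andP[s0 s1] e'] := mean_value_axis (y + t *: ha) b h (ddf a).
have nd (c : 'I_n) : `|(h *: delta_mx 0 c : 'rV[R]_n)| <= `|h|.
  apply: norm_rV_le => // i; rewrite !mxE eqxx /= normrM ler_piMr //.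
  by case: (i == c); rewrite ?normr1 ?normr0.
exists (y + t *: ha + s *: hb).
  rewrite (_ : _ - y = t *: ha + s *: hb); last by apply/rowP => i; rewrite !mxE; ring.
  have sm (u : R) c : 0 < u -> u < 1 -> `|u *: (h *: delta_mx 0 c : 'rV[R]_n)| <= `|h|.
    move=> u0 u1; rewrite normrZ (gtr0_norm u0); apply: le_trans (nd c).
    by rewrite ler_piMl // ltW.
  apply: (le_trans (ler_normD _ _)); have := sm t a t0 t1; have := sm s b s0 s1; rewrite -/ha -/hb.
  by move: `|_| `|_| `|h| => p q u; lra.
have P := pdB a (dfs (y + t *: ha)) (df (y + t *: ha)); rewrite (pd_shift hb _ _ df) in P.
rewrite -/ha P e' in e; rewrite -[RHS]mulrA -/hb -[RHS]e.
move: (f _) (f _) (f _) (f _) => p q u w; ring.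
Qed.

Lemma schwarz n (f : 'rV[R]_n -> R) a b y :
  (forall x, differentiable f x) -> (forall i x, differentiable (pd i f) x) ->
  (forall i j, continuous (pd i (pd j f))) -> pd a (pd b f) y = pd b (pd a f) y.
Proof.
move=> df ddf cf; apply/eqP; rewrite -subr_eq0 -normr_le0 leNgt; apply/negP => d0.
set d := `|_| in d0; have d2 : 0 < d / 2 by rewrite divr_gt0.
have N1 : \forall z \near y, `|pd a (pd b f) y - pd a (pd b f) z| < d / 2.
  by move: (cf a b y) => /cvgrPdist_lt/(_ _ d2).
have N2 : \forall z \near y, `|pd b (pd a f) y - pd b (pd a f) z| < d / 2.
  by move: (cf b a y) => /cvgrPdist_lt/(_ _ d2).
have [e /= e0 he] := (nbhs_ballP _ _).1 (filterI N1 N2).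
have h0 : e / 3 != 0 by rewrite gt_eqF // divr_gt0.
have eh : 2 * `|e / 3| < e by rewrite gtr0_norm ?divr_gt0 //; lra.
have [z hz ez] := second_difference y a b h0 df ddf.
have [w hw ew] := second_difference y b a h0 df ddf.
have E : pd b (pd a f) z = pd a (pd b f) w.
  apply: (mulfI (mulf_neq0 h0 h0)); rewrite -[LHS]ez -[RHS]ew (addrAC y (_ *: delta_mx 0 b)).
  exact: sub_swap.
have [] := he z; first by rewrite -ball_normE /= distrC (le_lt_trans hz).
have [] := he w; first by rewrite -ball_normE /= distrC (le_lt_trans hw).
by rewrite E => h1 _ _ h2; exact: (close_half h1 h2).
Qed.

End Schwarz.

(** * The geodesic equation in Lagrange's form *)

Section ELForm.
Context {R : realType}.
Variable n : nat.
Implicit Types (g : 'rV[R]_n -> 'M[R]_n) (c dc : R -> 'rV[R]_n) (y u v w : 'rV[R]_n) (t : R).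

Definition dmx g (b : 'I_n) y : 'M[R]_n := \matrix_(i, j) pd b (fun x => g x i j) y.
Definition dirmx g y v : 'M[R]_n := \sum_b v 0 b *: dmx g b y.
Definition geoacc g y v : 'rV[R]_n := \row_k - \sum_i \sum_j christoffel g y k i j * (v 0 i * v 0 j).
(** The derivative of the kinetic energy with respect to the position: the right-hand side of
    Lagrange's equations. *)
Definition elf g y v : 'rV[R]_n := \row_l (2^-1 * dot (v *m dmx g l y) v).

Lemma dirmxE g y v i j : dirmx g y v i j = \sum_b v 0 b * pd b (fun x => g x i j) y.
Proof. by rewrite summxE; apply: eq_bigr => b _; rewrite !mxE. Qed.

Lemma dot_dirmx g y v w : 2^-1 * dot (w *m dirmx g y v) w = dot v (elf g y w).
Proof.
rewrite /dirmx mulmx_sumr {2}/dot (eq_bigr (fun b => 2^-1 * (v 0 b * dot (w *m dmx g b y) w))); last first.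
  by move=> b _; rewrite mxE; ring.
rewrite -mulr_sumr; congr (_ * _).
rewrite (big_morph (fun x => dot x w) (fun x y => dotDl x y w) (_ : dot 0 w = 0)); last first.
  by rewrite -(scale0r 0) dotZl mul0r.
by apply: eq_bigr => b _; rewrite -scalemxAr dotZl.
Qed.

(** Along a geodesic the momentum [v *m g] thus has derivative [elf]. In this form a change of chart
    only transposes Jacobians, while Christoffel symbols transform with second derivatives. *)
Lemma geoacc_el g y v : g y \in unitmx -> (g y)^T = g y -> (forall i j x, g x i j = g x j i) ->
  geoacc g y v *m g y = elf g y v - v *m dirmx g y v.
Proof.
move=> gu gs sym; pose b : 'rV[R]_n := v *m dirmx g y v - elf g y v.
have -> : geoacc g y v = - b *m invmx (g y); last by rewrite mulmxKV // /b opprB.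
apply/rowP => k; rewrite !mxE; transitivity (\sum_l - (b 0 l * invmx (g y) k l)); last first.
  apply: eq_bigr => l _; rewrite [(- b) 0 l]mxE mulNr; congr (- (_ * _)).
  by rewrite -[in RHS]gs -trmx_inv mxE.
rewrite sumrN; congr (- _).
have B l : b 0 l = \sum_i \sum_j (pd i (fun x => g x j l) y - 2^-1 * pd l (fun x => g x i j) y) * (v 0 i * v 0 j).
  rewrite /b !mxE.
  have -> : \sum_j v 0 j * dirmx g y v j l = \sum_i \sum_j pd i (fun x => g x j l) y * (v 0 i * v 0 j).
    rewrite exchange_big /=; apply: eq_bigr => j _; rewrite dirmxE mulr_sumr.
    by apply: eq_bigr => i _; ring.
  have -> : 2^-1 * dot (v *m dmx g l y) v = \sum_i \sum_j 2^-1 * pd l (fun x => g x i j) y * (v 0 i * v 0 j).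
    rewrite /dot exchange_big mulr_sumr /=; apply: eq_bigr => j _; rewrite mxE mulr_suml mulr_sumr.
    by apply: eq_bigr => i _; rewrite !mxE; ring.
  rewrite -sumrB; apply: eq_bigr => i _; rewrite -sumrB; apply: eq_bigr => j _; ring.
transitivity (\sum_l \sum_i \sum_j (2^-1 * (invmx (g y) k l * (pd i (fun x => g x j l) y + pd j (fun x => g x i l) y - pd l (fun x => g x i j) y)) * (v 0 i * v 0 j))).
  symmetry; rewrite exchange_big /=; apply: eq_bigr => i _; rewrite exchange_big /=; apply: eq_bigr => j _.
  by rewrite /christoffel mulr_sumr mulr_suml.
apply: eq_bigr => l _; rewrite B mulr_suml.
(* The first two terms of the Christoffel symbol give equal sums, since [v 0 i * v 0 j] is
   symmetric. *)
pose S1 := \sum_i \sum_j 2^-1 * invmx (g y) k l * pd i (fun x => g x j l) y * (v 0 i * v 0 j).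
pose S2 := \sum_i \sum_j 2^-1 * invmx (g y) k l * pd j (fun x => g x i l) y * (v 0 i * v 0 j).
have S12 : S1 = S2.
  by rewrite /S1 exchange_big /=; apply: eq_bigr => i _; apply: eq_bigr => j _; ring.
transitivity (S1 + S2 - \sum_i \sum_j 2^-1 * invmx (g y) k l * pd l (fun x => g x i j) y * (v 0 i * v 0 j)).
  rewrite -!big_split -sumrB /=; apply: eq_bigr => i _; rewrite -!big_split -sumrB /=; apply: eq_bigr => j _; ring.
rewrite -S12 /S1 -!big_split -sumrB /=; apply: eq_bigr => i _; rewrite -!big_split -sumrB mulr_suml /=; apply: eq_bigr => j _.
by field.
Qed.

Lemma geoacc_uniq g y v a : g y \in unitmx -> (g y)^T = g y -> (forall i j x, g x i j = g x j i) ->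
  a *m g y = elf g y v - v *m dirmx g y v -> a = geoacc g y v.
Proof. by move=> gu gs sym e; rewrite -[a](mulmxK gu) e -geoacc_el // mulmxK. Qed.

Lemma is_derive_chain (f : 'rV[R]_n -> R) c v t : is_derive t (1 : R) c v -> differentiable f (c t) ->
  is_derive t (1 : R) (fun s => f (c s)) (\sum_b v 0 b * pd b f (c t)).
Proof.
move=> [dc ec] df; have dc' : differentiable c t by apply/derivable1_diffP.
have dfc : differentiable (f \o c) t by exact: differentiable_comp.
apply: DeriveDef; first by apply: diff_derivable; exact: dfc.
rewrite derive_comp //; apply: eq_bigr => j _; congr (_ * _).
by rewrite -ec derive_coord.
Qed.

Lemma is_derive_mx_chain g c v t : is_derive t (1 : R) c v -> (forall i j x, differentiable (fun y => g y i j) x) ->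
  forall i j, is_derive t (1 : R) (fun s => g (c s) i j) (dirmx g (c t) v i j).
Proof. by move=> hc dg i j; rewrite dirmxE; apply: (@is_derive_chain (fun y => g y i j)). Qed.

Lemma is_derive_mulmx (u : R -> 'rV[R]_n) (A : R -> 'M[R]_n) du (dA : 'M[R]_n) t : is_derive t (1 : R) u du ->
  (forall i j, is_derive t (1 : R) (fun s => A s i j) (dA i j)) ->
  is_derive t (1 : R) (fun s => u s *m A s) (du *m A t + u t *m dA).
Proof.
move=> hu hA; apply: is_derive_coords => j; rewrite !mxE -big_split /=.
rewrite (_ : (fun s => _) = (fun s => \sum_i u s 0 i * A s i j)); last by apply/funext => s; rewrite mxE.
apply: is_derive_bigsum => i; have H := is_deriveM (is_derive_coord i hu) (hA i j).
by apply: (is_derive_eq H); rewrite /GRing.scale /=; ring.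
Qed.

Lemma is_derive_dotw (u w : R -> 'rV[R]_n) du dw t : is_derive t (1 : R) u du -> is_derive t (1 : R) w dw ->
  is_derive t (1 : R) (fun s => dot (u s) (w s)) (dot du (w t) + dot (u t) dw).
Proof.
move=> hu hw; rewrite /dot -big_split /=.
apply: is_derive_bigsum => i; have H := is_deriveM (is_derive_coord i hu) (is_derive_coord i hw).
by apply: (is_derive_eq H); rewrite /GRing.scale /=; ring.
Qed.

Lemma is_derive_uniq (V : normedModType R) (f : R -> V) (a b : V) t :
  is_derive t (1 : R) f a -> is_derive t (1 : R) f b -> a = b.
Proof. by move=> [_ <-] [_ <-]. Qed.

Lemma dot_mulmx_tr (u w : 'rV[R]_n) (A : 'M[R]_n) : dot (u *m A) w = dot u (w *m A^T).
Proof. by rewrite !dotE trmx_mul trmxK mulmxA. Qed.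

(** The acceleration contributes twice its product with the momentum, and by [geoacc_el] this
    cancels the variation of the metric along the curve. *)
Lemma energy_derive g c dc t : (forall i j x, differentiable (fun y => g y i j) x) ->
  g (c t) \in unitmx -> (forall i j x, g x i j = g x j i) ->
  is_derive t (1 : R) c (dc t) -> is_derive t (1 : R) dc (geoacc g (c t) (dc t)) ->
  is_derive t (1 : R) (fun s => dot (dc s *m g (c s)) (dc s)) 0.
Proof.
move=> dg gu sym hc hd; have gs : (g (c t))^T = g (c t) by apply/matrixP => i j; rewrite mxE.
have H := is_derive_dotw (is_derive_mulmx hd (is_derive_mx_chain hc dg)) hd.
apply: (is_derive_eq H); have E := geoacc_el (dc t) gu gs sym.
rewrite [dot (_ *m _) (geoacc _ _ _)]dot_mulmx_tr gs [dot (dc t) _]dotC E subrK.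
rewrite dotBl; have D := dot_dirmx g (c t) (dc t) (dc t).
rewrite [dot (elf _ _ _) _]dotC -D; lra.
Qed.

End ELForm.

(** * Bounds on Christoffel symbols and the geodesic field *)

Section ChristoffelBounds.
Context {R : realType}.
Variable n : nat.
Local Notation T1 := (fun _ : unit => True).

(** The charts of all geometries form a single family, so that bounds over it depend on [n] only. *)
Record chart_of_geom := ChartOfGeom { cgk : R ; cgG : geom n cgk ; cgi : cgG }.

Definition cgD (eta : R) p := 0 < cgk p <= eta.

Lemma ubk_christoffel (P : Type) (D : P -> Prop) k (g : P -> 'rV[R]_n -> 'M[R]_n) (f : P -> R) :
  (forall i j, ubk D k (fun p x => invmx (g p x) i j)) ->
  (forall l i j, ubk D k (fun p x => f p * pd l (fun y => g p y i j) x)) ->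
  forall l i j, ubk D k (fun p x => f p * christoffel (g p) x l i j).
Proof.
move=> hi hg l i j.
apply: (@ubk_ext _ _ _ _ _ (fun p x => 2^-1 * \sum_(m <- index_enum 'I_n) invmx (g p x) l m *
  (f p * pd i (fun y => g p y j m) x + f p * pd j (fun y => g p y i m) x - f p * pd m (fun y => g p y i j) x))).
  move=> p _ x; rewrite /christoffel mulrCA; congr (_ * _); rewrite mulr_sumr; apply: eq_bigr => m _.
  by rewrite /pd; ring.
apply: ubkM; first exact: ubk_cst1.
apply: ubk_sum => m; apply: ubkM => //; apply: ubkB => //; exact: ubkD.
Qed.

Lemma pd_sub_cst m (f : 'rV[R]_m -> R) (c : R) i x : (forall y, differentiable f y) ->
  pd i (fun y => f y - c) x = pd i f x.
Proof. by move=> df; rewrite (pdB i (df x) (@differentiable_cst _ _ _ c x)) pd_cst subr0. Qed.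

Lemma gg_differentiable (kappa : R) (G : geom n kappa) (i : G) a b (x : 'rV[R]_n) : differentiable (fun y => gg i y a b) x.
Proof. by have [K hK] := gg_smooth i a b 1%N; case: (hK tt I) => _ []. Qed.

Lemma christoffel_bounds : exists eta : R, 0 < eta /\ forall (kappa : R) (G : geom n kappa), 0 < kappa <= eta ->
  forall (i : G) l a b, ub T1 (fun _ (y : 'rV[R]_n) => christoffel (gg i) y l a b).
Proof.
have [eta eta0 hdet] := @det_near1 R n; exists eta; split=> // kappa G /andP[k0 ke] i l a b k.
apply: (@ubk_ext _ _ _ _ _ (fun _ y => 1 * christoffel (gg i) y l a b)); first by move=> p _ x; rewrite mul1r.
apply: (@ubk_christoffel _ _ _ (fun _ => gg i) (fun=> 1)) => [a' b'|l' a' b'].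
  apply: (@ubk_invmx _ _ _ _ _ _ _ 2^-1) => [|p _ x|i' j']; first by rewrite invr_gt0.
    rewrite (_ : gg i x = 1%:M + (gg i x - 1%:M)); last by rewrite addrC subrK.
    apply: hdet => c d; rewrite !mxE; apply: le_trans ke.
    exact: bd_bound (gg_small i c d) x.
  exact: gg_smooth.
apply: ubkM; first exact: ubk_cst1.
have := @ubk_lbk _ _ T1 n k.+1 (fun _ y => gg i y a' b') (gg_smooth i a' b' k.+1).
by case=> _; apply.
Qed.

(** The symbols are linear in the first derivatives of the metric, which are at most [cgk p]; after
    division by [cgk p] a bounded family remains. [gg_small] controls two derivatives of the metric,
    which leaves one for the symbols. *)
Lemma ubk_christoffel_small : exists2 eta : R, 0 < eta & forall l a b,
  ubk (cgD eta) 1 (fun p y => (cgk p)^-1 * christoffel (gg (cgi p)) y l a b).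
Proof.
have [eta1 eta10 hdet] := @det_near1 R n; pose eta := Num.min eta1 1.
exists eta; first by rewrite lt_min eta10 ltr01.
move=> l a b.
  apply: (@ubk_christoffel _ _ _ (fun p => gg (cgi p)) (fun p => (cgk p)^-1)) => [a' b'|l' a' b'].
    apply: (@ubk_invmx _ _ _ _ _ _ _ 2^-1) => [|p /andP[p0 pe] x|i' j']; first by rewrite invr_gt0.
      rewrite (_ : gg (cgi p) x = 1%:M + (gg (cgi p) x - 1%:M)); last by rewrite addrC subrK.
      apply: hdet => c d; rewrite !mxE.
      apply: (le_trans (bd_bound (gg_small (cgi p) c d) x)); apply: (le_trans pe).
      by rewrite ge_min lexx.
    apply: (@ubk_ext _ _ _ _ _ (fun p y => (gg (cgi p) y i' j' - (i' == j')%:R) + (i' == j')%:R)).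
      by move=> p _ x; rewrite subrK.
    apply: ubkD; last exact: ubk_cst1.
    exists 1 => p /andP[p0 pe]; apply: bd_le (bd_lower (gg_small (cgi p) i' j')).
    by apply: (le_trans pe); rewrite ge_min lexx orbT.
  exists (2 ^+ 1 * (1 * 1)) => p /andP[p0 pe].
  have [_ [_ /(_ l') h]] := gg_small (cgi p) a' b'.
  have e : pd l' (fun y => gg (cgi p) y a' b' - (a' == b')%:R) =1 pd l' (fun y => gg (cgi p) y a' b').
    by move=> x; rewrite pd_sub_cst // => y; exact: gg_differentiable.
  have h1 : bd 1 (cgk p) (pd l' (fun y => gg (cgi p) y a' b' - (a' == b')%:R)) := h.
  have h' := bdM (bd_cst _ 1 ((cgk p)^-1)) (bd_ext e h1).
  by apply: bd_le h'; rewrite gtr0_norm ?invr_gt0 // mulVf ?gt_eqF // mulr1.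
Qed.

Lemma christoffel_small : exists eta K : R, [/\ 0 < eta, 0 < K & forall (kappa : R) (G : geom n kappa), 0 < kappa <= eta ->
  forall (i : G) l a b, bd 1 (K * kappa) (fun y : 'rV[R]_n => christoffel (gg i) y l a b)].
Proof.
have [eta eta0 H] := ubk_christoffel_small.
have [K hK] := choice (fun t : 'I_n * 'I_n * 'I_n => H t.1.1 t.1.2 t.2).
pose L := 1 + \sum_t `|K t|; have L0 : 0 < L by rewrite ltr_pwDl // sumr_ge0.
exists eta, (2 * L); split; [exact: eta0|by rewrite mulr_gt0|].
move=> kappa G k_ i l a b; have k0 : 0 < kappa by case/andP: k_.
have h := hK (l, a, b) (ChartOfGeom i) k_.
have h' := bdM (bd_cst _ 1 kappa) h.
have e : (fun x => kappa * (kappa^-1 * christoffel (gg i) x l a b)) =1 (fun y => christoffel (gg i) y l a b).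
  by move=> x; rewrite mulrA mulfV ?gt_eqF // mul1r.
apply: bd_le (bd_ext e h'); rewrite expr1 -mulrA ler_pM2l // gtr0_norm // mulrC ler_pM2r //.
apply: (le_trans (ler_norm _)); rewrite /L (bigD1 (l, a, b)) //= addrCA lerDl addr_ge0 // sumr_ge0 //.
Qed.

End ChristoffelBounds.

Section GeodesicField.
Context {R : realType}.
Variables (n : nat) (g : 'rV[R]_n -> 'M[R]_n) (rho : R).
Hypothesis rho0 : 0 <= rho.
Local Notation T1 := (fun _ : unit => True).

(** The geodesic equation as a first-order system. The acceleration is quadratic in the velocity, so
    the velocity is cut off there to make the field globally Lipschitz. *)
Definition geofield (w : 'rV[R]_(n + n)) : 'rV[R]_(n + n) :=
  row_mx (rsubmx w) (geoacc g (lsubmx w) (cutv rho (rsubmx w))).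

Lemma LB_geofield : (forall l i j, ub T1 (fun _ y => christoffel g y l i j)) -> LB T1 (fun _ => geofield).
Proof.
move=> hg k; apply: LBk_row_mx; first exact: LBk_rsubmx.
move=> l; apply: ubk_lbk.
apply: (@ubk_ext _ _ _ _ _ (fun _ w => - \sum_(i <- index_enum 'I_n) \sum_(j <- index_enum 'I_n)
   christoffel g (lsubmx w) l i j * (cutv rho (rsubmx w) 0 i * cutv rho (rsubmx w) 0 j))).
  by move=> p _ w; rewrite mxE.
have hc i : ubk T1 k (fun _ (w : 'rV[R]_(n + n)) => cutv rho (rsubmx w) 0 i).
  by apply: (@ubk_comp _ _ _ _ _ _ (fun _ xi => cutv rho xi 0 i) (fun _ w => rsubmx w)); [exact: ub_cutv|exact: LBk_rsubmx].
apply: ubkN; apply: ubk_sum => i; apply: ubk_sum => j; apply: ubkM; last by apply: ubkM; exact: hc.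
by apply: (@ubk_comp _ _ _ _ _ _ (fun _ y => christoffel g y l i j) (fun _ w => lsubmx w)); [exact: hg|exact: LBk_lsubmx].
Qed.

Lemma geoacc_bound y v (K : R) : 0 <= K -> (forall l i j, `|christoffel g y l i j| <= K) ->
  `|geoacc g y v| <= n%:R * (n%:R * (K * en v ^+ 2)).
Proof.
move=> K0 hK; have B0 : 0 <= K * en v ^+ 2 by rewrite mulr_ge0 ?sqr_ge0.
apply: norm_rV_le => [|l]; first exact: mulr_ge0 (ler0n _ _) (mulr_ge0 (ler0n _ _) B0).
rewrite mxE normrN; apply: (le_trans (ler_norm_sum _ _ _)).
apply: (@le_trans _ _ (\sum_(i < n) n%:R * (K * en v ^+ 2))); last by rewrite sumr_const card_ord -[leLHS]mulr_natl.
apply: ler_sum => i _; apply: (le_trans (ler_norm_sum _ _ _)).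
apply: (@le_trans _ _ (\sum_(j < n) K * en v ^+ 2)); last by rewrite sumr_const card_ord -[leLHS]mulr_natl.
apply: ler_sum => j _; have h : `|v 0 i * v 0 j| <= en v ^+ 2.
  by rewrite normrM expr2; exact: ler_pM (normr_ge0 _) (normr_ge0 _) (coord_le_en _ _) (coord_le_en _ _).
by rewrite normrM; exact: ler_pM (normr_ge0 _) (normr_ge0 _) (hK _ _ _) h.
Qed.

Lemma geoaccZ y v a : geoacc g y (a *: v) = a ^+ 2 *: geoacc g y v.
Proof.
apply/rowP => l; rewrite !mxE mulrN mulr_sumr; congr (- _); apply: eq_bigr => i _; rewrite mulr_sumr.
by apply: eq_bigr => j _; rewrite !mxE; ring.
Qed.

End GeodesicField.

Section NearReal.
Context {R : realType}.

Lemma near_and (P Q : R -> Prop) (t : R) : (\forall s \near t, P s) -> (\forall s \near t, Q s) ->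
  \forall s \near t, P s /\ Q s.
Proof. by move=> h h'; apply: filterS2 h h' => s. Qed.

Lemma near_ball (P : R -> Prop) (t : R) : (\forall s \near t, P s) ->
  exists2 e, 0 < e & forall s, `|s - t| < e -> P s.
Proof.
move=> /nbhs_ballP[e /= e0 he]; exists e => // s hs; apply: he.
by rewrite -ball_normE /= distrC.
Qed.

Lemma LB_unique m (F : 'rV[R]_m -> 'rV[R]_m) (u v : R -> 'rV[R]_m) (a b : R) :
  LB (fun _ : unit => True) (fun _ => F) -> a <= b ->
  (forall t, a <= t <= b -> is_derive t (1 : R) u (F (u t)) /\ is_derive t (1 : R) v (F (v t))) ->
  u a = v a -> u b = v b.
Proof.
move=> LF ab h; have [K K0 hK] := LB_bounds LF.
apply: (@flow_unique R m F (lipc m K) u v a b) => //.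
- exact: lipc_ge0.
- by move=> t _; exact: LB_en_lip.
- by move=> t /h[].
- by move=> t /h[].
Qed.

End NearReal.

(** * Geodesics of the manifold and their uniqueness *)

Section Geodesics.
Context {R : realType}.
Variables (n : nat) (kappa : R) (G : geom n kappa).
Hypothesis kappa_small : n%:R ^+ 2 * kappa <= 1 / 100.
Variable r : R.
Hypothesis r0 : 0 < r.
Local Notation M := (@mfd R n kappa G kappa_small r r0).
Local Notation nu := (n%:R ^+ 2 * kappa).
Local Notation T1 := (fun _ : unit => True).
Implicit Types (i j : G) (p q : M) (y z v : 'rV[R]_n) (s t : R) (gam : R -> M) (c dc : R -> 'rV[R]_n).

Lemma quad_dot i y v : quad i y v = dot (v *m gg i y) v.
Proof. by rewrite dotE. Qed.

Lemma gg_unit i y : gg i y \in unitmx.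
Proof.
rewrite -row_free_unit; apply: inj_row_free => v e; apply/eqP; case: (eqVneq v 0) => // v0.
by have := quad_gt0 kappa_small i y v0; rewrite quad_dot e dotE mul0mx mxE ltxx.
Qed.

Lemma gg_symE i a b y : gg i y a b = gg i y b a.
Proof. by rewrite -[in LHS](gg_sym i y) mxE. Qed.

Lemma ub_jac i j a b : j \in gnb i -> ub T1 (fun _ y => jac (gT i j) y a b).
Proof.
move=> ij k; apply: (@ubk_ext _ _ _ _ _ (fun _ => pd a (fun x => gT i j x 0 b))); first by move=> p _ y; rewrite mxE.
exact: (gT_smooth ij k.+1 b).2.
Qed.

Lemma ub_differentiable (f : 'rV[R]_n -> R) : ub T1 (fun _ => f) -> forall x, differentiable f x.
Proof. by move=> h x; have [K hK] := h 1%N; case: (hK tt I) => _ []. Qed.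

Lemma jac_differentiable i j a b y : j \in gnb i -> differentiable (fun y => jac (gT i j) y a b) y.
Proof. by move=> ij; apply: ub_differentiable; exact: ub_jac. Qed.

Lemma pd_jac i j l b m y : j \in gnb i -> pd l (fun x => jac (gT i j) x b m) y = pd b (fun x => jac (gT i j) x l m) y.
Proof.
move=> ij; have e a b' : (fun x => jac (gT i j) x a b') = pd a (fun x => gT i j x 0 b').
  by apply/funext => x; rewrite mxE.
rewrite !e; apply: schwarz => [x|a x|a a'].
- exact: (gT_smooth ij 1%N m).1 tt I x.
- by rewrite -e; exact: jac_differentiable.
- rewrite -e; have [K hK] := ub_jac a' m ij 1%N; have [_ [_ h]] := hK tt I.
  exact: (h a).2.
Qed.

Lemma jac_unit i j y : overlap i j y -> jac (gT i j) y \in unitmx.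
Proof.
move=> [hy ij hz]; have := gg_unit i y; rewrite (gg_inv ij hy hz) unitmx_mul.
by move=> /andP[]; rewrite unitmx_mul => /andP[].
Qed.

Lemma dirmx_delta (g : 'rV[R]_n -> 'M[R]_n) y l : dirmx g y (delta_mx 0 l) = dmx g l y.
Proof.
rewrite /dirmx (bigD1 l) //= big1 ?addr0 ?mxE ?eqxx ?scale1r // => b bl.
by rewrite mxE (negbTE bl) andbF scale0r.
Qed.

(* Schwarz's theorem makes the second derivatives of the transition map cancel:
   Lagrange's equations do not depend on the chart. *)
Lemma elf_change i j y v : overlap i j y ->
  elf (gg i) y v = elf (gg j) (gT i j y) (v *m jac (gT i j) y) *m (jac (gT i j) y)^T
   + (v *m jac (gT i j) y *m gg j (gT i j y)) *m (dirmx (jac (gT i j)) y v)^T.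
Proof.
move=> o; have [hy ij hz] := o; set J := jac (gT i j); set z := gT i j y; set w := v *m J y.
(* The component [l] comes from differentiating, along the axis [l], the invariance of the energy of
   the fixed vector [v]. *)
apply/rowP => l; pose x (s : R) := y + s *: delta_mx 0 l.
have x0 : x 0 = y by rewrite /x scale0r addr0.
have hx : is_derive (0 : R) (1 : R) x (delta_mx 0 l).
  have H := is_deriveD (is_derive_cst y (0 : R) 1) (is_derive_scalel (delta_mx 0 l) (is_derive_id (0 : R) (1 : R))).
  by apply: (is_derive_eq H); rewrite add0r scale1r.
have hv : is_derive (0 : R) (1 : R) (cst v) (0 : 'rV[R]_n) by exact: is_derive_cst.
have D1 := is_derive_dotw (is_derive_mulmx hv (is_derive_mx_chain hx (fun a b y => gg_differentiable i a b y))) hv.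
have hw := is_derive_mulmx hv (is_derive_mx_chain hx (fun a b y => @jac_differentiable i j a b y ij)).
have hT := is_derive_comp_jac hx (gT_differentiable ij _).
have D2 := is_derive_dotw (is_derive_mulmx hw (is_derive_mx_chain hT (fun a b y => gg_differentiable j a b y))) hw.
have N : \forall s \near (0 : R), overlap i j (x s).
  have := is_derive_continuous hx; apply; rewrite x0.
  exact: (open_nbhs_nbhs (conj (@open_overlap _ _ _ G i j) o)).
have E : \forall s \near (0 : R), dot (cst v s *m J (x s) *m gg j ((gT i j \o x) s)) (cst v s *m J (x s)) = dot (cst v s *m gg i (x s)) (cst v s).
  by apply: filterS N => s os; rewrite /= -!quad_dot -quad_inv.
have := is_derive_uniq D1 (near_eq_is_derive E D2).
rewrite /= x0 !mul0mx !add0r !dirmx_delta -/J -/z -/w.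
rewrite -(scale0r 0) dotZr mul0r addr0 => {}E.
rewrite [LHS]mxE E dotDl [X in _ * (X + _ + _)]dot_mulmx_tr gg_sym [X in _ * (_ + _ + X)]dotC.
rewrite -rowE; have := dot_dirmx (gg j) z (row l (J y)) w => D.
rewrite mxE; have -> : (elf (gg j) z w *m (J y)^T) 0 l = dot (row l (J y)) (elf (gg j) z w).
  by rewrite mxE /dot; apply: eq_bigr => a _; rewrite !mxE mulrC.
rewrite -D; have -> : (w *m gg j z *m (dirmx J y v)^T) 0 l = dot (v *m dmx J l y) (w *m gg j z).
  rewrite mxE /dot; apply: eq_bigr => m _; rewrite mulrC mxE dirmxE mxE; congr (_ * _); rewrite [RHS]mxE.
  by apply: eq_bigr => b _; rewrite mxE /J pd_jac.
by move: (dot _ _) (dot _ _) => a b; field.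
Qed.

Definition ggeo gam i c dc t := \forall s \near t, [/\ en (c s) < 3 / 5, gam s = pt i (c s),
  is_derive s (1 : R) c (dc s) & is_derive s (1 : R) dc (geoacc (gg i) (c s) (dc s))].

(** The geodesic equation near [t] in some chart; by [ggeo_change] every chart around the point
    serves. *)
Definition geo_at gam t := exists i c dc, ggeo gam i c dc t.

Lemma ggeo_repr gam i c dc t : ggeo gam i c dc t -> repr gam i c dc t.
Proof. by apply: filterS => s []. Qed.

(** The momentum in chart [i] is the momentum in chart [j] times the transposed Jacobian.
    Differentiating this and using [elf_change], the terms with the derivative of the Jacobian
    cancel; the Jacobian being invertible, Lagrange's equations hold in [j]. *)
Lemma ggeo_change gam i j c dc t : ggeo gam i c dc t -> ptdom j (gam t) ->
  ggeo gam j (gT i j \o c) (fun s => dc s *m jac (gT i j) (c s)) t.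
Proof.
move=> h dj; have hr := ggeo_repr h.
apply: filterS2 (repr_change hr dj) (filterI (nbhs_interior h) (nbhs_interior (repr_overlap hr dj))).
move=> s [h1 h2 h3] [hs ho]; split=> //.
have [ov _] := nbhs_singleton ho; have [_ ij _] := ov.
have [_ _ dcs das] := nbhs_singleton hs.
set J := jac (gT i j) in h3 *.
have hw := is_derive_mulmx das (is_derive_mx_chain dcs (fun a b y => @jac_differentiable i j a b y ij)).
rewrite -/J in hw; set w' := (_ + _) in hw.
have hp := is_derive_mulmx hw (is_derive_mx_chain h3 (fun a b y => gg_differentiable j a b y)).
set p' := (_ + _) in hp.
have hJt a b : is_derive s (1 : R) (fun u => (J (c u))^T a b) ((dirmx J (c s) (dc s))^T a b).
  rewrite mxE (_ : (fun u => _) = (fun u => J (c u) b a)); last by apply/funext => u; rewrite mxE.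
  exact: (is_derive_mx_chain dcs (fun a b y => @jac_differentiable i j a b y ij)).
have hq := is_derive_mulmx hp hJt.
have hpi := is_derive_mulmx das (is_derive_mx_chain dcs (fun a b y => gg_differentiable i a b y)).
rewrite geoacc_el ?subrK ?gg_unit ?gg_sym // in hpi; last by move=> *; exact: gg_symE.
have E : \forall u \near s, dc u *m J (c u) *m gg j ((gT i j \o c) u) *m (J (c u))^T = dc u *m gg i (c u).
  by apply: filterS ho => u [[v1 v2 v3] _]; rewrite (gg_inv v2 v1 v3) !mulmxA.
have := is_derive_uniq hpi (near_eq_is_derive E hq).
rewrite (elf_change _ ov) -/J => /addIr e.
have {}e : p' = elf (gg j) (gT i j (c s)) (dc s *m J (c s)).
  apply/esym; have uJ : (J (c s))^T \in unitmx by rewrite unitmx_tr jac_unit.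
  by rewrite -[LHS](mulmxK uJ) e mulmxK.
have -> : geoacc (gg j) ((gT i j \o c) s) (dc s *m J (c s)) = w'; last exact: hw.
apply/esym/geoacc_uniq; rewrite ?gg_unit ?gg_sym //; first by move=> *; exact: gg_symE.
by rewrite /= -e /p' addrK.
Qed.

Lemma is_derive_affine (a b t : R) : is_derive t (1 : R) (fun s => a * s + b) a.
Proof.
have H := is_deriveD (is_deriveM (is_derive_cst a t 1) (is_derive_id t (1 : R))) (is_derive_cst b t 1).
by apply: (is_derive_eq H); rewrite scaler0 !addr0 /GRing.scale /= mulr1.
Qed.

Lemma ggeo_affine gam i c dc (a b t : R) : ggeo gam i c dc (a * t + b) ->
  ggeo (fun s => gam (a * s + b)) i (fun s => c (a * s + b)) (fun s => a *: dc (a * s + b)) t.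
Proof.
move=> h; have cc := is_derive_cont (is_derive_affine a b t).
have N : \forall s \near t, [/\ en (c (a * s + b)) < 3 / 5, gam (a * s + b) = pt i (c (a * s + b)),
    is_derive (a * s + b) (1 : R) c (dc (a * s + b)) &
    is_derive (a * s + b) (1 : R) dc (geoacc (gg i) (c (a * s + b)) (dc (a * s + b)))] by exact: (cc _ h).
apply: filterS N => s [h1 h2 h3 h4]; split=> //.
  exact: is_derive_reparam (is_derive_affine a b s) h3.
have H := is_deriveZ a (is_derive_reparam (is_derive_affine a b s) h4).
by apply: (is_derive_eq H); rewrite geoaccZ scalerA expr2.
Qed.

Lemma geo_at_affine gam (a b t : R) : geo_at gam (a * t + b) -> geo_at (fun s => gam (a * s + b)) t.
Proof. by move=> [i [c [dc h]]]; do 3 eexists; exact: ggeo_affine h. Qed.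

Lemma repr_near gam i c dc t : repr gam i c dc t -> \forall s \near t, (ch i \o gam) s = c s.
Proof. by apply: filterS => s [h1 h2 _]; rewrite /= h2 ch_pt. Qed.

Lemma repr_derive1 gam i c dc t : repr gam i c dc t -> derive1 (ch i \o gam) t = dc t.
Proof.
move=> h; have [_ _ D] := nbhs_singleton h; have E := repr_near h.
by rewrite derive1E (near_eq_derive _ E); case: D.
Qed.

Lemma geo_at_base gam t : geo_at gam t -> exists c dc, ggeo gam (gbase (gam t)) c dc t.
Proof. by move=> [i [c [dc h]]]; do 2 eexists; exact: ggeo_change h (gbaseP (gam t)).2. Qed.

Lemma velocity_affine gam (a b t : R) : geo_at gam (a * t + b) ->
  velocity (fun s => gam (a * s + b)) t = a *: velocity gam (a * t + b).
Proof.
move=> /geo_at_base[c [dc h]]; rewrite /velocity /=.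
by rewrite (repr_derive1 (ggeo_repr (ggeo_affine h))) (repr_derive1 (ggeo_repr h)).
Qed.

Lemma velocity_near gam gam' t : (\forall s \near t, gam s = gam' s) -> velocity gam t = velocity gam' t.
Proof.
move=> E; rewrite /velocity (nbhs_singleton E) !derive1E; apply: near_eq_derive.
by apply: filterS E => s /= ->.
Qed.

Lemma geo_at_near gam gam' t : (\forall s \near t, gam s = gam' s) -> geo_at gam t -> geo_at gam' t.
Proof. by move=> E [i [c [dc h]]]; exists i, c, dc; apply: filterS2 E h => s -> []. Qed.

Lemma geo_at_cont gam t : geo_at gam t -> {for t, continuous gam}.
Proof.
move=> [i [c [dc h]]]; have [h1 h2 h3 _] := nbhs_singleton h.
have E : {near t, pt i \o c =1 gam} by apply: filterS h => s [_ ->].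
apply: (near_eq_continuous E).
by apply: (@continuous_comp _ _ _ c (pt i)); [exact: is_derive_continuous h3|exact: pt_continuous].
Qed.

Lemma christoffel_scale i y l a b : christoffel (fun y => r ^+ 2 *: gg i y) y l a b = christoffel (gg i) y l a b.
Proof.
have r2 : r ^+ 2 != 0 by rewrite expf_neq0 // gt_eqF.
rewrite /christoffel invmxZ ?gg_unit //; last first.
  by rewrite unitmxE detZ unitrM -unitmxE gg_unit andbT unitrX // unitfE.
congr (_ * _); apply: eq_bigr => m _; rewrite mxE.
have D a' b' (c' : 'I_n) : 'D_(delta_mx 0 c') (fun y => (r ^+ 2 *: gg i y) a' b') y = r ^+ 2 * pd c' (fun y => gg i y a' b') y.
  rewrite (_ : (fun y => _) = (fun y => r ^+ 2 * gg i y a' b')); last by apply/funext => x; rewrite mxE.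
  rewrite -/(pd c' _ y) pdM ?pd_cst ?mul0r ?addr0 //.
  exact: gg_differentiable.
rewrite !D -mulrDr -mulrBr mulrA [_^-1 * _]mulrC -mulrA mulrA; congr (_ * _).
by rewrite divfK.
Qed.

Lemma geodesic_of gam : (forall t, geo_at gam t) -> geodesic gam.
Proof.
move=> h; split=> [t|p t dp]; first exact: geo_at_cont.
have [i [c [dc hg]]] := h t; have {}hg := ggeo_change hg dp.
move: hg; set C := (_ \o _); set DC := (fun s => _) => hg.
have hr := ggeo_repr hg; have [_ _ D1 D2] := nbhs_singleton hg.
have N1 : \forall s \near t, derive1 (ch (gbase p) \o gam) s = DC s.
  by apply: filterS (nbhs_interior hr) => s; exact: repr_derive1.
have D2' : is_derive t (1 : R) (derive1 (ch (gbase p) \o gam)) (geoacc (gg (gbase p)) (C t) (DC t)).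
  by apply: near_eq_is_derive D2; apply: filterS N1 => s ->.
split.
- apply: filterS (nbhs_interior hr) => s hs; have [_ _ [D _]] := nbhs_singleton hs.
  have E := repr_near hs; apply/derivable1_diffP; apply: near_eq_differentiable E _.
  by apply/derivable1_diffP.
- by case: D2'.
- move=> k; rewrite derive1E; case: D2' => _ ->; rewrite mxE; congr (- _).
  apply: eq_bigr => a _; apply: eq_bigr => b _.
  by rewrite christoffel_scale (nbhs_singleton N1) (nbhs_singleton (repr_near hr)).
Qed.

Lemma geodesic_at gam t : geodesic gam -> geo_at gam t.
Proof.
move=> [cg hg]; pose p := gam t; set j := gbase p; exists j, (ch j \o gam), (derive1 (ch j \o gam)).
have N : \forall s \near t, ptdom j (gam s).
  exact: (cg t _ (open_nbhs_nbhs (conj (@open_ptdom _ _ _ G j) (gbaseP p).2))).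
apply: filterS N => s dp; have [h1 h2 h3] := hg p s dp; have [n1 n2] := pt_ch dp.
split; [exact: n1|by rewrite /= n2| |].
  by rewrite derive1E; apply: derivableP; exact: (nbhs_singleton h1).
have -> : geoacc (gg j) ((ch j \o gam) s) (derive1 (ch j \o gam) s) = derive1 (derive1 (ch j \o gam)) s.
  apply/rowP => k; rewrite h3 mxE; congr (- _).
  by apply: eq_bigr => a _; apply: eq_bigr => b _; rewrite christoffel_scale.
by rewrite derive1E; apply: derivableP.
Qed.

Lemma is_derive_row_mx a b (c1 : R -> 'rV[R]_a) (c2 : R -> 'rV[R]_b) (v1 : 'rV[R]_a) (v2 : 'rV[R]_b) t :
  is_derive t (1 : R) c1 v1 -> is_derive t (1 : R) c2 v2 ->
  is_derive t (1 : R) (fun s => row_mx (c1 s) (c2 s)) (row_mx v1 v2).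
Proof.
move=> h1 h2; apply: is_derive_coords => l; case: (split_ordP l) => l' ->.
  rewrite row_mxEl (_ : (fun s => _) = (fun s => c1 s 0 l')); first exact: is_derive_coord.
  by apply/funext => s; rewrite row_mxEl.
rewrite row_mxEr (_ : (fun s => _) = (fun s => c2 s 0 l')); first exact: is_derive_coord.
by apply/funext => s; rewrite row_mxEr.
Qed.

Hypothesis chr_ub : forall (i : G) l a b, ub T1 (fun _ (y : 'rV[R]_n) => christoffel (gg i) y l a b).

(** For a short time both coordinate velocities stay below [rho], where the cut-off is inactive: the
    two curves solve the same Lipschitz equation. *)
Lemma geo_unique_right gam gam' t : geo_at gam t -> geo_at gam' t -> gam t = gam' t ->
  velocity gam t = velocity gam' t -> exists2 e, 0 < e & forall s, t <= s < t + e -> gam s = gam' s.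
Proof.
move=> g1 g2 ep ev; set j := gbase (gam t).
have [c [dc h]] := geo_at_base g1; rewrite -/j in h.
have [c' [dc' h']] := geo_at_base g2; rewrite -ep -/j in h'.
have [n1 n2 n3 n4] := nbhs_singleton h; have [m1 m2 m3 m4] := nbhs_singleton h'.
have ec : c t = c' t := pt_inj n1 m1 (etrans (esym n2) (etrans ep m2)).
have ed : dc t = dc' t.
  rewrite -(repr_derive1 (ggeo_repr h)) -(repr_derive1 (ggeo_repr h')).
  by move: ev; rewrite /velocity /= -ep.
pose rho := en (dc t) + 1; have rho0 : 0 <= rho by rewrite addr_ge0 // en_ge0.
have near_rho (d : R -> 'rV[R]_n) a : is_derive t (1 : R) d a -> d t = dc t -> \forall s \near t, en (d s) < rho.
  move=> hd e; have cd : {for t, continuous (fun s => en (d s))}.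
    by apply: (@continuous_comp _ _ _ d en); [exact: is_derive_continuous hd|exact: en_continuous].
  by apply: (cd [set x | x < rho]); apply: lt_nbhsl; rewrite e ltrDl.
have [e e0 he] := near_ball (near_and (near_and h h') (near_and (near_rho _ _ n4 erefl) (near_rho _ _ m4 (esym ed)))).
exists e; first exact: e0.
move=> s /andP[ts se].
pose F := geofield (gg j) rho; have LF : LB T1 (fun _ => F) by exact: LB_geofield.
have sol u : t <= u <= s -> [/\ gam u = pt j (c u), gam' u = pt j (c' u),
    is_derive u (1 : R) (fun s => row_mx (c s) (dc s)) (F (row_mx (c u) (dc u))) &
    is_derive u (1 : R) (fun s => row_mx (c' s) (dc' s)) (F (row_mx (c' u) (dc' u)))].
  move=> /andP[tu us]; have [|[[q1 q2 q3 q4] [w1 w2 w3 w4]] [r1 r2]] := he u.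
    by rewrite ltr_norml; apply/andP; split; lra.
  split; [exact: q2|exact: w2| |]; rewrite /F /geofield row_mxKl row_mxKr.
    by rewrite (cutv_id rho0 (ltW r1)); exact: is_derive_row_mx q3 q4.
  by rewrite (cutv_id rho0 (ltW r2)); exact: is_derive_row_mx w3 w4.
have E : row_mx (c s) (dc s) = row_mx (c' s) (dc' s).
  have U := @LB_unique R _ F (fun s => row_mx (c s) (dc s)) (fun s => row_mx (c' s) (dc' s)) t s LF ts.
  apply: U.
    by move=> u hu; have [_ _ a1 a2] := sol u hu; split; [exact: a1|exact: a2].
  by rewrite ec ed.
have [-> -> _ _] := sol s (introT andP (conj ts (lexx s))).
by have := congr1 lsubmx E; rewrite !row_mxKl => ->.
Qed.

Lemma geo_unique_near gam gam' t : geo_at gam t -> geo_at gam' t -> gam t = gam' t ->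
  velocity gam t = velocity gam' t -> \forall s \near t, gam s = gam' s.
Proof.
move=> g1 g2 ep ev; have [e e0 he] := geo_unique_right g1 g2 ep ev.
(* The left side follows from the right one by reversing time about [t]. *)
have et : -1 * t + 2 * t = t by ring.
have [||||e' e'0 he'] := @geo_unique_right (fun s => gam (-1 * s + 2 * t)) (fun s => gam' (-1 * s + 2 * t)) t _ _ _.
- by apply: geo_at_affine; rewrite et.
- by apply: geo_at_affine; rewrite et.
- by rewrite et.
- rewrite velocity_affine; last by rewrite et.
  rewrite velocity_affine; last by rewrite et.
  by rewrite et ev.
apply/nbhs_ballP; exists (Num.min e e') => /=; first by rewrite lt_min e0.
move=> s; rewrite -ball_normE /= lt_min => /andP[h1 h2].
have [ts|st] := leP t s.
  by apply: he; rewrite ts; move: h1; rewrite ltr_distl => /andP[h1 h1']; lra.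
have := he' (2 * t - s); rewrite (_ : -1 * (2 * t - s) + 2 * t = s); last by ring.
by apply; move: h2; rewrite ltr_distl => /andP[h2 h2']; apply/andP; split; lra.
Qed.

Lemma left_near a t (Q : R -> Prop) : a < t -> (\forall s \near t, Q s) -> exists2 s, a < s < t & Q s.
Proof.
move=> at_ /nbhs_ballP[e /= e0 he]; pose s := Num.max ((a + t) / 2) (t - e / 2).
have s1 : t - e / 2 <= s by rewrite le_max lexx orbT.
have s2 : s < t by rewrite gt_max; apply/andP; split; lra.
have s3 : (a + t) / 2 <= s by rewrite le_max lexx.
exists s; first by rewrite s2 andbT; lra.
by apply: he; rewrite -ball_normE /= ltr_norml; apply/andP; split; lra.
Qed.

(** Continuous induction. At a limit time the positions agree because the manifold is separated; if
    the velocities differed they would already differ shortly before, where the curves coincide. *)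
Lemma geo_unique gam gam' T : (forall t, 0 <= t <= T -> geo_at gam t) -> (forall t, 0 <= t <= T -> geo_at gam' t) ->
  gam 0 = gam' 0 -> velocity gam 0 = velocity gam' 0 ->
  forall t, 0 <= t <= T -> gam t = gam' t /\ velocity gam t = velocity gam' t.
Proof.
move=> g1 g2 ep ev; apply: real_induction; first by split.
- move=> t /andP[t0 tT] /(_ t); rewrite t0 lexx => /(_ isT)[e1 e2].
  have t0T : 0 <= t <= T by rewrite t0 ltW.
  have [e /= e0 he] := (nbhs_ballP _ _).1 (nbhs_interior (geo_unique_near (g1 t t0T) (g2 t t0T) e1 e2)).
  exists e; first exact: e0.
  move=> s /andP[ts se] _.
  have N : \forall u \near s, gam u = gam' u.
    by apply: he; rewrite -ball_normE /= ltr_norml; apply/andP; split; lra.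
  by split; [exact: nbhs_singleton N|exact: velocity_near].
move=> t /andP[t0 tT] IH; have t0T : 0 <= t <= T by rewrite tT ltW.
have gt1 := g1 t t0T; have gt2 := g2 t t0T.
have E : gam t = gam' t.
  apply: (@carr_hausdorff _ _ _ G) => A B hA hB.
  have N : \forall s \near t, A (gam s) /\ B (gam' s) := near_and (geo_at_cont gt1 hA) (geo_at_cont gt2 hB).
  have [s /andP[s0 st] [As Bs]] := left_near t0 N.
  exists (gam s); split; [exact: As|].
  by rewrite (IH s _).1 ?st ?ltW //; exact: Bs.
split; first exact: E.
have [c [dc h]] := geo_at_base gt1; have [c' [dc' h']] := geo_at_base gt2; rewrite -E in h'.
set j := gbase (gam t) in h h'.
have -> : velocity gam t = dc t by exact: repr_derive1 (ggeo_repr h).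
have -> : velocity gam' t = dc' t by rewrite -(repr_derive1 (ggeo_repr h')) /velocity -E.
apply/eqP; rewrite -subr_eq0; apply/eqP/en_eq0/eqP; rewrite eq_le en_ge0 andbT leNgt; apply/negP => d0.
have [_ _ _ k1] := nbhs_singleton h; have [_ _ _ k2] := nbhs_singleton h'.
have cd : {for t, continuous (fun s => en (dc s - dc' s))}.
  apply: (@continuous_comp _ _ _ (fun s => dc s - dc' s) en); last exact: en_continuous.
  by apply: continuousB; [exact: is_derive_continuous k1|exact: is_derive_continuous k2].
have N0 : \forall s \near t, 0 < en (dc s - dc' s) := cd [set x | 0 < x] (lt_nbhsr d0).
have N := near_and N0 (near_and (nbhs_interior h) (nbhs_interior h')).
have [s /andP[s0 st] [ds [hs hs']]] := left_near t0 N.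
move: ds => /=; rewrite -(repr_derive1 (ggeo_repr hs)) -(repr_derive1 (ggeo_repr hs')).
suff -> : derive1 (ch j \o gam) s = derive1 (ch j \o gam') s by rewrite subrr en0 ltxx.
rewrite !derive1E; apply: near_eq_derive.
have N' : \forall u \near s, 0 < u < t.
  by near=> u; apply/andP; split; near: u; [exact: lt_nbhsr|exact: lt_nbhsl].
by apply: filterS N' => u /andP[u0 ut]; rewrite /= (IH u _).1 // ut ltW.
Unshelve. all: by end_near. Qed.

Lemma speed_constant gam T : 0 <= T -> (forall t, 0 <= t <= T -> geo_at gam t) -> speed gam T = speed gam 0.
Proof.
move=> T0 h; have D t : 0 <= t <= T -> is_derive t (1 : R) (fun t => speed gam t ^+ 2) 0.
  move=> tT; have [i [c [dc hg]]] := h t tT; have [h1 h2 h3 h4] := nbhs_singleton hg.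
  have H := is_deriveM (is_derive_cst (r ^+ 2) t 1) (energy_derive (fun a b y => gg_differentiable i a b y) (gg_unit i _) (fun a b x => gg_symE i a b x) h3 h4).
  have E : \forall s \near t, r ^+ 2 * dot (dc s *m gg i (c s)) (dc s) = speed gam s ^+ 2.
    apply: filterS (nbhs_interior hg) => s hs; rewrite /speed (repr_velocity (ggeo_repr hs)) /spd exprMn sqr_sqrtr ?quad_dot //.
    by rewrite -quad_dot quad_ge0.
  apply: near_eq_is_derive E _; apply: (is_derive_eq H).
  by rewrite scaler0 add0r scaler0.
have D0 t : 0 <= t <= T -> is_derive t (1 : R) (cst (0 : R)) 0 by move=> _; exact: is_derive_cst.
have e' : speed gam T ^+ 2 - speed gam 0 ^+ 2 = 0 - 0 := derive_eq T0 D D0.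
have e : speed gam T ^+ 2 = speed gam 0 ^+ 2 by apply/eqP; rewrite -subr_eq0 e' subr0.
have := speed_ge0 gam T; have := speed_ge0 gam 0; move: e; clear.
move: (speed gam T) (speed gam 0) => a b e b0 a0; apply/eqP.
by rewrite -(eqrXn2 (n := 2)) // e.
Qed.

End Geodesics.

(** * Geodesics inside one chart and their extension to the whole line *)

Section ChartGeodesics.
Context {R : realType}.
Variables (n : nat) (g : 'rV[R]_n -> 'M[R]_n) (K : R).
Local Notation T1 := (fun _ : unit => True).
Hypothesis chr_ub : forall l a b, ub T1 (fun _ (y : 'rV[R]_n) => christoffel g y l a b).
Hypotheses (K0 : 0 <= K) (chr_le : forall l a b y, `|christoffel g y l a b| <= K).
Hypothesis K_small : n%:R * (n%:R * (n%:R * (K * 4))) <= 1 / 200.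

Local Notation F := (geofield g 1).

Lemma LB_F : LB T1 (fun _ => F).
Proof. by apply: LB_geofield => //; rewrite ler01. Qed.

Lemma gflow_exists : exists Phi : 'rV[R]_(n + n) -> R -> 'rV[R]_(n + n),
  forall w, Phi w 0 = w /\ forall t, is_derive t (1 : R) (Phi w) (F (Phi w t)).
Proof.
have [L L0 hL] := LB_bounds LB_F.
have L1 : 0 < (n + n)%:R * L + 1 by rewrite ltr_wpDl // mulr_ge0 // ltW.
have lipF x y : `|F x - F y| <= ((n + n)%:R * L + 1) * `|x - y|.
  by apply: (le_trans (LB_lip LB_F L0 hL x y)); rewrite ler_wpM2r // lerDl.
by have [Phi hPhi] := choice (flow_exists L1 lipF); exists Phi.
Qed.

Definition gflow := projT1 (cid gflow_exists).

Lemma gflowP w : gflow w 0 = w /\ forall t, is_derive t (1 : R) (gflow w) (F (gflow w t)).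
Proof. exact: (projT2 (cid gflow_exists)). Qed.

Definition gpos y v t := lsubmx (gflow (row_mx y v) t).
Definition gvel y v t := rsubmx (gflow (row_mx y v) t).

Lemma gpos0 y v : gpos y v 0 = y.
Proof. by rewrite /gpos (gflowP _).1 row_mxKl. Qed.

Lemma gvel0 y v : gvel y v 0 = v.
Proof. by rewrite /gvel (gflowP _).1 row_mxKr. Qed.

Lemma gpos_derive y v t : is_derive t (1 : R) (gpos y v) (gvel y v t).
Proof. by have := is_derive_lsubmx ((gflowP (row_mx y v)).2 t); rewrite row_mxKl. Qed.

Lemma gvel_derive y v t : is_derive t (1 : R) (gvel y v) (geoacc g (gpos y v t) (cutv 1 (gvel y v t))).
Proof. by have := is_derive_rsubmx ((gflowP (row_mx y v)).2 t); rewrite row_mxKr. Qed.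

(** The cut-off velocity has norm at most 2, whence the factor 4 in [K_small]. *)
Lemma acc_le y v : en (geoacc g y (cutv 1 v)) <= 1 / 200.
Proof.
apply: le_trans K_small; apply: (le_trans (en_le_norm _)); rewrite ler_wpM2l //.
apply: (le_trans (geoacc_bound _ K0 (fun l a b => chr_le l a b y))).
rewrite !ler_wpM2l //; have := cutv_bound (m := n) ler01 v; have := en_ge0 (cutv 1 v).
move: (en _) => x x0 x2; have : x * x <= 2 * 2 by rewrite ler_pM //; lra.
by rewrite expr2; lra.
Qed.

Lemma gvel_close y v t : `|t| <= 101 / 100 -> en (gvel y v t - v) <= 1 / 100.
Proof.
move=> ht; have H a b : a <= b -> en (gvel y v b - gvel y v a) <= 1 / 200 * b - 1 / 200 * a.
  move=> ab; have D1 s : a <= s <= b -> is_derive s (1 : R) (gvel y v) (geoacc g (gpos y v s) (cutv 1 (gvel y v s))).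
    by move=> _; exact: gvel_derive.
  have D2 s : a <= s <= b -> is_derive s (1 : R) (fun s => 1 / 200 * s) (1 / 200).
    by move=> _; have H := is_deriveM (is_derive_cst (1 / 200 : R) s 1) (is_derive_id s (1 : R)); apply: (is_derive_eq H); rewrite scaler0 addr0 /GRing.scale /= mulr1.
  exact: (en_derive_le ab D1 D2 (fun s _ => acc_le _ _)).
move: ht; rewrite ler_norml => /andP[h1 h2]; have [t0|t0] := leP 0 t.
  by have := H 0 t t0; rewrite gvel0; lra.
by have := H t 0 (ltW t0); rewrite gvel0 enB; lra.
Qed.

Lemma gvel_le y v t : en v <= 51 / 100 -> `|t| <= 101 / 100 -> en (gvel y v t) <= 52 / 100.
Proof.
move=> hv ht; have := gvel_close y v ht; have := en_triangle (gvel y v t - v) v.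
by rewrite subrK; lra.
Qed.

(** A vector of Riemannian norm at most [r / 2] has Euclidean norm at most 51/100, and its speed
    stays below 52/100. Starting within 1/20 of the centre, the geodesic remains within 58/100 <
    3/5. Times slightly beyond 1 provide a neighbourhood of the end time. *)
Lemma gpos_close y v t : en v <= 51 / 100 -> `|t| <= 101 / 100 -> en (gpos y v t - y) <= 53 / 100.
Proof.
move=> hv ht; have H a b : a <= b -> -(101/100) <= a -> b <= 101/100 -> en (gpos y v b - gpos y v a) <= 52 / 100 * b - 52 / 100 * a.
  move=> ab ha hb; have D1 s : a <= s <= b -> is_derive s (1 : R) (gpos y v) (gvel y v s).
    by move=> _; exact: gpos_derive.
  have D2 s : a <= s <= b -> is_derive s (1 : R) (fun s => 52 / 100 * s) (52 / 100).
    by move=> _; have H := is_deriveM (is_derive_cst (52 / 100 : R) s 1) (is_derive_id s (1 : R)); apply: (is_derive_eq H); rewrite scaler0 addr0 /GRing.scale /= mulr1.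
  apply: (en_derive_le ab D1 D2) => s /andP[s1 s2]; apply: gvel_le => //.
  by rewrite ler_norml; apply/andP; split; lra.
move: ht; rewrite ler_norml => /andP[h1 h2]; have [t0|t0] := leP 0 t.
  by have := H 0 t t0; rewrite gpos0; lra.
by have := H t 0 (ltW t0); rewrite gpos0 enB; lra.
Qed.

Lemma gvel_geodesic y v t : en v <= 51 / 100 -> `|t| <= 101 / 100 ->
  is_derive t (1 : R) (gvel y v) (geoacc g (gpos y v t) (gvel y v t)).
Proof.
by move=> hv ht; have := gvel_derive y v t; rewrite cutv_id // (le_trans (gvel_le y hv ht)) //; lra.
Qed.

End ChartGeodesics.

Section GeodesicExistence.
Context {R : realType}.
Variables (n : nat) (kappa : R) (G : geom n kappa).
Hypothesis kappa_small : n%:R ^+ 2 * kappa <= 1 / 100.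
Variable r : R.
Hypothesis r0 : 0 < r.
Local Notation M := (@mfd R n kappa G kappa_small r r0).
Local Notation T1 := (fun _ : unit => True).
Implicit Types (i j : G) (p q x : M) (y z v : 'rV[R]_n) (s t : R) (gam : R -> M).
Hypothesis chr_ub : forall (i : G) l a b, ub T1 (fun _ (y : 'rV[R]_n) => christoffel (gg i) y l a b).
Variable K : R.
Hypotheses (K0 : 0 <= K) (chr_le : forall (i : G) l a b y, `|christoffel (gg i) y l a b| <= K).
Hypothesis K_small : n%:R * (n%:R * (n%:R * (K * 4))) <= 1 / 200.

Definition cpos i := gpos (chr_ub i).
Definition cvel i := gvel (chr_ub i).

Lemma tnorm_en x v : tnorm x v <= r / 2 -> en v <= 51 / 100.
Proof.
rewrite tnorm_spd => h; have := en_le_spd kappa_small r0 (gbase x) (ch (gbase x) x) v.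
have n0 := nu_ge0 (gbase x); have n1 := kappa_small; move: (n%:R ^+ 2 * kappa) n0 n1 => u u0 u1.
have := spd_ge0 r0 (gbase x) (ch (gbase x) x) v; move: (spd _ _ _ _) h => d h d0 h2.
rewrite -(ler_pM2l r0); apply: (le_trans h2).
have : (1 + u) * d <= (1 + 1 / 100) * (r / 2) by rewrite ler_pM //; lra.
by lra.
Qed.

Lemma chart_geodesic i y v t : en y < 1 / 20 -> en v <= 51 / 100 -> `|t| < 101 / 100 ->
  ggeo (fun s => pt i (cpos i y v s) : M) i (cpos i y v) (cvel i y v) t.
Proof.
move=> hy hv ht; have N : \forall s \near t, `|s| < 101 / 100.
  have c : {for t, continuous (fun s : R => `|s|)} by exact: norm_continuous.
  exact: (c [set u | u < 101 / 100] (lt_nbhsl ht)).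
apply: filterS N => s hs; have hs' := ltW hs; split=> //.
- have := gpos_close (chr_ub i) K0 (chr_le i) K_small y hv hs'.
  have := en_triangle (cpos i y v s - y) y; rewrite subrK -/(cpos i); lra.
- exact: gpos_derive.
- exact: (gvel_geodesic (chr_ub i) K0 (chr_le i) K_small y hv hs').
Qed.

Definition local_geo x v : R -> M := fun s => pt (gbase x) (cpos (gbase x) (ch (gbase x) x) v s).

Lemma local_geoP x v : tnorm x v <= r / 2 -> [/\ local_geo x v 0 = x, velocity (local_geo x v) 0 = v &
  forall t, `|t| < 101 / 100 -> geo_at (local_geo x v) t].
Proof.
move=> hv; have e0 : local_geo x v 0 = x.
  by rewrite /local_geo /cpos gpos0; exact: (pt_ch (gbaseP x).2).2.
have h t (ht : `|t| < 101 / 100) := chart_geodesic (gbase x) (gbaseP x).1 (tnorm_en hv) ht.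
split=> [//||t ht]; last by do 3 eexists; exact: h.
rewrite /velocity /= e0; have h0 := h 0; rewrite normr0 in h0.
by rewrite (repr_derive1 (ggeo_repr (h0 _))) ?/cvel ?gvel0 //; lra.
Qed.

Definition geo_from x v gam T := [/\ gam 0 = x, velocity gam 0 = v & forall t, 0 <= t <= T -> geo_at gam t].

(** The speed is constant, so the velocity at [T] satisfies the same bound and a chart geodesic of
    the same duration starts there; uniqueness near [T] makes the junction a geodesic. *)
Lemma geo_extend x v gam T : 0 <= T -> tnorm x v <= r / 2 -> geo_from x v gam T ->
  exists gam', geo_from x v gam' (T + 1 / 2).
Proof.
move=> T0 hv [g0 gv g]; have sT := speed_constant T0 g.
rewrite {2}/speed g0 gv in sT.
have hv' : tnorm (gam T) (velocity gam T) <= r / 2 by rewrite -/(speed gam T) sT.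
have [l0 lv lg] := local_geoP hv'; set h := local_geo _ _ in l0 lv lg.
pose h' s := h (1 * s - T).
have eT : 1 * T - T = 0 by ring.
have hg t : `|1 * t - T| < 101 / 100 -> geo_at h' t by move=> ht; apply: geo_at_affine; exact: lg.
have aT : geo_at h' T by apply: hg; rewrite eT normr0; lra.
have TT : 0 <= T <= T by rewrite T0 lexx.
have ev : velocity gam T = velocity h' T.
  rewrite /h' velocity_affine; first by rewrite eT lv scale1r.
  by apply: lg; rewrite eT normr0; lra.
have ep : gam T = h' T by rewrite /h' eT l0.
have N := geo_unique_near chr_ub (g T TT) aT ep ev.
have [e e0 he] := near_ball N.
pose gam' s := if s <= T then gam s else h' s.
have near_gam t : t < T + e -> (t <= T) -> \forall s \near t, gam s = gam' s.
  move=> te tT; have : \forall s \near t, s < T + e by exact: lt_nbhsl.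
  apply: filterS => s se; rewrite /gam'; case: (leP s T) => [//|Ts].
  by apply: he; rewrite ltr_norml; apply/andP; split; lra.
exists gam'; split.
- by rewrite /gam' T0.
- rewrite -gv; apply: velocity_near; apply: filterS (near_gam 0 _ T0) => [s -> //|]; lra.
- move=> t /andP[t0 tT]; have [tT'|Tt] := leP t T.
    have tn : t < T + e by lra.
    by apply: geo_at_near (near_gam t tn tT') _; apply: g; rewrite t0.
  have Nt : \forall s \near t, h' s = gam' s.
    have : \forall s \near t, T < s by exact: lt_nbhsr.
    by apply: filterS => s Ts; rewrite /gam' leNgt Ts.
  by apply: geo_at_near Nt _; apply: hg; rewrite mul1r ltr_norml; apply/andP; split; lra.
Qed.

Lemma geo_forward x v : tnorm x v <= r / 2 -> forall k : nat, exists gam, geo_from x v gam (k%:R / 2).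
Proof.
move=> hv; elim=> [|k [gam IH]].
  have [l0 lv lg] := local_geoP hv; exists (local_geo x v); split=> // t; rewrite mul0r -eq_le => /eqP <-.
  by apply: lg; rewrite normr0; lra.
have k0 : 0 <= k%:R / 2 :> R by rewrite divr_ge0.
have [gam' h] := geo_extend k0 hv IH; exists gam'.
by rewrite -natr1 mulrDl.
Qed.

Lemma spd_opp x v : tnorm x (- v) = tnorm x v.
Proof. by rewrite !tnorm_spd spdN. Qed.

(** [exp_map] asks for geodesics on the whole line. The forward geodesics on longer and longer
    intervals agree, and the past is the reversed future of the opposite vector. *)
Lemma geodesic_exists x v : tnorm x v <= r / 2 -> exists gam, [/\ geodesic gam, gam 0 = x & velocity gam 0 = v].
Proof.
move=> hv; have [gp hp] := choice (geo_forward hv).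
have hv' : tnorm x (- v) <= r / 2 by rewrite spd_opp.
have [gm hm] := choice (geo_forward hv').
(* Enough half-units to go beyond [|t| + 1], so that one piece covers a neighbourhood of [t]. *)
pose N (t : R) : nat := Num.bound (2 * `|t| + 2).
have hN t : `|t| + 1 <= (N t)%:R / 2.
  have h0 : 0 <= 2 * `|t| + 2 by rewrite addr_ge0 // mulr_ge0.
  by have := archi_boundP h0; rewrite -/(N t); lra.
pose gam t := if 0 <= t then gp (N t) t else gm (N t) (- t).
have agree w (f : nat -> R -> M) : (forall k, geo_from x w (f k) (k%:R / 2)) -> forall k l t, 0 <= t -> t <= k%:R / 2 -> t <= l%:R / 2 -> f k t = f l t.
  move=> hf k l t t0 tk tl; have [k0 kv kg] := hf k; have [l0 lv lg] := hf l.
  have [|||||e _] := @geo_unique R n kappa G kappa_small r r0 chr_ub (f k) (f l) t _ _ _ _ t.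
  - by move=> s /andP[s0 st]; apply: kg; rewrite s0 (le_trans st).
  - by move=> s /andP[s0 st]; apply: lg; rewrite s0 (le_trans st).
  - by rewrite k0 l0.
  - by rewrite kv lv.
  - by rewrite t0 lexx.
  - exact: e.
have pos t : 0 < t -> \forall s \near t, gp (N t) s = gam s.
  move=> t0; have N1 : \forall s \near t, 0 < s by exact: lt_nbhsr.
  have N2 : \forall s \near t, s < t + 1 by apply: lt_nbhsl; rewrite ltrDl.
  apply: filterS2 N1 N2 => s s0 st; rewrite /gam (ltW s0); apply: (agree v) => //; first exact: ltW.
    by have := hN t; rewrite gtr0_norm //; lra.
  by have := hN s; rewrite gtr0_norm //; lra.
have neg t : t < 0 -> \forall s \near t, gm (N t) (-1 * s + 0) = gam s.
  move=> t0; have N1 : \forall s \near t, s < 0 by exact: lt_nbhsl.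
  have N2 : \forall s \near t, t - 1 < s by apply: lt_nbhsr; lra.
  apply: filterS2 N1 N2 => s s0 st; rewrite /gam leNgt s0 /= mulN1r addr0; apply: (agree (- v)) => //; first by lra.
    by have := hN t; rewrite ltr0_norm //; lra.
  by have := hN s; rewrite ltr0_norm //; lra.
have z0 k : 0 <= (0 : R) <= k%:R / 2 by rewrite lexx divr_ge0.
have zero : \forall s \near (0 : R), gp 2%N s = gam s.
  have [p0 pv pg] := hp 2%N; have [m0 mv mg] := hm 2%N.
  have gN : geo_at (gm 2%N) (-1 * 0 + 0) by rewrite mulr0 addr0; exact: mg.
  have U : \forall s \near (0 : R), gp 2%N s = gm 2%N (-1 * s + 0).
    apply: (geo_unique_near chr_ub (pg 0 (z0 _)) (geo_at_affine gN)).
      by rewrite mulr0 addr0 p0 m0.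
    by rewrite (velocity_affine gN) mulr0 addr0 mv pv scaleN1r opprK.
  have N1 : \forall s \near (0 : R), `|s| < 1.
    have c : {for (0 : R), continuous (fun s : R => `|s|)} by exact: norm_continuous.
    by apply: (c [set u | u < 1]); apply: lt_nbhsl; rewrite normr0.
  apply: filterS2 U N1 => s es s1; have s2 := hN s; rewrite /gam; case: (leP 0 s) => s0.
    by apply: (agree v) => //; rewrite ?ger0_norm // in s1 s2 *; lra.
  rewrite es mulN1r addr0; apply: (agree (- v)) => //; rewrite ?ltr0_norm // in s1 s2 *; lra.
exists gam; split.
- apply: geodesic_of => t; have [t0|t0|<-] := ltgtP 0 t.
  + apply: geo_at_near (pos t t0) _; have [_ _ pg] := hp (N t); apply: pg.
    by have := hN t; rewrite gtr0_norm //; lra.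
  + apply: geo_at_near (neg t t0) _; have [_ _ mg] := hm (N t); apply: geo_at_affine; apply: mg.
    by have := hN t; rewrite ltr0_norm //; lra.
  + by apply: geo_at_near zero _; have [_ _ pg] := hp 2%N; exact: pg.
- by rewrite -(nbhs_singleton zero); have [] := hp 2%N.
- by rewrite -(velocity_near zero); have [] := hp 2%N.
Qed.

Lemma exp_mapE x v : tnorm x v <= r / 2 ->
  exp_map x v = pt (gbase x) (cpos (gbase x) (ch (gbase x) x) v 1).
Proof.
move=> hv; rewrite /exp_map; have [gam [hg h0 hv0]] := geodesic_exists hv.
case: xgetP => [q _ [gam' [hg' h0' hv' <-]]|/(_ (gam 1))]; last by case; exists gam.
have [l0 lv lg] := local_geoP hv; rewrite -/(local_geo x v 1).
have [|||||e _] := @geo_unique R n kappa G kappa_small r r0 chr_ub gam' (local_geo x v) 1 _ _ _ _ 1.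
- by move=> t _; exact: geodesic_at.
- by move=> t /andP[t0 t1]; apply: lg; rewrite ger0_norm //; lra.
- by rewrite h0' l0.
- by rewrite hv' lv.
- by rewrite ler01 lexx.
- exact: e.
Qed.

End GeodesicExistence.

(** * The exponential map and the injectivity radius *)

Section ExpNearIdentity.
Context {R : realType}.
Local Notation T1 := (fun _ : unit => True).

Lemma flow_variation m (F : 'rV[R]_m -> 'rV[R]_m) (Phi : 'rV[R]_m -> R -> 'rV[R]_m) x : LB T1 (fun _ => F) ->
  (forall x, Phi x 0 = x /\ forall t, is_derive t (1 : R) (Phi x) (F (Phi x t))) ->
  exists xi : 'I_m -> R -> 'rV[R]_m, [/\ forall i, xi i 0 = delta_mx 0 i,
    forall i (t : R), 0 <= t <= 1 -> is_derive t (1 : R) (xi i) (xi i t *m jac F (Phi x t)),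
    differentiable (fun y => Phi y 1) x & forall i j, pd i (fun y => Phi y 1 0 j) x = xi i 1 0 j].
Proof.
move=> LF flowP; have [K K0 hK] := LB_bounds LF; pose V := varfield F K.
have LV : LB T1 (fun _ => V) by exact: LB_varfield.
have [K' K'0 hK'] := LB_bounds LV.
have L0 : 0 < (m + m)%:R * K' + 1 by rewrite ltr_wpDl // mulr_ge0 // ltW.
have lipV y z : `|V y - V z| <= ((m + m)%:R * K' + 1) * `|y - z|.
  by apply: (le_trans (LB_lip LV K'0 hK' y z)); rewrite ler_wpM2r // lerDl.
have [Psi hPsi] := choice (flow_exists L0 lipV).
pose xi i (s : R) := rsubmx (Psi (row_mx x (delta_mx 0 i)) s).
have xi0 i : xi i 0 = delta_mx 0 i by rewrite /xi (hPsi _).1 row_mxKr.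
have hxi i (t : R) : 0 <= t <= 1 -> is_derive t (1 : R) (xi i) (xi i t *m jac F (Phi x t)).
  move=> ht; have [W0 hW] := hPsi (row_mx x (delta_mx 0 i)).
  by have [_ H] := varflow LF K0 hK flowP W0 hW ht; exact: H.
have [d e] := variation_deriv LF K0 hK flowP xi0 hxi.
by exists xi.
Qed.

Lemma abs_derive_le (f df : R -> R) (c : R) : (forall t : R, 0 <= t <= 1 -> is_derive t (1 : R) f (df t)) ->
  (forall t : R, 0 <= t <= 1 -> `|df t| <= c) -> forall t : R, 0 <= t <= 1 -> `|f t - f 0| <= c.
Proof.
move=> hf hc t /andP[t0 t1].
have sub s : 0 <= s <= t -> 0 <= s <= 1 by move=> /andP[-> /le_trans ->].
have D s : 0 <= s <= t -> is_derive s (1 : R) (fun s => c * s) c.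
  by move=> _; have H := is_deriveM (is_derive_cst c s 1) (is_derive_id s (1 : R)); apply: (is_derive_eq H); rewrite scaler0 addr0 /GRing.scale /= mulr1.
have D1 s : 0 <= s <= t -> is_derive s (1 : R) f (df s) by move=> /sub; exact: hf.
have D2 s : 0 <= s <= t -> is_derive s (1 : R) (fun s => - f s) (- df s) by move=> hs; exact: is_deriveN (D1 s hs).
have l1 s : 0 <= s <= t -> df s <= c by move=> /sub/hc/(le_trans (ler_norm _)).
have l2 s : 0 <= s <= t -> - df s <= c by move=> /sub/hc; apply: le_trans; rewrite -normrN ler_norm.
have := derive_le t0 D1 D l1; have := derive_le t0 D2 D l2; rewrite mulr0 subr0 => h2 h1.
have c0 : 0 <= c by have := hc 0; rewrite lexx ler01 => /(_ isT); exact: le_trans.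
have : c * t <= c by rewrite ler_piMr.
by rewrite ler_norml; move: (c * t) (f t) (f 0) h1 h2 => u a b h1 h2 h3; apply/andP; split; lra.
Qed.

Variable n : nat.

Lemma acceleration_small : exists eta K : R, [/\ 0 < eta, 0 < K & forall (kappa : R) (G : geom n kappa), 0 < kappa <= eta ->
  forall (i : G) l a w, `|pd a (fun w => geofield (gg i) 1 w 0 (rshift n l)) w| <= K * kappa].
Proof.
have [eta eta0 H] := @ubk_christoffel_small R n.
have Hl l : ubk (cgD eta) 1 (fun p (w : 'rV[R]_(n + n)) => (cgk p)^-1 * geofield (gg (cgi p)) 1 w 0 (rshift n l)).
  apply: (@ubk_ext _ _ _ _ _ (fun p w => - \sum_(i <- index_enum 'I_n) \sum_(j <- index_enum 'I_n)
     ((cgk p)^-1 * christoffel (gg (cgi p)) (lsubmx w) l i j) * (cutv 1 (rsubmx w) 0 i * cutv 1 (rsubmx w) 0 j))).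
    move=> p _ w; rewrite /geofield row_mxEr mxE mulrN mulr_sumr; congr (- _).
    symmetry; apply: eq_bigr => i _; rewrite mulr_sumr; apply: eq_bigr => j _; exact: mulrA.
  have hc i : ubk (cgD (n:=n) eta) 1 (fun _ (w : 'rV[R]_(n + n)) => cutv 1 (rsubmx w) 0 i).
    by apply: (@ubk_comp _ _ _ _ _ _ (fun _ xi => cutv 1 xi 0 i) (fun _ w => rsubmx w)); [exact: ub_cutv|exact: LBk_rsubmx].
  apply: ubkN; apply: ubk_sum => i; apply: ubk_sum => j; apply: ubkM; last by apply: ubkM; exact: hc.
  by apply: (@ubk_comp _ _ _ _ _ _ (fun p y => (cgk p)^-1 * christoffel (gg (cgi p)) y l i j) (fun _ w => lsubmx w)); [exact: H|exact: LBk_lsubmx].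
have [K hK] := choice Hl; pose L := 1 + \sum_l `|K l|; have L0 : 0 < L by rewrite ltr_pwDl // sumr_ge0.
exists eta, L; split=> // kappa G k_ i l a w; have k0 : 0 < kappa by case/andP: k_.
have [_ [df /(_ a) [hb _]]] := hK l (ChartOfGeom i) k_.
have e : pd a (fun w => geofield (gg i) 1 w 0 (rshift n l)) w = kappa * pd a (fun w => kappa^-1 * geofield (gg i) 1 w 0 (rshift n l)) w.
  rewrite -[LHS]add0r -[X in X + _](mul0r (kappa^-1 * geofield (gg i) 1 w 0 (rshift n l))) -(pd_cst kappa a w).
  rewrite [RHS](_ : _ = pd a (fun w => kappa * (kappa^-1 * geofield (gg i) 1 w 0 (rshift n l))) w).
    rewrite pd_cst mul0r add0r; congr (pd a _ w); apply/funext => u.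
    by rewrite mulrA mulfV ?gt_eqF // mul1r.
  by rewrite pdM ?pd_cst ?mul0r ?addr0 //; exact: df.
rewrite e normrM gtr0_norm // mulrC ler_pM2r // (le_trans (hb w)) // (le_trans (ler_norm _)) //.
by rewrite /L (bigD1 l) //= addrCA lerDl addr_ge0 // sumr_ge0.
Qed.

(** [z] is the variation of the geodesic flow when the initial velocity moves along the axis [a].
    Its velocity part has derivative O(kappa), hence stays within [eps] of the unit vector; its
    position part starts at 0 and is the integral of the velocity part, hence ends within [eps] of
    the unit vector. *)
Lemma exp_near_identity (eps : R) : 0 < eps -> exists2 eta : R, 0 < eta & forall (kappa : R) (G : geom n kappa), 0 < kappa <= eta ->
  forall (i : G) (cu : forall l a b, ub T1 (fun _ (y : 'rV[R]_n) => christoffel (gg i) y l a b)) y0 a j v,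
  `|pd a (fun v => (gpos cu y0 v 1 - y0 - v) 0 j) v| <= eps.
Proof.
move=> eps0; have [eta1 [K [eta10 K0 hK]]] := acceleration_small.
(* The entries of the Jacobian of the geodesic field are at most 1 once [K * kappa <= 1], so [c]
   bounds its Euclidean operator norm. *)
pose m := (n + n)%N; pose c : R := m%:R * (m%:R * 1); have c0 : 0 <= c by rewrite !mulr_ge0.
pose B := expR (2 * c + 1); have B1 : 1 <= B by rewrite -expR0 ler_expR addr_ge0 // mulr_ge0.
have B0 : 0 <= B by exact: le_trans ler01 B1.
pose C := m%:R * B * K; have C0 : 0 <= C by exact: mulr_ge0 (mulr_ge0 (ler0n _ _) B0) (ltW K0).
pose eta := Num.min (Num.min eta1 K^-1) (eps / (C + 1)).
have C1 : 0 < C + 1 by rewrite ltr_wpDl.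
exists eta; first by rewrite !lt_min eta10 invr_gt0 K0 divr_gt0.
move=> kappa G /andP[k0]; rewrite !le_min => /andP[/andP[ke kK] kC] i cu y0 a j v.
have k1 : 0 < kappa <= eta1 by rewrite k0.
have Kk1 : K * kappa <= 1 by rewrite mulrC -ler_pdivlMr // mul1r.
have CK : C * kappa <= eps.
  rewrite ler_pdivlMr // in kC; apply: le_trans kC; rewrite mulrC ler_pM2l // lerDl //.
have [xi [xi0 hxi dPhi ePhi]] := @flow_variation _ _ _ (row_mx y0 v) (LB_F cu) (gflowP cu).
set x := row_mx y0 v in hxi dPhi ePhi.
pose b := rshift n a; pose z := xi b.
have pdl l d w : pd d (fun w => geofield (gg i) 1 w 0 (lshift n l)) w = (d == rshift n l)%:R.
  rewrite (_ : (fun w => _) = (fun w : 'rV[R]_(n + n) => w 0 (rshift n l))) ?pd_coord //.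
  by apply/funext => u; rewrite /geofield row_mxEl mxE.
have zE t l : (z t *m jac (geofield (gg i) 1) (gflow cu x t)) 0 (lshift n l) = z t 0 (rshift n l).
  rewrite mxE (bigD1 (rshift n l)) //= big1 ?addr0; first by rewrite mxE pdl eqxx mulr1.
  by move=> d dl; rewrite mxE pdl (negbTE dl) mulr0.
have jb d d' w : `|jac (geofield (gg i) 1) w d d'| <= 1.
  rewrite mxE; case: (split_ordP d') => l ->; last by apply: le_trans Kk1; exact: hK.
  by rewrite pdl; case: (_ == _); rewrite ?normr1 ?normr0.
have zB t : 0 <= t <= 1 -> en (z t) <= B.
  move=> /andP[t0 t1]; apply: en_sqr_le => //.
  have D s : 0 <= s <= t -> is_derive s (1 : R) z (z s *m jac (geofield (gg i) 1) (gflow cu x s)).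
    by move=> /andP[s0 s1]; apply: hxi; rewrite s0 (le_trans s1).
  have l s : 0 <= s <= t -> en (z s *m jac (geofield (gg i) 1) (gflow cu x s)) <= c * en (z s) + 0.
    move=> _; rewrite addr0; apply: en_norm_le; first by rewrite mulr1.
    by apply: norm_mulmx_le.
  apply: (le_trans (gronwall c0 (lexx 0) t0 D l)).
  rewrite /z xi0 en_delta expr1n expr0n /= mul0r addr0 mul1r subr0.
  apply: (@le_trans _ _ B); last by rewrite expr2 ler_peMl.
  by rewrite ler_expR -[leRHS]mulr1 ler_wpM2l // addr_ge0 // mulr_ge0.
have z01 : 0 <= (1 : R) <= 1 by apply/andP; split; [exact: ler01|exact: lexx].
have zr l t : 0 <= t <= 1 -> `|z t 0 (rshift n l) - (l == a)%:R| <= eps.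
  move=> t01; have := abs_derive_le (f := fun t => z t 0 (rshift n l)) (c := eps) (fun s hs => is_derive_coord (rshift n l) (hxi b s hs)) _ t01.
  rewrite /z xi0 mxE eqxx /b (inj_eq (@rshift_inj _ _)); apply=> s hs.
  apply: le_trans CK; rewrite mxE; apply: (le_trans (ler_norm_sum _ _ _)).
  apply: (@le_trans _ _ (\sum_(d < m) B * (K * kappa))); last first.
    by rewrite sumr_const card_ord -[leLHS]mulr_natl /C !mulrA.
  apply: ler_sum => d _; rewrite normrM; apply: ler_pM => //; last by rewrite mxE; exact: hK.
  by apply: le_trans (zB s hs); exact: coord_le_en.
have zl : `|z 1 0 (lshift n j) - (j == a)%:R| <= eps.
  have D (s : R) : 0 <= s <= 1 -> is_derive s (1 : R) (fun t => z t 0 (lshift n j) - (j == a)%:R * t) (z s 0 (rshift n j) - (j == a)%:R).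
    move=> hs; apply: is_deriveB; first by rewrite -zE; exact: is_derive_coord (hxi b s hs).
    have H := is_deriveM (is_derive_cst ((j == a)%:R : R) s 1) (is_derive_id s (1 : R)).
    by apply: (is_derive_eq H); rewrite scaler0 addr0 /GRing.scale /= mulr1.
  have := abs_derive_le D (zr j) z01; rewrite {2}/z xi0 mxE /b eq_lrshift andbF.
  by rewrite mulr1 mulr0 !subr0.
have dc : differentiable (fun w => gflow cu w 1 0 (lshift n j)) x.
  exact: (differentiable_coord_comp (f := fun w => gflow cu w 1)).
have dr : differentiable (fun v : 'rV[R]_n => row_mx y0 v) v.
  apply: differentiable_coords => q d; rewrite ord1; case: (split_ordP d) => l ->.
    rewrite (_ : (fun v => _) = (fun _ : 'rV[R]_n => y0 0 l)); first exact: differentiable_cst.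
    by apply/funext => u; rewrite row_mxEl.
  rewrite (_ : (fun v => _) = (fun u : 'rV[R]_n => u 0 l)); first exact: differentiable_coord.
  by apply/funext => u; rewrite row_mxEr.
have P1 : pd a (fun v => gflow cu (row_mx y0 v) 1 0 (lshift n j)) v = z 1 0 (lshift n j).
  rewrite (pd_comp (f := fun w => gflow cu w 1 0 (lshift n j)) (h := fun v => row_mx y0 v)) //.
  rewrite (bigD1 b) //= big1 ?addr0 => [|d db].
    rewrite (_ : (fun v => _) = (fun u : 'rV[R]_n => u 0 a)); last by apply/funext => u; rewrite row_mxEr.
    by rewrite pd_coord eqxx mul1r ePhi.
  case: (split_ordP d) db => l -> => db.
    rewrite (_ : (fun v => _) = (fun _ : 'rV[R]_n => y0 0 l)); last by apply/funext => u; rewrite row_mxEl.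
    by rewrite pd_cst mul0r.
  rewrite (_ : (fun v => _) = (fun u : 'rV[R]_n => u 0 l)); last by apply/funext => u; rewrite row_mxEr.
  rewrite pd_coord; case: eqP => [e|_]; last by rewrite mul0r.
  by rewrite /b e eqxx in db.
have dg : differentiable (fun v => gflow cu (row_mx y0 v) 1 0 (lshift n j)) v.
  by apply: (@differentiable_comp _ _ _ _ (fun v => row_mx y0 v) (fun w => gflow cu w 1 0 (lshift n j))).
rewrite (_ : (fun v => _) = (fun v => (gflow cu (row_mx y0 v) 1 0 (lshift n j) - y0 0 j) - v 0 j)); last first.
  by apply/funext => u; rewrite /gpos !mxE.
rewrite pdB; [|by apply: differentiableB; [exact: dg|exact: differentiable_cst]|exact: differentiable_coord].
have P2 := pdB a dg (@differentiable_cst _ _ _ (y0 0 j) v).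
by rewrite [X in `|X - _|]P2 pd_cst subr0 P1 pd_coord eq_sym.
Qed.

End ExpNearIdentity.

Section ExpDiffeo.
Context {R : realType}.
Variables (n : nat) (kappa : R) (G : geom n kappa).
Hypothesis kappa_small : n%:R ^+ 2 * kappa <= 1 / 100.
Variable r : R.
Hypothesis r0 : 0 < r.
Local Notation M := (@mfd R n kappa G kappa_small r r0).
Local Notation T1 := (fun _ : unit => True).
Implicit Types (i j : G) (p q x : M) (y z v : 'rV[R]_n).
Hypothesis chr_ub : forall (i : G) l a b, ub T1 (fun _ (y : 'rV[R]_n) => christoffel (gg i) y l a b).
Variable K : R.
Hypotheses (K0 : 0 <= K) (chr_le : forall (i : G) l a b y, `|christoffel (gg i) y l a b| <= K).
Hypothesis K_small : n%:R * (n%:R * (n%:R * (K * 4))) <= 1 / 200.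

Lemma LB_cpos i y : LB T1 (fun _ v => cpos chr_ub i y v 1).
Proof.
move=> k j; apply: (@lbk_ext _ _ _ _ _ (fun _ v => gflow (chr_ub i) (row_mx y v) 1 0 (lshift n j))).
  by move=> p _ v; rewrite /cpos /gpos mxE.
apply: (@lbk_comp _ _ _ _ _ _ (fun _ w => gflow (chr_ub i) w 1 0 (lshift n j)) (fun _ v => row_mx y v)).
  exact: (flow_LBk k (LB_F (chr_ub i)) (gflowP (chr_ub i)) (lshift n j)).
by apply: LBk_row_mx => j'; [exact: lbk_cst|exact: lbk_coord].
Qed.

Lemma tnorm_continuous x : continuous (fun v => tnorm x v).
Proof.
move=> v; rewrite (_ : (fun v => _) = (fun v => r * Num.sqrt (quad (gbase x) (ch (gbase x) x) v))); last first.
  by apply/funext => u; rewrite tnorm_spd.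
apply: (@continuous_comp _ _ _ (fun v => quad (gbase x) (ch (gbase x) x) v) (fun u => r * Num.sqrt u)); last first.
  by apply: continuousM; [exact: cst_continuous|exact: sqrt_continuous].
rewrite (_ : (fun v => _) = (fun v : 'rV[R]_n => \sum_b (\sum_a v 0 a * gg (gbase x) (ch (gbase x) x) a b) * v 0 b)); last first.
  by apply/funext => u; rewrite /quad mxE; apply: eq_bigr => b _; rewrite !mxE.
apply: continuous_bigsum => b; apply: continuousM; last exact: coord_continuous.
apply: continuous_bigsum => a; apply: continuousM; [exact: coord_continuous|exact: cst_continuous].
Qed.

Hypothesis cpos_inverse : forall i y, exists kk : 'rV[R]_n -> 'rV[R]_n,
  [/\ LB T1 (fun _ => kk), forall z, cpos chr_ub i y (kk z) 1 = z & forall v, kk (cpos chr_ub i y v 1) = v].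

(** On this ball the geodesics stay in the chart at [x], where the exponential map is the time-1
    position [E]. By assumption [E] has a smooth inverse [kk] on the whole space, and every
    condition is read through [E], [kk] and the transition maps. *)
Lemma exp_diffeo x : exp_diffeo_ball x (r / 2).
Proof.
set i := gbase x; set y := ch i x; have [kk [Lk Ek kE]] := cpos_inverse i y.
pose E v := cpos chr_ub i y v 1; have LE : LB T1 (fun _ => E) by exact: LB_cpos.
have cE : continuous E by exact: (LBk_continuous (LE 0%N) (p := tt) I).
have ck : continuous kk by exact: (LBk_continuous (Lk 0%N) (p := tt) I).
have oB : open [set v : 'rV[R]_n | tnorm x v < r / 2].
  rewrite (_ : [set v | _] = (fun v => tnorm x v) @^-1` [set u | u < r / 2]) //.
  by apply: open_comp => [v _|]; [exact: tnorm_continuous|exact: open_lt].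
have hE v : tnorm x v < r / 2 -> en (E v) < 3 / 5 /\ exp_map x v = pt i (E v).
  move=> hv; split; last exact: (exp_mapE chr_ub K0 chr_le K_small (ltW hv)).
  have l1 : `|(1 : R)| <= 101 / 100 by rewrite normr1; lra.
  have := gpos_close (chr_ub i) K0 (chr_le i) K_small y (tnorm_en (ltW hv)) l1.
  have := en_triangle (E v - y) y; rewrite subrK; have := (gbaseP x).1; rewrite -/i -/y /E /cpos; lra.
set B := [set v | tnorm x v < r / 2].
have oI : open (exp_map x @` B).
  have := @open_pt _ _ _ G i _ (open_comp (fun z _ => ck z) oB); congr open; apply/seteqP; split=> p /=.
    move=> [z [hz Bz ->]]; exists (kk z) => //.
    by rewrite (hE _ Bz).2 /E Ek.
  by move=> [v Bv <-]; have [h1 ->] := hE v Bv; exists (E v); split=> //; rewrite /E kE.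
have dE j v : tnorm x v < r / 2 -> ptdom j (exp_map x v) <-> overlap i j (E v).
  move=> hv; have [h1 ->] := hE v hv; split=> [[z hz e]|[_ ij hj]].
    by have [ij e'] := pt_eq_tr h1 hz e; split=> //; rewrite e'.
  by exists (gT i j (E v)) => //; rewrite pt_trE.
split=> //.
  move=> p; set j := gbase p.
  have -> : B `&` exp_map x @^-1` dom p = B `&` E @^-1` overlap i j.
    by apply/seteqP; split=> v /= [hv]; split=> //; apply/dE.
  have oBE : open (B `&` E @^-1` overlap i j).
    apply: openI => //; apply: open_comp => [v _|]; first exact: cE.
    exact: open_overlap.
  split; first exact: oBE.
  have [ij|nij] := boolP (j \in gnb i); last first.
    apply: (smooth_congr (g := fun=> 0) oBE); first by move=> v [_ [_ ij]]; rewrite ij in nij.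
    by apply: (LB_smooth (D := T1) (f := fun _ _ => 0) oBE (p := tt)) => // k a; apply: lbk_cst.
  apply: (smooth_congr (g := gT i j \o E) oBE).
    by move=> v [hv ov]; rewrite /= (hE v hv).2 ch_transition.
  apply: (LB_smooth (D := T1) (f := fun _ => gT i j \o E) oBE (p := tt)) => // k.
  by apply: (@LBk_comp _ _ _ _ _ _ _ (fun _ => gT i j) (fun _ => E)); [exact: gT_smooth|exact: LE].
exists (kk \o ch i); split=> [v hv|p].
  by have [h1 e] := hE v hv; rewrite /= e ch_pt // /E kE.
set j := gbase p.
have -> : chart p @` (dom p `&` exp_map x @` B) = [set z | en z < 3 / 5 /\ (exp_map x @` B) (pt j z)].
  apply/seteqP; split=> [_ [q [[z hz ->] iq] <-]|z [hz iz]] /=; rewrite -/j.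
    by rewrite ch_pt.
  by exists (pt j z); [split=> //; exists z|rewrite ch_pt].
have oS : open [set z | en z < 3 / 5 /\ (exp_map x @` B) (pt j z)] by exact: (oI j).
have ovl z : en z < 3 / 5 -> (exp_map x @` B) (pt j z) -> overlap j i z.
  move=> hz [v hv e]; have [h1 e1] := hE v hv.
  by have [ji e2] := pt_eq_tr hz h1 (etrans (esym e) e1); split=> //; rewrite e2.
have [ji|nji] := boolP (i \in gnb j); last first.
  apply: (smooth_congr (g := fun=> 0) oS); first by move=> z [hz iz]; have [_ ji] := ovl z hz iz; rewrite ji in nji.
  by apply: (LB_smooth (D := T1) (f := fun _ _ => 0) oS (p := tt)) => // k a; apply: lbk_cst.
apply: (smooth_congr (g := kk \o gT j i) oS).
  by move=> z [hz iz]; rewrite /= ch_transition //; exact: ovl.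
apply: (LB_smooth (D := T1) (f := fun _ => kk \o gT j i) oS (p := tt)) => // k.
by apply: (@LBk_comp _ _ _ _ _ _ _ (fun _ => kk) (fun _ => gT j i)); [exact: Lk|exact: gT_smooth].
Qed.

Lemma inj_radius_ge : ((r / 2)%:E <= inj_radius M)%E.
Proof.
apply/ereal_infP => _ [x _ <-]; apply: ereal_sup_ubound.
by exists (r / 2) => //; split; [rewrite divr_gt0|exact: exp_diffeo].
Qed.

End ExpDiffeo.

Section InjectivityRadius.
Context {R : realType}.
Variable n : nat.
Local Notation T1 := (fun _ : unit => True).

Lemma mfd_inj_radius : exists2 eta : R, 0 < eta & forall (kappa : R) (G : geom n kappa)
  (kappa_small : n%:R ^+ 2 * kappa <= 1 / 100) (r : R) (r0 : 0 < r), 0 < kappa <= eta ->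
  ((r / 2)%:E <= inj_radius (mfd G kappa_small r0))%E.
Proof.
have [e1 [e10 H1]] := @christoffel_bounds R n.
have [e2 [K2 [e20 K20 H2]]] := @christoffel_small R n.
have [e3 e30 H3] := @near_identity_inverse R n.
have [e4 e40 H4] := exp_near_identity n e30.
pose N : R := n%:R * (n%:R * (n%:R * 4)); have N0 : 0 <= N by rewrite !mulr_ge0.
have c0 : 0 < 1 / 200 / (N * K2 + 1) by rewrite divr_gt0 // ltr_wpDl // mulr_ge0 // ltW.
exists (Num.min (Num.min e1 e2) (Num.min e4 (1 / 200 / (N * K2 + 1)))); first by rewrite !lt_min e10 e20 e40.
move=> kappa G ks r r0 /andP[k0]; rewrite !le_min => /andP[/andP[k1 k2] /andP[k4 kN]].
have chr_ub : forall (i : G) l a b, ub T1 (fun _ (y : 'rV[R]_n) => christoffel (gg i) y l a b).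
  by apply: H1; rewrite k0.
have K0 : 0 <= K2 * kappa by rewrite mulr_ge0 // ltW.
have chr_le (i : G) l a b y : `|christoffel (gg i) y l a b| <= K2 * kappa.
  have h : 0 < kappa <= e2 by rewrite k0.
  exact: bd_bound (H2 _ G h i l a b) y.
have K_small : n%:R * (n%:R * (n%:R * (K2 * kappa * 4))) <= 1 / 200.
  rewrite (_ : _ * _ = N * K2 * kappa); last by rewrite /N; ring.
  have NK : 0 <= N * K2 by rewrite mulr_ge0 // ltW.
  rewrite ler_pdivlMr ?ltr_wpDl // in kN; apply: le_trans kN.
  by rewrite mulrC ler_pM2l // lerDl.
apply: (inj_radius_ge ks r0 (chr_ub := chr_ub) K0 chr_le K_small) => i y.
pose e (v : 'rV[R]_n) := cpos chr_ub i y v 1 - y - v.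
have LBe : LB T1 (fun _ => e).
  move=> k j; apply: (@lbk_ext _ _ _ _ _ (fun _ v => cpos chr_ub i y v 1 0 j - y 0 j - v 0 j)).
    by move=> p _ v; rewrite !mxE.
  apply: lbkB; last exact: lbk_coord.
  by apply: lbkB; [exact: (LB_cpos chr_ub i y k j)|exact: lbk_cst].
have [|kk [Lk Ek kE]] := H3 unit T1 (fun _ => e) LBe.
  by move=> p _ a j v; apply: H4; rewrite k0.
exists (fun z => kk tt (z - y)); split.
- move=> k; apply: (@LBk_comp _ _ _ _ _ _ _ (fun _ => kk tt) (fun _ z => z - y)).
    by move=> j; apply: (lbk_ext _ (lbk_reindex (s := fun _ : unit => tt) _ (Lk k j))).
  move=> j; apply: (@lbk_ext _ _ _ _ _ (fun _ v => v 0 j - y 0 j)); first by move=> p _ v; rewrite !mxE.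
  by apply: lbkB; [exact: lbk_coord|exact: lbk_cst].
- move=> z; have := Ek tt I (z - y); rewrite /e; set v := kk tt (z - y) => h.
  by rewrite -[RHS](subrK y) -h; apply/rowP => a; rewrite !mxE; ring.
- move=> v; have := kE tt I v; rewrite /e => {2}<-; congr (kk tt _).
  by apply/rowP => a; rewrite !mxE; ring.
Qed.

End InjectivityRadius.

(** * Symmetries of the curvature and the sectional bound *)

Section CurvatureSymmetry.
Context {R : realType}.

Lemma addmxE n (A B : 'M[R]_n) a b : (A + B) a b = A a b + B a b.
Proof. by rewrite mxE. Qed.

Lemma oppmxE n (A : 'M[R]_n) a b : (- A) a b = - A a b.
Proof. by rewrite mxE. Qed.

Lemma alternate4 n (a b c d : 'M[R]_n) : a - b + c - d = - (b - a + d - c).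
Proof. by apply/matrixP => p q; rewrite !(addmxE, oppmxE); ring. Qed.

(** The algebra behind [curvmx_antisym]: [A] and [B] are connection matrices, [D] and [E] their
    derivatives, and the left side is the difference of the two mixed second derivatives of the
    metric. *)
Lemma compatible_antisym n (g A B D E : 'M[R]_n) : g^T = g ->
  (g *m A + A^T *m g) *m B + g *m D + (D^T *m g + B^T *m (g *m A + A^T *m g))
   - ((g *m B + B^T *m g) *m A + g *m E + (E^T *m g + A^T *m (g *m B + B^T *m g))) =
  g *m (D - E + A *m B - B *m A) + (g *m (D - E + A *m B - B *m A))^T.
Proof.
have trD (X Y : 'M[R]_n) : (X + Y)^T = X^T + Y^T by exact: raddfD.
have trN (X : 'M[R]_n) : (- X)^T = - X^T by exact: raddfN.
move=> gT; rewrite trmx_mul gT !(trD, trN) !trmx_mul.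
rewrite !(mulmxDl, mulmxDr, mulmxN, mulNmx, mulmxA).
by apply/matrixP => p q; rewrite !(addmxE, oppmxE); ring.
Qed.

Variables (n : nat) (g : 'rV[R]_n -> 'M[R]_n).
Implicit Types (x : 'rV[R]_n) (u v w : 'rV[R]_n) (i j k l : 'I_n).
Hypothesis g_unit : forall x, g x \in unitmx.
Hypothesis g_symE : forall a b x, g x a b = g x b a.
Hypothesis dg : forall a b x, differentiable (fun y => g y a b) x.
Hypothesis ddg : forall a b i x, differentiable (pd i (fun y => g y a b)) x.
Hypothesis cdg : forall a b i j, continuous (pd j (pd i (fun y => g y a b))).
Hypothesis dchr : forall l i k x, differentiable (fun y => christoffel g y l i k) x.

Definition conn i x : 'M[R]_n := \matrix_(l, k) christoffel g x l i k.

Definition curvmx i j x : 'M[R]_n :=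
  dmx (conn j) i x - dmx (conn i) j x + conn i x *m conn j x - conn j x *m conn i x.

Lemma g_tr x : (g x)^T = g x.
Proof. by apply/matrixP => a b; rewrite mxE. Qed.

Lemma lower_conn i x : g x *m conn i x =
  \matrix_(l, k) (2^-1 * (pd i (fun y => g y k l) x + pd k (fun y => g y i l) x - pd l (fun y => g y i k) x)).
Proof.
set S := (X in _ = X); rewrite (_ : conn i x = invmx (g x) *m S) ?mulKVmx //.
apply/matrixP => l k; rewrite !mxE /christoffel mulr_sumr; apply: eq_bigr => m _.
by rewrite mxE mulrCA.
Qed.

Lemma metric_compatible i x : dmx g i x = g x *m conn i x + (conn i x)^T *m g x.
Proof.
have -> : (conn i x)^T *m g x = (g x *m conn i x)^T by rewrite trmx_mul g_tr.
have sy a b c : pd c (fun y => g y a b) x = pd c (fun y => g y b a) x.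
  by congr (pd c _ x); apply/funext => y.
rewrite lower_conn; apply/matrixP => a b; rewrite !mxE (sy b a i) (sy i a b) (sy i b a); by field.
Qed.

Lemma dmxM (A B : 'rV[R]_n -> 'M[R]_n) i x : (forall a b y, differentiable (fun y => A y a b) y) ->
  (forall a b y, differentiable (fun y => B y a b) y) ->
  dmx (fun y => A y *m B y) i x = dmx A i x *m B x + A x *m dmx B i x.
Proof.
move=> dA dB; apply/matrixP => a b; rewrite !mxE -big_split /=.
rewrite (_ : (fun y => _) = (fun y => \sum_(c <- index_enum 'I_n) A y a c * B y c b)); last by apply/funext => y; rewrite mxE.
rewrite pd_sum => [|c]; last by apply: differentiableM; [exact: dA|exact: dB].
apply: eq_bigr => c _; rewrite pdM; [|exact: dA|exact: dB].
by rewrite !mxE addrC; congr (_ + _); rewrite mulrC.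
Qed.

Lemma dmxD (A B : 'rV[R]_n -> 'M[R]_n) i x : (forall a b y, differentiable (fun y => A y a b) y) ->
  (forall a b y, differentiable (fun y => B y a b) y) ->
  dmx (fun y => A y + B y) i x = dmx A i x + dmx B i x.
Proof.
move=> dA dB; apply/matrixP => a b; rewrite !mxE.
rewrite (_ : (fun y => _) = (fun y => A y a b + B y a b)); last by apply/funext => y; rewrite mxE.
by rewrite pdD; [|exact: dA|exact: dB].
Qed.

Lemma dmxT (A : 'rV[R]_n -> 'M[R]_n) i x : dmx (fun y => (A y)^T) i x = (dmx A i x)^T.
Proof.
by apply/matrixP => a b; rewrite !mxE; congr (pd i _ x); apply/funext => y; rewrite mxE.
Qed.

Lemma conn_differentiable i a b x : differentiable (fun y => conn i y a b) x.
Proof.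
rewrite (_ : (fun y => _) = (fun y => christoffel g y a i b)); first exact: dchr.
by apply/funext => y; rewrite mxE.
Qed.

Lemma second_metric i j x : dmx (dmx g i) j x = dmx g j x *m conn i x + g x *m dmx (conn i) j x
  + ((dmx (conn i) j x)^T *m g x + (conn i x)^T *m dmx g j x).
Proof.
rewrite (_ : dmx g i = (fun y => g y *m conn i y + (conn i y)^T *m g y)); last first.
  by apply/funext => y; exact: metric_compatible.
have dct a b y : differentiable (fun y => (conn i y)^T a b) y.
  rewrite (_ : (fun y => _) = (fun y => conn i y b a)); first exact: conn_differentiable.
  by apply/funext => z; rewrite mxE.
have dp (A B : 'rV[R]_n -> 'M[R]_n) : (forall a b y, differentiable (fun y => A y a b) y) ->
  (forall a b y, differentiable (fun y => B y a b) y) -> forall a b y, differentiable (fun y => (A y *m B y) a b) y.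
  move=> dA dB a b y; rewrite (_ : (fun y => _) = (fun y => \sum_(c <- index_enum 'I_n) A y a c * B y c b)); last by apply/funext => z; rewrite mxE.
  by apply: differentiable_bigsum => c; apply: differentiableM; [exact: dA|exact: dB].
rewrite dmxD; [|exact: dp dg (@conn_differentiable i)|exact: dp dct dg].
by rewrite dmxM ?dmxM ?dmxT //; exact: conn_differentiable.
Qed.

(** The second derivatives of the metric commute. Expressed through the connection by metric
    compatibility, their difference is the symmetric part of the lowered curvature. *)
Lemma curvmx_antisym i j x : g x *m curvmx i j x + (g x *m curvmx i j x)^T = 0.
Proof.
have E : dmx (dmx g i) j x = dmx (dmx g j) i x.
  apply/matrixP => a b; rewrite [LHS]mxE [RHS]mxE.
  rewrite (_ : (fun y => _) = pd i (fun y => g y a b)); last by apply/funext => y; rewrite mxE.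
  rewrite [in RHS](_ : (fun y => _) = pd j (fun y => g y a b)); last by apply/funext => y; rewrite mxE.
  by apply: schwarz => [y|c y|c d]; [exact: dg|exact: ddg|exact: cdg].
have {E} := E; rewrite !second_metric !metric_compatible => /esym/eqP; rewrite -subr_eq0 => /eqP E.
by rewrite /curvmx -compatible_antisym ?g_tr.
Qed.

Lemma curvature_mx x u v w : curvature g x u v w = \sum_i \sum_j (u 0 i * v 0 j) *: (w *m (curvmx i j x)^T).
Proof.
apply/rowP => l; rewrite summxE mxE; apply: eq_bigr => i _; rewrite summxE; apply: eq_bigr => j _.
rewrite !mxE mulr_sumr; apply: eq_bigr => k _; rewrite !mxE.
rewrite (_ : (fun y => conn j y l k) = (fun y => christoffel g y l j k)); last by apply/funext => y; rewrite mxE.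
rewrite (_ : (fun y => conn i y l k) = (fun y => christoffel g y l i k)); last by apply/funext => y; rewrite mxE.
rewrite sumrB !mulrA; congr (_ * _); rewrite -addrA; congr (_ + (_ - _)); by apply: eq_bigr => m _; rewrite !mxE.
Qed.

Lemma curvature_orth x u v w : dot (curvature g x u v w *m g x) w = 0.
Proof.
rewrite curvature_mx dotE !mulmx_suml summxE big1 // => i _; rewrite !mulmx_suml summxE big1 // => j _.
rewrite -!scalemxAl mxE; apply/eqP; rewrite mulf_eq0; apply/orP; right; apply/eqP.
set A := g x *m curvmx i j x; have e : A = - A^T by apply/eqP; rewrite -subr_eq0 opprK; apply/eqP; exact: curvmx_antisym.
have s : w *m (curvmx i j x)^T *m g x *m w^T = w *m A^T *m w^T by rewrite /A trmx_mul g_tr !mulmxA.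
have t : w *m A^T *m w^T = (w *m A *m w^T)^T by rewrite !trmx_mul trmxK mulmxA.
have h : (w *m A *m w^T) 0 0 = - (w *m A^T *m w^T) 0 0 by rewrite {1}e mulmxN mulNmx mxE.
have h2 : (w *m A^T *m w^T) 0 0 = (w *m A *m w^T) 0 0 by rewrite t mxE.
rewrite s; move: h h2; move: ((w *m A^T *m w^T) 0 0) ((w *m A *m w^T) 0 0) => p q; lra.
Qed.

Lemma curvature_same x v w : curvature g x v v w = 0.
Proof.
have a i j : curvmx i j x = - curvmx j i x.
  exact: alternate4.
rewrite curvature_mx; set S := (X in X = _); have e : S = - S.
  rewrite {1}/S exchange_big -sumrN /=; apply: eq_bigr => i _; rewrite -sumrN; apply: eq_bigr => j _.
  by rewrite [v 0 j * _]mulrC [in LHS]a linearN /= mulmxN scalerN.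
by apply/rowP => l; have := congr1 (fun z : 'rV[R]_n => z 0 l) e; rewrite !mxE; lra.
Qed.

Lemma curvatureBl x u u' v w : curvature g x (u - u') v w = curvature g x u v w - curvature g x u' v w.
Proof.
rewrite !curvature_mx -sumrB; apply: eq_bigr => i _; rewrite -sumrB; apply: eq_bigr => j _.
by rewrite !mxE mulrBl scalerBl.
Qed.

Lemma curvatureZl x (a : R) u v w : curvature g x (a *: u) v w = a *: curvature g x u v w.
Proof.
rewrite !curvature_mx scaler_sumr; apply: eq_bigr => i _; rewrite scaler_sumr; apply: eq_bigr => j _.
by rewrite mxE scalerA mulrA.
Qed.

(** As [K <= 1], the products of two Christoffel symbols are also at most [K], so the bound is
    linear in [K]. *)
Lemma curvature_bound x u v w (K : R) : 0 <= K <= 1 -> (forall l i k, `|christoffel g x l i k| <= K) ->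
  (forall j l i k, `|pd j (fun y => christoffel g y l i k) x| <= K) ->
  en (curvature g x u v w) <= n%:R * (n%:R * (n%:R * (n%:R * (2 * (1 + n%:R) * K * (en u * en v * en w))))).
Proof.
move=> /andP[K0 K1] h1 h2; have E0 : 0 <= en u * en v * en w by rewrite !mulr_ge0 ?en_ge0.
set Q := 2 * (1 + n%:R) * K * (en u * en v * en w).
have Q0 : 0 <= Q by rewrite /Q; apply: mulr_ge0 => //; rewrite !mulr_ge0 // addr_ge0.
apply: (le_trans (en_le_norm _)); rewrite ler_wpM2l //.
apply: norm_rV_le => [|l]; first exact: mulr_ge0 (ler0n _ _) (mulr_ge0 (ler0n _ _) (mulr_ge0 (ler0n _ _) Q0)).
have S (f : 'I_n -> R) c : (forall i, `|f i| <= c) -> `|\sum_i f i| <= n%:R * c.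
  move=> h; apply: (le_trans (ler_norm_sum _ _ _)); apply: (@le_trans _ _ (\sum_(i < n) c)); first by apply: ler_sum.
  by rewrite sumr_const card_ord -[leLHS]mulr_natl.
rewrite mxE; apply: (S) => i; apply: (S) => j; apply: (S) => k.
rewrite normrM mulrC /Q; apply: ler_pM => //.
  have hG a b : `|\sum_m (christoffel g x l a m * christoffel g x m b k - christoffel g x l b m * christoffel g x m a k)| <= n%:R * (2 * K).
    apply: S => m; apply: (le_trans (ler_normB _ _)); rewrite mulr2n mulrDl mul1r.
    by apply: lerD; rewrite normrM -[leRHS]mulr1; apply: ler_pM => //; apply: le_trans K1.
  have := hG i j; have := h2 i l j k; have := h2 j l i k; rewrite /pd => a1 a2 a3.
  apply: (le_trans (ler_normD _ _)); apply: (le_trans (lerD (ler_normB _ _) (lexx _))).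
  rewrite (_ : 2 * (1 + n%:R) * K = K + K + n%:R * (2 * K)); last by ring.
  exact: lerD (lerD a2 a1) a3.
rewrite !normrM; apply: ler_pM; rewrite ?mulr_ge0 ?coord_le_en //.
by apply: ler_pM; rewrite ?coord_le_en.
Qed.

End CurvatureSymmetry.

Section SectionalBound.
Context {R : realType}.
Variable n : nat.

Lemma prod_close (a b x y : R) : 0 <= a -> 0 <= b -> 99 / 100 * a <= x -> 99 / 100 * b <= y -> a * b <= 2 * (x * y).
Proof.
move=> a0 b0 ax by_; have a0' : 0 <= 99 / 100 * a by lra.
have b0' : 0 <= 99 / 100 * b by lra.
have := ler_pM a0' b0' ax by_; rewrite mulrACA; have := mulr_ge0 a0 b0; lra.
Qed.

(** The quotient degenerates when [u] and [v] become parallel. Replacing [u] by its component [u']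
    orthogonal to [v] leaves the numerator unchanged by the antisymmetries of the curvature, and
    turns the denominator into a product of squared norms comparable to the Euclidean ones. *)
Lemma sectional_bound : exists eta C : R, [/\ 0 < eta, 0 < C & forall (kappa : R) (G : geom n kappa)
  (kappa_small : n%:R ^+ 2 * kappa <= 1 / 100) (r : R) (r0 : 0 < r), 0 < kappa <= eta ->
  sectional_le (mfd G kappa_small r0) (C * kappa * r ^- 2)].
Proof.
have [e1 [e10 H1]] := @christoffel_bounds R n.
have [e2 [K2 [e20 K20 H2]]] := @christoffel_small R n.
pose C0 : R := n%:R * (n%:R * 2) * (n%:R * (n%:R * (n%:R * (n%:R * (2 * (1 + n%:R) * K2))))).
have C00 : 0 <= C0.
  by rewrite /C0 !mulr_ge0 ?addr_ge0 // ltW.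
exists (Num.min (Num.min e1 e2) (Num.min 1 K2^-1)), (2 * C0 + 1); split; first by rewrite !lt_min e10 e20 ltr01 invr_gt0.
  by rewrite ltr_wpDl // mulr_ge0.
move=> kappa G ks r r0 /andP[k0]; rewrite !le_min => /andP[/andP[k1 k2] /andP[k3 k4]] p u v fr.
set i := gbase p; set y := ch i p.
have chr_ub : forall (i : G) l a b, ub (fun _ : unit => True) (fun _ (y : 'rV[R]_n) => christoffel (gg i) y l a b).
  by apply: H1; rewrite k0.
have k2' : 0 < kappa <= e2 by rewrite k0.
have K01 : 0 <= K2 * kappa <= 1 by rewrite mulr_ge0 ?(ltW k0) ?(ltW K20) //= mulrC -ler_pdivlMr // mul1r.
have gu := gg_unit ks i; have gs a b z := gg_symE i a b z.
have dg a b z := gg_differentiable i a b z.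
have ddg a b c z : differentiable (pd c (fun y => gg i y a b)) z.
  have [L hL] := gg_smooth i a b 2%N; case: (hL tt I) => _ [_ /(_ c)] [_ [d _]]; exact: d.
have cdg a b c d : continuous (pd d (pd c (fun y => gg i y a b))).
  have [L hL] := gg_smooth i a b 2%N; case: (hL tt I) => _ [_ /(_ c)] [_ [_ /(_ d)]] [_ cc]; exact: cc.
have dchr l a b z : differentiable (fun y => christoffel (gg i) y l a b) z by exact: ub_differentiable (chr_ub i l a b) z.
have cs : curvature (tensor p) (chart p p) = curvature (gg i) y.
  apply/funext => a; apply/funext => b; apply/funext => c; apply/rowP => l; rewrite !mxE.
  have e l' a' b' : (fun z => christoffel (tensor p) z l' a' b') = (fun z => christoffel (gg i) z l' a' b').
    by apply/funext => z; exact: christoffel_scale.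
  by do 3 (apply: eq_bigr => ? _); rewrite !e; congr (_ * (_ + _)); apply: eq_bigr => m _; rewrite !christoffel_scale.
pose ip a b := dot (a *m gg i y) b.
have inE a b : inner p a b = r ^+ 2 * ip a b.
  by rewrite /inner /ip dotE /= -scalemxAr -scalemxAl mxE.
have ipB a b c : ip (a - b) c = ip a c - ip b c by rewrite /ip mulmxBl dotBl.
have ipZ t a b : ip (t *: a) b = t * ip a b by rewrite /ip -scalemxAl dotZl.
have ipC a b : ip a b = ip b a by rewrite /ip dot_mulmx_tr gg_sym dotC.
have ipq a : ip a a = quad i y a by rewrite quad_dot.
have v0 : v != 0 by move: fr; rewrite free_cons seq1_free => /andP[].
have u0 t : u - t *: v != 0.
  move: fr; rewrite free_cons => /andP[+ _]; apply: contra; rewrite subr_eq0 => /eqP ->.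
  by rewrite span_seq1; apply: rpredZ; exact: memv_line.
have vp : 0 < ip v v by rewrite ipq; exact: (quad_gt0 ks).
pose t := ip u v / ip v v; pose u' := u - t *: v; pose Rm := curvature (gg i) y u v v.
have up : 0 < ip u' u' by rewrite ipq; exact: (quad_gt0 ks i y (u0 t)).
have uv : ip u' v = 0 by rewrite /u' ipB ipZ /t divfK ?subrr // gt_eqF.
have eR : curvature (gg i) y u' v v = Rm.
  by rewrite /u' curvatureBl [X in _ - X]curvatureZl [X in _ *: X]curvature_same scaler0 subr0.
have Rv : ip Rm v = 0 by exact: (curvature_orth gu gs dg ddg cdg dchr).
have num : ip Rm u = ip Rm u'.
  have -> : u = u' + t *: v by rewrite /u' subrK.
  by rewrite ipC /ip mulmxDl dotDl -/(ip u' Rm) -/(ip (t *: v) Rm) ipZ [ip v _]ipC Rv mulr0 addr0 ipC.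
have den : ip u u * ip v v - ip u v ^+ 2 = ip u' u' * ip v v.
  have -> : ip u' u' = ip u u - t * ip u v.
    by rewrite {1}/u' ipB ipZ [ip v u']ipC uv mulr0 subr0 ipC /u' ipB ipZ [ip v u]ipC.
  rewrite mulrBl; congr (_ - _); rewrite /t expr2; field; exact: lt0r_neq0.
have secE : sectional p u v = ip Rm u' / (ip u' u' * ip v v) / r ^+ 2.
  rewrite /sectional cs -/Rm !inE num.
  rewrite (_ : r ^+ 2 * ip u u * (r ^+ 2 * ip v v) - (r ^+ 2 * ip u v) ^+ 2 = r ^+ 2 * r ^+ 2 * (ip u' u' * ip v v)); last first.
    by rewrite -den; ring.
  by field; rewrite !gt_eqF ?mulr_gt0 // exprn_gt0.
have cb := @curvature_bound R n (gg i) y u' v v (K2 * kappa) K01 (fun l a b => bd_bound (H2 _ G k2' i l a b) y) _.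
have {}cb : en Rm <= n%:R * (n%:R * (n%:R * (n%:R * (2 * (1 + n%:R) * (K2 * kappa) * (en u' * en v * en v))))).
  rewrite -eR; apply: cb => j l a b; have [_ [_ /(_ j) [h _]]] := H2 _ G k2' i l a b; exact: h.
have gb a : en (a *m gg i y) <= n%:R * (n%:R * 2) * en a.
  apply: en_norm_le; first by rewrite mulr_ge0.
  apply: norm_mulmx_le => // c d; have := bd_bound (gg_small i c d) y.
  have : `|(c == d)%:R| <= 1 :> R by case: (_ == _); rewrite ?normr1 ?normr0.
  move: ((c == d)%:R) => w hw hk; have := ler_normD (gg i y c d - w) w; rewrite subrK; lra.
have N : `|ip Rm u'| <= C0 * kappa * (dot u' u' * dot v v).
  apply: (le_trans (dot_norm_le _ _)).
  apply: (@le_trans _ _ (n%:R * (n%:R * 2) * (n%:R * (n%:R * (n%:R * (n%:R * (2 * (1 + n%:R) * (K2 * kappa) * (en u' * en v * en v)))))) * en u')).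
    rewrite ler_wpM2r ?en_ge0 //; apply: (le_trans (gb _)); rewrite ler_wpM2l // !mulr_ge0 //.
  by rewrite -!enK /C0 le_eqVlt; apply/orP; left; apply/eqP; ring.
have q1 := quad_close ks i y u'; have q2 := quad_close ks i y v; rewrite -!ipq in q1 q2.
have D1 : 99 / 100 * dot u' u' <= ip u' u' by move: q1; rewrite ler_distl => /andP[]; lra.
have D2 : 99 / 100 * dot v v <= ip v v by move: q2; rewrite ler_distl => /andP[]; lra.
have d1 := dot_ge0 u'; have d2 := dot_ge0 v.
have D := prod_close d1 d2 D1 D2.
rewrite secE normrM normrM normfV [X in _ * X]normfV !(gtr0_norm (mulr_gt0 up vp)) (gtr0_norm (exprn_gt0 2 r0)).
rewrite ler_pM2r ?invr_gt0 ?exprn_gt0 // ler_pdivrMr ?mulr_gt0 //; apply: (le_trans N).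
apply: (@le_trans _ _ (C0 * kappa * (2 * (ip u' u' * ip v v)))); first by rewrite ler_wpM2l // mulr_ge0 // ltW.
have W := mulr_gt0 up vp; move: (ip u' u' * ip v v) W => x x0.
have : 0 <= kappa * x by rewrite mulr_ge0 // ltW.
by rewrite !mulrDl mul1r; lra.
Qed.

End SectionalBound.

(** * The averaged metric and the glued geometry *)

Section Gluing.
Context {R : realType}.
Variables (n Kc N : nat) (C : R).
Let rho : R := 13 / 20.
(** All margins together cost less than 3/100, so the final cocycle condition holds within 13/20 -
    3/100 = 31/50, the outer radius of the cut-off [chi]. *)
Let d : R := 3 / 100 / Kc.+2%:R.
Implicit Types (y : 'rV[R]_n).

Lemma jac_comp (f g h : 'rV[R]_n -> 'rV[R]_n) y : (forall x, differentiable f x) ->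
  (forall x, differentiable g x) -> (\forall x \near y, h x = g (f x)) -> jac h y = jac f y *m jac g (f y).
Proof.
move=> df dg hn; apply/matrixP => a b; rewrite !mxE /pd.
rewrite (near_eq_derive (g := fun x => g (f x) 0 b)); last by apply: filterS hn => x ->.
rewrite -[LHS]/(pd a (fun x => (fun z => g z 0 b) (f x)) y) pd_comp //.
  by apply: eq_bigr => c _; rewrite !mxE.
exact: differentiable_coord_comp.
Qed.

(** Corrections move points by at most 1/100: the radii 1/25 and 1/2 for affine maps become 1/20 and
    less than 3/5, as [geom] demands. *)
Record regular (G : @gdata R n) : Prop := Regular {
  reg_orth : forall i j : G, j \in nb i -> forall a b,
    `|(lin i j *m (lin i j)^T - 1%:M : 'M[R]_n) a b| <= C * eps G ;
  reg_cover : forall (i : G) (y : 'rV[R]_n), en y < 3 / 5 -> exists2 l, l \in nb i & en (aff i l y) < 1 / 25 ;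
  reg_conn : forall P : G -> Prop, (exists i, P i) ->
    (forall i j : G, j \in nb i -> en (trn i j) < 1 / 2 -> P i -> P j) -> forall i, P i
}.

Hypothesis C0 : 0 <= C.
Variables (sigma : R) (e : @pt2 R n -> 'rV[R]_n -> 'rV[R]_n).
Hypotheses (s0 : 0 < sigma) (ube : forall a, ub (Dst Kc N C rho sigma Kc) (fun p y => e p y 0 a)).
Hypothesis hst : forall G, good Kc N C rho G -> eps G < sigma -> stage_ok rho d Kc e G.

Let chi : 'rV[R]_n -> R := bump (3 / 5) (31 / 50).

Let ra0 : (0 : R) <= 3 / 5. Proof. lra. Qed.
Let rab : (3 / 5 : R) < 31 / 50. Proof. lra. Qed.
Let chi1 y : en y < 3 / 5 -> chi y = 1. Proof. by move=> h; apply: bump1 => //; exact: ltW. Qed.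
Let chi_neq0 y : chi y != 0 -> en y < 31 / 50. Proof. exact: (bump_neq0 ra0 rab). Qed.

Let chi_ge0' y : 0 <= chi y. Proof. exact: bump_ge0. Qed.

Let d0 : 0 < d. Proof. by rewrite divr_gt0. Qed.

Let dK : d * Kc.+2%:R = 3 / 100. Proof. by rewrite /d divfK. Qed.

Let d_small : d <= 3 / 200.
Proof.
rewrite -(ler_pM2r (x := Kc.+2%:R)) // dK.
have : (2 : R) <= Kc.+2%:R by rewrite ler_nat.
lra.
Qed.

Let rad_big y : en y < 31 / 50 -> en y < rad rho d Kc.
Proof.
move=> h; apply: (lt_trans h); rewrite /rad /rho.
have : d * Kc.+1%:R < 3 / 100 by rewrite -dK ltr_pM2l // ltr_nat.
lra.
Qed.

Let big y : en y < 3 / 5 -> en y < 31 / 50. Proof. by move=> h; lra. Qed.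

Let D (p : @pt2 R n) := Dst Kc N C rho sigma Kc p /\ regular (g2 p).

Let ubeD a : ub D (fun p y => e p y 0 a).
Proof. by move=> k; apply: (@ubk_dom _ _ _ (Dst Kc N C rho sigma Kc)); [move=> p []|exact: ube]. Qed.

(* [J J^T - 1] divided by [eps], for [J = lin i j + eps * jac e] *)
Definition strain (p : @pt2 R n) y : 'M[R]_n :=
  let L := lin (i2 p) (j2 p) in let E := jac (e p) y in
  (if pselect (D p) then (eps (g2 p))^-1 *: (L *m L^T - 1%:M) else 0)
  + (L *m E^T + E *m L^T + eps (g2 p) *: (E *m E^T)).

Lemma ub_jac_e a b : ub D (fun p y => jac (e p) y a b).
Proof.
move=> k; apply: (@ubk_ext _ _ _ _ _ (fun p y => pd a (fun x => e p x 0 b) y)) => [p _ y|].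
  by rewrite mxE.
exact: ((ubk_lbk (ubeD b k.+1)).2 a).
Qed.

Lemma ub_strain a b : ub D (fun p y => strain p y a b).
Proof.
move=> k; pose L (p : @pt2 R n) := lin (i2 p) (j2 p).
have hL c1 c2 : ubk D k (fun p (_ : 'rV[R]_n) => L p c1 c2).
  by apply: ubk_cst; exists C => p [[g _ ij _ _] _]; exact: good_lin g _ _ ij _ _.
apply: (@ubk_ext _ _ _ _ _ (fun p y =>
   (if pselect (D p) then (eps (g2 p))^-1 *: (L p *m (L p)^T - 1%:M) else 0) a b
   + (\sum_(c <- index_enum 'I_n) L p a c * jac (e p) y b c
   + \sum_(c <- index_enum 'I_n) jac (e p) y a c * L p b c
   + eps (g2 p) * (\sum_(c <- index_enum 'I_n) jac (e p) y a c * jac (e p) y b c)))).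
  move=> p _ y; rewrite /strain -/(L p) addmxE addmxE addmxE; congr (_ + (_ + _ + _)).
  - by rewrite mxE; apply: eq_bigr => c _; rewrite [X in _ = _ * X]mxE.
  - by rewrite mxE; apply: eq_bigr => c _; rewrite [X in _ = _ * X]mxE.
  - by rewrite mxE; congr (_ * _); rewrite mxE; apply: eq_bigr => c _; rewrite [X in _ = _ * X]mxE.
apply: ubkD; [|apply: ubkD; [apply: ubkD|]].
- apply: ubk_cst; exists C => p Dp; case: pselect => //= _; have [[g _ ij _ _] rg] := Dp.
  have e0 := good_eps0 g.
  rewrite mxE normrM gtr0_norm ?invr_gt0 // mulrC ler_pdivrMr //; exact: reg_orth.
- by apply: ubk_sum => c; apply: ubkM; [exact: hL|exact: ub_jac_e].
- by apply: ubk_sum => c; apply: ubkM; [exact: ub_jac_e|exact: hL].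
- apply: ubkM; last by apply: ubk_sum => c; apply: ubkM; exact: ub_jac_e.
  apply: ubk_cst; exists 1 => p [[/good_eps/andP[e0 e1] _ _ _ _] _].
  by rewrite ger0_norm // ltW.
Qed.

Record pt1 := Pt1 { g1 : @gdata R n ; i1 : g1 }.
Let D1 (p : pt1) := [/\ good Kc N C rho (g1 p), eps (g1 p) < sigma & regular (g1 p)].

Definition weight (G : @gdata R n) (i : G) y : R :=
  \sum_(m <- nb i) chi (tr e i m y) + 1 - chi y.

(** The mean of the Euclidean metrics pulled back from the neighbouring charts, minus the identity,
    in units of [eps]; see [avgE]. *)
Definition avg (G : @gdata R n) (i : G) y : 'M[R]_n :=
  (weight i y)^-1 *: \sum_(m <- nb i) chi (tr e i m y) *: strain (Pt2 i m) y.

Let D1_D p m : D1 p -> m \in nb (i1 p) -> D (Pt2 (i1 p) m).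
Proof. by case: p m => G i m [g h r] /= im; split => //; split=> //; exact: good_col g _. Qed.

Lemma weight_ge1 (G : @gdata R n) (i : G) y : D1 (Pt1 i) -> 1 <= weight i y.
Proof.
move=> [/= g h r]; rewrite /weight (bigD1_seq i) ?(good_refl g) ?(good_uniq g) //=.
rewrite (stage_id (hst g h)) ?(good_col g) //.
have : 0 <= \sum_(m <- nb i | m != i) chi (tr e i m y) by exact: sumr_ge0.
by move: (\sum_(_ <- _ | _) _) (chi y) => u v; lra.
Qed.

Lemma lb_trD : LB D (fun p => tr e (i2 p) (j2 p)).
Proof. by apply: (@lb_tr _ _ Kc N C rho _ _ id) => [p [[]]//|]; exact: ubeD. Qed.

Lemma ub_avg a b : ub D1 (fun p y => avg (i1 p) y a b).
Proof.
move=> k.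
have hchi : ubk D k (fun p y => chi (tr e (i2 p) (j2 p) y)).
  apply: (@ubk_comp _ _ _ _ _ _ (fun _ => chi) (fun p => tr e (i2 p) (j2 p))); first exact: ub_bump.
  exact: lb_trD.
have hw : ubk D1 k (fun p y => weight (i1 p) y).
  apply: ubkB; last exact: ub_bump.
  apply: ubkD; last exact: ubk_cst1.
  apply: (ubk_sum_seq (q := fun p m => Pt2 (i1 p) m) hchi); first by move=> p Dp m; exact: D1_D.
  by move=> p [g _ _]; exact: good_size g _.
apply: (@ubk_ext _ _ _ _ _ (fun p y => (weight (i1 p) y)^-1 *
   \sum_(m <- nb (i1 p)) (fun q y => chi (tr e (i2 q) (j2 q) y) * strain q y a b) (Pt2 (i1 p) m) y)).
  move=> p _ y; rewrite /avg [RHS]mxE summxE; congr (_ * _).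
  by apply: eq_bigr => m _; rewrite [RHS]mxE.
apply: ubkM.
  by apply: (ubk_inv ltr01 _ hw) => -[G i] Dp y; exact: weight_ge1.
apply: (@ubk_sum_seq _ _ _ _ D _ _ N _ _ (fun p m => Pt2 (i1 p) m) (fun q y => chi (tr e (i2 q) (j2 q) y) * strain q y a b)).
- by apply: ubkM => //; exact: ub_strain.
- by move=> p Dp m; exact: D1_D.
- by move=> p [g _ _]; exact: good_size g _.
Qed.

Lemma jac_tr p y : D p -> jac (tr e (i2 p) (j2 p)) y = lin (i2 p) (j2 p) + eps (g2 p) *: jac (e p) y.
Proof.
move=> Dp; apply/matrixP => a b; rewrite [RHS]addmxE ![in RHS]mxE [LHS]mxE.
have df c : differentiable (fun x => e p x 0 c) y by apply: (ubk_lbk (ubeD c 1%N)).1.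
have -> : (fun x => tr e (i2 p) (j2 p) x 0 b) =
   (fun x => (\sum_(c <- index_enum 'I_n) x 0 c * lin (i2 p) (j2 p) c b + trn (i2 p) (j2 p) 0 b)
       + eps (g2 p) * e p x 0 b).
  by apply/funext => x; case: p Dp df => G i j Dp df; rewrite /tr /aff !mxE.
have d1 : differentiable (fun x : 'rV[R]_n => \sum_(c <- index_enum 'I_n) x 0 c * lin (i2 p) (j2 p) c b) y.
  by apply: differentiable_bigsum => c; apply: differentiableM => //; exact: differentiable_coord.
rewrite pdD //; last first.
- exact: (@differentiableM _ _ (fun=> eps (g2 p))).
- exact: differentiableD.
have -> : pd a (fun x => eps (g2 p) * e p x 0 b) y = eps (g2 p) * pd a (fun x => e p x 0 b) y.
  by rewrite (@pdM _ _ (fun=> eps (g2 p)) (fun x => e p x 0 b)) // pd_cst; ring.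
congr (_ + _).
rewrite pdD // pd_cst addr0 pd_sum; last first.
  by move=> c; apply: differentiableM => //; exact: differentiable_coord.
have pdc c : pd a (fun x : 'rV[R]_n => x 0 c * lin (i2 p) (j2 p) c b) y = (a == c)%:R * lin (i2 p) (j2 p) c b.
  rewrite (@pdM _ _ (fun x => x 0 c) (fun=> lin (i2 p) (j2 p) c b)) //; last exact: differentiable_coord.
  by rewrite pd_cst mulr0 add0r pd_coord.
rewrite (bigD1 a) //= pdc eqxx mul1r big1 ?addr0 // => c ca.
by rewrite pdc eq_sym (negbTE ca) mul0r.
Qed.

Lemma strainE p y : D p -> let J := jac (tr e (i2 p) (j2 p)) y in
  eps (g2 p) *: strain p y = J *m J^T - 1%:M.
Proof.
move=> Dp J; rewrite /J jac_tr // /strain; case: pselect => //= _.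
have [[g _ _ _ _] _] := Dp; have e0 := good_eps0 g.
set L := lin _ _; set E := jac _ _.
have -> : (L + eps (g2 p) *: E)^T = L^T + eps (g2 p) *: E^T by apply/matrixP => a b; rewrite !mxE.
rewrite mulmxDl !mulmxDr -?scalemxAr -?scalemxAl -?scalemxAr !scalerDr !scalerA.
rewrite divff ?gt_eqF // !scale1r.
by rewrite addrAC !addrA.
Qed.

Lemma avgE (G : @gdata R n) (i : G) y : D1 (Pt1 i) -> en y < 3 / 5 ->
  1%:M + eps G *: avg i y = (\sum_(m <- nb i) chi (tr e i m y))^-1 *:
    \sum_(m <- nb i) chi (tr e i m y) *: (jac (tr e i m) y *m (jac (tr e i m) y)^T).
Proof.
move=> D1i hy; have w1 := weight_ge1 y D1i.
have wE : weight i y = \sum_(m <- nb i) chi (tr e i m y) by rewrite /weight chi1 // addrK.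
have w0 : weight i y != 0 by rewrite gt_eqF // (lt_le_trans ltr01).
rewrite -wE; apply: (scalerI w0); rewrite [RHS]scalerA divff // scale1r scalerDr /avg scalerA mulrC -scalerA.
rewrite scalerKV ?unitfE //.
rewrite {1}wE scaler_suml scaler_sumr -big_split /=; apply: eq_big_seq => m im.
have := strainE y (D1_D D1i im) => /= E.
by rewrite [X in _ + X]scalerA mulrC -[X in _ + X]scalerA E scalerBr addrC subrK.
Qed.

Section Geom.
Variable G : @gdata R n.
Hypotheses (hg : good Kc N C rho G) (hs : eps G < sigma) (hr : regular G).
Let st := hst hg hs.
Let cK (i : G) : (col i < Kc)%N := good_col hg i.

Let Tid (i : G) y : tr e i i y = y. Proof. exact: (stage_id st). Qed.
Let Tinv (i j : G) : j \in nb i -> forall y, tr e j i (tr e i j y) = y.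
Proof. by move=> ij y; exact: (stage_inv st). Qed.

Let Tcocycle (i j l : G) : j \in nb i -> l \in nb i -> forall y, en y < 31 / 50 ->
    en (tr e i j y) < 31 / 50 -> en (tr e i l y) < 31 / 50 ->
    l \in nb j /\ tr e j l (tr e i j y) = tr e i l y.
Proof. by move=> ij il y h1 h2 h3; apply: (stage_cocycle st) => //; exact: rad_big. Qed.

Let Tclose (i j : G) y : j \in nb i -> en (tr e i j y) <= en (aff i j y) + 1 / 100.
Proof.
move=> ij; have := stage_close st (cK i) (cK j) ij y => h.
by rewrite /tr (le_trans (en_triangle _ _)) // lerD2l (le_trans h) //; have := d_small; lra.
Qed.

Let DG (i j : G) : j \in nb i -> D (Pt2 i j).
Proof. by move=> ij; split=> //; split. Qed.

Let D1G (i : G) : D1 (Pt1 i). Proof. by []. Qed.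

Let Tsm (i j : G) : j \in nb i -> LB (fun _ : unit => True) (fun _ => tr e i j).
Proof.
move=> ij; apply: (@lb_tr _ _ Kc N C rho _ _ (fun _ : unit => Pt2 i j)) => // a k.
by apply: (@ubk_reindex _ _ _ _ _ (fun _ : unit => Pt2 i j) _ _ _ _ (ubeD a k)) => _ _; exact: DG.
Qed.

Let Tdiff (i j : G) : j \in nb i -> forall x, differentiable (tr e i j) x.
Proof. by move=> ij x; exact: (LBk_differentiable (Tsm ij 1%N) I). Qed.

Let Tcont (i j : G) : j \in nb i -> continuous (tr e i j).
Proof. by move=> ij; exact: (LBk_continuous (Tsm ij 0%N) I). Qed.

Definition glued_tensor (i : G) y : 'M[R]_n := 1%:M + eps G *: avg i y.

Let jac_cocycle (i j l : G) y : j \in nb i -> l \in nb i -> l \in nb j -> en y < 31 / 50 ->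
  en (tr e i j y) < 31 / 50 -> en (tr e i l y) < 31 / 50 ->
  jac (tr e i l) y = jac (tr e i j) y *m jac (tr e j l) (tr e i j y).
Proof.
move=> ij il jl h1 h2 h3; apply: jac_comp; [exact: Tdiff|exact: Tdiff|].
have oB := @open_en_ball R n (31 / 50).
have o2 := open_comp (fun x _ => Tcont ij (x := x)) oB.
have o3 := open_comp (fun x _ => Tcont il (x := x)) oB.
apply: filterS (open_nbhs_nbhs (conj (openI oB (openI o2 o3)) (conj h1 (conj h2 h3)))) => x /= [k1 [k2 k3]].
by have [_ ->] := Tcocycle ij il k1 k2 k3.
Qed.

(** The averages at [y] and at [z] run over the same charts with the same weights, by the cocycle
    condition; the chain rule gives the common factor [jac (tr e i j) y]. *)
Lemma glued_inv (i j : G) : j \in nb i -> forall y, en y < 3 / 5 -> en (tr e i j y) < 3 / 5 ->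
  glued_tensor i y = jac (tr e i j) y *m glued_tensor j (tr e i j y) *m (jac (tr e i j) y)^T.
Proof.
move=> ij y hy; set z := tr e i j y => hz; have ji := good_sym hg ij.
have zi : tr e j i z = y by exact: Tinv.
have Ei : glued_tensor i y = _ := avgE (D1G i) hy.
have Ej : glued_tensor j z = _ := avgE (D1G j) hz.
apply: (etrans Ei); rewrite Ej {Ei Ej}.
have key m : m \in nb i -> chi (tr e i m y) != 0 ->
    [/\ m \in nb j, chi (tr e j m z) != 0 & tr e j m z = tr e i m y].
  move=> im h; have := chi_neq0 h => hm.
  by have [jm E] := Tcocycle ij im (big hy) (big hz) hm; rewrite /z E.
have key' m : m \in nb j -> chi (tr e j m z) != 0 -> m \in nb i /\ chi (tr e i m y) != 0.
  move=> jm h; have := chi_neq0 h => hm.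
  have := Tcocycle ji jm (big hz); rewrite zi => /(_ (big hy) hm) [im E].
  by rewrite E.
have re (W : nmodType) (f f' : G -> W) :
    (forall m, m \in nb i -> m \in nb j -> chi (tr e i m y) != 0 -> tr e j m z = tr e i m y -> f m = f' m) ->
    (forall m, chi (tr e i m y) = 0 -> f m = 0) -> (forall m, chi (tr e j m z) = 0 -> f' m = 0) ->
    \sum_(m <- nb i) f m = \sum_(m <- nb j) f' m.
  move=> ff h0 h0'.
  apply: (big_seq_congr (P := fun m => chi (tr e i m y) != 0) (P' := fun m => chi (tr e j m z) != 0)).
  - exact: good_uniq hg _.
  - exact: good_uniq hg _.
  - by move=> m im h; have [jm h' E] := key m im h; split=> //; exact: ff.
  - exact: key'.
  - by move=> m; rewrite negbK => /eqP; exact: h0.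
  - by move=> m; rewrite negbK => /eqP; exact: h0'.
have E1 : \sum_(m <- nb i) chi (tr e i m y) = \sum_(m <- nb j) chi (tr e j m z).
  by apply: (re _ (fun m => chi (tr e i m y)) (fun m => chi (tr e j m z))) => [m _ _ _ ->||].
rewrite -scalemxAr -scalemxAl mulmx_sumr mulmx_suml E1; congr (_ *: _).
apply: (re _ (fun m => chi (tr e i m y) *: (jac (tr e i m) y *m (jac (tr e i m) y)^T))
  (fun m => jac (tr e i j) y *m (chi (tr e j m z) *: (jac (tr e j m) z *m (jac (tr e j m) z)^T)) *m (jac (tr e i j) y)^T)).
- move=> m im jm h E; rewrite E -scalemxAr -scalemxAl; congr (_ *: _).
  by rewrite (jac_cocycle ij im jm (big hy) (big hz) (chi_neq0 h)) trmx_mul !mulmxA.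
- by move=> m ->; rewrite scale0r.
- by move=> m ->; rewrite scale0r mulmx0 mul0mx.
Qed.

Variable K : R.
Hypothesis hK : forall p a b, D1 p -> bd 2 (K / 4) (fun y => avg (i1 p) y a b).

Lemma strain_sym p y : (strain p y)^T = strain p y.
Proof.
rewrite /strain; case: pselect => h.
  by rewrite !linearD !linearZ /= !trmx_mul !trmxK linearN /= trmx1; congr (_ + (_ + _)); rewrite addrC.
by rewrite !linearD linearZ /= !trmx_mul !trmxK trmx0; congr (_ + (_ + _)); rewrite addrC.
Qed.

(** The definition is transparent, so that its transition maps compute to [tr e]. The product rule
    at order 2 costs the factor 4 that [K / 4] in [hK] compensates. *)
Definition glued : geom n (K * eps G).
Proof.
apply: (@Geom _ _ _ G (@nb _ _ G) (@tr _ _ e G) glued_tensor).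
- exact: good_refl hg.
- exact: good_sym hg.
- exact: Tsm.
- exact: Tid.
- exact: Tinv.
- by move=> i j l ij il y h1 h2 h3; apply: Tcocycle => //; exact: big.
- move=> i y hy; have [l il hl] := reg_cover hr i hy; exists l => //.
  by have := Tclose y il; lra.
- move=> P Pi hP; apply: (reg_conn hr Pi) => i j ij ht; apply: (hP i j 0 ij); first by rewrite en0; lra.
  by have := Tclose 0 ij; rewrite /aff mul0mx add0r; lra.
- move=> i a b k; apply: (@ubk_ext _ _ _ _ _ (fun _ y => (1%:M : 'M[R]_n) a b + eps G * avg i y a b)).
    by move=> _ _ y; rewrite /glued_tensor addmxE [X in _ = _ + X]mxE.
  apply: ubkD; first exact: ubk_cst1.
  apply: ubkM; first exact: ubk_cst1.
  by apply: (@ubk_reindex _ _ _ _ _ (fun _ : unit => Pt1 i) _ _ _ _ (ub_avg a b k)).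
- move=> i y; rewrite /glued_tensor linearD linearZ /= trmx1; congr (_ + _ *: _).
  rewrite /avg linearZ linear_sum /=; congr (_ *: _); apply: eq_bigr => m _.
  by rewrite linearZ /= strain_sym.
- move=> i a b; have e0 := ltW (good_eps0 hg).
  have h := bdM (bd_cst n 2 (eps G)) (hK a b (D1G i)).
  have h2 : 2 ^+ 2 * (`|eps G| * (K / 4)) = K * eps G by rewrite ger0_norm //; lra.
  rewrite -h2; apply: bd_ext h => y /=.
  have -> : glued_tensor i y a b = (a == b)%:R + eps G * avg i y a b.
    by rewrite /glued_tensor addmxE; congr (_ + _); rewrite mxE.
  by rewrite addrAC subrr add0r.
- exact: glued_inv.
Defined.

End Geom.

End Gluing.

Lemma glue_geom {R : realType} n Kc N (C : R) : 0 <= C -> exists sigma K : R, [/\ 0 < sigma, 1 <= K &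
  forall G : @gdata R n, good Kc N C (13 / 20) G -> regular C G -> eps G < sigma ->
  exists Gm : geom n (K * eps G), exists f : G -> Gm,
   [/\ forall i', exists i, f i = i',
       forall i j, (f j \in gnb (f i)) = (j \in nb i) &
       forall i j, j \in nb i -> forall y, en (gT (f i) (f j) y - aff i j y) <= K * eps G]].
Proof.
move=> C0.
pose d : R := 3 / 100 / Kc.+2%:R; have d0 : 0 < d by rewrite divr_gt0.
have [||sigma s0 [e ue hst]] := @stage_all R n Kc N C (13 / 20) d C0 d0 _ _ Kc (leqnn _).
- by rewrite /d divfK //; lra.
- lra.
have [K1' hK1'] := choice (fun q : 'I_n * 'I_n => ub_avg ue hst q.1 q.2 2%N).
pose K1 a b := K1' (a, b); have hK1 a b := hK1' (a, b).
have [K2 K20 hK2] := ub_bound ue.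
(* The terms secure [1 <= K], the bounds on the averaged metric up to order 2 with their factor 4,
   and the Euclidean norm of the correction. *)
pose K := 1 + 4 * \sum_a \sum_b `|K1 a b| + n%:R * K2.
have S0 : 0 <= \sum_a \sum_b `|K1 a b| by do 2! (apply: sumr_ge0 => ? _).
have nK : 0 <= n%:R * K2 by exact: mulr_ge0.
exists sigma, K; split => //; first by rewrite /K; move: (\sum_a _) (n%:R * K2) S0 nK => u v; lra.
move=> G hg hr hs.
have hK (p : pt1 n) a b : [/\ good Kc N C (13/20) (g1 p), eps (g1 p) < sigma & regular C (g1 p)] ->
    bd 2 (K / 4) (fun y => avg Kc N C sigma e (i1 p) y a b).
  move=> Dp; apply: bd_le (hK1 a b p Dp); rewrite /K.
  have : K1 a b <= \sum_a \sum_b `|K1 a b|.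
    rewrite (bigD1 a) //= (bigD1 b) //=; apply: (le_trans (ler_norm _)).
    rewrite -addrA lerDl addr_ge0 ?sumr_ge0 // => ? _; exact: sumr_ge0.
  by rewrite -/(K1 a b); move: (K1 a b) (\sum_a _) (n%:R * K2) S0 nK => w u v ? ? ?; lra.
exists (glued ue hst hg hs hr hK), id; split => //; first by move=> i; exists i.
move=> i j ij y; rewrite -[gT _ _ _]/(tr e i j y) /tr addrAC subrr add0r enZ.
have e0 := good_eps0 hg; rewrite gtr0_norm // mulrC ler_pM2r //.
apply: (le_trans (en_le_norm _)); apply: (@le_trans _ _ (n%:R * K2)).
  rewrite ler_wpM2l // norm_rV_le // => a; apply: hK2; split=> //; exact: good_col hg _.
by rewrite /K; move: (\sum_a _) (n%:R * K2) S0 nK => u v; lra.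
Qed.

(** * Nets, packing and colourings *)

Section Nets.
Context {R : realType}.

(** The cell of [y] in a cubic grid of mesh [1 / (200 * n.+1)] on the cube of side 4 around 0. The
    mesh gives cells of Euclidean diameter at most 1/200. *)
Definition cell n (y : 'rV[R]_n) : {ffun 'I_n -> 'I_(4 * (200 * n.+1)).+1} :=
  [ffun a => inord (Num.truncn ((y 0 a + 2) * (200 * n.+1)%:R))].

Lemma cell_close n (y z : 'rV[R]_n) : en y <= 2 -> en z <= 2 -> cell y = cell z -> en (y - z) <= 1 / 200.
Proof.
move=> hy hz E; pose h : R := (200 * n.+1)%:R; have h0 : 0 < h by rewrite ltr0n.
have key (v : 'rV[R]_n) a : en v <= 2 -> 0 <= (v 0 a + 2) * h /\
    (Num.truncn ((v 0 a + 2) * h)%R < (4 * (200 * n.+1)).+1)%N.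
  move=> hv; have va := le_trans (coord_le_en v a) hv.
  have : - 2 <= v 0 a <= 2 by rewrite -ler_norml.
  move=> /andP[v1 v2]; have p0 : 0 <= (v 0 a + 2) * h by apply: mulr_ge0; [lra|exact: ltW].
  split => //; rewrite truncn_lt_nat //; apply: (@le_lt_trans _ _ (4 * h)).
    by rewrite ler_pM2r //; lra.
  by rewrite -[4 * h]natrM ltr_nat.
have D a : `|(y - z) 0 a| <= h^-1.
  have [y0 y1] := key y a hy; have [z0 z1] := key z a hz.
  have /(congr1 val) := congr1 (fun f : {ffun _ -> _} => f a) E.
  rewrite !ffunE [\val (inord _)](inordK y1) [\val (inord _)](inordK z1) => e1.
  have /andP[a1 a2] := truncn_itv y0; have /andP[b1 b2] := truncn_itv z0.
  rewrite e1 in a1 a2; move: (Num.truncn _) a1 a2 b1 b2 => k.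
  rewrite -[k.+1%:R]natr1 => a1 a2 b1 b2.
  rewrite -(ler_pM2r h0) mulVf ?gt_eqF // -[X in `|_| * X]gtr0_norm // -normrM.
  rewrite !mxE ler_norml; apply/andP; move: (y 0 a) (z 0 a) (k%:R) a1 a2 b1 b2 => u v w.
  by move=> ? ? ? ?; split; lra.
apply: (le_trans (en_le_norm _)).
have h' : `|y - z| <= h^-1 by rewrite norm_rV_le // invr_ge0 ltW.
apply: (@le_trans _ _ (n%:R * h^-1)); first by rewrite ler_wpM2l.
rewrite ler_pdivrMr // /h natrM -[n.+1%:R]natr1.
have : (0 : R) <= n%:R by []. 
by move: (n%:R) => x x0; lra.
Qed.

Lemma finite_enum (I : eqType) (A : I -> Prop) (P : nat) :
  (forall s : seq I, uniq s -> (forall i, i \in s -> A i) -> (size s <= P)%N) ->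
  exists s : seq I, uniq s /\ forall i, i \in s <-> A i.
Proof.
move=> h.
pose Q k := `[< exists s : seq I, [/\ uniq s, forall i, i \in s -> A i & size s = k] >].
have Q0 : exists k, Q k by exists 0%N; apply/asboolP; exists [::].
have QP k : Q k -> (k <= P)%N by move=> /asboolP[s [u hs <-]]; exact: h.
case: (ex_maxnP Q0 QP) => k /asboolP[s [u hs sk]] km; exists s; split => // i; split; first exact: hs.
move=> Ai; case: (boolP (i \in s)) => // nis.
have : Q k.+1 by apply/asboolP; exists (i :: s); split; [rewrite /= nis|move=> j; rewrite inE => /orP[/eqP->|/hs]|rewrite /= sk].
by move=> /km; rewrite ltnn.
Qed.

(* Distances are divided by the scale [r]: [phi x] maps the unit ball centred at
   [x] to Euclidean space. *)
Record flat (n : nat) (e : R) (X : Type) (D : X -> X -> R) (phi : X -> X -> 'rV[R]_n) : Prop := Flat {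
  fl_eps : 0 < e <= 1 / 1000 ;
  fl_refl : forall x, D x x = 0 ;
  fl_sym : forall x y, D x y = D y x ;
  fl_tri : forall x y z, D x z <= D x y + D y z ;
  fl_chain : forall x y, exists N (c : nat -> X), [/\ c 0%N = x, c N = y,
     forall k, (k < N)%N -> D (c k) (c k.+1) <= e &
     forall k, (k <= N)%N -> D x (c k) + D (c k) y <= D x y + e] ;
  fl_center : forall x, phi x x = 0 ;
  fl_dist : forall x y z, D x y < 1 -> D x z < 1 -> `|en (phi x y - phi x z) - D y z| <= e ;
  fl_onto : forall x v, en v < 1 -> exists y, D x y < 1 /\ en (phi x y - v) <= e
}.

Definition splits (X : Type) (D : X -> X -> R) (e : R) := forall x y c,
  0 <= c <= D x y -> exists2 z, D x z <= c + e & D z y <= D x y - c + e.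

Variables (n : nat) (e : R) (X : Type) (D : X -> X -> R) (phi : X -> X -> 'rV[R]_n).
Hypothesis hX : flat e D phi.

Lemma flat_ge0 x y : 0 <= D x y.
Proof. by have := fl_tri hX x y x; rewrite (fl_refl hX) (fl_sym hX y); lra. Qed.

(** Take the first point of the chain at distance at least [c] from [x]. Its predecessor is closer
    than [c], and the straightness of the chain bounds the remaining distance. *)
Lemma flat_splits : splits D e.
Proof.
move=> x y c /andP[c0 cD]; have /andP[e0 _] := fl_eps hX.
have [N [u [u0 uN us ud]]] := fl_chain hX x y.
have ex : exists k, (k <= N)%N && (c <= D x (u k)) by exists N; rewrite leqnn uN.
case: (ex_minnP ex) => k /andP[kN ck] km.
exists (u k).
  case: k kN ck km => [|k] kN ck km; first by rewrite u0 (fl_refl hX); lra.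
  have : D x (u k) < c.
    by rewrite ltNge; apply/negP => h; have := km k; rewrite h (ltnW kN) ltnn => /(_ isT).
  by have := us k kN; have := fl_tri hX x (u k) (u k.+1); lra.
by have := ud k kN; lra.
Qed.

(** Neighbours may be 7/5 apart, each outside the unit ball of the other; their charts are compared
    around this point, which lies in both balls. *)
Lemma flat_midpoint x y : D x y < 7 / 5 -> exists m, D x m <= 7 / 10 + e /\ D m y <= 7 / 10 + e.
Proof.
move=> h; have /andP[e0 _] := fl_eps hX; have [h'|h'] := lerP (D x y) (7 / 10).
  by exists x; rewrite (fl_refl hX); split; lra.
have [|m h1 h2] := @flat_splits x y (7 / 10); first by apply/andP; split; lra.
by exists m; split; lra.
Qed.

Lemma flat_norm x y : D x y < 1 -> `|en (phi x y) - D x y| <= e.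
Proof.
move=> h; have := fl_dist hX (x := x) (y := y) (z := x) h.
by rewrite (fl_center hX) subr0 (fl_sym hX y) (fl_refl hX) => /(_ ltr01).
Qed.

Definition packing_bound := #|{: {ffun 'I_n -> 'I_(4 * (200 * n.+1)).+1} * {ffun 'I_n -> 'I_(4 * (200 * n.+1)).+1}}|.

(* A point is located by the cell of its midpoint with [x], then by its cell in
   a chart centred at a fixed point of the first cell. *)
Lemma packing (I : eqType) (p : I -> X) x (s : seq I) : uniq s ->
  (forall i, i \in s -> D x (p i) < 7 / 5) ->
  (forall i j, i \in s -> j \in s -> i != j -> 1 / 30 <= D (p i) (p j)) -> (size s <= packing_bound)%N.
Proof.
move=> us hs sep; have /andP[e0 e1] := fl_eps hX.
have [m hm] : {m : I -> X & forall i, i \in s -> D x (m i) <= 7 / 10 + e /\ D (m i) (p i) <= 7 / 10 + e}.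
  apply: (choice (P := fun i y => i \in s -> D x y <= 7 / 10 + e /\ D y (p i) <= 7 / 10 + e)) => i.
  case: (boolP (i \in s)) => [/hs/flat_midpoint[y hy]|_]; first by exists y.
  by exists x.
pose c1 i := cell (phi x (m i)).
have [rep hrep] : {rep : {ffun 'I_n -> 'I_(4 * (200 * n.+1)).+1} -> X & forall i, i \in s ->
    exists2 j, j \in s & c1 j = c1 i /\ rep (c1 i) = m j}.
  have H t : exists y, forall i, i \in s -> c1 i = t -> exists2 j, j \in s & c1 j = t /\ y = m j.
    have [[i si ci]|no] := pselect (exists2 i, i \in s & c1 i = t); first by exists (m i) => _ _ _; exists i.
    by exists x => i si ci; case: no; exists i.
  by have [rep h] := choice H; exists rep => i si; exact: (h (c1 i) i si erefl).
pose code i := (c1 i, cell (phi (rep (c1 i)) (p i))).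
have near i : i \in s -> D (rep (c1 i)) (p i) < 3 / 4.
  move=> si; have [j sj [ej ->]] := hrep i si; have [a1 a2] := hm i si; have [b1 b2] := hm j sj.
  have xi : D x (m i) < 1 by lra.
  have xj : D x (m j) < 1 by lra.
  have ni := flat_norm xi; have nj := flat_norm xj; have nd := fl_dist hX xj xi.
  rewrite !ler_norml in ni nj nd; case/andP: ni => _ ni; case/andP: nj => _ nj; case/andP: nd => nd _.
  have hc : en (phi x (m j) - phi x (m i)) <= 1 / 200 by apply: cell_close ej; lra.
  by have := fl_tri hX (m j) (m i) (p i); lra.
have inj : {in s &, injective code}.
  move=> i j si sj [E1 E2]; apply: contrapT => /eqP nij; have := sep i j si sj nij.
  have hi := near i si; have hj := near j sj; rewrite -E1 in hj E2; move: (rep (c1 i)) hi hj E2 => y hi hj E2.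
  have yi : D y (p i) < 1 by lra.
  have yj : D y (p j) < 1 by lra.
  have ni := flat_norm yi; have nj := flat_norm yj; have nd := fl_dist hX yi yj.
  rewrite !ler_norml in ni nj nd; case/andP: ni => _ ni; case/andP: nj => _ nj; case/andP: nd => nd _.
  have hc : en (phi y (p i) - phi y (p j)) <= 1 / 200 by apply: cell_close E2; lra.
  by lra.
rewrite -(size_map code) /packing_bound; move: (map code s) (map_inj_in_uniq inj) => s'.
by rewrite us => /card_uniqP <-; exact: max_card.
Qed.

Definition far (A : set X) : set X := [set x | forall a, A a -> 1 / 30 <= D x a].

Definition sep75 (A : set X) := forall a b, A a -> A b -> a <> b -> 7 / 5 <= D a b.

Lemma maximal_separated (U : set X) : exists A : set X, [/\ A `<=` U, sep75 A &
  forall x, U x -> exists2 a, A a & D x a < 7 / 5].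
Proof.
have [|A [[AU sA] mA]] := @Zorn_bigcup X [set A | A `<=` U /\ sep75 A].
  move=> F hF tF; split; first by move=> x [A FA Ax]; have [h _] := hF A FA; exact: h.
  move=> a b [A FA Aa] [B FB Bb] ab; have [h|h] := tF A B FA FB.
    by have [_ hB] := hF B FB; apply: hB => //; exact: h.
  by have [_ hA] := hF A FA; apply: hA => //; exact: h.
exists A; split=> // x Ux; apply: contrapT => no.
have nA : ~ A x by move=> Ax; apply: no; exists x => //; rewrite (fl_refl hX); lra.
have far a : A a -> 7 / 5 <= D x a by move=> Aa; rewrite leNgt; apply/negP => h; apply: no; exists a.
apply: (mA (A `|` [set x])).
  by split; [move=> y Ay; left|move=> h; apply: nA; apply: h; right].
split; first by move=> y [/AU|->].
move=> a b [Aa|->] [Ab|->] ab //; [exact: sA|by rewrite (fl_sym hX); exact: far|exact: far].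
Qed.

(* Each colour is a maximal separated subset of what the previous ones miss. *)
Lemma coloured_net : exists (I : eqType) (p : I -> X) (cl : I -> nat) (nbs : I -> seq I),
  [/\ forall i, (cl i < packing_bound.+1)%N,
      forall i, uniq (nbs i) /\ (size (nbs i) <= packing_bound)%N,
      forall i j, j \in nbs i <-> D (p i) (p j) < 7 / 5,
      forall i j, D (p i) (p j) < 7 / 5 -> cl i = cl j -> i = j &
      forall x, exists i, D x (p i) < 1 / 30].
Proof.
have [S hS] := choice maximal_separated.
pose U := fix U k : set X := if k is k'.+1 then U k' `|` S (far (U k')) else set0.
have UE k x : U k x <-> exists2 l, (l < k)%N & S (far (U l)) x.
  elim: k => [|k IH]; first by split=> // -[].
  split=> [[/IH[l lk h]|h]|[l lk h]].
  - by exists l => //; exact: leq_trans lk _.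
  - by exists k.
  - move: lk; rewrite ltnS leq_eqVlt => /orP[/eqP E|lk]; first by right; rewrite -E.
    by left; apply/IH; exists l.
pose T := {q : nat * X | (q.1 < packing_bound.+1)%N /\ S (far (U q.1)) q.2}.
pose I : eqType := HB.pack T (gen_eqMixin T).
pose p (i : I) := (sval i).2; pose cl (i : I) := (sval i).1.
have Sp i : S (far (U (cl i))) (p i) by have [] := svalP i.
have sepS (i j : I) : (cl i < cl j)%N -> 1 / 30 <= D (p j) (p i).
  move=> lt; have [h _ _] := hS (far (U (cl j))); apply: (h _ (Sp j)).
  by apply/UE; exists (cl i).
have colour (i j : I) : D (p i) (p j) < 7 / 5 -> cl i = cl j -> i = j.
  move=> hd E; have Epp : p i = p j.
    apply: contrapT => np; have [_ h _] := hS (far (U (cl i))).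
    have Sj := Sp j; rewrite -E in Sj.
    by have := h _ _ (Sp i) Sj np; lra.
  have : sval i = sval j by move: E Epp; rewrite /p /cl; case: (sval i) (sval j) => a b [c d] /= -> ->.
  by case: i {hd E Epp} => i hi; case: j => j hj /= E; subst j; congr exist; exact: Prop_irrelevance.
have sep (i j : I) : i != j -> 1 / 30 <= D (p i) (p j).
  move=> nij; rewrite leNgt; apply/negP => h; case: (ltngtP (cl i) (cl j)) => [lt|lt|E].
  - by have := sepS _ _ lt; rewrite (fl_sym hX); lra.
  - by have := sepS _ _ lt; lra.
  - by move/eqP: nij; apply; apply: colour => //; lra.
have fin i : exists s : seq I, uniq s /\ forall j, j \in s <-> D (p i) (p j) < 7 / 5.
  apply: (@finite_enum _ _ packing_bound) => s us hs; apply: (packing (x := p i)) us hs _ => a b _ _; exact: sep.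
have [nbs hnb] := choice fin.
exists I, p, cl, nbs; split => //.
- by move=> i; have [] := svalP i.
- move=> i; have [u h] := hnb i; split => //.
  by apply: (@packing I p (p i) (nbs i) u) => [j /h|a b _ _ /sep].
- by move=> i j; have [_] := hnb i.
(* A point missed by the net is far from every colour class, hence within 7/5 of a vertex of each of
   the [packing_bound.+1] colours by maximality. These vertices contradict [packing]. *)
move=> x; apply: contrapT => no.
have fx l : (l < packing_bound.+2)%N -> far (U l) x.
  move=> ll a /UE[k kl Sa]; rewrite leNgt; apply/negP => h; apply: no.
  have hq : (k < packing_bound.+1)%N by rewrite (leq_trans kl) // -ltnS.
  by exists (exist _ (k, a) (conj hq Sa) : I).
have H (l : 'I_packing_bound.+1) : exists a, S (far (U l)) a /\ D x a < 7 / 5.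
  have [_ _ h] := hS (far (U l)); have [|a Sa ha] := h x; last by exists a.
  by apply: fx; rewrite (leq_trans (ltn_ord l)).
have [a ha] := choice H.
pose q (l : 'I_packing_bound.+1) : I := exist _ (nat_of_ord l, a l) (conj (ltn_ord l) (ha l).1).
have : (size (map q (enum 'I_packing_bound.+1)) <= packing_bound)%N.
  apply: (packing (p := p) (x := x)).
  - rewrite map_inj_uniq ?enum_uniq // => l l' E.
    by apply/val_inj; have := congr1 cl E.
  - by move=> _ /mapP[l _ ->]; have [] := ha l.
  - by move=> i j _ _; exact: sep.
by rewrite size_map size_enum_ord ltnn.
Qed.

End Nets.

Ltac qlra := clear; intros; lra.

(** * Almost orthogonal affine transition maps *)

Section AlmostOrthogonal.
Context {R : realType} (n : nat).
Implicit Types (u v w y : 'rV[R]_n) (L M : 'M[R]_n).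

Lemma en_mulmx_le (c : R) v M : 0 <= c -> (forall a b, `|M a b| <= c) -> en (v *m M) <= n%:R ^+ 2 * c * en v.
Proof.
move=> c0 h; apply: (le_trans (en_le_norm _)).
rewrite expr2 -!mulrA ler_wpM2l // mulrA.
by apply: (le_trans (norm_mulmx_le v c0 h)); rewrite ler_wpM2l ?mulr_ge0 // norm_le_en.
Qed.

Lemma dot_mulmx u v M : dot (u *m M) v = dot u (v *m M^T).
Proof. by rewrite !dotE trmx_mul trmxK mulmxA. Qed.

Lemma gramE L a b : (L *m L^T) a b = dot (row a L) (row b L).
Proof. by rewrite mxE; apply: eq_bigr => c _; rewrite !mxE. Qed.

(** Both defects have the same Frobenius norm, by cyclicity of the trace. *)
Lemma gram_defect_sym L (c : R) : (forall a b, `|(L *m L^T - 1%:M) a b| <= c) ->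
  forall a b, `|(L^T *m L - 1%:M) a b| <= n%:R * c.
Proof.
pose frob M : R := \tr (M *m M^T).
have frobE M : frob M = \sum_a \sum_b M a b ^+ 2.
  apply: eq_bigr => a _; rewrite mxE; apply: eq_bigr => b _; rewrite mxE expr2 //.
have E : frob (L^T *m L - 1%:M) = frob (L *m L^T - 1%:M).
  have sq M : M^T = M -> frob (M - 1%:M) = \tr (M *m M) - \tr M - \tr M + \tr (1%:M : 'M[R]_n).
    move=> s; rewrite /frob linearB /= s trmx1 mulmxBl !mulmxBr mulmx1 mul1mx mulmx1 !linearB /=; ring.
  rewrite !sq ?trmx_mul ?trmxK //.
  by rewrite (mxtrace_mulC L^T L) -(mulmxA L^T) (mxtrace_mulC L^T) !mulmxA.
move=> h a b; have c0 : 0 <= c := le_trans (normr_ge0 _) (h a b).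
rewrite -[leLHS]ger0_norm // -[leRHS]ger0_norm ?mulr_ge0 // -ler_sqr ?nnegrE ?normr_ge0 //.
rewrite ger0_norm // (ger0_norm (mulr_ge0 (ler0n R n) c0)) real_normK ?num_real //.
apply: (@le_trans _ _ (frob (L^T *m L - 1%:M))).
  rewrite frobE (bigD1 a) //= (bigD1 b) //= -addrA lerDl addr_ge0 ?sumr_ge0 // => i _.
    exact: sqr_ge0.
  by apply: sumr_ge0 => j _; exact: sqr_ge0.
rewrite E frobE; apply: (@le_trans _ _ (\sum_(a < n) \sum_(b < n) c ^+ 2)).
  apply: ler_sum => i _; apply: ler_sum => j _.
  by rewrite -[leLHS]real_normK ?num_real // ler_sqr ?nnegrE.
rewrite sumr_const card_ord sumr_const card_ord -[leLHS]mulr_natl -[X in _ * X]mulr_natl.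
by rewrite exprMn expr2 mulrA.
Qed.

Lemma almost_isometry L (c : R) : 0 <= c -> (forall a b, `|(L *m L^T - 1%:M) a b| <= c) ->
  n%:R ^+ 2 * c <= 1 / 2 -> forall v, en v <= 2 * en (v *m L).
Proof.
move=> c0 h hc v.
have E : dot (v *m L) (v *m L) = dot v v + dot v (v *m (L *m L^T - 1%:M)).
  by rewrite dot_mulmx mulmxBr mulmx1 mulmxA dotBr addrC subrK.
have := dot_norm_le v (v *m (L *m L^T - 1%:M)); rewrite ler_norml => /andP[h1 _].
have h2 := en_mulmx_le v c0 h.
rewrite -ler_sqr ?nnegrE ?mulr_ge0 ?en_ge0 // exprMn enK enK E.
have v0 := en_ge0 v; rewrite -enK.
have : en v * en (v *m (L *m L^T - 1%:M)) <= 1 / 2 * en v ^+ 2.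
  rewrite expr2 mulrCA; apply: ler_wpM2l => //; apply: (le_trans h2); exact: ler_wpM2r.
by move: (dot v _) (en v ^+ 2) (en v * _) (sqr_ge0 (en v)) h1 => d e f ? ? ?; lra.
Qed.

Lemma almost_isometry_unit L : (forall v, en v <= 2 * en (v *m L)) -> L \in unitmx.
Proof.
move=> h; rewrite -row_free_unit -kermx_eq0; apply/eqP/row_matrixP => a; rewrite row0.
apply: en_eq0; apply/eqP; rewrite eq_le en_ge0 andbT.
by have := h (row a (kermx L)); rewrite -row_mul mulmx_ker row0 en0 mulr0.
Qed.

Lemma row_delta_en (a : 'I_n) : en (delta_mx 0 a : 'rV[R]_n) = 1.
Proof.
rewrite /en (_ : dot _ _ = 1) ?sqrtr1 // /dot (bigD1 a) //= big1 => [|b ba].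
  by rewrite !mxE !eqxx mulr1 addr0.
by rewrite !mxE (negbTE ba) mulr0.
Qed.

(* By polarization, a map preserving distances up to [e] almost preserves scalar products. *)
Lemma dot_close m (u v : 'rV[R]_n) (u' v' : 'rV[R]_m) (e : R) : 0 <= e ->
  `|en u - en u'| <= 2 * e -> `|en v - en v'| <= 2 * e -> `|en (u - v) - en (u' - v')| <= 2 * e ->
  en u <= 21 / 10 -> en v <= 21 / 10 -> en (u - v) <= 21 / 10 ->
  en u' <= 21 / 10 -> en v' <= 21 / 10 -> en (u' - v') <= 21 / 10 ->
  `|dot u v - dot u' v'| <= 20 * e.
Proof.
move=> e0.
have sq (x y : R) : 0 <= x -> 0 <= y -> `|x - y| <= 2 * e -> x <= 21 / 10 -> y <= 21 / 10 ->
    `|x ^+ 2 - y ^+ 2| <= 42 / 5 * e.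
  move=> x0 y0 h hx hy; rewrite subr_sqr normrM (ger0_norm (addr_ge0 x0 y0)).
  rewrite (_ : 42 / 5 * e = 2 * e * (21 / 5)); last by field.
  by apply: ler_pM => //; [exact: addr_ge0|lra].
have pol k (a b : 'rV[R]_k) : dot a b = (en a ^+ 2 + en b ^+ 2 - en (a - b) ^+ 2) / 2.
  by rewrite !enK dotBl !dotBr (dotC b a); field.
move=> h1 h2 h3 b1 b2 b3 b1' b2' b3'; rewrite !pol.
have := sq _ _ (en_ge0 _) (en_ge0 _) h1 b1 b1'; have := sq _ _ (en_ge0 _) (en_ge0 _) h2 b2 b2'.
have := sq _ _ (en_ge0 _) (en_ge0 _) h3 b3 b3'; rewrite !ler_norml.
move: (en u ^+ 2) (en v ^+ 2) (en (u - v) ^+ 2) (en u' ^+ 2) (en v' ^+ 2) (en (u' - v') ^+ 2) => a b c a' b' c'.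
by move=> /andP[? ?] /andP[? ?] /andP[? ?]; apply/andP; split; lra.
Qed.

Definition frame_const : R := (25 * 25) + (n%:R ^+ 2 * (n%:R * (25 * 25)) * (21 / 10) + n%:R ^+ 2 * 11 * (n%:R * (13 * 10))).

Lemma frame_const_ge : (25 * 25) <= frame_const.
Proof.
have a0 : (0 : R) <= 21 / 10 by lra.
have b0 : (0 : R) <= 25 * 25 by lra.
have c0 : (0 : R) <= 13 * 10 by lra.
have d0 : (0 : R) <= 11 by lra.
have N0 : (0 : R) <= n%:R by [].
rewrite /frame_const lerDl; apply: addr_ge0; apply: mulr_ge0; try exact: mulr_ge0.
Qed.

(** The vectors [u] are nearly an orthogonal frame of length 1/5 and [w] is its image, so [L] sends
    the basis to [5 *: w]. Equal Gram matrices up to O(e) make [L] almost orthogonal, and a vector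
    is recovered from its products with the frame. *)
Lemma frame_transition (e : R) (u w : 'I_n -> 'rV[R]_n) : 0 <= e <= 1 / 1000 ->
  (forall a, en (u a - (1 / 5) *: delta_mx 0 a) <= 2 * e) -> (forall a, en (w a) <= 21 / 10) ->
  (forall a b, `|dot (u a) (u b) - dot (w a) (w b)| <= 20 * e) ->
  let L := \matrix_a (5 *: w a) in
  [/\ forall a b, `|L a b| <= 11, forall a b, `|(L *m L^T - 1%:M) a b| <= (25 * 25) * e &
      forall x y, en x <= 21 / 10 -> en y <= 21 / 10 ->
        (forall a, `|dot x (u a) - dot y (w a)| <= 20 * e) -> en (x *m L - y) <= frame_const * e].
Proof.
move=> /andP[e0 e1] hu hw huw L.
have Lr a : row a L = 5 *: w a by apply/rowP => b; rewrite !mxE.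
have hL a b : `|L a b| <= 11.
  have -> : L a b = row a L 0 b by rewrite [RHS]mxE.
  by apply: (le_trans (coord_le_en _ _)); rewrite Lr enZ ger0_norm //; have := hw a; lra.
have dl (x : 'rV[R]_n) a : dot x ((1 / 5) *: delta_mx 0 a) = 1 / 5 * x 0 a.
  rewrite dotZr /dot (bigD1 a) //= big1 => [|b ba]; first by rewrite mxE !eqxx mulr1 addr0.
  by rewrite mxE (negbTE ba) mulr0.
have near x a : en x <= 21 / 10 -> `|dot x (u a) - 1 / 5 * x 0 a| <= 21 / 5 * e.
  move=> hx; rewrite -dl -dotBr; apply: (le_trans (dot_norm_le _ _)).
  by rewrite (_ : 21 / 5 * e = 21 / 10 * (2 * e)); [apply: ler_pM => //; exact: en_ge0|field].
have horth a b : `|(L *m L^T - 1%:M) a b| <= (25 * 25) * e.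
  rewrite addmxE oppmxE gramE !Lr dotZl dotZr mxE.
  have hub : en (u a) <= 21 / 10.
    have := en_triangle (u a - (1 / 5) *: delta_mx 0 a) ((1 / 5) *: delta_mx 0 a).
    rewrite subrK enZ row_delta_en ger0_norm ?divr_ge0 // => h; have := hu a; lra.
  have h1 := near (u a) b hub; have h2 := huw a b.
  have h3 : `|5 * u a 0 b - (a == b)%:R| <= 10 * e.
    have := le_trans (coord_le_en (u a - (1 / 5) *: delta_mx 0 a) b) (hu a).
    rewrite !mxE eqxx /= (eq_sym b a) !ler_norml.
    by move: ((a == b)%:R : R) (u a 0 b) => p q /andP[? ?]; apply/andP; split; lra.
  move: h1 h2 h3; rewrite !ler_norml.
  move: ((a == b)%:R : R) (u a 0 b) (dot (u a) (u b)) (dot (w a) (w b)) => p q s t /andP[? ?] /andP[? ?] /andP[? ?].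
  by apply/andP; split; lra.
split=> // x y hx hy hxy.
have c0 : 0 <= (25 * 25) * e by rewrite mulr_ge0.
have h1 a : `|(y *m L^T - x) 0 a| <= (13 * 10) * e.
  have E : (y *m L^T) 0 a = 5 * dot y (w a).
    by rewrite -dotZr -Lr mxE; apply: eq_bigr => b _; rewrite !mxE.
  rewrite mxE [X in _ + X]mxE E; have := near x a hx; have := hxy a; rewrite !ler_norml.
  by move: (x 0 a) (dot x (u a)) (dot y (w a)) => q s t /andP[? ?] /andP[? ?]; apply/andP; split; lra.
have h2 : en (y *m L^T - x) <= n%:R * ((13 * 10) * e).
  apply: (le_trans (en_le_norm _)); rewrite ler_wpM2l // norm_rV_le // mulr_ge0 //.
have -> : x *m L - y = y *m (L^T *m L - 1%:M) - (y *m L^T - x) *m L.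
  by rewrite mulmxBr mulmx1 mulmxBl !mulmxA opprB [RHS]addrC addrA subrK.
have h0 := gram_defect_sym horth.
have g1 := en_mulmx_le y (mulr_ge0 (ler0n R n) c0) h0.
have g2 := en_mulmx_le (y *m L^T - x) (ler0n R 11) hL.
have N0 : (0 : R) <= n%:R by [].
have k1 : en (y *m (L^T *m L - 1%:M)) <= n%:R ^+ 2 * (n%:R * ((25 * 25) * e)) * (21 / 10).
  by apply: (le_trans g1); apply: ler_wpM2l => //; apply: mulr_ge0; [exact: exprn_ge0|exact: mulr_ge0].
have k2 : en ((y *m L^T - x) *m L) <= n%:R ^+ 2 * 11 * (n%:R * ((13 * 10) * e)).
  by apply: (le_trans g2); exact: ler_wpM2l.
apply: (le_trans (en_triangle _ _)); rewrite enN; apply: (le_trans (lerD k1 k2)).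
rewrite /frame_const; move: (n%:R) N0 => N N0.
rewrite [leRHS]mulrDl -[leLHS]add0r; apply: lerD; first by [].
by rewrite le_eqVlt; apply/orP; left; apply/eqP; ring.
Qed.

End AlmostOrthogonal.

Section Transitions.
Context {R : realType} (n : nat) (e : R) (X : Type) (D : X -> X -> R) (phi : X -> X -> 'rV[R]_n).
Hypothesis hX : flat e D phi.

Ltac slra := clear -hX; intros; lra.

Record trans (C : R) (x0 x1 : X) (L : 'M[R]_n) (b : 'rV[R]_n) : Prop := Trans {
  tr_lin : forall a c, `|L a c| <= C ;
  tr_trn : forall a, `|b 0 a| <= C ;
  tr_orth : forall a c, `|(L *m L^T - 1%:M) a c| <= C * e ;
  tr_app : forall x, D x0 x < 1 -> D x1 x < 1 -> en (phi x0 x *m L + b - phi x1 x) <= C * e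
}.

Lemma trans_le C C' x0 x1 L b : C <= C' -> trans C x0 x1 L b -> trans C' x0 x1 L b.
Proof.
have /andP[e0 _] := fl_eps hX.
move=> h [h1 h2 h3 h4]; have h' : C * e <= C' * e by apply: ler_wpM2r => //; exact: ltW.
split=> [a c|a|a c|x hx hx']; by [exact: le_trans (h1 a c) h|exact: le_trans (h2 a) h|
  exact: le_trans (h3 a c) h'|exact: le_trans (h4 x hx hx') h'].
Qed.

Lemma flat_upper x0 x y : D x0 x < 1 -> D x0 y < 1 -> en (phi x0 x - phi x0 y) <= D x y + e.
Proof. by move=> hx hy; have := fl_dist hX hx hy; rewrite ler_norml => /andP[_]; lra. Qed.

Lemma flat_lower x0 x y : D x0 x < 1 -> D x0 y < 1 -> D x y <= en (phi x0 x - phi x0 y) + e.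
Proof. by move=> hx hy; have := fl_dist hX hx hy; rewrite ler_norml => /andP[]; lra. Qed.

Lemma flat_en x0 x : D x0 x < 1 -> en (phi x0 x) <= D x0 x + e.
Proof. by move=> hx; have := flat_norm hX hx; rewrite ler_norml => /andP[_]; lra. Qed.

Lemma flat_of_en x0 x : D x0 x < 1 -> D x0 x <= en (phi x0 x) + e.
Proof. by move=> hx; have := flat_norm hX hx; rewrite ler_norml => /andP[]; lra. Qed.

(* A point whose coordinates at [x0] are those of [x] moved by [v]. *)
Lemma flat_move x0 x v c : D x0 x <= c -> en v <= 1 / 5 -> c <= 3 / 4 ->
  exists q, [/\ D x0 q < 1, D x q <= 1 / 5 + 2 * e & en (phi x0 q - (phi x0 x + v)) <= e].
Proof.
move=> hx hv hc; have /andP[e0 e1] := fl_eps hX; have hx1 : D x0 x < 1 by lra.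
have hen := flat_en hx1; have := en_triangle (phi x0 x) v => ht.
have [|q [hq hq']] := fl_onto hX x0 (v := phi x0 x + v); first by lra.
exists q; split=> //; have := flat_lower hx1 hq.
have : en (phi x0 x - phi x0 q) <= e + en v.
  rewrite enB (_ : phi x0 q - phi x0 x = (phi x0 q - (phi x0 x + v)) + v); last by rewrite opprD addrA subrK.
  by apply: (le_trans (en_triangle _ _)); rewrite lerD2r.
lra.
Qed.

Definition trans_const : R := 4 * frame_const n + n%:R ^+ 2 * 22 + 11.

(** The points [q a] are displaced from the midpoint [m] by 1/5 along the axes of the first chart,
    and lie in both unit balls. Both charts give the distances up to [e], hence scalar products
    around [m] up to O(e), and [frame_transition] applies. *)
Lemma trans_exists x0 x1 : D x0 x1 < 7 / 5 -> exists L b, trans trans_const x0 x1 L b.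
Proof.
move=> hd; have /andP[e0 e1] := fl_eps hX.
have [m [m0 m1]] := flat_midpoint hX hd; rewrite (fl_sym hX) in m1.
have H a : exists q, [/\ D x0 q < 1, D m q <= 1 / 5 + 2 * e &
    en (phi x0 q - (phi x0 m + (1 / 5) *: delta_mx 0 a)) <= e].
  apply: (flat_move (c := 7 / 10 + e)) => //; last by lra.
  by rewrite enZ row_delta_en ger0_norm; lra.
have [q hq] := choice H.
have q0 a : D x0 (q a) < 1 by have [] := hq a.
have q1 a : D x1 (q a) < 1 by have [_ h _] := hq a; have := fl_tri hX x1 m (q a); lra.
have m0' : D x0 m < 1 by lra.
have m1' : D x1 m < 1 by lra.
pose u x := phi x0 x - phi x0 m; pose w x := phi x1 x - phi x1 m.
have uB x y : u x - u y = phi x0 x - phi x0 y by rewrite /u opprB addrA subrK.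
have wB x y : w x - w y = phi x1 x - phi x1 y by rewrite /w opprB addrA subrK.
have near x y : D x0 x < 1 -> D x0 y < 1 -> D x1 x < 1 -> D x1 y < 1 ->
    [/\ `|en (phi x0 x - phi x0 y) - en (phi x1 x - phi x1 y)| <= 2 * e,
      en (phi x0 x - phi x0 y) <= 21 / 10 & en (phi x1 x - phi x1 y) <= 21 / 10].
  move=> a1 a2 b1 b2; have := flat_upper a1 a2; have := flat_lower a1 a2.
  have := flat_upper b1 b2; have := flat_lower b1 b2; have := fl_tri hX x x0 y; rewrite (fl_sym hX x x0).
  move: (en (_ - _)) (en (phi x1 x - phi x1 y)) => s t; rewrite ler_norml.
  by move: a1 a2 e1; clear -hX; intros; split; [apply/andP; split; lra|lra|lra].
have dots x y : D x0 x < 1 -> D x0 y < 1 -> D x1 x < 1 -> D x1 y < 1 ->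
    `|dot (u x) (u y) - dot (w x) (w y)| <= 20 * e.
  move=> a1 a2 b1 b2; have [c1 c2 c3] := near _ _ a1 m0' b1 m1'; have [d1 d2 d3] := near _ _ a2 m0' b2 m1'.
  have [f1 f2 f3] := near _ _ a1 a2 b1 b2.
  by apply: dot_close; rewrite ?uB ?wB //; exact: ltW.
have [||||h1 h2 h3] := @frame_transition R n e (fun a => u (q a)) (fun a => w (q a)).
- by rewrite ltW.
- move=> a; have [_ _ h] := hq a; rewrite /u -addrA -opprD; lra.
- by move=> a; have [] := near _ _ (q0 a) m0' (q1 a) m1'.
- by move=> a b; exact: dots.
set L := \matrix_a _ in h1 h2 h3.
rewrite /trans_const; move: (frame_const n) (@frame_const_ge R n) h3 => F fc h3.
have n0 : 0 <= n%:R ^+ 2 * 22 :> R by rewrite mulr_ge0 ?exprn_ge0.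
exists L, (phi x1 m - phi x0 m *m L); split.
- by move=> a c; apply: (le_trans (h1 a c));lra.
- move=> a; apply: (le_trans (coord_le_en _ _)).
  have := en_triangle (phi x1 m) (- (phi x0 m *m L)); rewrite enN.
  have g := en_mulmx_le (phi x0 m) (ler0n R 11) h1.
  have em0 := flat_en m0'; have em1 := flat_en m1'.
  have : n%:R ^+ 2 * 11 * en (phi x0 m) <= n%:R ^+ 2 * 11 * 2.
    by apply: ler_wpM2l; [rewrite mulr_ge0 ?exprn_ge0|lra].
  by move=> ? ?; lra.
- move=> a c; apply: (le_trans (h2 a c)); apply: ler_wpM2r; first exact: ltW.
  by lra.
- move=> x hx hx'; rewrite (_ : _ - phi x1 x = u x *m L - w x); last first.
    by rewrite /u /w mulmxBl opprB !addrA addrAC (addrAC _ (- (_ *m L))).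
  have [] := near _ _ hx m0' hx' m1' => _ g1 g2.
  apply: (le_trans (h3 _ _ g1 g2 _)) => [a|]; first exact: dots.
  by apply: ler_wpM2r; [exact: ltW|lra].
Qed.

(** Taking the inverse for the backward transition, instead of an independent approximation, makes
    [good_affK] exact. *)
Lemma trans_inv C x0 x1 L b : 0 <= C -> n%:R ^+ 2 * (C * e) <= 1 / 2 -> trans C x0 x1 L b ->
  L \in unitmx /\ trans (2 + (2 + 4 * n%:R ^+ 2) * C + 2 * n%:R * C) x1 x0 (invmx L) (- (b *m invmx L)).
Proof.
move=> C0 hC [h1 h2 h3 h4]; have /andP[e0 e1] := fl_eps hX.
have Ce : 0 <= C * e by rewrite mulr_ge0 // ltW.
have iso := almost_isometry Ce h3 hC.
have uL := almost_isometry_unit iso; split => //.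
have inv v : en (v *m invmx L) <= 2 * en v by have := iso (v *m invmx L); rewrite mulmxKV.
have rowX a : en (row a (invmx L)) <= 2 by rewrite rowE; have := inv (delta_mx 0 a); rewrite row_delta_en mulr1.
have nC : 0 <= n%:R * C by exact: mulr_ge0.
have n2C : 0 <= n%:R ^+ 2 * C by rewrite mulr_ge0 ?exprn_ge0.
split.
- move=> a c; have -> : invmx L a c = row a (invmx L) 0 c by rewrite [RHS]mxE.
  by apply: (le_trans (coord_le_en _ _)); have := rowX a; lra.
- move=> a; apply: (le_trans (coord_le_en _ _)); rewrite enN; apply: (le_trans (inv b)).
  have hb : en b <= n%:R * C by apply: (le_trans (en_le_norm _)); rewrite ler_wpM2l // norm_rV_le.
  lra.
- move=> a c.
  have -> : invmx L *m (invmx L)^T - 1%:M = - (invmx L *m (L *m L^T - 1%:M) *m (invmx L)^T).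
    rewrite mulmxBr mulmx1 mulmxBl opprB mulmxA mulVmx // mul1mx -trmx_mul mulVmx // trmx1 //.
  have E : (invmx L *m (L *m L^T - 1%:M) *m (invmx L)^T) a c = dot (row a (invmx L) *m (L *m L^T - 1%:M)) (row c (invmx L)).
    by rewrite -row_mul mxE; apply: eq_bigr => d _; rewrite !mxE.
  rewrite mxE normrN E; apply: (le_trans (dot_norm_le _ _)).
  have g := en_mulmx_le (row a (invmx L)) Ce h3.
  have g2 : n%:R ^+ 2 * (C * e) * en (row a (invmx L)) <= n%:R ^+ 2 * (C * e) * 2.
    by apply: ler_wpM2l => //; rewrite mulr_ge0 ?exprn_ge0.
  have := ler_pM (en_ge0 _) (en_ge0 _) (le_trans g g2) (rowX c) => g3.
  apply: (le_trans g3); rewrite (_ : _ * 2 * 2 = (4 * (n%:R ^+ 2 * C)) * e); last by ring.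
  by apply: ler_wpM2r; [exact: ltW|lra].
- move=> x hx hx'; have := h4 x hx' hx => h.
  have -> : phi x1 x *m invmx L + - (b *m invmx L) - phi x0 x = - ((phi x0 x *m L + b - phi x1 x) *m invmx L).
    rewrite mulmxBl mulmxDl mulmxK //; move: (phi x1 x *m _) (b *m _) (phi x0 x) => p q s.
    by apply/rowP => c; rewrite !mxE; ring.
  rewrite enN; apply: (le_trans (inv _)).
  apply: (@le_trans _ _ (2 * C * e)); first by rewrite -mulrA ler_wpM2l.
  by apply: ler_wpM2r; [exact: ltW|lra].
Qed.

(* A point moving along a segment in both charts stays in both unit balls. *)
Lemma continuation C x0 x1 L b y : 0 <= C -> (n%:R ^+ 2 + 1) * (C * e) <= 1 / 200 -> trans C x0 x1 L b ->
  D x0 x1 < 7 / 5 -> en y < 13 / 20 -> en (y *m L + b) < 13 / 20 ->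
  exists x, [/\ en (phi x0 x - y) <= e, D x0 x < 67 / 100 & D x1 x < 67 / 100].
Proof.
move=> C0 hC [h1 h2 h3 h4] hd hy hAy; have /andP[e0 e1] := fl_eps hX.
have Ce : 0 <= C * e by rewrite mulr_ge0 // ltW.
have n2 : 0 <= n%:R ^+ 2 * (C * e) by rewrite mulr_ge0 ?exprn_ge0.
have [m [m0 m1]] := flat_midpoint hX hd; rewrite (fl_sym hX) in m1.
have m0' : D x0 m < 1 by lra.
have m1' : D x1 m < 1 by lra.
have app x z : D x0 x < 1 -> D x1 x < 1 -> en (phi x0 x - z) <= e -> en (phi x1 x) <= en (z *m L + b) + 1 / 200.
  move=> a1 a2 a3; have g := en_mulmx_le (phi x0 x - z) C0 h1.
  have g2 : n%:R ^+ 2 * C * en (phi x0 x - z) <= n%:R ^+ 2 * C * e by apply: ler_wpM2l => //; rewrite mulr_ge0 ?exprn_ge0.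
  have -> : phi x1 x = - (phi x0 x *m L + b - phi x1 x) + ((phi x0 x - z) *m L) + (z *m L + b).
    rewrite mulmxBl; move: (phi x0 x *m _) (z *m _) (phi x1 x) => p q s.
    by apply/rowP => c; rewrite !mxE; ring.
  apply: (le_trans (en_triangle _ _)); rewrite addrC lerD2l; apply: (le_trans (en_triangle _ _)); rewrite enN.
  have := h4 x a1 a2; move: hC g g2; rewrite mulrDl mul1r mulrA.
  by move: (en _) (en ((_ - _) *m _)) (n%:R ^+ 2 * C * en _) (n%:R ^+ 2 * C * e) => s t p q ? ? ? ?; lra.
(* The segment has length at most 136/100; each of its 20 steps is at most 7/100, too short to lead
   from radius 3/4 out of the second unit ball, so that its chart applies again. *)
pose y0 := phi x0 m; pose z k : 'rV[R]_n := y0 + (k%:R / 20) *: (y - y0).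
have em0 := flat_en m0'; have em1 := flat_en m1'.
have conv k : (k <= 20)%N -> en (z k *m L + b) <= 72 / 100.
  move=> hk; have t0 : 0 <= k%:R / 20 :> R by rewrite divr_ge0.
  have t1 : k%:R / 20 <= 1 :> R by rewrite ler_pdivrMr // mul1r ler_nat.
  rewrite /z; move: (k%:R / 20) t0 t1 => t t0 t1.
  have -> : (y0 + t *: (y - y0)) *m L + b = (1 - t) *: (y0 *m L + b) + t *: (y *m L + b).
    rewrite mulmxDl -scalemxAl mulmxBl; apply/rowP => c.
    by rewrite !mxE; move: (\sum_ _ _) (\sum_ _ _) (b 0 c) => p q s; ring.
  apply: (le_trans (en_triangle _ _)); rewrite !enZ !ger0_norm ?subr_ge0 //.
  have a0 : en (y0 *m L + b) <= 72 / 100.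
    have := en_triangle (y0 *m L + b - phi x1 m) (phi x1 m); rewrite subrK.
    by have := h4 m m0' m1'; rewrite -/y0; move: hC; rewrite mulrDl; lra.
  have t1' : 0 <= 1 - t by move: t1; slra.
  have := ler_wpM2l t1' a0; have := ler_wpM2l t0 (ltW hAy); move: t0 t1; slra.
have en0y : en (y - y0) <= 136 / 100.
  by have := en_triangle y (- y0); rewrite enN /y0; lra.
have enz k : (k <= 20)%N -> en (z k) < 1.
  move=> hk; have t0 : 0 <= k%:R / 20 :> R by rewrite divr_ge0.
  have t1 : k%:R / 20 <= 1 :> R by rewrite ler_pdivrMr // mul1r ler_nat.
  rewrite /z; move: (k%:R / 20) t0 t1 => t t0 t1.
  have -> : y0 + t *: (y - y0) = (1 - t) *: y0 + t *: y by apply/rowP => c; rewrite !mxE; ring.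
  apply: (le_lt_trans (en_triangle _ _)); rewrite !enZ !ger0_norm ?subr_ge0 //.
  have a0 : en y0 <= 72 / 100 by rewrite /y0; lra.
  have t1' : 0 <= 1 - t by move: t1; slra.
  have := ler_wpM2l t1' a0; have := ler_wpM2l t0 (ltW hy); move: t0 t1; slra.
have P k : (k <= 20)%N -> exists x, [/\ en (phi x0 x - z k) <= e, D x0 x < 1 & D x1 x <= 3 / 4].
  elim: k => [|k IH] hk.
    exists m; split => //; last by lra.
    by rewrite /z mul0r scale0r addr0 subrr en0 ltW.
  have [x [a1 a2 a3]] := IH (ltnW hk).
  have [x' [b1 b2]] := fl_onto hX x0 (enz _ hk).
  have st : en (z k - z k.+1) <= 7 / 100.
    rewrite enB /z (_ : _ - _ = 20^-1 *: (y - y0)).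
      by rewrite enZ ger0_norm ?invr_ge0 //; move: en0y; slra.
    by rewrite opprD addrACA subrr add0r -scalerBl -[k.+1%:R]natr1 -mulrBl addrAC subrr add0r mul1r.
  have dd : en (phi x0 x - phi x0 x') <= 7 / 100 + 2 * e.
    have := en_triangleB (phi x0 x) (z k) (phi x0 x'); have := en_triangleB (z k) (z k.+1) (phi x0 x').
    by rewrite (enB (z k.+1)); move: st a1 b2; slra.
  have := flat_lower a2 b1 => dl; have := fl_tri hX x1 x x' => tr'.
  have c1 : D x1 x' < 1 by move: tr' dl dd a3 e1; slra.
  exists x'; split => //; have := app x' _ b1 c1 b2; have := conv _ hk; have := flat_of_en c1; move: e1; slra.
have [x [a1 a2 a3]] := P 20%N (leqnn _).
have zy : z 20%N = y by rewrite /z divff // scale1r addrC subrK.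
rewrite zy in a1; have a3' : D x1 x < 1 by lra.
exists x; split => //.
  have := flat_of_en a2; have := en_triangle (phi x0 x - y) y; rewrite subrK; move: a1 hy e1; slra.
by have := app x _ a2 a3' a1; have := flat_of_en a3'; move: hAy e1; slra.
Qed.

End Transitions.

Section Atlas.
Context {R : realType} (n : nat) (e : R) (X : Type) (D : X -> X -> R) (phi : X -> X -> 'rV[R]_n).
Hypothesis hX : flat e D phi.
Variable C : R.
Hypothesis C1 : 1 <= C.
Notation tran := (trans e D phi).

Let e0 : 0 < e. Proof. by have /andP[] := fl_eps hX. Qed.
Let e1 : e <= 1 / 1000. Proof. by have /andP[] := fl_eps hX. Qed.
Let C0 : 0 <= C. Proof. exact: le_trans ler01 C1. Qed.

Lemma trans_lip x0 x1 L b v t : tran C x0 x1 L b -> en v <= t -> en (v *m L) <= n%:R ^+ 2 * C * t.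
Proof.
move=> h hv; apply: (le_trans (en_mulmx_le v C0 (tr_lin h))).
by apply: ler_wpM2l => //; rewrite mulr_ge0 ?exprn_ge0.
Qed.

Lemma trans_near x0 x1 L b x y t : tran C x0 x1 L b -> D x0 x < 1 -> D x1 x < 1 -> en (phi x0 x - y) <= t ->
  en (y *m L + b - phi x1 x) <= C * e + n%:R ^+ 2 * C * t.
Proof.
move=> h h0 h1 hy.
have -> : y *m L + b - phi x1 x = (phi x0 x *m L + b - phi x1 x) + - ((phi x0 x - y) *m L).
  rewrite mulmxBl; move: (phi x0 x *m _) (y *m _) (phi x1 x) => p q s.
  by apply/rowP => c; rewrite !mxE; ring.
apply: (le_trans (en_triangle _ _)); rewrite enN; apply: lerD; first exact: tr_app h _ h0 h1.
exact: trans_lip h hy.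
Qed.

Lemma trans_refl x : tran C x x 1%:M 0.
Proof.
split=> [a c|a|a c|y _ _].
- by rewrite mxE; case: eqP => _; rewrite ?normr1 ?normr0.
- by rewrite mxE normr0.
- by rewrite trmx1 mulmx1 subrr mxE normr0 mulr_ge0 // ltW.
- by rewrite mulmx1 addr0 subrr en0 mulr_ge0 // ltW.
Qed.

Definition defect_const : R := 2 * C + n%:R ^+ 2 * C * C.
Definition lin_defect_const : R := 10 * defect_const + 5 * (n%:R ^+ 2 * (n%:R * C * C + C)).
Definition cocycle_const : R := lin_defect_const + defect_const + n%:R ^+ 2 * lin_defect_const.

(** The cocycle error [F] is affine and O(e) at coordinates of points seen in all three charts.
    Evaluated at [x] and at points displaced by about 1/5 along each axis, it controls its own
    coefficients. *)
Lemma trans_cocycle x0 x1 x2 L01 b01 L12 b12 L02 b02 x :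
  tran C x0 x1 L01 b01 -> tran C x1 x2 L12 b12 -> tran C x0 x2 L02 b02 ->
  D x0 x <= 7 / 10 -> D x1 x <= 7 / 10 -> D x2 x <= 7 / 10 ->
  (forall a c, `|(L01 *m L12 - L02) a c| <= cocycle_const * e) /\
  (forall c, `|(b01 *m L12 + b12 - b02) 0 c| <= cocycle_const * e).
Proof.
move=> t01 t12 t02 h0 h1 h2.
pose F y := y *m (L01 *m L12 - L02) + (b01 *m L12 + b12 - b02).
have n0 : 0 <= n%:R :> R by []. have nn0 : 0 <= n%:R ^+ 2 :> R by exact: exprn_ge0.
have nC : 0 <= n%:R * C * C by rewrite !mulr_ge0.
have nnC : 0 <= n%:R ^+ 2 * C * C by rewrite !mulr_ge0.
have dc0 : 0 <= defect_const by rewrite /defect_const; have := C0; lra.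
have small q : D x0 q < 1 -> D x1 q < 1 -> D x2 q < 1 -> en (F (phi x0 q)) <= defect_const * e.
  move=> q0 q1 q2.
  have -> : F (phi x0 q) = (phi x0 q *m L01 + b01 - phi x1 q) *m L12 + (phi x1 q *m L12 + b12 - phi x2 q)
       + - (phi x0 q *m L02 + b02 - phi x2 q).
    rewrite /F mulmxBl mulmxDl mulmxBr mulmxA.
    move: (phi x0 q *m _ *m _) (phi x0 q *m L02) (b01 *m _) (phi x1 q *m _) (phi x2 q) => a b c d f.
    by apply/rowP => i; rewrite !mxE; ring.
  apply: (le_trans (en_triangle _ _)); rewrite enN; have := en_triangle ((phi x0 q *m L01 + b01 - phi x1 q) *m L12) (phi x1 q *m L12 + b12 - phi x2 q).
  have := trans_lip t12 (tr_app t01 q0 q1); have := tr_app t12 q1 q2; have := tr_app t02 q0 q2.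
  rewrite /defect_const; move: (en _) (en (_ *m L12)) (en _) (en _) => a b c d; rewrite !mulrDl mulrA; lra.
have x01 : D x0 x < 1 by lra.
have h0' : (7 / 10 : R) <= 3 / 4 by lra.
have dl a c : `|(L01 *m L12 - L02) a c| <= lin_defect_const * e.
  have [|q [q0 qx hq]] := flat_move hX (x0 := x0) (x := x) (v := (1 / 5) *: delta_mx 0 a) h0 _ h0'.
    by rewrite enZ row_delta_en ger0_norm; lra.
  have q1 : D x1 q < 1 by have := fl_tri hX x1 x q; have := e1; lra.
  have q2 : D x2 q < 1 by have := fl_tri hX x2 x q; have := e1; lra.
  have s1 := small q q0 q1 q2.
  have s2 : en (F (phi x0 x)) <= defect_const * e by apply: small => //; lra.
  set M := L01 *m L12 - L02; set v := phi x0 q - (phi x0 x + (1 / 5) *: delta_mx 0 a) in hq.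
  have hM a' c' : `|M a' c'| <= n%:R * C * C + C.
    rewrite /M addmxE oppmxE; apply: (le_trans (ler_normB _ _)); apply: lerD; last exact: tr_lin t02 _ _.
    rewrite mxE; apply: (le_trans (ler_norm_sum _ _ _)).
    apply: (@le_trans _ _ (\sum_(i < n) C * C)).
      by apply: ler_sum => i _; rewrite normrM; apply: ler_pM => //; [exact: tr_lin t01 _ _|exact: tr_lin t12 _ _].
    by rewrite sumr_const card_ord -[leLHS]mulr_natl mulrA.
  have E : (1 / 5) *: row a M = F (phi x0 q) + - F (phi x0 x) + - (v *m M).
    rewrite /F -/M /v mulmxBl mulmxDl -scalemxAl rowE.
    move: (phi x0 q *m _) (phi x0 x *m _) (delta_mx _ _ *m _) (b01 *m _ + _ - _) => s t r f.
    by apply/rowP => i; rewrite !mxE; ring.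
  have Q0 : 0 <= n%:R * C * C + C by rewrite addr_ge0.
  have g : en (v *m M) <= n%:R ^+ 2 * (n%:R * C * C + C) * e.
    apply: (le_trans (en_mulmx_le v Q0 hM)); apply: ler_wpM2l => //; exact: mulr_ge0.
  have := coord_le_en ((1 / 5) *: row a M) c; rewrite !mxE normrM ger0_norm ?divr_ge0 // => k.
  have := en_triangle (F (phi x0 q) + - F (phi x0 x)) (- (v *m M)); rewrite -E enN => k1.
  have := en_triangle (F (phi x0 q)) (- F (phi x0 x)); rewrite enN => k2.
  rewrite /lin_defect_const; move: (n%:R ^+ 2 * _) defect_const k k1 k2 g s1 s2 {dc0 small} => Q K.
  rewrite mulrDl -!mulrA; lra.
have lc0 : 0 <= lin_defect_const.
  rewrite /lin_defect_const; have : 0 <= n%:R ^+ 2 * (n%:R * C * C + C) by rewrite mulr_ge0 // addr_ge0.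
  by move: dc0; move: defect_const (n%:R ^+ 2 * _) => a b; lra.
have nl : 0 <= n%:R ^+ 2 * lin_defect_const by exact: mulr_ge0.
split=> [a c|c].
  apply: (le_trans (dl a c)); apply: ler_wpM2r; first exact: ltW.
  by rewrite /cocycle_const; lra.
apply: (le_trans (coord_le_en _ _)).
have -> : b01 *m L12 + b12 - b02 = F (phi x0 x) + - (phi x0 x *m (L01 *m L12 - L02)).
  by rewrite /F [RHS]addrAC subrr add0r.
apply: (le_trans (en_triangle _ _)); rewrite enN.
have s2 : en (F (phi x0 x)) <= defect_const * e by apply: small => //; lra.
have le0 : 0 <= lin_defect_const * e by rewrite mulr_ge0 // ltW.
have g := en_mulmx_le (phi x0 x) le0 dl.
have g2 : n%:R ^+ 2 * (lin_defect_const * e) * en (phi x0 x) <= n%:R ^+ 2 * (lin_defect_const * e) * 1.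
  by apply: ler_wpM2l; [exact: mulr_ge0|have := flat_en hX x01; have := e1; lra].
have := mulr_ge0 lc0 (ltW e0); move: g g2 s2; rewrite /cocycle_const mulr1 [_ * (_ * e)]mulrA.
move: (n%:R ^+ 2 * lin_defect_const) lin_defect_const defect_const => a b c'.
by rewrite !mulrDl => ? ? ? ?; lra.
Qed.

End Atlas.

(** * Gluing data from the approximate charts *)

Section AtlasData.
Context {R : realType} (n : nat).

Definition atlas_const : R := 2 + (2 + 4 * n%:R ^+ 2) * trans_const n + 2 * n%:R * trans_const n.
Definition atlas_bound : R := atlas_const + cocycle_const n atlas_const.

Lemma trans_const_ge0 : 0 <= trans_const n :> R.
Proof.
have := @frame_const_ge R n; have : 0 <= n%:R ^+ 2 :> R by exact: exprn_ge0.
rewrite /trans_const; move: (frame_const n) (n%:R ^+ 2) => a b; lra.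
Qed.

Lemma atlas_const_ge : 2 <= atlas_const /\ trans_const n <= atlas_const.
Proof.
have t0 := trans_const_ge0.
have : 0 <= n%:R ^+ 2 * trans_const n :> R by rewrite mulr_ge0 ?exprn_ge0.
have : 0 <= n%:R * trans_const n :> R by rewrite mulr_ge0.
rewrite /atlas_const; move: (trans_const n) t0 => t t0; rewrite mulrDl -!mulrA.
by move: (n%:R * t) (n%:R ^+ 2 * t) => a b ? ?; split; lra.
Qed.

Lemma cocycle_const_ge0 (C : R) : 0 <= C -> 0 <= cocycle_const n C.
Proof.
move=> C0; have nn : 0 <= n%:R ^+ 2 :> R by exact: exprn_ge0.
have n0 : 0 <= n%:R :> R by [].
have d0 : 0 <= defect_const n C by rewrite /defect_const addr_ge0 // !mulr_ge0.
have l0 : 0 <= lin_defect_const n C by rewrite /lin_defect_const addr_ge0 // !mulr_ge0 // addr_ge0 // !mulr_ge0.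
rewrite /cocycle_const; apply: addr_ge0; first exact: addr_ge0.
exact: mulr_ge0.
Qed.

Lemma atlas_bound_ge : atlas_const <= atlas_bound.
Proof.
rewrite /atlas_bound lerDl; apply: cocycle_const_ge0.
by have [h _] := atlas_const_ge; lra.
Qed.

Lemma flat_gdata (e : R) (X : Type) (D : X -> X -> R) (phi : X -> X -> 'rV[R]_n) : flat e D phi ->
  (n%:R ^+ 2 + 1) * (atlas_bound * e) <= 1 / 1000 ->
  exists (G : gdata n) (p : G -> X),
  [/\ eps G = e,
      good (packing_bound n).+1 (packing_bound n) atlas_bound (13 / 20) G /\ regular atlas_bound G,
      forall i j : G, j \in nb i <-> D (p i) (p j) < 7 / 5,
      forall x, exists i : G, D x (p i) < 1 / 30 &
      forall i j : G, j \in nb i -> trans e D phi atlas_bound (p i) (p j) (lin i j) (trn i j)].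
Proof.
move=> hX sm; have /andP[e0 e1] := fl_eps hX; have e0' := ltW e0.
have [I [p [cl [nbs [cl_lt nbs_u nbsP colour cover]]]]] := coloured_net hX.
have [C2 tC] := atlas_const_ge; have CB := atlas_bound_ge; have t0 := trans_const_ge0.
have C1 : 1 <= atlas_const by lra.
have B1 : 1 <= atlas_bound by lra.
have B0 : 0 <= atlas_bound by lra.
have nn : 0 <= n%:R ^+ 2 :> R by exact: exprn_ge0.
have smB (c : R) : 0 <= c <= atlas_bound -> 0 <= c * e /\ (n%:R ^+ 2 + 1) * (c * e) <= 1 / 1000.
  move=> /andP[c0 cB]; split; first exact: mulr_ge0.
  apply: le_trans sm; apply: ler_wpM2l; first by rewrite addr_ge0.
  exact: ler_wpM2r.
have H (q : I * I) : exists t : ('M[R]_n * 'rV[R]_n) * ('M[R]_n * 'rV[R]_n), D (p q.1) (p q.2) < 7 / 5 ->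
    [/\ trans e D phi atlas_const (p q.1) (p q.2) t.1.1 t.1.2,
        trans e D phi atlas_const (p q.2) (p q.1) t.2.1 t.2.2,
        forall y, (y *m t.1.1 + t.1.2) *m t.2.1 + t.2.2 = y &
        forall y, (y *m t.2.1 + t.2.2) *m t.1.1 + t.1.2 = y].
  case: q => i j /=; case: (ltP (D (p i) (p j)) (7 / 5)) => [h|h]; last by exists (0, 0, (0, 0)).
  have [L [b t]] := trans_exists hX h.
  have [sm0 sm1] : 0 <= trans_const n * e /\ (n%:R ^+ 2 + 1) * (trans_const n * e) <= 1 / 1000.
    by apply: smB; rewrite t0 /=; lra.
  have [|uL ti] := trans_inv hX t0 _ t; first by move: sm1; rewrite mulrDl mul1r; lra.
  exists ((L, b), (invmx L, - (b *m invmx L))) => _ /=; split.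
  - by apply: (@trans_le _ _ _ _ _ _ hX (trans_const n) atlas_const).
  - exact: ti.
  - by move=> y; rewrite mulmxDl mulmxK // addrK.
  - by move=> y; rewrite mulmxDl mulNmx !mulmxKV // subrK.
have [t ht] := choice H.
(* Distinct neighbours have different colours. The approximate transition is used from the lower
   colour to the higher one, and its exact inverse the other way. *)
pose ln (i j : I) := if i == j then 1%:M else if (cl i < cl j)%N then (t (i, j)).1.1 else (t (j, i)).2.1.
pose tn (i j : I) := if i == j then 0 else if (cl i < cl j)%N then (t (i, j)).1.2 else (t (j, i)).2.2.
pose G := GData cl nbs ln tn e.
have nb_sym (i j : I) : j \in nbs i -> i \in nbs j by move=> /nbsP h; apply/nbsP; rewrite (fl_sym hX).
have tr0 (i j : I) : j \in nbs i -> trans e D phi atlas_const (p i) (p j) (ln i j) (tn i j).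
  move=> ij; rewrite /ln /tn; case: eqP => [->|_]; first exact: trans_refl hX _ C1 _.
  case: ifP => _; first by have /nbsP/(ht (i, j))[] := ij.
  by have /nbsP/(ht (j, i))[] := nb_sym _ _ ij.
have tr1 (i j : I) : j \in nbs i -> trans e D phi atlas_bound (p i) (p j) (ln i j) (tn i j).
  by move=> /tr0; apply: (@trans_le _ _ _ _ _ _ hX atlas_const atlas_bound).
have [[s0 s1] [s2 s3]] : (0 <= atlas_const * e /\ (n%:R ^+ 2 + 1) * (atlas_const * e) <= 1 / 1000) /\
   (0 <= atlas_bound * e /\ (n%:R ^+ 2 + 1) * (atlas_bound * e) <= 1 / 1000).
  by split; apply: smB; apply/andP; split; move: C1 CB B0; qlra.
have cont (i j : I) y : j \in nbs i -> en y < 13 / 20 -> en (y *m ln i j + tn i j) < 13 / 20 ->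
    exists x, [/\ en (phi (p i) x - y) <= e, D (p i) x < 67 / 100 & D (p j) x < 67 / 100].
  move=> ij h1 h2; apply: (continuation hX _ _ (tr1 i j ij) _ h1 h2) => //; last exact/nbsP.
  by apply: (le_trans sm); qlra.
have cBe : cocycle_const n atlas_const * e <= atlas_bound * e.
  by apply: ler_wpM2r => //; rewrite /atlas_bound lerDr; move: C1; qlra.
(* [continuation] towards [j] and towards [l] gives two points with nearly the same coordinates in
   [i], hence at distance at most [3 * e]. The first is then seen in all three charts. *)
have cocycle (i j l : I) : j \in nbs i -> l \in nbs i -> forall y,
    en y < 13 / 20 -> en (y *m ln i j + tn i j) < 13 / 20 -> en (y *m ln i l + tn i l) < 13 / 20 ->
    l \in nbs j /\ @near_cocycle R n atlas_bound G i j l.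
  move=> ij il y hy hj hl.
  have [x [x1 x2 x3]] := cont _ _ _ ij hy hj; have [x' [y1 y2 y3]] := cont _ _ _ il hy hl.
  have dx : D x x' <= 3 * e.
    have x2' : D (p i) x < 1 by move: x2; qlra.
    have y2' : D (p i) x' < 1 by move: y2; qlra.
    have := flat_lower hX x2' y2'; have := en_triangleB (phi (p i) x) y (phi (p i) x').
    by rewrite (enB y); move: x1 y1; qlra.
  have x4 : D (p l) x <= 7 / 10 by have := fl_tri hX (p l) x' x; rewrite (fl_sym hX x'); move: dx y3 e1; qlra.
  have jl : l \in nbs j.
    by apply/nbsP; have := fl_tri hX (p j) x (p l); rewrite (fl_sym hX x); move: x3 x4; qlra.
  have x2' : D (p i) x <= 7 / 10 by move: x2; qlra.
  have x3' : D (p j) x <= 7 / 10 by move: x3; qlra.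
  split => //; have [g1 g2] := trans_cocycle hX C1 (tr0 _ _ ij) (tr0 _ _ jl) (tr0 _ _ il) x2' x3' x4.
  split=> [a c|c]; by [exact: le_trans (g1 a c) cBe|exact: le_trans (g2 c) cBe].
have near_vtx (i j : I) : D (p i) (p j) < 1 / 10 -> j \in nbs i /\ en (tn i j) < 1 / 2.
  move=> h; have ij : j \in nbs i by apply/nbsP; move: h; qlra.
  split => //; have /(tr_app (tr1 _ _ ij)) : D (p i) (p i) < 1 by rewrite (fl_refl hX).
  have h' : D (p j) (p i) < 1 by rewrite (fl_sym hX); move: h; qlra.
  move=> /(_ h'); rewrite (fl_center hX) mul0mx add0r => k.
  have := en_triangle (tn i j - phi (p j) (p i)) (phi (p j) (p i)); rewrite subrK.
  have := flat_en hX h'; rewrite (fl_sym hX) => k2.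
  by move: s3 h e1 k k2; rewrite mulrDl mul1r; have := mulr_ge0 nn s2; qlra.
exists G, p; split => //.
split; first split.
- by rewrite /= e0 /=; move: e1; qlra.
- exact: cl_lt.
- by move=> i; have [] := nbs_u i.
- by move=> i; have [] := nbs_u i.
- by move=> i; apply/nbsP; rewrite (fl_refl hX); qlra.
- exact: nb_sym.
- by move=> i j /nbsP; exact: colour.
- by move=> i j ij; exact: tr_lin (tr1 i j ij).
- by move=> i j ij; exact: tr_trn (tr1 i j ij).
- by move=> i y; rewrite /aff /= /ln /tn eqxx mulmx1 addr0.
- move=> i j ij y; rewrite /aff /= /ln /tn (eq_sym j i); case: eqP => [_|nij]; first by rewrite !mulmx1 !addr0.
  case: (ltngtP (cl i) (cl j)) => [_|_|E].
  + by have /nbsP/(ht (i, j))[_ _ h _] := ij; exact: h.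
  + by have /nbsP/(ht (j, i))[_ _ _ h] := nb_sym _ _ ij; exact: h.
  + by case: nij; apply: colour => //; exact/nbsP.
- by move=> i j l ij il y; exact: cocycle.
split.
- by move=> i j ij; exact: tr_orth (tr1 i j ij).
- move=> i y hy.
  have [|x [x1 x2]] := fl_onto hX (p i) (v := y); first by move: hy; qlra.
  have [l hl] := cover x; have hx := flat_of_en hX x1.
  have ey : en (phi (p i) x) <= en y + e by have := en_triangle (phi (p i) x - y) y; rewrite subrK; move: x2; qlra.
  have il : l \in nbs i by apply/nbsP; have := fl_tri hX (p i) x (p l); move: hl hx ey hy e1; qlra.
  exists l => //; rewrite (fl_sym hX) in hl; have hl' : D (p l) x < 1 by move: hl; qlra.
  have := trans_near B1 (tr1 _ _ il) x1 hl' x2; have := flat_en hX hl'.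
  have := en_triangle (aff (G := G) i l y - phi (p l) x) (phi (p l) x); rewrite subrK /aff /=.
  by move: s3 hl e1; rewrite mulrDl mul1r mulrA; qlra.
move=> P [i0 Pi0] hP j.
have [N [c [c0 cN cs _]]] := fl_chain hX (p i0) (p j).
have step (i l : I) : D (p i) (p l) < 1 / 10 -> P i -> P l.
  by move=> h; have [il ht'] := near_vtx _ _ h; exact: hP.
suff Q k : (k <= N)%N -> forall v, D (c k) (p v) < 1 / 30 -> P v.
  by apply: (Q N (leqnn _)); rewrite cN (fl_refl hX); qlra.
elim: k => [|k IH] hk v hv; first by apply: step Pi0; rewrite -c0; move: hv; qlra.
have [u hu] := cover (c k); apply: (step u); last exact: IH (ltnW hk) u hu.
have := fl_tri hX (p u) (c k) (p v); have := fl_tri hX (c k) (c k.+1) (p v); have := cs k hk.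
by rewrite (fl_sym hX (p u) (c k)); move: hu hv e1; qlra.
Qed.

End AtlasData.

(** * From local to global comparison of distances *)

Section LocalToGlobal.
Context {R : realType} (X Y : Type) (D : X -> X -> R) (D' : Y -> Y -> R).

(** Cut off a piece of length about 3/10. This costs [2 * e] for the splitting and [eta] for the
    comparison, which [(8 * e + 4 * eta) * (3 / 10 - e)] pays for, as [3 / 10 - e >= 1 / 4]. The
    induction counts quarters of a unit. *)
Lemma splits_global (e eta : R) (F : X -> Y) : 0 < e <= 1 / 50 -> 0 <= eta ->
  (forall x y, 0 <= D x y) -> (forall p q q', D' p q' <= D' p q + D' q q') -> splits D e ->
  (forall x y, D x y < 2 / 5 -> D' (F x) (F y) <= D x y + eta) ->
  forall x y, D' (F x) (F y) <= (1 + (8 * e + 4 * eta)) * D x y + eta.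
Proof.
move=> /andP[e0 e1] eta0 D0 tri sp loc x y.
have [K KE] : exists K, K = 8 * e + 4 * eta by exists (8 * e + 4 * eta).
rewrite -KE; suff H k : forall x y, D x y < k%:R * (1 / 4) -> D' (F x) (F y) <= (1 + K) * D x y + eta.
  have [k _ hk] : exists2 k : nat, True & D x y < k%:R * (1 / 4).
    exists (Num.truncn (4 * D x y)).+1 => //.
    have /andP[_] := truncn_itv (mulr_ge0 (ler0n R 4) (D0 x y)).
    by move: (Num.truncn _).+1 => k; move: (k%:R : R) => u; lra.
  exact: (H k).
elim: k => [|k IH] {}x {}y hk; first by have := D0 x y; move: hk; rewrite mul0r; lra.
have K0 : 0 <= K by lra.
have [hs|hs] := ltP (D x y) (2 / 5).
  have := loc _ _ hs; have := mulr_ge0 K0 (D0 x y); rewrite mulrDl mul1r; lra.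
have [|z z1 z2] := sp x y (3 / 10); first by apply/andP; split; lra.
have h1 : D x z < 2 / 5 by lra.
have h2 : D z y < k%:R * (1 / 4).
  by move: hk; rewrite -[k.+1%:R]natr1; move: (k%:R : R) => u; lra.
have l1 := loc _ _ h1; have l2 := IH _ _ h2; have := tri (F x) (F z) (F y).
have K1 : 0 <= 1 + K by lra.
have g : (1 + K) * D z y <= (1 + K) * (D x y - 3 / 10 + e) by exact: ler_wpM2l.
have h : 3 / 10 + e + eta <= (1 + K) * (3 / 10 - e).
  rewrite mulrDl mul1r; have : K * (1 / 4) <= K * (3 / 10 - e) by apply: ler_wpM2l; lra.
  lra.
move: l1 l2 g h z1; rewrite !mulrDr; move: (1 + _) => L.
by rewrite !mulrN; move: (L * D x y) (L * (3 / 10)) (L * e) (L * D z y) => ? ? ? ? ? ? ? ? ? ?; lra.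
Qed.

End LocalToGlobal.

Record close_maps (R : realType) (X Y : Type) (D : X -> X -> R) (D' : Y -> Y -> R) (e eta : R)
    (F : X -> Y) (g : Y -> X) : Prop := CloseMaps {
  cm_eps : 0 < e <= 1 / 50 ;
  cm_eta : 0 <= eta ;
  cm_ge0 : forall x y, 0 <= D x y ;
  cm_sym : forall x y, D x y = D y x ;
  cm_tri : forall x y z, D x z <= D x y + D y z ;
  cm_splits : splits D e ;
  cm_local : forall x y, D x y < 2 / 5 -> D' (F x) (F y) <= D x y + eta ;
  cm_inv : forall x, D (g (F x)) x <= eta
}.

Section CloseMaps.
Context {R : realType} (X Y : Type) (D : X -> X -> R) (D' : Y -> Y -> R) (e eta : R) (F : X -> Y) (g : Y -> X).
Hypotheses (h : close_maps D D' e eta F g) (h' : close_maps D' D e eta g F).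
Let K := 8 * e + 4 * eta.

Lemma close_maps_upper x y : D' (F x) (F y) <= (1 + K) * D x y + eta.
Proof.
exact: (splits_global (cm_eps h) (cm_eta h) (cm_ge0 h) (cm_tri h') (cm_splits h) (cm_local h)).
Qed.

(** The upper bound for [g] at the images, plus the displacement [eta] of [g \o F] at both ends. *)
Lemma close_maps_lower x y : D x y <= (1 + K) * D' (F x) (F y) + 3 * eta.
Proof.
have : D (g (F x)) (g (F y)) <= (1 + K) * D' (F x) (F y) + eta.
  exact: (splits_global (cm_eps h') (cm_eta h') (cm_ge0 h') (cm_tri h) (cm_splits h') (cm_local h')).
have := cm_tri h x (g (F x)) y; have := cm_tri h (g (F x)) (g (F y)) y.
have := cm_inv h x; rewrite (cm_sym h _ x); have := cm_inv h y; lra.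
Qed.

Lemma close_maps_quasi (r C t : R) : 0 < r -> K <= C * t -> 3 * eta < C * t ->
  quasi_isometry (1 + C * t) (C * t * r) (fun x y => r * D x y) (fun p q => r * D' p q) F.
Proof.
move=> r0 hK ht; have eta0 := cm_eta h; have /andP[e0 _] := cm_eps h; split.
  move=> q; exists (g q); rewrite mulrC ler_pM2r // (cm_sym h').
  by apply: (le_trans (cm_inv h' q)); lra.
move=> x y; have u := close_maps_upper x y; have l := close_maps_lower x y.
have d0 := cm_ge0 h x y; have d0' := cm_ge0 h' (F x) (F y).
have L0 : 0 < 1 + C * t by rewrite ltr_pwDl //; lra.
have kd : (1 + K) * D x y <= (1 + C * t) * D x y by apply: ler_wpM2r => //; lra.
have kd' : (1 + K) * D' (F x) (F y) <= (1 + C * t) * D' (F x) (F y) by apply: ler_wpM2r => //; lra.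
split.
  rewrite mulrCA (mulrC (C * t)) -mulrBr ltr_pM2l // ltrBlDr -(ltr_pM2l L0) mulrA divff ?gt_eqF // mul1r mulrDr.
  have : C * t <= (1 + C * t) * (C * t) by rewrite ler_peMl //; lra.
  by move: (_ * D' _ _) (_ * D' _ _) kd' l => a b; lra.
rewrite mulrCA (mulrC (C * t)) -mulrDr ltr_pM2l //.
lra.
Qed.

(* Over a bounded space the multiplicative error becomes additive. *)
Lemma close_maps_distortion (d : R) x y : 1 <= d -> D x y <= d -> K <= 1 -> eta <= 1 ->
  `|D' (F x) (F y) - D x y| <= (3 * K + 3 * eta) * d.
Proof.
move=> d1 hd K1 eta1; have eta0 := cm_eta h; have /andP[e0 _] := cm_eps h.
have K0 : 0 <= K by rewrite /K; lra.
have := close_maps_upper x y; have := close_maps_lower x y.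
move: K K0 K1 => k K0 K1 l u; have d0 := cm_ge0 h x y; have d0' := cm_ge0 h' (F x) (F y).
have a1 : k * D x y <= k * d by exact: ler_wpM2l.
have a2 : eta <= eta * d by rewrite ler_peMr.
have a3 : k * D x y <= 1 * D x y by exact: ler_wpM2r.
have a4 : k * D' (F x) (F y) <= k * (3 * d).
  by apply: ler_wpM2l => //; move: u; rewrite mulrDl; lra.
have a5 : 0 <= k * d by rewrite mulr_ge0 //; lra.
have a6 : 0 <= eta * d by rewrite mulr_ge0 //; lra.
have -> : (3 * k + 3 * eta) * d = 3 * (k * d) + 3 * (eta * d) by ring.
rewrite (_ : k * (3 * d) = 3 * (k * d)) in a4; last by ring.
rewrite mulrDl mul1r in u; rewrite mulrDl mul1r in l.
rewrite ler_norml; move: a1 a2 a3 a4 a5 a6 u l d0 d0'.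
by clear; intros; apply/andP; split; lra.
Qed.

End CloseMaps.

(** * Maps between the space and the manifold *)

Section ApproximationMaps.
Context {R : realType} (n : nat) (e : R) (X : Type) (D : X -> X -> R) (phi : X -> X -> 'rV[R]_n).
Hypothesis hX : flat e D phi.
Variables (B K : R) (G : @gdata R n) (p : G -> X) (Gm : geom n (K * e)) (f : G -> Gm).
Hypotheses (B1 : 1 <= B) (K1 : 1 <= K).
Hypothesis vtx_nb : forall i j : G, j \in nb i <-> D (p i) (p j) < 7 / 5.
Hypothesis vtx_cover : forall x, exists i : G, D x (p i) < 1 / 30.
Hypothesis vtx_trans : forall i j : G, j \in nb i -> trans e D phi B (p i) (p j) (lin i j) (trn i j).
Hypothesis f_surj : forall i', exists i, f i = i'.
Hypothesis f_nb : forall i j, (f j \in gnb (f i)) = (j \in nb i).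
Hypothesis f_close : forall i j : G, j \in nb i -> forall y, en (gT (f i) (f j) y - aff i j y) <= K * e.
Hypothesis kappa_small : n%:R ^+ 2 * (K * e) <= 1 / 100.
Hypothesis B_small : (n%:R ^+ 2 + 1) * (B * e) <= 1 / 1000.
Hypothesis K_small : K * e <= 1 / 1000.
Variables (r : R) (r0 : 0 < r).
Local Notation M := (mfd Gm kappa_small r0).
Local Notation nu := (n%:R ^+ 2 * (K * e)).
Let D' (q q' : M) : R := riem_dist q q' / r.

Let e0 : 0 < e. Proof. by have /andP[] := fl_eps hX. Qed.
Let e1 : e <= 1 / 1000. Proof. by have /andP[] := fl_eps hX. Qed.
Let nu0 : 0 <= nu.
Proof. apply: mulr_ge0; first exact: exprn_ge0.
by apply: mulr_ge0; [exact: le_trans ler01 K1|exact: ltW]. Qed.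
Let Be : 0 <= B * e /\ 0 <= n%:R ^+ 2 * (B * e) /\ n%:R ^+ 2 * (B * e) + B * e <= 1 / 1000.
Proof.
have h : 0 <= B * e by apply: mulr_ge0; [exact: le_trans ler01 B1|exact: ltW].
split=> //; split; first by rewrite mulr_ge0 ?exprn_ge0.
by move: B_small; rewrite mulrDl mul1r.
Qed.

Let D'_tri q q' q'' : D' q q'' <= D' q q' + D' q' q''.
Proof. by rewrite /D' -mulrDl ler_pM2r ?invr_gt0 //; exact: rd_triangle. Qed.

Let D'_sym q q' : D' q q' = D' q' q. Proof. by rewrite /D' rd_sym. Qed.

Let D'_pt i y z : en y < 3 / 5 -> en z < 3 / 5 -> D' (pt i y) (pt i z) <= (1 + nu) * en (z - y).
Proof.
move=> hy hz; rewrite /D' ler_pdivrMr //; apply: (le_trans (rd_upper kappa_small r0 i hy hz)).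
by rewrite mulrAC.
Qed.

Let D'_close i y z (t : R) : en y < 3 / 5 -> en z < 3 / 5 -> en (z - y) <= t -> D' (pt i y) (pt i z) <= 2 * t.
Proof.
move=> hy hz ht; apply: (le_trans (D'_pt i hy hz)); have t0 := le_trans (en_ge0 _) ht.
apply: (@le_trans _ _ ((1 + nu) * t)); first by apply: ler_wpM2l => //; have := nu0; lra.
by apply: ler_wpM2r => //; have := kappa_small; lra.
Qed.

Definition near_vtx x : G := projT1 (cid (vtx_cover x)).

Lemma near_vtxP x : D (p (near_vtx x)) x < 1 / 30.
Proof. by rewrite (fl_sym hX) /near_vtx; case: cid. Qed.

Definition lift_vtx (i' : Gm) : G := projT1 (cid (f_surj i')).

Lemma lift_vtxK i' : f (lift_vtx i') = i'. Proof. by rewrite /lift_vtx; case: cid. Qed.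

Definition to_mfd x : M := pt (f (near_vtx x)) (phi (p (near_vtx x)) x).

Let from_ex (q : M) : exists x, D (p (lift_vtx (gbase q))) x < 1 /\ en (phi (p (lift_vtx (gbase q))) x - ch (gbase q) q) <= e.
Proof.
have [h _] := @gbaseP R n (K * e) Gm q.
by apply: (fl_onto hX); apply: (lt_trans h); lra.
Qed.

Definition from_mfd (q : M) : X := projT1 (cid (from_ex q)).

Lemma from_mfdP (q : M) : exists i y, [/\ q = pt (f i) y, en y < 1 / 20, f i = gbase q,
  D (p i) (from_mfd q) < 1 & en (phi (p i) (from_mfd q) - y) <= e].
Proof.
have [h /pt_ch[h1 h2]] := @gbaseP R n (K * e) Gm q.
exists (lift_vtx (gbase q)), (ch (gbase q) q); split => //.
- by rewrite lift_vtxK h2.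
- exact: lift_vtxK.
- by rewrite /from_mfd; case: cid => x [].
- by rewrite /from_mfd; case: cid => x [].
Qed.

Let c1 : R := 2 * (K + B) * e.

(** The arbitrary choice of a vertex near [x] matters only up to O(e): the glued transition is
    [K * e]-close to the affine one, which matches the two approximate charts up to [B * e]. *)
Lemma to_mfd_chart (i : G) x : D (p i) x < 11 / 20 -> D' (pt (f i) (phi (p i) x)) (to_mfd x) <= c1.
Proof.
move=> hx; have hu := near_vtxP x; set u := near_vtx x in hu.
have [b0 [b1 b2]] := Be.
have ui : i \in nb u.
  by apply/vtx_nb; have := fl_tri hX (p u) x (p i); rewrite (fl_sym hX x); move: hx hu; lra.
have hu1 : D (p u) x < 1 by lra.
have hx1 : D (p i) x < 1 by lra.
set y := phi (p u) x; have ey : en y < 3 / 5 by have := flat_en hX hu1; rewrite -/y; have := e1; lra.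
have a1 := f_close ui y; have a2 := tr_app (vtx_trans ui) hu1 hx1.
set z := gT (f u) (f i) y in a1.
have ez : en (z - phi (p i) x) <= (K + B) * e.
  by apply: (le_trans (en_triangleB _ (aff u i y) _)); rewrite mulrDl; apply: lerD.
have ex := flat_en hX hx1; have ks := K_small.
have ez2 : en z < 3 / 5.
  have := en_triangle (z - phi (p i) x) (phi (p i) x); rewrite subrK.
  by move: ez ex hx; rewrite mulrDl; have := e1; lra.
have ex2 : en (phi (p i) x) < 3 / 5 by have := e1; lra.
rewrite /to_mfd -/u -/y -(@pt_trE _ _ _ Gm (f u) (f i) y ey) ?f_nb // -/z D'_sym.
rewrite /c1 -mulrA; apply: D'_close => //; by rewrite enB.
Qed.

Let c2 : R := (K + (1 + n%:R ^+ 2) * B + 5) * e.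

(** The point [x0] supplied by [continuation] is seen in both charts, and the two candidate
    preimages of [q] are compared with it. *)
Lemma from_mfd_chart (i : G) y x (q : M) : q = pt (f i) y -> en y < 11 / 20 -> D (p i) x < 1 ->
  en (phi (p i) x - y) <= e -> D (from_mfd q) x <= c2.
Proof.
move=> qE hy hx hxy; have [i0 [y0 [qE0 hy0 _ hg hgy]]] := from_mfdP q.
have [b0 [b1 b2]] := Be; have ks := K_small.
have y0' : en y0 < 3 / 5 by lra.
have y' : en y < 3 / 5 by lra.
have [] := pt_eq_tr y0' y' (etrans (esym qE0) qE); rewrite f_nb => i0i Ty.
have a1 := f_close i0i y0; rewrite Ty in a1.
have ha : en (aff i0 i y0) < 13 / 20.
  have := en_triangle (aff i0 i y0 - y) y; rewrite subrK enB; lra.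
have [||x0 [h1 h2 h3]] := continuation hX (le_trans ler01 B1) _ (vtx_trans i0i) ((vtx_nb i0 i).1 i0i) _ ha.
- by have := B_small; lra.
- lra.
have h2' : D (p i0) x0 < 1 by lra.
have h3' : D (p i) x0 < 1 by lra.
have t := trans_near B1 (vtx_trans i0i) h2' h3' h1.
have d1 := flat_lower hX hg h2'; have d2 := flat_lower hX h3' hx.
have d3 := en_triangleB (phi (p i0) (from_mfd q)) y0 (phi (p i0) x0); rewrite (enB y0) in d3.
have d4 := en_triangleB (phi (p i) x0) (aff i0 i y0) (phi (p i) x).
have d5 := en_triangleB (aff i0 i y0) y (phi (p i) x).
rewrite (enB (phi (p i) x0) (aff i0 i y0)) in d4; rewrite (enB (aff i0 i y0) y) (enB y (phi (p i) x)) in d5.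
have := fl_tri hX (from_mfd q) x0 x; rewrite /c2 /aff in d3 d4 d5 a1 t *.
by rewrite (_ : _ * e = K * e + B * e + n%:R ^+ 2 * B * e + 5 * e); [lra|ring].
Qed.

Definition maps_const : R := n%:R ^+ 2 * K + 2 * K + 2 * B + (1 + n%:R ^+ 2) * B + 10.

Lemma maps_const_ge : c1 + nu + 2 * e <= maps_const * e /\ c2 + nu + 3 * e <= maps_const * e /\ 0 <= maps_const * e.
Proof.
have [b0 [b1 _]] := Be; have h := nu0; have k0 : 0 <= K * e by apply: mulr_ge0; [exact: le_trans ler01 K1|exact: ltW].
have -> : maps_const * e = nu + 2 * (K * e) + 2 * (B * e) + (B * e + n%:R ^+ 2 * (B * e)) + 10 * e.
  by rewrite /maps_const; ring.
have -> : c1 = 2 * (K * e) + 2 * (B * e) by rewrite /c1; ring.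
have -> : c2 = K * e + (B * e + n%:R ^+ 2 * (B * e)) + 5 * e by rewrite /c2; ring.
by have ee := e0; split; [lra|split; lra].
Qed.

Lemma close_maps_to : close_maps D D' e (maps_const * e) to_mfd from_mfd.
Proof.
have [m1 [m2 m3]] := maps_const_ge; have ee := e0; have ee1 := e1; have nn := nu0; have ks := kappa_small.
split=> //.
- by rewrite ee /=; lra.
- exact: flat_ge0 hX.
- exact: fl_sym hX.
- exact: fl_tri hX.
- exact: flat_splits hX.
(* Distances below 2/5 are read in the chart of the vertex near [x], since 1/30 + 2/5 < 11/20. *)
- move=> x y hxy; have hx := near_vtxP x; set i := near_vtx x in hx.
  have hy : D (p i) y < 11 / 20 by have := fl_tri hX (p i) x y; lra.
  have hx1 : D (p i) x < 1 by lra.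
  have hy1 : D (p i) y < 1 by lra.
  have a := to_mfd_chart hy; have ex := flat_en hX hx1; have ey := flat_en hX hy1.
  have ex' : en (phi (p i) x) < 3 / 5 by lra.
  have ey' : en (phi (p i) y) < 3 / 5 by lra.
  have b := D'_pt (f i) ex' ey'; have c := flat_upper hX hy1 hx1; rewrite (fl_sym hX y) in c.
  have d := D'_tri (to_mfd x) (pt (f i) (phi (p i) y)) (to_mfd y).
  have g : nu * en (phi (p i) y - phi (p i) x) <= nu * 1 by apply: ler_wpM2l => //; lra.
  rewrite -[pt (f i) (phi (p i) x)]/(to_mfd x) mulrDl mul1r in b; lra.
- move=> x; have hx := near_vtxP x; set i := near_vtx x in hx; have hx1 : D (p i) x < 1 by lra.
  have := @from_mfd_chart i (phi (p i) x) x (to_mfd x) erefl _ hx1.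
  by rewrite subrr en0 => /(_ _ (ltW ee)) h; apply: (le_trans (h _)); have := flat_en hX hx1; lra.
Qed.

Lemma close_maps_from : close_maps D' D e (maps_const * e) from_mfd to_mfd.
Proof.
have [m1 [m2 m3]] := maps_const_ge; have ee := e0; have ee1 := e1; have nn := nu0; have ks := kappa_small.
split=> //.
- by rewrite ee /=; lra.
- by move=> q q'; rewrite /D' divr_ge0 ?rd_ge0 // ltW.
- move=> q q' c /andP[c0 cq].
  have [||z [z1 z2]] := @rd_split R n (K * e) Gm kappa_small r r0 q q' (r * c) (r * e).
  + exact: mulr_gt0.
  + apply/andP; split; first exact: mulr_ge0 (ltW r0) c0.
    by move: cq; rewrite /D' ler_pdivlMr // mulrC.
  exists z; rewrite /D' ler_pdivrMr //.
    by apply: (le_trans z1); rewrite (mulrC r) ler_pM2r //; lra.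
  apply: (le_trans z2); rewrite mulrDl mulrBl divfK ?gt_eqF //; lra.
- move=> q q' hq; have [i [y [qE hy fi hg hgy]]] := from_mfdP q.
  have y' : en y < 3 / 5 by lra.
  have hd : riem_dist q q' < r * (2 / 5) by move: hq; rewrite /D' ltr_pdivrMr // (mulrC (2 / 5) r).
  have qE' : q = pt (gbase q) y by rewrite -fi.
  have [||z [z1 z2 z3]] := @rd_lower R n (K * e) Gm kappa_small r r0 q y q' (r * (2 / 5)) y'.
  + by rewrite -qE'.
  + rewrite mulrA divfK ?gt_eqF //; lra.
  rewrite -fi in z2.
  have {}z3 : en (z - y) <= (1 + nu) * D' q q' by apply: (le_trans z3); rewrite -qE' mulrAC -mulrA.
  have z4 : en z < 11 / 20.
    have := en_triangle (z - y) y; rewrite subrK => t.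
    have : (1 + nu) * D' q q' <= (1 + nu) * (2 / 5) by apply: ler_wpM2l; lra.
    lra.
  have [|x [hx hxz]] := fl_onto hX (p i) (v := z); first by lra.
  have a := from_mfd_chart z2 z4 hx hxz; rewrite (fl_sym hX) in a.
  have b := flat_lower hX hg hx; have c := en_triangleB (phi (p i) (from_mfd q)) y (phi (p i) x).
  have d := en_triangleB y z (phi (p i) x); rewrite (enB z) in d; rewrite enB in z3.
  have g := fl_tri hX (from_mfd q) x (from_mfd q').
  have k : nu * D' q q' <= nu * 1 by apply: ler_wpM2l => //; lra.
  rewrite mulrDl mul1r in z3; lra.
- move=> q; have [i [y [qE hy _ hg hgy]]] := from_mfdP q.
  have ey : en (phi (p i) (from_mfd q)) <= en y + e.
    by have := en_triangle (phi (p i) (from_mfd q) - y) y; rewrite subrK; lra.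
  have hg' := flat_of_en hX hg.
  have hg2 : D (p i) (from_mfd q) < 11 / 20 by lra.
  have a := to_mfd_chart hg2; have y' : en y < 3 / 5 by lra.
  have ey' : en (phi (p i) (from_mfd q)) < 3 / 5 by lra.
  have b := D'_close (f i) y' ey' hgy; rewrite -qE in b.
  have c := D'_tri (to_mfd (from_mfd q)) (pt (f i) (phi (p i) (from_mfd q))) q.
  rewrite (D'_sym (to_mfd _) (pt _ _)) (D'_sym (pt _ _) q) in c; lra.
Qed.

End ApproximationMaps.

(** * Gromov-Hausdorff distance from a map of small distortion *)

Record distance_axioms (R : realType) (T : Type) (d : T -> T -> R) : Prop := DistanceAxioms {
  dist_refl : forall x, d x x = 0 ;
  dist_eq0 : forall x y, d x y = 0 -> x = y ;
  dist_sym : forall x y, d x y = d y x ;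
  dist_tri : forall y x z, d x z <= d x y + d y z
}.

Lemma dist_ge0 (R : realType) (T : Type) (d : T -> T -> R) : distance_axioms d -> forall x y, 0 <= d x y.
Proof. by move=> h x y; have := dist_tri h y x x; rewrite (dist_refl h) (dist_sym h y); lra. Qed.

Definition metric_of (R : realType) (T : Type) (d : T -> T -> R) & distance_axioms d : Type := T.

Section MetricOf.
Context {R : realType} (T : choiceType) (d : T -> T -> R) (h : distance_axioms d).
HB.instance Definition _ := Choice.copy (metric_of h) T.
HB.instance Definition _ := @isMetric.Build R (metric_of h) d (dist_refl h) (dist_eq0 h) (dist_sym h) (dist_tri h).
End MetricOf.

Section GluedMetric.
Context {R : realType} (X Y : choiceType) (dX : X -> X -> R) (dY : Y -> Y -> R) (F : X -> Y) (rho : R).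
Hypotheses (hX : distance_axioms dX) (hY : distance_axioms dY) (rho0 : 0 < rho).
Hypothesis distortion : forall x y, `|dY (F x) (F y) - dX x y| <= 2 * rho.

(* Each point of [X] is joined to its image by a segment of length [rho]. *)
Let bridges x q : set R := [set l | exists y, l = rho + (dX x y + dY (F y) q)].

Definition bridge x q : R := inf (bridges x q).

Let bridges_has_inf x q : has_inf (bridges x q).
Proof.
split; first by exists (rho + (dX x x + dY (F x) q)), x.
by exists 0 => _ [y ->]; have := dist_ge0 hX x y; have := dist_ge0 hY (F y) q; have := rho0; lra.
Qed.

Lemma bridge_le y x q : bridge x q <= rho + (dX x y + dY (F y) q).
Proof. by apply: ge_inf; [case: (bridges_has_inf x q)|exists y]. Qed.

Lemma le_bridge a x q : (forall y, a <= rho + (dX x y + dY (F y) q)) -> a <= bridge x q.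
Proof. by move=> h; apply: lb_le_inf => [|_ [y ->]//]; case: (bridges_has_inf x q). Qed.

Lemma bridge_gt0 x q : 0 < bridge x q.
Proof.
apply: (lt_le_trans rho0); apply: le_bridge => y.
by have := dist_ge0 hX x y; have := dist_ge0 hY (F y) q; have := rho0; lra.
Qed.

Definition glued_dist (a b : X + Y) : R :=
  match a, b with
  | inl x, inl y => dX x y
  | inr p, inr q => dY p q
  | inl x, inr q | inr q, inl x => bridge x q
  end.

Lemma bridge_triX x y q : bridge x q <= dX x y + bridge y q.
Proof.
rewrite -lerBlDl; apply: le_bridge => z; have := bridge_le z x q; have := dist_tri hX y x z; lra.
Qed.

Lemma bridge_triY x p q : bridge x q <= bridge x p + dY p q.
Proof.
rewrite -lerBlDr; apply: le_bridge => z; have := bridge_le z x q; have := dist_tri hY p (F z) q; lra.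
Qed.

Lemma bridge_bridgeX x y q : dX x y <= bridge x q + bridge y q.
Proof.
rewrite -lerBlDr; apply: le_bridge => x'; rewrite lerBlDr -lerBlDl; apply: le_bridge => y'.
have := distortion x' y'; rewrite ler_norml => /andP[+ _].
have := dist_tri hX x' x y; have := dist_tri hX y' x' y; rewrite (dist_sym hX y' y).
have := dist_tri hY q (F x') (F y'); rewrite (dist_sym hY q); lra.
Qed.

Lemma bridge_bridgeY p q x : dY p q <= bridge x p + bridge x q.
Proof.
rewrite -lerBlDr; apply: le_bridge => y; rewrite lerBlDr -lerBlDl; apply: le_bridge => z.
have := distortion y z; rewrite ler_norml => /andP[_].
have := dist_tri hY (F y) p q; have := dist_tri hY (F z) (F y) q; rewrite (dist_sym hY p (F y)).
have := dist_tri hX x y z; rewrite (dist_sym hX y x); lra.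
Qed.

Lemma glued_dist_axioms : distance_axioms glued_dist.
Proof.
split.
- by case=> x /=; [exact: dist_refl hX x|exact: dist_refl hY x].
- case=> [x|p] [y|q] /=.
  + by move=> /(dist_eq0 hX) ->.
  + by move=> e; have := bridge_gt0 x q; rewrite e ltxx.
  + by move=> e; have := bridge_gt0 y p; rewrite e ltxx.
  + by move=> /(dist_eq0 hY) ->.
- by case=> [x|p] [y|q] //=; [exact: dist_sym hX x y|exact: dist_sym hY p q].
- case=> [y|q] [x|p] [z|s] /=.
  + exact: dist_tri hX _ _ _.
  + exact: bridge_triX.
  + by rewrite addrC (dist_sym hX y); exact: bridge_triX.
  + exact: bridge_bridgeY.
  + exact: bridge_bridgeX.
  + exact: bridge_triY.
  + by rewrite addrC (dist_sym hY p); exact: bridge_triY.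
  + exact: dist_tri hY _ _ _.
Qed.

Lemma GH_dist_le (eta t : R) : (forall q, exists x, dY (F x) q <= eta) -> 0 <= eta -> rho + eta < t ->
  (GH_dist dX setT dY setT <= t%:E)%E.
Proof.
move=> net eta0 ht; apply: ereal_inf_lbound; exists t => //; have r0 := rho0; split; first by lra.
exists (metric_of glued_dist_axioms), (fun x => inl x), (fun q => inr q); split=> //.
(* An intermediate value, because the Hausdorff distance, itself an infimum, must be strictly less
   than [t]. *)
pose u := (rho + eta + t) / 2; have hu : rho + eta < u by rewrite /u; lra.
apply: (@le_lt_trans _ _ u%:E); last by rewrite lte_fin /u; lra.
apply: ereal_inf_lbound; exists u => //; split; first by lra.
- move=> _ [x _ <-]; exists (inr (F x)); first by exists (F x).
  rewrite /mdist /= ; have := bridge_le x x (F x); rewrite (dist_refl hX) (dist_refl hY); lra.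
- move=> _ [q _ <-]; have [x hx] := net q; exists (inl x); first by exists x.
  by rewrite /mdist /= ; have := bridge_le x x q; rewrite (dist_refl hX); lra.
Qed.

End GluedMetric.

(** * Approximate charts from the hypotheses on the space *)

Section FlatOfClose.
Context {R : realType} (n : nat) (r delta : R) (X : metricType R).
Hypotheses (r0 : 0 < r) (delta0 : 0 < delta).
Hypothesis intr : delta_intrinsic delta (@mdist R X).
Hypothesis close : delta_close_Rn n delta r (@mdist R X).

(** Each point of the ball is sent to a vector whose copy in the common space is closer than
    [delta], and the centre to 0 by the pointed condition. Comparing two points moves both ends,
    hence [2 * delta]. *)
Lemma close_chart (x : X) : exists phi : X -> 'rV[R]_n,
  [/\ phi x = 0,
      forall y z, mdist x y < r -> mdist x z < r -> `|en (phi y - phi z) - mdist y z| < 2 * delta &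
      forall v, en v < r -> exists y, mdist x y < r /\ en (phi y - v) < 2 * delta].
Proof.
have /ereal_inf_lt[_ [e [e0 [Z [f [g [hf hg hfg hc]]]]] <-]] := close x; rewrite lte_fin => ed.
have /ereal_inf_lt[_ [e' [e'0 hp hq]] <-] := hfg; rewrite lte_fin => e'e.
have ex y : exists v : 'rV[R]_n, mdist x y < r -> [/\ en v < r, mdist (f y) (g v) < delta & y = x -> v = 0].
  have [->|yx] := eqVneq y x.
    exists 0; rewrite en0 => _; split=> //; exact: lt_trans ed.
  have [h|h] := boolP (mdist x y < r); last by exists 0.
  have [_ [v hv <-] hd] := hp _ (ex_intro2 _ _ y h erefl).
  exists v => _; split; last by move=> e1; rewrite e1 eqxx in yx.
    by move: hv; rewrite /dball /= eucl_distE sub0r enN.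
  by lra.
have [phi hphi] := choice ex.
have iso y z : mdist x y < r -> mdist x z < r -> mdist (f y) (f z) = mdist y z by move=> *; exact: hf.
have isog u v : en u < r -> en v < r -> mdist (g u) (g v) = en (u - v).
  by move=> hu hv; rewrite hg ?eucl_distE //; rewrite /dball /= eucl_distE sub0r enN.
exists phi; split.
- have [|_ _ ->//] := hphi x; by rewrite mdistxx.
- move=> y z hy hz; have [y1 y2 _] := hphi y hy; have [z1 z2 _] := hphi z hz.
  rewrite -isog // -iso //.
  have := metric_triangle (f y) (g (phi y)) (f z); have := metric_triangle (g (phi y)) (g (phi z)) (f z).
  have := metric_triangle (g (phi y)) (f y) (g (phi z)); have := metric_triangle (f y) (f z) (g (phi z)).
  rewrite (metric_sym (g (phi z)) (f z)) (metric_sym (g (phi y)) (f y)).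
  by move=> *; rewrite ltr_norml; apply/andP; split; lra.
- move=> v hv; have [|_ [y hy <-] hd] := hq (g v).
    by exists v => //; rewrite /dball /= eucl_distE sub0r enN.
  exists y; split=> //; have [y1 y2 _] := hphi y hy.
  rewrite -isog //; have := metric_triangle (g (phi y)) (f y) (g v).
  by rewrite (metric_sym (g (phi y)) (f y)); lra.
Qed.

Lemma flat_of_close : 2 * delta / r <= 1 / 1000 -> exists phi : X -> X -> 'rV[R]_n,
  flat (2 * delta / r) (fun x y => mdist x y / r) phi.
Proof.
move=> small; have d0 := delta0; have ir : 0 < r^-1 by rewrite invr_gt0.
have [phi hphi] := choice close_chart.
have lt1 x y : (mdist x y / r < 1) = (mdist x y < r) :> bool by rewrite ltr_pdivrMr // mul1r.
exists (fun x y => r^-1 *: phi x y); split.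
- by rewrite small andbT !mulr_gt0.
- by move=> x; rewrite mdistxx mul0r.
- by move=> x y; rewrite metric_sym.
- by move=> x y z; rewrite -mulrDl ler_pM2r // metric_triangle.
- move=> x y; have [N [c [c0 cN ch st]]] := intr x y.
  exists N, (fun k => c (inord k)); split.
  + by rewrite -c0; congr c; apply: val_inj; rewrite /= inordK.
  + by rewrite -cN; congr c; apply: val_inj; rewrite /= inordK.
  + move=> k kN; rewrite ler_pM2r //.
    have := ch (inord k) (inord k.+1); rewrite !inordK ?ltnS //; last exact: ltnW.
    by move=> /(_ erefl); lra.
  + move=> k kN; rewrite -!mulrDl ler_pM2r //.
    (* Straightness speaks of three strictly increasing indices, so the two ends of the chain are
       treated apart. *)
    have [->|k0] := posnP k.
      by rewrite (_ : inord 0 = ord0) ?c0 ?mdistxx ?add0r; [lra|apply: val_inj; rewrite /= inordK].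
    have [kE|kN'] := eqVneq k N.
      by rewrite (_ : inord k = ord_max) ?cN ?mdistxx ?addr0; [lra|apply: val_inj; rewrite /= inordK ?kE].
    have := st ord0 (inord k) ord_max; rewrite inordK ?ltnS // k0 c0 cN /= ltn_neqAle kN' kN => /(_ isT).
    lra.
- by move=> x; have [-> _ _] := hphi x; rewrite scaler0.
- move=> x y z; rewrite !lt1 => hy hz; have [_ + _] := hphi x => /(_ y z hy hz) h.
  rewrite -scalerBr enZ (gtr0_norm ir) mulrC -mulrBl normrM (gtr0_norm ir) ler_pM2r //; exact: ltW.
- move=> x v hv; have [_ _ /(_ (r *: v))[]] := hphi x.
    by rewrite enZ gtr0_norm // gtr_pMr.
  move=> y [hy h]; exists y; rewrite lt1; split=> //.
  rewrite -[v](scalerK (a := r)) ?gt_eqF // -scalerBr enZ (gtr0_norm ir) mulrC ler_pM2r //; exact: ltW.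
Qed.

End FlatOfClose.

Lemma diam_le (R : realType) (T : Type) (d : T -> T -> R) x y : ((d x y)%:E <= diam d)%E.
Proof. by apply: ereal_sup_ubound; exists (x, y). Qed.

Lemma common_threshold (R : realFieldType) (a b c d : R) : 0 < a -> 0 < b -> 0 < c -> 0 < d ->
  exists2 s : R, 0 < s & [/\ s <= a, s <= b, s <= c & s <= d].
Proof.
move=> a0 b0 c0 d0; exists (Num.min (Num.min a b) (Num.min c d)); first by rewrite !lt_min a0 b0 c0.
by rewrite !ge_min !lexx !orbT.
Qed.

Lemma mfd_distance_axioms (R : realType) (n : nat) (kappa : R) (G : geom n kappa)
  (kappa_small : n%:R ^+ 2 * kappa <= 1 / 100) (r : R) (r0 : 0 < r) :
  distance_axioms (@riem_dist R n (mfd G kappa_small r0)).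
Proof. by split; [exact: rd_refl|exact: rd_eq0|exact: rd_sym|exact: rd_triangle]. Qed.

Lemma mdist_axioms (R : realType) (X : metricType R) : distance_axioms (@mdist R X).
Proof.
by split; [exact: mdistxx|exact: mdist_positivity|exact: metric_sym|move=> y x z; exact: metric_triangle].
Qed.

(** Relative to [d], the distortion takes [24 * e + 15 * eta] and the density of the image at most
    [eta]; the rest of [32 * e + 20 * eta] is slack for strict inequalities. *)
Lemma close_maps_GH (R : realType) (X Y : choiceType) (dX : X -> X -> R) (dY : Y -> Y -> R) (r e eta d t : R)
    (F : X -> Y) (g : Y -> X) : distance_axioms dX -> distance_axioms dY -> 0 < r <= d ->
  close_maps (fun x y => dX x y / r) (fun p q => dY p q / r) e eta F g ->
  close_maps (fun p q => dY p q / r) (fun x y => dX x y / r) e eta g F ->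
  (forall x y, dX x y <= d) -> 8 * e + 4 * eta <= 1 -> eta <= 1 ->
  (32 * e + 20 * eta) * d < t -> (GH_dist dX setT dY setT <= t%:E)%E.
Proof.
move=> hX hY /andP[r0 rd] cF cg hd hk heta ht.
have /andP[e0 _] := cm_eps cF; have eta0 := cm_eta cF; have d0 : 0 < d by exact: lt_le_trans rd.
pose rho := (3 * (8 * e + 4 * eta) + 3 * eta) * d.
have rho0 : 0 < rho by rewrite /rho mulr_gt0 //; lra.
have dis x y : `|dY (F x) (F y) - dX x y| <= 2 * rho.
  have d1 : 1 <= d / r by rewrite ler_pdivlMr // mul1r.
  have d2 : dX x y / r <= d / r by rewrite ler_pM2r ?invr_gt0.
  have := close_maps_distortion cF cg d1 d2 hk heta.
  rewrite -mulrBl normrM (gtr0_norm (x := r^-1)) ?invr_gt0 // mulrA ler_pM2r ?invr_gt0 // => h.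
  by apply: (le_trans h); rewrite -/rho; move: rho rho0 => u; clear; lra.
apply: (GH_dist_le hX hY rho0 dis (eta := r * eta)).
- by move=> q; exists (g q); have := cm_inv cg q; rewrite ler_pdivrMr // mulrC.
- by rewrite mulr_ge0 // ltW.
apply: le_lt_trans ht; have : r * eta <= d * eta by rewrite ler_wpM2r.
have -> : (32 * e + 20 * eta) * d = 32 * (e * d) + 20 * (d * eta) by ring.
rewrite /rho (_ : _ * d = 24 * (e * d) + 15 * (d * eta)); last by ring.
have : 0 < e * d by rewrite mulr_gt0.
have : 0 <= d * eta by rewrite mulr_ge0 // ltW.
by move: (e * d) (d * eta) (r * eta) => u v w; clear; lra.
Qed.

(** * Choice of the constants and conclusion *)

Theorem theorem1 (R : realType) (n : nat) :
  exists sigma1 C1 C2 : R,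
    [/\ 0 < sigma1, 0 < C1, 0 < C2 &
    forall (r : R) (X : metricType R) (delta : R),
      0 < r ->
      (r%:E < diam (@mdist R X))%E ->
      0 < delta < sigma1 * r ->
      delta_intrinsic delta (@mdist R X) ->
      delta_close_Rn n delta r (@mdist R X) ->
      exists M : riemannian_manifold R n,
        [/\ complete_manifold M,
            quasi_isometric (1 + C1 * delta * r^-1) (C1 * delta)
              (@mdist R X) (@riem_dist R n M),
            ((diam (@mdist R X) < +oo)%E ->
             (GH_dist (@mdist R X) setT (@riem_dist R n M) setT
                <= (2 * C1 * delta * r^-1)%:E * diam (@mdist R X))%E),
            sectional_le M (C2 * delta * r ^- 3) &
            ((r / 2)%:E <= inj_radius M)%E]].
Proof.
have [B BE] : exists B : R, B = atlas_bound n by exists (atlas_bound n).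
have B1 : 1 <= B by have [h _] := @atlas_const_ge R n; have := @atlas_bound_ge R n; rewrite BE; lra.
have [sigma [K [s0 K1 HK]]] := glue_geom n (packing_bound n).+1 (packing_bound n) (le_trans ler01 B1).
have [eta1 e10 Hinj] := @mfd_inj_radius R n.
have [eta2 [C [e20 C0 Hsec]]] := @sectional_bound R n.
have [th th0 [t1 t2 t3 t4]] : exists2 s : R, 0 < s & [/\ s <= 1 / 1000, s <= sigma, s <= eta1 & s <= eta2].
  by have h : 0 < 1 / 1000 :> R; [lra|exact: common_threshold h s0 e10 e20].
have nn0 : 0 <= n%:R ^+ 2 :> R by exact: exprn_ge0.
have [m mE] : exists m : R, m = maps_const n B K by exists (maps_const n B K).
have m0 : 0 <= m by rewrite mE /maps_const !addr_ge0 // ?mulr_ge0 ?addr_ge0 //; lra.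
(* The single condition [Q * e < th] implies every smallness requirement below. *)
have [Q QE] : exists Q : R, Q = (n%:R ^+ 2 + 1) * B + (n%:R ^+ 2 + 1) * K + 2 * m + 10 by eexists.
have b0 : 0 <= n%:R ^+ 2 * B by rewrite mulr_ge0 //; lra.
have k0 : 0 <= n%:R ^+ 2 * K by rewrite mulr_ge0 //; lra.
have Q0 : 0 < Q by move: b0 k0; rewrite QE !mulrDl !mul1r; lra.
(* The charts have error [e = 2 * delta / r], which explains the factors 2: the comparison of
   distances costs [(32 + 20 * m) * e], and the curvature is at most [C * (K * e) / r ^+ 2]. *)
exists (th / (2 * Q)), (64 + 40 * m), (2 * C * K); split.
- by rewrite divr_gt0 // mulr_gt0.
- lra.
- by rewrite !mulr_gt0 //; lra.
move=> r X delta r0 hdiam /andP[d0 hd] intr close.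
have [e eE] : exists e, e = 2 * delta / r by eexists.
have e0 : 0 < e by rewrite eE !mulr_gt0 // invr_gt0.
have Qe : Q * e < th.
  move: hd; rewrite mulrAC ltr_pdivlMr; last by rewrite mulr_gt0.
  by rewrite eE -(ltr_pdivrMr _ _ r0) => h; apply: le_lt_trans h; rewrite le_eqVlt; apply/orP; left; apply/eqP; ring.
have me0 : 0 <= m * e by rewrite mulr_ge0 // ltW.
have be0 : 0 <= n%:R ^+ 2 * (B * e) by rewrite mulrA mulr_ge0 // ltW.
have ke0 : 0 <= n%:R ^+ 2 * (K * e) by rewrite mulrA mulr_ge0 // ltW.
have Be : e <= B * e by rewrite ler_peMl // ltW.
have Ke : e <= K * e by rewrite ler_peMl // ltW.
have {Qe} Qe : n%:R ^+ 2 * (B * e) + B * e + (n%:R ^+ 2 * (K * e) + K * e) + 2 * (m * e) + 10 * e < th.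
  by apply: le_lt_trans Qe; rewrite QE le_eqVlt; apply/orP; left; apply/eqP; ring.
have e1 : e <= 1 / 1000 by clear -Qe t1 me0 be0 ke0 Be Ke e0; lra.
have Bsm : (n%:R ^+ 2 + 1) * (B * e) <= 1 / 1000.
  by rewrite mulrDl mul1r; clear -Qe t1 me0 be0 ke0 Be Ke e0; lra.
have kap : n%:R ^+ 2 * (K * e) <= 1 / 100 by clear -Qe t1 me0 be0 ke0 Be Ke e0; lra.
have Ksm : K * e <= 1 / 1000 by clear -Qe t1 me0 be0 ke0 Be Ke e0; lra.
have esig : e < sigma by clear -Qe t2 me0 be0 ke0 Be Ke e0; lra.
have kinj : 0 < K * e <= eta1 by clear -Qe t3 me0 be0 ke0 Be Ke e0; apply/andP; split; lra.
have ksec : 0 < K * e <= eta2 by clear -Qe t4 me0 be0 ke0 Be Ke e0; apply/andP; split; lra.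
have mes : m * e <= 1 / 1000 by clear -Qe t1 me0 be0 ke0 Be Ke e0; lra.
have [phi hX] : exists phi : X -> X -> 'rV[R]_n, flat e (fun x y => mdist x y / r) phi.
  by rewrite eE; apply: flat_of_close => //; rewrite -eE.
have := flat_gdata hX; rewrite -BE => /(_ Bsm)[G [p [GE [good_G reg_G] vnb vcov vtr]]].
have := HK G good_G reg_G; rewrite GE => /(_ esig)[Gm [f [fs fnb fcl]]].
have [F [g [cF cg]]] : exists (F : X -> mfd Gm kap r0) (g : mfd Gm kap r0 -> X),
    close_maps (fun x y => mdist x y / r) (fun p q => riem_dist p q / r) e (m * e) F g /\
    close_maps (fun p q => riem_dist p q / r) (fun x y => mdist x y / r) e (m * e) g F.
  rewrite mE; eexists; eexists; split.
    exact: (close_maps_to hX B1 K1 vnb vcov vtr fs fnb fcl kap Bsm Ksm r0).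
  exact: (close_maps_from hX B1 K1 vnb vcov vtr fs fnb fcl kap Bsm Ksm r0).
have rn0 : r != 0 by rewrite gt_eqF.
have quasi (T T' : Type) (dT : T -> T -> R) (dT' : T' -> T' -> R) h h' :
    close_maps (fun x y => dT x y / r) (fun x y => dT' x y / r) e (m * e) h h' ->
    close_maps (fun x y => dT' x y / r) (fun x y => dT x y / r) e (m * e) h' h ->
    quasi_isometry (1 + (64 + 40 * m) * delta / r) ((64 + 40 * m) * delta) dT dT' h.
  move=> c c'; have scale (U : Type) (dU : U -> U -> R) : dU = fun x y => r * (dU x y / r).
    by apply/funext => x; apply/funext => y; rewrite mulrCA divff // mulr1.
  have -> : (64 + 40 * m) * delta / r = (32 + 20 * m) * e by rewrite eE; field.
  have -> : (64 + 40 * m) * delta = (32 + 20 * m) * e * r by rewrite eE; field.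
  rewrite (scale _ dT) (scale _ dT'); apply: (close_maps_quasi c c' r0).
    by rewrite (mulrDl 32) -(mulrA 20); clear -me0 e0; lra.
  by rewrite (mulrDl 32) -(mulrA 20); clear -me0 e0; lra.
exists (mfd Gm kap r0); split.
- exact: complete_mfd.
- by split; [exists F; exact: quasi cF cg|exists g; exact: quasi cg cF].
- move=> dfin; have [d dE] : exists d : R, diam (@mdist R X) = d%:E.
    by case: (diam _) hdiam dfin => [d _ _|//|//]; exists d.
  rewrite dE -EFinM; rewrite dE lte_fin in hdiam; have dp : 0 < d := lt_trans r0 hdiam.
  (* Here the hypothesis that the diameter exceeds [r] enters: additive errors at scale [r] are
     absorbed into multiples of [d]. *)
  apply: (close_maps_GH (r := r) (d := d) (@mdist_axioms R X) (mfd_distance_axioms Gm kap r0) _ cF cg).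
  + by rewrite r0 ltW.
  + by move=> x y; have := diam_le (@mdist R X) x y; rewrite dE lee_fin.
  + by clear -e1 mes; lra.
  + by clear -mes; lra.
  rewrite (_ : 2 * _ * _ / r = (64 + 40 * m) * e); last by rewrite eE; field.
  by rewrite ltr_pM2r // (mulrDl 64) -(mulrA 40); clear -me0 e0; lra.
- rewrite (_ : _ / r ^+ 3 = C * (K * e) / r ^+ 2); first exact: Hsec.
  by rewrite eE; field.
- exact: Hinj.
Qed.
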